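(* Every $\mathcal L_{\operatorname{lift}}$-formula is $T^{\operatorname{dhl}}_{\operatorname{lift}}$-equivalent to a boolean combination of special formulas.
   Context: Let $\mathcal L$ be the language of ordered differential rings $\{+,-,\cdot,0,1,\leqslant,\partial\}$ together with a binary relation $\dot{\preccurlyeq}$ for the dominance relation of a valuation ring $\dot{\mathcal O}$, and $T^{\operatorname{dhl}}$ the $\mathcal L$-theory of pre-$H$-fields $(K,\dot{\mathcal O})$ that are differential-henselian and Liouville closed (real closed, closed under integration and exponential integration) with $\dot{\mathcal O}\neq K$. Let $\mathcal L_{\operatorname{res}}$ extend the language of ordered differential rings and $T_{\operatorname{res}}$ be an $\mathcal L_{\operatorname{res}}$-theory. Let $\mathcal L_{\operatorname{lift}}=\mathcal L\cup\mathcal L_{\operatorname{res}}\cup\{U\}$, $U$ a unary predicate, and $T^{\operatorname{dhl}}_{\operatorname{lift}}$ the theory of structures $(K,\bm k)$ with $(K,\dot{\mathcal O})\models T^{\operatorname{dhl}}$, $U$ interpreted as a lift $\bm k\subseteq\dot{\mathcal O}$ of the differential residue field $\operatorname{res}(K,\dot{\mathcal O})$ (a differential subfield of $\dot{\mathcal O}$ mapped isomorphically onto $\operatorname{res}(K,\dot{\mathcal O})$ by the residue map), and $\bm k\models T_{\operatorname{res}}$ (extra symbols of $\mathcal L_{\operatorname{res}}$ trivial off $\bm k$). An $\operatorname{r}$-relative formula is built from quantifier-free $\mathcal L_{\operatorname{res}}$-formulas by boolean connectives and quantifiers relativized to $U$. A formula in $y$ is special if it is of the form $\exists x \in U\ (\theta(x)\wedge\varphi(x,y))$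 with $\theta(x)$ an $\operatorname{r}$-relative formula and $\varphi(x,y)$ a quantifier-free $\mathcal L$-formula. *)

(* Defs.v *)
From HB Require Import structures.
From mathcomp Require Import all_boot all_order all_algebra.
From mathcomp Require Import mpoly.

Set Implicit Arguments.
Unset Strict Implicit.
Unset Printing Implicit Defensive.

Import Order.TTheory GRing.Theory Num.Theory.
Local Open Scope ring_scope.

(** * First-order logic *)

(* [fsym L k] and [rsym L k] are the function and relation symbols of arity
   [k]; constants are function symbols of arity 0. *)
Record language := Language {
  fsym : nat -> Type;
  rsym : nat -> Type }.

Inductive term (L : language) (n : nat) : Type :=
| Var (i : 'I_n)
| App (k : nat) (f : fsym L k) (a : 'I_k -> term L n).

(* [formula L n] consists of the L-formulas with free variables among
   x_0, ..., x_(n-1). A quantifier binds variable 0 of its body, and variable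
   i.+1 of the body is variable i outside. *)
Inductive formula (L : language) : nat -> Type :=
| FTrue n : formula L n
| FFalse n : formula L n
| FEq n (s t : term L n) : formula L n
| FRel n (k : nat) (r : rsym L k) (a : 'I_k -> term L n) : formula L n
| FNot n (phi : formula L n) : formula L n
| FAnd n (phi psi : formula L n) : formula L n
| FOr n (phi psi : formula L n) : formula L n
| FEx n (phi : formula L n.+1) : formula L n
| FAll n (phi : formula L n.+1) : formula L n.

Arguments Var {L n} i.
Arguments App {L n k} f a.
Arguments FTrue {L n}.
Arguments FFalse {L n}.
Arguments FEq {L n} s t.
Arguments FRel {L n k} r a.
Arguments FNot {L n} phi.
Arguments FAnd {L n} phi psi.
Arguments FOr {L n} phi psi.
Arguments FEx {L n} phi.
Arguments FAll {L n} phi.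

Definition theory (L : language) := formula L 0 -> Prop.

Fixpoint quantifier_free (L : language) (n : nat) (phi : formula L n) : bool :=
  match phi with
  | FTrue _ | FFalse _ | FEq _ _ _ | FRel _ _ _ _ => true
  | FNot _ phi => quantifier_free phi
  | FAnd _ phi psi | FOr _ phi psi => quantifier_free phi && quantifier_free psi
  | FEx _ _ | FAll _ _ => false
  end.

Inductive boolean_combination (L : language) (n : nat)
    (P : formula L n -> Prop) : formula L n -> Prop :=
| BCbase phi : P phi -> boolean_combination P phi
| BCtrue : boolean_combination P FTrue
| BCfalse : boolean_combination P FFalse
| BCnot phi : boolean_combination P phi -> boolean_combination P (FNot phi)
| BCand phi psi : boolean_combination P phi -> boolean_combination P psi ->
    boolean_combination P (FAnd phi psi)
| BCor phi psi : boolean_combination P phi -> boolean_combination P psi ->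
    boolean_combination P (FOr phi psi).

Definition scons (T : Type) (n : nat) (a : T) (v : 'I_n -> T) : 'I_n.+1 -> T :=
  fun i => if unlift ord0 i is Some j then v j else a.

(** ** Renaming of variables *)

Fixpoint trename (L : language) (m n : nat) (s : 'I_m -> 'I_n)
    (t : term L m) : term L n :=
  match t with
  | Var i => Var (s i)
  | App _ f a => App f (fun i => trename s (a i))
  end.

Fixpoint frename (L : language) (m n : nat) (s : 'I_m -> 'I_n)
    (phi : formula L m) : formula L n :=
  match phi in formula _ m return ('I_m -> 'I_n) -> formula L n with
  | FTrue _ => fun _ => FTrue
  | FFalse _ => fun _ => FFalse
  | FEq _ t u => fun s => FEq (trename s t) (trename s u)
  | FRel _ _ r a => fun s => FRel r (fun i => trename s (a i))
  | FNot _ phi => fun s => FNot (frename s phi)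
  | FAnd _ phi psi => fun s => FAnd (frename s phi) (frename s psi)
  | FOr _ phi psi => fun s => FOr (frename s phi) (frename s psi)
  | FEx _ phi => fun s => FEx (frename (scons ord0 (lift ord0 \o s)) phi)
  | FAll _ phi => fun s => FAll (frename (scons ord0 (lift ord0 \o s)) phi)
  end s.

(** ** Inclusions of languages *)

Record language_map (L L' : language) := LanguageMap {
  fmapsym : forall k, fsym L k -> fsym L' k;
  rmapsym : forall k, rsym L k -> rsym L' k }.

Fixpoint tmap (L L' : language) (h : language_map L L') (n : nat)
    (t : term L n) : term L' n :=
  match t with
  | Var i => Var i
  | App _ f a => App (fmapsym h f) (fun i => tmap h (a i))
  end.

Fixpoint fmap (L L' : language) (h : language_map L L') (n : nat)
    (phi : formula L n) : formula L' n :=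
  match phi with
  | FTrue _ => FTrue
  | FFalse _ => FFalse
  | FEq _ t u => FEq (tmap h t) (tmap h u)
  | FRel _ _ r a => FRel (rmapsym h r) (fun i => tmap h (a i))
  | FNot _ phi => FNot (fmap h phi)
  | FAnd _ phi psi => FAnd (fmap h phi) (fmap h psi)
  | FOr _ phi psi => FOr (fmap h phi) (fmap h psi)
  | FEx _ phi => FEx (fmap h phi)
  | FAll _ phi => FAll (fmap h phi)
  end.

Definition language_sum (L L' : language) : language :=
  Language (fun k => fsym L k + fsym L' k)%type
           (fun k => rsym L k + rsym L' k)%type.

(** ** Structures *)

Record interpretation (L : language) (T : Type) := Interpretation {
  fint : forall k, fsym L k -> ('I_k -> T) -> T;
  rint : forall k, rsym L k -> ('I_k -> T) -> Prop }.

Record structure (L : language) := Structure {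
  carrier :> Type;
  interp : interpretation L carrier }.

Definition interp_sum (L L' : language) (T : Type)
    (I : interpretation L T) (I' : interpretation L' T) :
    interpretation (language_sum L L') T :=
  Interpretation (L := language_sum L L')
    (fun k f => match f with inl f => fint I f | inr f => fint I' f end)
    (fun k r => match r with inl r => rint I r | inr r => rint I' r end).

Fixpoint eval (L : language) (M : structure L) (n : nat) (v : 'I_n -> M)
    (t : term L n) : M :=
  match t with
  | Var i => v i
  | App _ f a => fint (interp M) f (fun i => eval v (a i))
  end.

Fixpoint sat (L : language) (M : structure L) (n : nat) (phi : formula L n) :
    ('I_n -> M) -> Prop :=
  match phi with
  | FTrue _ => fun _ => True
  | FFalse _ => fun _ => False
  | FEq _ s t => fun v => eval v s = eval v t
  | FRel _ _ r a => fun v => rint (interp M) r (fun i => eval v (a i))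
  | FNot _ phi => fun v => ~ sat phi v
  | FAnd _ phi psi => fun v => sat phi v /\ sat psi v
  | FOr _ phi psi => fun v => sat phi v \/ sat psi v
  | FEx _ phi => fun v => exists a : M, sat phi (scons a v)
  | FAll _ phi => fun v => forall a : M, sat phi (scons a v)
  end.

Definition models (L : language) (M : structure L) (T : theory L) : Prop :=
  forall sigma : formula L 0, T sigma -> forall v : 'I_0 -> M, sat sigma v.

Definition equivalent_in (L : language) (C : structure L -> Prop) (n : nat)
    (phi psi : formula L n) : Prop :=
  forall M : structure L, C M ->
  forall v : 'I_n -> M, sat phi v <-> sat psi v.

Definition reduct (L L' : language) (h : language_map L L')
    (M : structure L') : structure L :=
  Structure (Interpretation
    (fun k f => fint (interp M) (fmapsym h f))
    (fun k r => rint (interp M) (rmapsym h r))).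

Definition closed_under (L : language) (M : structure L) (P : M -> Prop) :
    Prop :=
  forall (k : nat) (f : fsym L k) (a : 'I_k -> M),
    (forall i, P (a i)) -> P (fint (interp M) f a).

Definition substructure (L : language) (M : structure L) (P : M -> Prop)
    (clP : closed_under P) : structure L :=
  Structure (carrier := {x : M | P x}) (Interpretation
    (fun k f a => exist P (fint (interp M) f (fun i => sval (a i)))
                          (clP k f _ (fun i => svalP (a i))))
    (fun k r a => rint (interp M) r (fun i => sval (a i)))).

(** * Ordered valued differential fields *)

Section ValuedDifferentialFields.

Variables (K : realFieldType) (der : K -> K) (O : {pred K}).

Definition derivation : Prop :=
  (forall x y, der (x + y) = der x + der y) /\
  (forall x y, der (x * y) = der x * y + x * der y).

Definition valuation_ring : Prop :=
  GRing.subring_closed O /\ forall x, x != 0 -> x \in O \/ x^-1 \in O.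

Definition dominated (f g : K) : Prop := exists2 c, c \in O & f = c * g.
Definition strictly_dominated (f g : K) : Prop :=
  dominated f g /\ ~ dominated g f.

Definition logder (f : K) : K := der f / f.

Definition pre_H_field : Prop :=
  [/\ derivation,
      valuation_ring,
      forall a b x, a \in O -> b \in O -> a <= x <= b -> x \in O,
      forall f, (forall a, a \in O -> a < f) -> 0 < der f
    & forall f g, f != 0 -> g != 0 -> dominated f 1 ->
        strictly_dominated g 1 -> strictly_dominated (der f) (logder g)].

Definition small_derivation : Prop :=
  forall f, strictly_dominated f 1 -> strictly_dominated (der f) 1.

(* Linear surjectivity of the differential residue field O/m, in terms of
   representatives in O: x and y in O have the same residue iff
   x - y is strictly dominated by 1. *)
Definition residue_linearly_surjective : Prop :=
  forall (r : nat) (a : 'I_r.+1 -> K) (b : K),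
    (forall i, a i \in O) -> (exists i, ~ strictly_dominated (a i) 1) ->
    b \in O ->
    exists2 y, y \in O &
      strictly_dominated (\sum_(i < r.+1) a i * iter i der y - b) 1.

(* A differential polynomial of order at most r is an element of
   K[Y_0, ..., Y_r], with Y_i standing for the i-th derivative of Y. *)
Definition dpoly_eval (r : nat) (P : {mpoly K[r.+1]}) (y : K) : K :=
  P.@[fun i : 'I_r.+1 => iter i der y].

Definition homogeneous_part (r d : nat) (P : {mpoly K[r.+1]}) :
    {mpoly K[r.+1]} :=
  pihomog mdeg d P.

(* The valuation is extended to differential polynomials as the minimum of the
   valuations of the coefficients. *)
Definition dpoly_dominated1 (r : nat) (P : {mpoly K[r.+1]}) : Prop :=
  forall m, dominated P@_m 1.
Definition dpoly_strictly_dominated1 (r : nat) (P : {mpoly K[r.+1]}) : Prop :=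
  forall m, strictly_dominated P@_m 1.

Definition differential_henselian : Prop :=
  [/\ small_derivation,
      residue_linearly_surjective
    & forall (r : nat) (P : {mpoly K[r.+1]}),
        dpoly_dominated1 P ->
        dpoly_strictly_dominated1 (homogeneous_part 0 P) ->
        dpoly_dominated1 (homogeneous_part 1 P) ->
        ~ dpoly_strictly_dominated1 (homogeneous_part 1 P) ->
        exists2 y, strictly_dominated y 1 & dpoly_eval P y = 0].

Definition Liouville_closed : Prop :=
  [/\ Num.real_closed_axiom K,
      forall a, exists y, der y = a
    & forall a, exists2 y, y != 0 & logder y = a].

Definition dhl : Prop :=
  [/\ pre_H_field, differential_henselian, Liouville_closed
    & exists x, x \notin O].

(* The residue map is injective on k and maps k onto O/m. *)
Definition residue_lift (k : {pred K}) : Prop :=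
  [/\ GRing.divring_closed k,
      {in k, forall u, der u \in k},
      {subset k <= O},
      {in k &, forall u v, strictly_dominated (u - v) 1 -> u = v}
    & forall a, a \in O -> exists2 u, u \in k & strictly_dominated (a - u) 1].

End ValuedDifferentialFields.

(** * The languages *)

Inductive odr_fsym : nat -> Type :=
| SZero : odr_fsym 0
| SOne : odr_fsym 0
| SOpp : odr_fsym 1
| SDer : odr_fsym 1
| SAdd : odr_fsym 2
| SMul : odr_fsym 2.

Inductive odr_rsym : nat -> Type := SLe : odr_rsym 2.
Inductive dom_rsym : nat -> Type := SDom : dom_rsym 2.
Inductive U_rsym : nat -> Type := SU : U_rsym 1.

Definition lang_odr : language := Language odr_fsym odr_rsym.
Definition lang_dom : language := Language (fun _ => Empty_set) dom_rsym.
Definition lang_U : language := Language (fun _ => Empty_set) U_rsym.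

Definition lang_L : language := language_sum lang_odr lang_dom.

(* E is the language of the symbols of L_res that do not belong to the language
   of ordered differential rings. *)
Definition lang_res (E : language) : language := language_sum lang_odr E.
Definition lang_lift (E : language) : language :=
  language_sum lang_L (language_sum E lang_U).

Definition L_to_lift (E : language) : language_map lang_L (lang_lift E) :=
  LanguageMap (L' := lang_lift E) (fun _ => inl) (fun _ => inl).

Definition res_to_lift (E : language) :
    language_map (lang_res E) (lang_lift E) :=
  LanguageMap (L := lang_res E) (L' := lang_lift E)
    (fun k f => match f with inl f => inl (inl f) | inr f => inr (inl f) end)
    (fun k r => match r with inl r => inl (inl r) | inr r => inr (inl r) end).

(** * Special formulas *)

Section SpecialFormulas.

Variable E : language.

Definition in_U (n : nat) (t : term (lang_lift E) n) :
    formula (lang_lift E) n :=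
  FRel (L := lang_lift E) (inr (inr SU)) (fun _ => t).

Definition FExU (n : nat) (phi : formula (lang_lift E) n.+1) :
    formula (lang_lift E) n :=
  FEx (FAnd (in_U (Var ord0)) phi).

Definition FAllU (n : nat) (phi : formula (lang_lift E) n.+1) :
    formula (lang_lift E) n :=
  FAll (FOr (FNot (in_U (Var ord0))) phi).

Inductive r_relative : forall n : nat, formula (lang_lift E) n -> Prop :=
| RRqf n (phi : formula (lang_res E) n) :
    quantifier_free phi -> r_relative (fmap (res_to_lift E) phi)
| RRnot n (phi : formula (lang_lift E) n) :
    r_relative phi -> r_relative (FNot phi)
| RRand n (phi psi : formula (lang_lift E) n) :
    r_relative phi -> r_relative psi -> r_relative (FAnd phi psi)
| RRor n (phi psi : formula (lang_lift E) n) :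
    r_relative phi -> r_relative psi -> r_relative (FOr phi psi)
| RRex n (phi : formula (lang_lift E) n.+1) :
    r_relative phi -> r_relative (FExU phi)
| RRall n (phi : formula (lang_lift E) n.+1) :
    r_relative phi -> r_relative (FAllU phi).

(* Binds the variables 0, ..., m-1. *)
Fixpoint FExsU (m n : nat) :
    formula (lang_lift E) (m + n) -> formula (lang_lift E) n :=
  match m return formula (lang_lift E) (m + n) -> formula (lang_lift E) n with
  | 0%N => id
  | m'.+1 => fun phi => FExsU (FExU phi)
  end.

(* The variables of x are 0, ..., m-1 and those of y are m, ..., m+n-1. *)
Definition special (n : nat) (psi : formula (lang_lift E) n) : Prop :=
  exists (m : nat) (theta : formula (lang_lift E) m)
         (phi : formula lang_L (m + n)),
    [/\ r_relative theta, quantifier_free phi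
      & psi = FExsU (FAnd (frename (@lshift m n) theta)
                          (fmap (L_to_lift E) phi))].

End SpecialFormulas.

(** * Models of the theory of lifts *)

Section LiftStructures.

Variables (E : language) (K : realFieldType).

Definition odr_interp (der : K -> K) : interpretation lang_odr K :=
  Interpretation (L := lang_odr)
    (fun k f => match f in odr_fsym k return ('I_k -> K) -> K with
      | SZero => fun _ => 0
      | SOne => fun _ => 1
      | SOpp => fun a => - a ord0
      | SDer => fun a => der (a ord0)
      | SAdd => fun a => a ord0 + a ord_max
      | SMul => fun a => a ord0 * a ord_max
      end)
    (fun k r => match r in odr_rsym k return ('I_k -> K) -> Prop with
      | SLe => fun a => a ord0 <= a ord_max
      end).

Definition dom_interp (O : {pred K}) : interpretation lang_dom K :=
  Interpretation (L := lang_dom)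
    (fun k f => match f with end)
    (fun k r => match r in dom_rsym k return ('I_k -> K) -> Prop with
      | SDom => fun a => dominated O (a ord0) (a ord_max)
      end).

Definition U_interp (k : {pred K}) : interpretation lang_U K :=
  Interpretation (L := lang_U)
    (fun j f => match f with end)
    (fun j r => match r in U_rsym j return ('I_j -> K) -> Prop with
      | SU => fun a => a ord0 \in k
      end).

Definition lift_structure (der : K -> K) (O k : {pred K})
    (I : interpretation E K) : structure (lang_lift E) :=
  Structure (L := lang_lift E)
    (interp_sum (interp_sum (odr_interp der) (dom_interp O))
                (interp_sum I (U_interp k))).

Definition trivial_off (k : {pred K}) (I : interpretation E K) : Prop :=
  (forall j (f : fsym E j) (a : 'I_j -> K),
     (exists i, a i \notin k) -> fint I f a = 0) /\
  (forall j (r : rsym E j) (a : 'I_j -> K),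
     (exists i, a i \notin k) -> ~ rint I r a).

(* In particular k is closed under the function symbols in E. *)
Definition lift_models (der : K -> K) (O k : {pred K})
    (I : interpretation E K) (Tres : theory (lang_res E)) : Prop :=
  exists clk : closed_under
      (M := reduct (res_to_lift E) (lift_structure der O k I))
      (fun x : K => x \in k),
    models (substructure clk) Tres.

End LiftStructures.

(* The class of models of T^dhl_lift. *)
Inductive dhl_lift (E : language) (Tres : theory (lang_res E)) :
    structure (lang_lift E) -> Prop :=
| DhlLift (K : realFieldType) (der : K -> K) (O k : {pred K})
    (I : interpretation E K) :
    dhl der O ->
    residue_lift der O k ->
    trivial_off k I ->
    lift_models der O k I Tres ->
    dhl_lift Tres (lift_structure der O k I).

(* Main.v *)
From HB Require Import structures.
From mathcomp Require Import all_boot all_order all_algebra.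
From mathcomp Require Import mpoly ring lra zify.
From mathcomp Require Import boolp classical_sets filter.
Require Import Defs.

Set Implicit Arguments.
Unset Strict Implicit.
Unset Printing Implicit Defensive.

Import Order.TTheory GRing.Theory Num.Theory.
Local Open Scope ring_scope.

(** Call a formula special-definable if it is equivalent to a special formula.
    Conjunctions, disjunctions and quantifiers over the lift k are harmless, and
    nested terms of the residue language are removed by graph formulas, so two
    points remain.

    Negation. Finitely many c_1, ..., c_N in K are combinations over k of some
    e_1 >> ... >> e_s > 0 which are themselves combinations of the c_l, since
    the residue field is k. If x ranges over k, a term in (x, y) is a
    combination of monomials in y with coefficients in k, so signs and dominance
    of terms are decided in k by the leading coordinates with respect to e.

    Quantification over K. By compactness it suffices to embed K over k and y
    into a model K* in which the formula is assumed to fail. Take a maximal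
    subfield F of K containing k and y, with an embedding into models preserving
    all quantifier-free data. If F <> K one adjoins an element of K. Either the
    value group of F is not divisible in that of K, and one adjoins a root; or
    some b is an immediate cut over F; or new values appear, and one adjoins an
    exponential integral of an element of F or an infinite chain b_0, b_1, ...
    in which b_(i+1) is the logarithmic derivative of b_i up to a factor of F.

    In the immediate case a differential polynomial P over F is settled if near
    b its nonconstant part is dominated by its constant part. If all P are
    settled, terms in b are asymptotic to terms in nearby elements of F.
    Otherwise an unsettled P of minimal complexity is shown to be quasilinear
    near b: if nonlinear parts persisted, comparing the norms of the homogeneous
    parts along multiplicative conjugates would, through minimality, contradict
    s^n << h for s the logarithmic derivative of h >> 1. A quasilinear unsettled
    P has a zero in the whole cut, by differential-henselianity and the fact that
    a linear operator of order r has at most r solutions of distinct value;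
    this zero is adjoined, reducing terms modulo P by pseudo-division. *)

(** Conjugating a homogeneous part of degree [e] by [h] multiplies its norm by [h ^+ e] only up to
    powers of a bound [s] of the logarithmic derivative of [h], because the derivatives of [h]
    enter. In the immediate case degrees are therefore compared modulo powers of [s]. For the linear
    part and a degree [d > 1], failure of quasilinearity gives one inequality, and settled
    directional derivatives give the reverse one with a loss of [s ^+ (2 * n * d)]. The radii of the
    cut are thus confined, in powers of [s], to the scale where both parts balance; taking for [s]
    the logarithmic derivative of the distance to that scale is absurd. The target model needs no
    saturation: the copy of an adjoined element may depend on the finitely many terms to be matched,
    as the maximal subfield is defined by finite satisfiability and limits are ultraproducts. The
    embedding need not respect the lifts, since the formula to be refuted is a quantifier-free
    formula of the ordered valued differential field. Hence a quantifier over the field becomes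
    existential quantifiers over the lift with a quantifier-free matrix. *)

Record dhlField := DhlField {
  dK :> realFieldType;
  dd : dK -> dK;
  dO : {pred dK};
  dhlP : dhl dd dO }.
Arguments dd {_} _.
Arguments dO : clear implicits.
Arguments dhlP : clear implicits.

(** * Dominance *)

Section Dominance.

Variable K : dhlField.
Let O := dO K.
Implicit Types f g h : K.

(* [dm], [sd], [asy], [eqv] are the relations usually written
   \preceq, \prec, \asymp and \sim. *)
Definition dm (f g : K) : bool := ((g == 0) ==> (f == 0)) && (f / g \in O).
Definition sd (f g : K) : bool := ~~ dm g f.
Definition asy (f g : K) : bool := dm f g && dm g f.
Definition eqv (f g : K) : bool := sd (f - g) g.

Lemma dmP f g : 0 \in O -> reflect (dominated O f g) (dm f g).
Proof.
move=> O0; rewrite /dm; apply: (iffP andP) => [[/implyP h1 h2]|[c cO ->]].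
  have [g0|g0] := eqVneq g 0.
    by exists 0 => //; rewrite mul0r; apply/eqP/h1/eqP.
  by exists (f / g) => //; rewrite divfK.
have [->|g0] := eqVneq g 0; first by rewrite mulr0 eqxx invr0 mulr0.
by rewrite mulfK.
Qed.

Lemma vrO : valuation_ring O. Proof. by case: (dhlP K) => -[]. Qed.
Lemma cvO a b x : a \in O -> b \in O -> a <= x <= b -> x \in O.
Proof. by case: (dhlP K) => -[_ _ h _ _] _ _ _; apply: h. Qed.

Lemma O1 : 1 \in O. Proof. by case: vrO => -[]. Qed.
Lemma OB x y : x \in O -> y \in O -> x - y \in O. Proof. by case: vrO => -[_ h _ _]; apply: h. Qed.
Lemma OM x y : x \in O -> y \in O -> x * y \in O. Proof. by case: vrO => -[_ _ h _]; apply: h. Qed.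
Lemma O0 : 0 \in O. Proof. by rewrite -(subrr 1) OB ?O1. Qed.
Lemma ON x : x \in O -> - x \in O. Proof. by move=> h; rewrite -sub0r OB ?O0. Qed.
Lemma OD x y : x \in O -> y \in O -> x + y \in O.
Proof. by move=> h1 h2; rewrite -[y]opprK OB ?ON. Qed.

Lemma dm1 f : dm f 1 = (f \in O).
Proof. by rewrite /dm oner_eq0 divr1. Qed.

Lemma dm_dom f g : dominated O f g <-> dm f g.
Proof. by split; [move/(dmP _ _ O0)|move/(dmP _ _ O0)]. Qed.

Lemma dm_total f g : dm f g || dm g f.
Proof.
rewrite /dm; have [->|g0] := eqVneq g 0; have [->|f0] := eqVneq f 0; rewrite ?mul0r ?O0 //=.
have /(proj2 vrO) : f / g != 0 by rewrite mulf_neq0 ?invr_eq0.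
by rewrite invf_div => -[] ->; rewrite ?orbT.
Qed.

Lemma dmxx f : dm f f. Proof. by have := dm_total f f; rewrite orbb. Qed.
Hint Resolve dmxx : core.

Lemma dm_trans g f h : dm f g -> dm g h -> dm f h.
Proof.
move=> /dm_dom [c cO ->] /dm_dom [d dO ->]; apply/dm_dom; exists (c * d); rewrite ?OM ?mulrA //.
Qed.

Lemma dmM f g f' g' : dm f g -> dm f' g' -> dm (f * f') (g * g').
Proof.
move=> /dm_dom [c cO ->] /dm_dom [d dO ->]; apply/dm_dom; exists (c * d); first by rewrite OM.
by rewrite mulrACA.
Qed.

Lemma dmD f g h : dm f h -> dm g h -> dm (f + g) h.
Proof.
move=> /dm_dom [c cO ->] /dm_dom [d dO ->]; apply/dm_dom; exists (c + d); first by rewrite OD.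
by rewrite mulrDl.
Qed.

Lemma dmN f g : dm (- f) g = dm f g.
Proof. by rewrite /dm oppr_eq0 mulNr; congr (_ && _); apply/idP/idP => /ON; rewrite ?opprK. Qed.
Lemma dmNr f g : dm f (- g) = dm f g.
Proof. by rewrite /dm oppr_eq0 invrN mulrN; congr (_ && _); apply/idP/idP => /ON; rewrite ?opprK. Qed.

Lemma dm0 f : dm 0 f. Proof. by rewrite /dm mul0r O0 eqxx implybT. Qed.
Hint Resolve dm0 : core.
Lemma dmx0 f : dm f 0 = (f == 0). Proof. by rewrite /dm eqxx invr0 mulr0 O0 andbT. Qed.

Lemma dm_pM2r h f g : h != 0 -> dm (f * h) (g * h) = dm f g.
Proof.
move=> h0; apply/idP/idP => H; last exact: dmM.
by have := dmM H (dmxx h^-1); rewrite !mulfK.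
Qed.
Lemma dm_pM2l h f g : h != 0 -> dm (h * f) (h * g) = dm f g.
Proof. by rewrite ![h * _]mulrC; apply: dm_pM2r. Qed.

Lemma dmB f g h : dm f h -> dm g h -> dm (f - g) h.
Proof. by move=> ? ?; rewrite dmD ?dmN. Qed.

Lemma sdN f g : sd (- f) g = sd f g. Proof. by rewrite /sd dmNr. Qed.
Lemma sdNr f g : sd f (- g) = sd f g. Proof. by rewrite /sd dmN. Qed.
Lemma sdW f g : sd f g -> dm f g.
Proof. by rewrite /sd => h; have := dm_total f g; rewrite (negPf h) orbF. Qed.
Lemma sd_dm_trans g f h : sd f g -> dm g h -> sd f h.
Proof. by rewrite /sd => h1 h2; apply: contra h1 => h3; apply: dm_trans h2 h3. Qed.
Lemma dm_sd_trans g f h : dm f g -> sd g h -> sd f h.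
Proof. by rewrite /sd => h1 h2; apply: contra h2 => h3; apply: dm_trans h3 h1. Qed.
Lemma sd_trans g f h : sd f g -> sd g h -> sd f h.
Proof. by move=> h1 /sdW; apply: sd_dm_trans. Qed.
Lemma sdxx f : sd f f = false. Proof. by rewrite /sd dmxx. Qed.
Lemma sdx0 f : sd f 0 = false. Proof. by rewrite /sd dm0. Qed.
Lemma sd0 f : sd 0 f = (f != 0). Proof. by rewrite /sd dmx0. Qed.
Lemma sd_neq0 f g : sd f g -> g != 0. Proof. by apply: contraTneq => ->; rewrite sdx0. Qed.
Lemma sd_pM2r h f g : h != 0 -> sd (f * h) (g * h) = sd f g.
Proof. by move=> h0; rewrite /sd dm_pM2r. Qed.
Lemma sd_pM2l h f g : h != 0 -> sd (h * f) (h * g) = sd f g.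
Proof. by move=> h0; rewrite /sd dm_pM2l. Qed.
Lemma sd_dmM f g f' g' : sd f g -> dm f' g' -> g' != 0 -> sd (f * f') (g * g').
Proof.
move=> h1 h2 h0; apply: (@dm_sd_trans (f * g')); first exact: dmM.
by rewrite sd_pM2r.
Qed.
Lemma dm_sdM f g f' g' : dm f g -> sd f' g' -> g != 0 -> sd (f * f') (g * g').
Proof. by move=> *; rewrite ![_ * f']mulrC ![_ * g']mulrC sd_dmM. Qed.
Lemma sdM f g f' g' : sd f g -> sd f' g' -> sd (f * f') (g * g').
Proof. by move=> h1 h2; apply: sd_dmM => //; [exact: sdW|exact: sd_neq0 h2]. Qed.

Lemma sdD f g h : sd f h -> sd g h -> sd (f + g) h.
Proof.
move=> h1 h2; have [fg|gf] := boolP (dm f g).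
  by apply: dm_sd_trans h2; apply: dmD.
by apply: dm_sd_trans h1; apply: dmD => //; apply: sdW.
Qed.
Lemma sdB f g h : sd f h -> sd g h -> sd (f - g) h.
Proof. by move=> ? ?; rewrite sdD ?sdN. Qed.

Lemma dm_sum (I : Type) (r : seq I) (P : pred I) (E : I -> K) h :
  (forall i, P i -> dm (E i) h) -> dm (\sum_(i <- r | P i) E i) h.
Proof. by move=> H; apply: (big_ind (fun x => dm x h)) => // x y; apply: dmD. Qed.
Lemma sd_sum (I : Type) (r : seq I) (P : pred I) (E : I -> K) h : h != 0 ->
  (forall i, P i -> sd (E i) h) -> sd (\sum_(i <- r | P i) E i) h.
Proof. by move=> h0 H; apply: (big_ind (fun x => sd x h)) => // [|x y]; [rewrite sd0|apply: sdD]. Qed.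

Lemma dmX f g n : dm f g -> dm (f ^+ n) (g ^+ n).
Proof. by move=> h; elim: n => [|n IH]; rewrite ?expr0 // !exprS dmM. Qed.
Lemma sdX f g n : sd f g -> sd (f ^+ n.+1) (g ^+ n.+1).
Proof. by move=> h; elim: n => [|n IH]; rewrite ?expr1 // exprS [g ^+ _]exprS sdM. Qed.
Lemma dmXK f g n : dm (f ^+ n.+1) (g ^+ n.+1) = dm f g.
Proof. by apply/idP/idP; [apply: contraLR; apply: sdX|apply: dmX]. Qed.
Lemma sdXK f g n : sd (f ^+ n.+1) (g ^+ n.+1) = sd f g.
Proof. by rewrite /sd dmXK. Qed.

Lemma dmV f g : f != 0 -> g != 0 -> dm f^-1 g^-1 = dm g f.
Proof.
move=> f0 g0; rewrite -(dm_pM2r _ _ (mulf_neq0 f0 g0)).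
by rewrite mulrA mulVf // mul1r [f * g]mulrC mulrA mulVf // mul1r.
Qed.
Lemma sdV f g : f != 0 -> g != 0 -> sd f^-1 g^-1 = sd g f.
Proof. by move=> f0 g0; rewrite /sd dmV. Qed.
Lemma dm_div f g h : g != 0 -> dm (f / g) h = dm f (h * g).
Proof. by move=> g0; rewrite -(dm_pM2r _ _ g0) divfK. Qed.
Lemma dm_divr f g h : g != 0 -> dm f (h / g) = dm (f * g) h.
Proof. by move=> g0; rewrite -(dm_pM2r _ _ g0) divfK. Qed.
Lemma sd_div f g h : g != 0 -> sd (f / g) h = sd f (h * g).
Proof. by move=> g0; rewrite /sd dm_divr. Qed.
Lemma sd_divr f g h : g != 0 -> sd f (h / g) = sd (f * g) h.
Proof. by move=> g0; rewrite /sd dm_div. Qed.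

Lemma dm_abs f g : dm `|f| g = dm f g.
Proof. by case: (ler0P f); rewrite ?dmN. Qed.
Lemma dm_absr f g : dm f `|g| = dm f g.
Proof. by case: (ler0P g); rewrite ?dmNr. Qed.
Lemma sd_abs f g : sd `|f| g = sd f g. Proof. by rewrite /sd dm_absr. Qed.
Lemma sd_absr f g : sd f `|g| = sd f g. Proof. by rewrite /sd dm_abs. Qed.
(** Convexity of the valuation ring: a quotient between -1 and 1 lies in it. This is how the order
    yields dominance. *)
Lemma le_dm f g : `|f| <= `|g| -> dm f g.
Proof.
have [->|g0] := eqVneq g 0; first by rewrite normr0 normr_le0 => /eqP ->.
move=> h; rewrite /dm (negPf g0) /=.
apply: (@cvO (-1) 1); [by rewrite ON ?O1|by rewrite O1|].
by rewrite -ler_norml normf_div ler_pdivrMr ?normr_gt0 ?mul1r.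
Qed.
Lemma sd_lt f g : sd f g -> `|f| < `|g|.
Proof. by rewrite ltNge; apply: contra; apply: le_dm. Qed.

Lemma asyxx f : asy f f. Proof. by rewrite /asy dmxx. Qed.
Lemma asy_sym f g : asy f g = asy g f. Proof. by rewrite /asy andbC. Qed.
Lemma asy_trans g f h : asy f g -> asy g h -> asy f h.
Proof. by rewrite /asy => /andP[a b] /andP[c d]; rewrite (dm_trans a c) (dm_trans d b). Qed.
Lemma asyM f g f' g' : asy f g -> asy f' g' -> asy (f * f') (g * g').
Proof. by rewrite /asy => /andP[a b] /andP[c d]; rewrite !dmM. Qed.
Lemma asy0 f : asy f 0 = (f == 0). Proof. by rewrite /asy dmx0 dm0 andbT. Qed.
Lemma asy_eq0 f g : asy f g -> (f == 0) = (g == 0).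
Proof.
move=> h; apply/idP/idP => /eqP e; move: h; rewrite e ?asy0 //.
by rewrite asy_sym asy0.
Qed.
Lemma asyX f g n : asy f g -> asy (f ^+ n) (g ^+ n).
Proof. by rewrite /asy => /andP[a b]; rewrite !dmX. Qed.
Lemma asyXK f g n : asy (f ^+ n.+1) (g ^+ n.+1) = asy f g.
Proof. by rewrite /asy !dmXK. Qed.
Lemma asyV f g : f != 0 -> asy f g -> asy f^-1 g^-1.
Proof.
move=> f0 h; have g0 : g != 0 by rewrite -(asy_eq0 h).
by move: h; rewrite /asy !dmV // andbC.
Qed.
Lemma asy_dml f f' g : asy f f' -> dm f g = dm f' g.
Proof. by case/andP => h1 h2; apply/idP/idP; apply: dm_trans. Qed.
Lemma asy_dmr f g g' : asy g g' -> dm f g = dm f g'.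
Proof. by case/andP => h1 h2; apply/idP/idP => /dm_trans; apply. Qed.
Lemma asy_sdl f f' g : asy f f' -> sd f g = sd f' g.
Proof. by move=> h; rewrite /sd (asy_dmr _ h). Qed.
Lemma asy_sdr f g g' : asy g g' -> sd f g = sd f g'.
Proof. by move=> h; rewrite /sd (asy_dml _ h). Qed.
Lemma asyNsd f g : asy f g = ~~ sd f g && ~~ sd g f.
Proof. by rewrite /asy /sd !negbK andbC. Qed.
Lemma asyP f g : [\/ sd f g, asy f g | sd g f].
Proof.
rewrite asyNsd; case: (boolP (sd f g)) => [?|_]; first by constructor 1.
by case: (boolP (sd g f)) => [?|_]; [constructor 3|constructor 2].
Qed.
Lemma asy_pM2r h f g : h != 0 -> asy (f * h) (g * h) = asy f g.
Proof. by move=> h0; rewrite /asy !dm_pM2r. Qed.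
Lemma asy_div1 f g : g != 0 -> asy (f / g) 1 = asy f g.
Proof. by move=> g0; rewrite -(asy_pM2r _ _ g0) divfK // mul1r. Qed.
Lemma sd_div1 f g : g != 0 -> sd (f / g) 1 = sd f g.
Proof. by move=> g0; rewrite sd_div // mul1r. Qed.
Lemma dm_div1 f g : g != 0 -> dm (f / g) 1 = dm f g.
Proof. by move=> g0; rewrite dm_div // mul1r. Qed.
Lemma sd1_div f g : g != 0 -> sd 1 (f / g) = sd g f.
Proof. by move=> g0; rewrite sd_divr // mul1r. Qed.

Lemma eqv_neq0 f g : eqv f g -> g != 0. Proof. exact: sd_neq0. Qed.
Lemma addr_sd_asy f g : sd g f -> asy (f + g) f.
Proof.
move=> h; rewrite /asy dmD ?(sdW h) //=; apply/negPn/negP => h2.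
have : sd ((f + g) - g) f by rewrite sdB.
by rewrite addrK sdxx.
Qed.
Lemma eqv_asy f g : eqv f g -> asy f g.
Proof. by move=> /addr_sd_asy; rewrite addrC subrK. Qed.
Lemma eqv_sg f g : eqv f g -> Num.sg f = Num.sg g.
Proof.
move=> /sd_lt; rewrite ltr_norml => /andP[].
case: (ltrgt0P g) => g0 h1 h2; rewrite ?(gtr0_sg g0) ?(ltr0_sg g0).
- by rewrite gtr0_sg //; lra.
- by rewrite ltr0_sg //; lra.
- by exfalso; move: h1 h2; rewrite g0; lra.
Qed.
Lemma eqvxx f : f != 0 -> eqv f f. Proof. by rewrite /eqv subrr sd0. Qed.
Lemma eqvM f g f' g' : eqv f g -> eqv f' g' -> eqv (f * f') (g * g').
Proof.
move=> h1 h2; rewrite /eqv.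
have -> : f * f' - g * g' = (f - g) * f' + g * (f' - g') by ring.
have g0 := eqv_neq0 h1; have g0' := eqv_neq0 h2.
apply: sdD; last by rewrite sd_pM2l.
by apply: sd_dmM => //; case/andP: (eqv_asy h2).
Qed.
Lemma eqvX f g n : eqv f g -> eqv (f ^+ n) (g ^+ n).
Proof.
move=> h; elim: n => [|n IH]; first by rewrite !expr0 eqvxx ?oner_neq0.
by rewrite !exprS eqvM.
Qed.

Lemma dm_max (I : eqType) (s : seq I) (E : I -> K) i0 : i0 \in s ->
  exists2 i, i \in s & forall j, j \in s -> dm (E j) (E i).
Proof.
elim: s i0 => // a s IH i0 _.
case: s IH => [|b s] IH; first by exists a; rewrite ?mem_head // => j; rewrite inE => /eqP ->.
have [|i si Hi] := IH b; first exact: mem_head.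
have [h|/sdW h] := boolP (dm (E a) (E i)).
  by exists i; [rewrite inE si orbT|move=> j; rewrite inE => /orP[/eqP->|/Hi]].
exists a; first exact: mem_head.
move=> j; rewrite inE => /orP[/eqP-> //|/Hi]; move/dm_trans; apply; exact: h.
Qed.

End Dominance.
#[export] Hint Resolve dmxx dm0 asyxx : core.
#[export] Hint Constants Opaque : core.

(** * Logarithmic derivatives *)

Section DhlFacts.

Variable K : dhlField.
Implicit Types f g h s t x y : K.
Notation ld := (logder (@dd K)).

Lemma sdomP f g : strictly_dominated (dO K) f g <-> sd f g.
Proof.
rewrite /strictly_dominated !dm_dom /sd; split=> [[_ /negP]|h] //.
by split; [apply: sdW|apply/negP].
Qed.

Lemma ddD x y : dd (x + y) = dd x + dd y.
Proof. by case: (dhlP K) => -[[h _] _ _ _ _] _ _ _; apply: h. Qed.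
Lemma ddM x y : dd (x * y) = dd x * y + x * dd y.
Proof. by case: (dhlP K) => -[[_ h] _ _ _ _] _ _ _; apply: h. Qed.
Lemma dd0 : dd (0 : K) = 0.
Proof. by have := ddD 0 0; rewrite addr0 => /eqP; rewrite -subr_eq subrr eq_sym => /eqP. Qed.
Lemma ddN x : dd (- x) = - dd x.
Proof. by apply/eqP; rewrite -addr_eq0 -ddD addNr dd0. Qed.
Lemma dd1 : dd (1 : K) = 0.
Proof.
have := ddM 1 1; rewrite !mulr1 mul1r => /eqP.
by rewrite -subr_eq subrr eq_sym => /eqP.
Qed.
Lemma dd_sum (I : Type) (r : seq I) (P : pred I) (E : I -> K) :
  dd (\sum_(i <- r | P i) E i) = \sum_(i <- r | P i) dd (E i).
Proof. exact: (big_morph _ ddD dd0). Qed.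
Lemma ldM f g : f != 0 -> g != 0 -> ld (f * g) = ld f + ld g.
Proof. by move=> f0 g0; rewrite /logder ddM; field; rewrite f0 g0. Qed.
Lemma ld1 : ld 1 = 0. Proof. by rewrite /logder dd1 mul0r. Qed.
Lemma ldV f : f != 0 -> ld f^-1 = - ld f.
Proof.
move=> f0; apply/eqP; rewrite -addr_eq0 -ldM ?invr_eq0 //.
by rewrite mulVf // ld1.
Qed.
Lemma ldf f g : f != 0 -> g != 0 -> ld (f / g) = ld f - ld g.
Proof. by move=> f0 g0; rewrite ldM ?invr_eq0 // ldV. Qed.
Lemma ldX f n : f != 0 -> ld (f ^+ n) = ld f *+ n.
Proof.
move=> f0; elim: n => [|n IH]; first by rewrite expr0 ld1 mulr0n.
by rewrite exprS ldM ?expf_neq0 // IH mulrS.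
Qed.
Lemma ldN f : ld (- f) = ld f.
Proof. by rewrite /logder ddN invrN mulrNN. Qed.
Lemma ld_abs f : ld `|f| = ld f.
Proof. by case: (ler0P f) => _; rewrite ?ldN. Qed.
Lemma dd_ld f : f != 0 -> dd f = f * ld f.
Proof. by move=> f0; rewrite /logder mulrC divfK. Qed.

Lemma dd_small f : sd f 1 -> sd (dd f) 1.
Proof.
by move=> h; apply/sdomP; case: (dhlP K) => _ [H _ _] _ _; apply/H/sdomP.
Qed.

(** Smallness of the derivation suffices: if [dd f] were infinite, its inverse [g] would be
    infinitesimal, and both [dd (f * g) = 1 + f * dd g] and [f * dd g] would be infinitesimal. *)
Lemma dd_O f : dm f 1 -> dm (dd f) 1.
Proof.
move=> f1; apply/negPn/negP => a1.
have a0 : dd f != 0 by apply: sd_neq0 a1.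
have g1 : sd (dd f)^-1 1 by rewrite -[1]invr1 sdV ?oner_neq0.
have : sd (dd (f * (dd f)^-1)) 1.
  by apply: dd_small; rewrite -[1]mulr1; apply: dm_sdM => //; rewrite oner_neq0.
rewrite ddM mulfV // => h.
have : sd (f * dd (dd f)^-1) 1.
  by rewrite -[1]mulr1; apply: dm_sdM => //; [apply: dd_small|rewrite oner_neq0].
by move=> h2; have := sdB h h2; rewrite addrK sdxx.
Qed.

Lemma dd_iter_O f i : dm f 1 -> dm (iter i dd f) 1.
Proof. by move=> h; elim: i => //= i; apply: dd_O. Qed.
Lemma dd_iter_small f i : sd f 1 -> sd (iter i dd f) 1.
Proof. by move=> h; elim: i => //= i; apply: dd_small. Qed.

Lemma linsurj (r : nat) (a : 'I_r.+1 -> K) b :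
  (forall i, dm (a i) 1) -> (exists i, dm 1 (a i)) -> dm b 1 ->
  exists2 y, dm y 1 & sd (\sum_(i < r.+1) a i * iter i dd y - b) 1.
Proof.
move=> Ha [i Hi] Hb; case: (dhlP K) => _ [_ H _] _ _.
have [|||y yO /sdomP h] := H r a b.
- by move=> j; rewrite -dm1.
- by exists i => /sdomP; rewrite /sd Hi.
- by rewrite -dm1.
by exists y; rewrite ?dm1.
Qed.

(** Linear surjectivity for the operator of order 1 with coefficients 0 and 1. Such an element is
    the yardstick in [ld_inf]. *)
Lemma dd_unit : exists2 f : K, dm f 1 & asy (dd f) 1.
Proof.
have [| | |y y1 h] := @linsurj 1 (fun i => (i == ord_max)%:R) 1.
- by move=> i; case: eqP => _; rewrite ?dm0 ?dmxx.
- by exists ord_max; rewrite eqxx dmxx.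
- exact: dmxx.
exists y => //; apply: eqv_asy; move: h; rewrite /eqv big_ord_recl big_ord1 /=.
by rewrite mul0r add0r mul1r.
Qed.

Lemma preH f g : f != 0 -> g != 0 -> dm f 1 -> sd g 1 -> sd (dd f) (ld g).
Proof.
case: (dhlP K) => -[_ _ _ _ H] _ _ _ f0 g0 f1 g1.
by apply/sdomP; apply: H => //; [apply/dm_dom|apply/sdomP].
Qed.

(** The last pre-H-field axiom, for an [f] whose derivative has size 1 and for the infinitesimal
    [h^-1], makes the logarithmic derivative infinite. Its sign comes from the axiom on elements
    exceeding the valuation ring, applied to [|h|]. *)
Lemma ld_inf h : sd 1 h -> sd 1 (ld h) /\ 0 < ld h.
Proof.
move=> h1; have h0 := sd_neq0 h1; split.
  have [f f1 df1] := dd_unit; rewrite -(asy_sdl _ df1) -sdNr -ldV //.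
  apply: preH => //; rewrite ?invr_eq0 //.
    by apply: contraTneq df1 => ->; rewrite dd0 asy_sym asy0 oner_eq0.
  by rewrite -[1]invr1 sdV ?oner_neq0.
rewrite -ld_abs /logder divr_gt0 ?normr_gt0 //.
case: (dhlP K) => -[_ _ _ H _] _ _ _; apply: H => a; rewrite -dm1 => a1.
apply: le_lt_trans (ler_norm a) _.
by apply: sd_lt; apply: dm_sd_trans a1 _; rewrite ?sd_absr.
Qed.
Lemma ld_small h : h != 0 -> sd h 1 -> sd 1 (ld h) /\ ld h < 0.
Proof.
move=> h0 h1; have h2 : sd 1 h^-1 by rewrite -[1]invr1 sdV ?oner_neq0.
by have := ld_inf h2; rewrite ldV // sdNr oppr_gt0.
Qed.
Lemma ld_asy h : asy h 1 -> dm (ld h) 1.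
Proof.
move=> h1; have h0 : h != 0 by rewrite (asy_eq0 h1) oner_eq0.
by rewrite /logder dm_div // mul1r (asy_dmr _ h1) dd_O //; case/andP: h1.
Qed.
(** Where [h] stands relative to 1 is decided by the sign and size of its logarithmic derivative.
    Dominance between monomials is later carried to other models by copying logarithmic
    derivatives. *)
Lemma sd1_ld h : h != 0 -> sd 1 h = sd 1 (ld h) && (0 < ld h).
Proof.
move=> h0; apply/idP/andP => [/ld_inf //|[h1 h2]].
case: (asyP h 1) => // [/(ld_small h0)[_]|/ld_asy].
  by move=> h3; move: (lt_trans h2 h3); rewrite ltxx.
by move: h1; rewrite /sd => /negPf ->.
Qed.
Lemma ld_sd1 h : h != 0 -> sd h 1 = sd 1 (ld h) && (ld h < 0).
Proof.
move=> h0; have := @sd1_ld h^-1; rewrite invr_eq0 h0 ldV // sdNr oppr_gt0 => <- //.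
by rewrite -{2}[1]invr1 sdV ?oner_neq0.
Qed.
Lemma asy1_ld h : h != 0 -> asy h 1 = dm (ld h) 1.
Proof.
move=> h0; apply/idP/idP => [/ld_asy //|h1].
by rewrite asyNsd sd1_ld // ld_sd1 // /sd h1.
Qed.

(** Intermediate values of [X ^+ n.+1 - x] between 0 and [1 + x]. *)
Lemma rootK x n : 0 < x -> exists2 y : K, 0 < y & y ^+ n.+1 = x.
Proof.
move=> x0; case: (dhlP K) => _ _ [H _ _] _.
have [||y /andP[y0 _] /rootP] := H (('X : {poly K}) ^+ n.+1 - x%:P) 0 (1 + x).
- by rewrite addr_ge0 ?ltW.
- rewrite !hornerE expr0n /= sub0r oppr_le0 ltW //= subr_ge0.
  apply: (@le_trans _ _ (1 + x)); first by rewrite lerDr.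
  by rewrite ler_eXnr // lerDl ltW.
rewrite !hornerE => /eqP; rewrite subr_eq0 => /eqP e.
exists y => //; rewrite lt_neqAle y0 andbT eq_sym; apply: contraTneq x0 => y0'.
by rewrite -e y0' expr0n ltxx.
Qed.

Lemma asyMn x n : asy (x *+ n.+1) x.
Proof.
apply/andP; split.
  by elim: n => [|n IH]; rewrite ?mulr1n // mulrS dmD.
by apply: le_dm; rewrite -mulr_natl normrM ger0_norm ?ler0n // ler_peMl // ler1n.
Qed.

(** Smallness of the derivation for [t^-1], whose derivative is minus [ld t / t]. *)
Lemma ld_lt_inf t : sd 1 t -> sd (ld t) t.
Proof.
move=> t1; have t0 := sd_neq0 t1.
have := @dd_small t^-1; rewrite -{1}[1]invr1 sdV ?oner_neq0 // => /(_ t1).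
rewrite dd_ld ?invr_eq0 // ldV // mulrN sdN mulrC sd_div ?mul1r //.
Qed.

(** A root of [|t|] has the same logarithmic derivative up to an integer factor, so raising the case
    of exponent 1 for the root to a power gives the claim. This estimate absorbs all later losses in
    powers of logarithmic derivatives. *)
Lemma ldX_lt_inf t n : sd 1 t -> sd (ld t ^+ n) t.
Proof.
case: n => [|n] t1; first by rewrite expr0.
have t0 := sd_neq0 t1.
have [|s s0 es] := @rootK `|t| n; first by rewrite normr_gt0.
have s1 : sd 1 s.
  by rewrite -(sdXK _ _ n) expr1n es sd_absr.
have s0' : s != 0 by rewrite gt_eqF.
rewrite -sd_absr -es; have := ld_lt_inf s1; rewrite -(sdXK _ _ n).
apply: dm_sd_trans; rewrite dmX //.
rewrite -ld_abs -es ldX //.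
by case/andP: (asyMn (ld s) n).
Qed.

(** In [g * (f / g)] both logarithmic derivatives are positive when [f / g] is infinite, so they
    cannot cancel; when [f / g] has size 1 its contribution is negligible. *)
Lemma ld_mono g f : sd 1 g -> dm g f -> dm (ld g) (ld f).
Proof.
move=> g1 gf; have g0 := sd_neq0 g1; have f1 := sd_dm_trans g1 gf.
have f0 := sd_neq0 f1; have [lg1 lg0] := ld_inf g1.
have -> : f = g * (f / g) by rewrite mulrC divfK.
have fg0 : f / g != 0 by rewrite mulf_neq0 ?invr_eq0.
rewrite ldM //; case: (asyP (f / g) 1) => [|h|/ld_inf[_ h]].
- by rewrite sd_div1 // /sd gf.
- have := sd_dm_trans (dm_sd_trans (ld_asy h) lg1) (dmxx _).
  by move/addr_sd_asy; rewrite /asy => /andP[].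
- by apply: le_dm; rewrite !gtr0_norm ?addr_gt0 // lerDl ltW.
Qed.
Lemma ld_mono_small g f : f != 0 -> sd g 1 -> dm f g -> dm (ld g) (ld f).
Proof.
move=> f0 g1 fg; have g0 : g != 0.
  by apply: contraTneq fg => ->; rewrite dmx0.
rewrite -(dmN (ld g)) -(dmNr _ (ld f)) -!ldV //; apply: ld_mono.
  by rewrite -{1}[1]invr1 sdV ?oner_neq0.
by rewrite dmV.
Qed.

(** In the product rule for [(f / g) * g], the term [dd (f / g) * g] is negligible against [dd g]
    because [dd (f / g)] is infinitesimal while [ld g] is infinite. *)
Lemma dd_sd f g : sd f g -> sd g 1 -> sd (dd f) (dd g).
Proof.
move=> fg g1; have g0 := sd_neq0 fg.
have [lg1 _] := ld_small g0 g1.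
have lg0 := sd_neq0 lg1.
have -> : dd f = f / g * (g * ld g) + dd (f / g) * g.
  by rewrite -(dd_ld g0) addrC -ddM divfK.
rewrite (dd_ld g0); apply: sdD.
  by have := sd_pM2r (f / g) 1 (mulf_neq0 g0 lg0); rewrite mul1r sd_div1 // => ->.
rewrite [g * ld g]mulrC sd_pM2r //; apply: sd_trans lg1.
by apply: dd_small; rewrite sd_div1.
Qed.

Lemma int_exists a : exists y : K, dd y = a.
Proof. by case: (dhlP K) => _ _ [_ H _] _; apply: H. Qed.
Lemma expint_exists a : exists2 y : K, y != 0 & ld y = a.
Proof. by case: (dhlP K) => _ _ [_ _ H] _; apply: H. Qed.
Lemma inf_exists : exists x : K, sd 1 x.
Proof.
by case: (dhlP K) => _ _ _ [x xO]; exists x; rewrite /sd dm1.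
Qed.

Lemma ld_dm s : dm 1 s -> dm (ld s) s.
Proof.
move=> s1; have [h|h] := boolP (dm s 1); last exact: sdW (ld_lt_inf h).
by apply: dm_trans (s1); apply: ld_asy; rewrite /asy h s1.
Qed.

Lemma dd_dmX x s n : dm 1 s -> dm x (s ^+ n) -> dm (dd x) (s ^+ n.+1).
Proof.
move=> s1 xs; have s0 : s != 0 by apply: contraTneq s1 => ->; rewrite dmx0 oner_eq0.
have sn0 : s ^+ n != 0 by rewrite expf_neq0.
rewrite -(divfK sn0 x) ddM exprS; apply: dmD.
  apply: dmM => //; apply: (dm_trans _ s1); apply: dd_O.
  by rewrite dm_div1.
rewrite dd_ld // mulrCA mulrC; apply: dmM => //.
rewrite -[X in dm _ X]mul1r; apply: dmM; first by rewrite dm_div1.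
rewrite ldX //; case: n {xs sn0} => [|n]; first by rewrite mulr0n dm0.
by rewrite (asy_dml _ (asyMn _ _)) ld_dm.
Qed.

(** Each derivation of [h] costs one factor [s], a bound for 1 and for the logarithmic derivative;
    the weight estimates below rest on this. *)
Lemma iter_dd_dm h s i : h != 0 -> dm 1 s -> dm (ld h) s ->
  dm (iter i dd h) (h * s ^+ i).
Proof.
move=> h0 s1 hs; rewrite mulrC -dm_div //; elim: i => [|i IH] /=.
  by rewrite divff // expr0.
have -> : dd (iter i dd h) / h = dd (iter i dd h / h) + (iter i dd h / h) * ld h.
  have e : iter i dd h = iter i dd h / h * h by rewrite divfK.
  by rewrite {1}e ddM /logder; field; exact: h0.
apply: dmD; first exact: dd_dmX.
by rewrite exprSr; apply: dmM.
Qed.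

End DhlFacts.

(** * Differential polynomials and conjugation *)

Section MpolyGeneric.

Variables (R : comNzRingType) (n : nat).
Implicit Types P Q : {mpoly R[n]}.

Lemma mpoly_ringind (T : {mpoly R[n]} -> Prop) :
  (forall c, T c%:MP) -> (forall i, T 'X_i) ->
  (forall P Q, T P -> T Q -> T (P + Q)) ->
  (forall P Q, T P -> T Q -> T (P * Q)) -> forall P, T P.
Proof.
move=> TC TX TD TM P; rewrite (mpolyE P); apply: (big_ind T) => //.
  by rewrite -mpolyC0.
move=> m _; rewrite -mul_mpolyC; apply: (TM) => //.
rewrite mpolyXE_id; apply: (big_ind T) => //; first by rewrite -mpolyC1.
move=> i _; move: (m i) => e; elim: e => [|k IH]; first by rewrite expr0 -mpolyC1.
by rewrite exprS; apply: (TM).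
Qed.

Lemma mnm_subxx (m : 'X_{1..n}) : (m - m = 0)%MM.
Proof. by apply/mnmP => i; rewrite mnmBE mnm0E subnn. Qed.

Lemma mcoeff0_meval P : P@_0 = P.@[fun=> 0].
Proof.
elim/mpoly_ringind: P => [c|i|P Q h1 h2|P Q h1 h2].
- by rewrite mcoeffC eqxx mulr1 mevalC.
- by rewrite mevalXU mcoeffX -mdeg_eq0 mdeg1.
- by rewrite mcoeffD mevalD h1 h2.
- by rewrite mevalM -h1 -h2 (rmorphM (mcoeff 0%MM)).
Qed.

Lemma comp_mpolyA (s t : n.-tuple {mpoly R[n]}) P :
  (P \mPo s) \mPo t = P \mPo [tuple (tnth s i) \mPo t | i < n].
Proof.
elim/mpoly_ringind: P => [c|i|P Q h1 h2|P Q h1 h2].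
- by rewrite !comp_mpolyC.
- by rewrite !comp_mpolyXU -!tnth_nth tnth_mktuple.
- by rewrite !comp_mpolyD h1 h2.
- by rewrite !rmorphM /= h1 h2.
Qed.

Section Chain.
Variable w : 'I_n -> R.
Definition dirv Q := \sum_i w i *: Q^`M(i).
Lemma dirvC c : dirv c%:MP = 0.
Proof. by rewrite /dirv big1 // => i _; rewrite mderivC scaler0. Qed.
Lemma dirvD P Q : dirv (P + Q) = dirv P + dirv Q.
Proof. by rewrite /dirv -big_split /=; apply: eq_bigr => i _; rewrite mderivD scalerDr. Qed.
Lemma dirvZ c Q : dirv (c *: Q) = c *: dirv Q.
Proof.
rewrite /dirv scaler_sumr; apply: eq_bigr => i _.
by rewrite mderivZ !scalerA mulrC.
Qed.
Lemma dirv_sum (I : Type) (r : seq I) (p : pred I) (E : I -> {mpoly R[n]}) :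
  dirv (\sum_(i <- r | p i) E i) = \sum_(i <- r | p i) dirv (E i).
Proof. by apply: (big_morph dirv dirvD); rewrite -mpolyC0 dirvC. Qed.
Lemma dirvM P Q : dirv (P * Q) = dirv P * Q + P * dirv Q.
Proof.
rewrite /dirv mulr_suml mulr_sumr -big_split /=; apply: eq_bigr => i _.
by rewrite mderivM scalerDr scalerAl scalerAr.
Qed.
Lemma dirvX i : dirv 'X_i = (w i)%:MP.
Proof.
rewrite /dirv (bigD1 i) //= big1 ?addr0 => [|j ji].
  by rewrite mderivX mnm1E eqxx mnm_subxx mpolyX0 scale1r -mul_mpolyC mulr1.
by rewrite mderivX mnm1E eq_sym (negPf ji) scale0r scaler0.
Qed.
End Chain.

Lemma dirv_comp w (s : n.-tuple {mpoly R[n]}) P :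
  dirv w (P \mPo s) = \sum_i (P^`M(i) \mPo s) * dirv w (tnth s i).
Proof.
elim/mpoly_ringind: P => [c|i|P Q h1 h2|P Q h1 h2].
- rewrite comp_mpolyC dirvC big1 // => i _.
  by rewrite mderivC comp_mpoly0 mul0r.
- rewrite comp_mpolyXU -tnth_nth (bigD1 i) //= big1 ?addr0 => [|j ji].
    by rewrite mderivX mnm1E eqxx mnm_subxx mpolyX0 scale1r comp_mpoly1 mul1r.
  by rewrite mderivX mnm1E eq_sym (negPf ji) scale0r comp_mpoly0 mul0r.
- rewrite comp_mpolyD dirvD h1 h2 -big_split /=; apply: eq_bigr => i _.
  by rewrite mderivD comp_mpolyD mulrDl.
- rewrite rmorphM /= dirvM h1 h2 mulr_suml mulr_sumr -big_split /=.
  apply: eq_bigr => i _; rewrite mderivM comp_mpolyD !rmorphM /=; ring.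
Qed.

End MpolyGeneric.

(** * Leibniz rule and the conjugates P(a + g Y) *)

Section Derivation.

Variables (R : comNzRingType) (d : R -> R).
Hypothesis dP : (forall x y, d (x + y) = d x + d y) /\ (forall x y, d (x * y) = d x * y + x * d y).

Lemma gdD x y : d (x + y) = d x + d y. Proof. by case: dP. Qed.
Lemma gdM x y : d (x * y) = d x * y + x * d y. Proof. by case: dP. Qed.
Lemma gd0 : d 0 = 0.
Proof. by have := gdD 0 0; rewrite addr0 => /eqP; rewrite -subr_eq subrr eq_sym => /eqP. Qed.
Lemma gd1 : d 1 = 0.
Proof. by have := gdM 1 1; rewrite !mulr1 mul1r => /eqP; rewrite -subr_eq subrr eq_sym => /eqP. Qed.
Lemma gd_sum (I : Type) (r : seq I) (p : pred I) (E : I -> R) :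
  d (\sum_(i <- r | p i) E i) = \sum_(i <- r | p i) d (E i).
Proof. exact: (big_morph _ gdD gd0). Qed.
Lemma gd_iterD k x y : iter k d (x + y) = iter k d x + iter k d y.
Proof. by elim: k => //= k ->; rewrite gdD. Qed.
Lemma gd_iter0 k : iter k d 0 = 0. Proof. by elim: k => //= k ->; rewrite gd0. Qed.
Lemma gd_iter1 k : iter k d 1 = (k == 0)%:R.
Proof. by elim: k => //= k ->; case: k => [|k] /=; rewrite ?gd1 ?gd0. Qed.
Lemma gd_nat k : d k%:R = 0.
Proof. by elim: k => [|k IH]; rewrite ?gd0 // -natr1 gdD IH gd1 addr0. Qed.
Lemma gd_iterN k x : iter k d (- x) = - iter k d x.
Proof. by apply/eqP; rewrite -addr_eq0 -gd_iterD addNr gd_iter0. Qed.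

Lemma Leibniz k x y : iter k d (x * y) =
  \sum_(j < k.+1) 'C(k, j)%:R * (iter (k - j) d x * iter j d y).
Proof.
elim: k => [|k IH]; first by rewrite big_ord1 bin0 mul1r.
rewrite iterS IH gd_sum.
under eq_bigr => j _ do rewrite gdM gd_nat mul0r add0r gdM mulrDr -!iterS.
rewrite big_split /= big_ord_recl [RHS]big_ord_recl /= !bin0 !subn0.
rewrite -!addrA; congr (_ + _).
rewrite [in X in _ + X]big_ord_recr [RHS]big_ord_recr /= !binn !subnn addrA; congr (_ + _).
rewrite -big_split /=; apply: eq_bigr => j _ /=.
have jk := ltn_ord j; rewrite /bump /= !add1n binS natrD mulrDl subSS.
by rewrite -!iterS -subSn // subSS.
Qed.

(** Both products are the trinomial coefficient of [a], [b], [c]; it matches the coefficients in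
    [cj_cj]. *)
Lemma bin_mul_swap a b c :
  ('C(a + b + c, a + b) * 'C(a + b, a) = 'C(a + b + c, a) * 'C(b + c, b))%N.
Proof.
have f0 k : (0 < k`!)%N by apply: fact_gt0.
have h1 : ('C(a + b + c, a + b) * ((a + b)`! * c`!) = (a + b + c)`!)%N.
  by rewrite -(@bin_fact (a + b + c) (a + b)) ?leq_addr // addKn.
have h2 : ('C(a + b, a) * (a`! * b`!) = (a + b)`!)%N.
  by rewrite -(@bin_fact (a + b) a) ?leq_addr // addKn.
have h3 : ('C(a + b + c, a) * (a`! * (b + c)`!) = (a + b + c)`!)%N.
  by rewrite -addnA -(@bin_fact (a + (b + c)) a) ?leq_addr // addKn.
have h4 : ('C(b + c, b) * (b`! * c`!) = (b + c)`!)%N.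
  by rewrite -(@bin_fact (b + c) b) ?leq_addr // addKn.
apply/eqP; rewrite -(@eqn_pmul2r (a`! * b`! * c`!)) ?muln_gt0 ?f0 //; apply/eqP.
transitivity ((a + b + c)`!).
  by rewrite -h1 -h2; ring.
by rewrite -h3 -h4; ring.
Qed.

Variable n : nat.
Implicit Types P Q : {mpoly R[n]}.

Definition jet (y : R) : 'I_n -> R := fun i => iter i d y.

(** The entries are the derivatives of [a + g Y], expanded by the Leibniz rule with ['X_j] standing
    for the [j]-th derivative of [Y]. *)
Definition sb (a g : R) : n.-tuple {mpoly R[n]} :=
  [tuple (iter i d a)%:MP + \sum_(j < n | (j <= i)%N) ('C(i, j)%:R * iter (i - j) d g) *: 'X_j | i < n].

(* [cj a g P] is the additive and multiplicative conjugate P_{+a, x g}, that is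
   P(a + g Y). *)
Definition cj (a g : R) P := P \mPo (sb a g).

Lemma Leibniz_n (i : 'I_n) x y : iter i d (x * y) =
  \sum_(j < n | (j <= i)%N) 'C(i, j)%:R * (iter (i - j) d x * iter j d y).
Proof.
rewrite Leibniz (big_ord_widen n (fun j : nat => 'C(i, j)%:R * (iter (i - j) d x * iter j d y))) //.
Qed.

Lemma cj_eval a g z P : (cj a g P).@[jet z] = P.@[jet (a + g * z)].
Proof.
rewrite /cj comp_mpoly_meval; apply: meval_eq => i.
rewrite tnth_mktuple mevalD mevalC /jet gd_iterD; congr (_ + _).
rewrite Leibniz_n (rmorph_sum (meval _)) /=; apply: eq_bigr => j _.
by rewrite mevalZ mevalXU mulrA.
Qed.

Lemma cj_cj a g c h P : cj c h (cj a g P) = cj (a + g * c) (g * h) P.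
Proof.
rewrite /cj comp_mpolyA; congr comp_mpoly; apply: eq_mktuple => i.
rewrite tnth_mktuple comp_mpolyD comp_mpolyC gd_iterD mpolyCD -addrA; congr (_ + _).
rewrite (rmorph_sum (comp_mpoly _)) /=.
under eq_bigr => j _ do
  rewrite comp_mpolyZ comp_mpolyXU -tnth_nth tnth_mktuple scalerDr scaler_sumr.
rewrite big_split /=; congr (_ + _).
  rewrite Leibniz_n (raddf_sum (@mpolyC n R)) /=; apply: eq_bigr => j _.
  by rewrite -mul_mpolyC -mpolyCM mulrA.
(* For a fixed variable ['X_l], the inner sum over [j] is to become the Leibniz expansion of the
   derivative of [g * h] of order [i - l]. *)
rewrite (exchange_big_dep (fun l : 'I_n => (l <= i)%N)) /=; last first.
  by move=> j l ji lj; apply: leq_trans lj ji.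
apply: eq_bigr => l li; under eq_bigr => j _ do rewrite scalerA.
rewrite -scaler_suml; congr (_ *: _).
rewrite Leibniz mulr_sumr.
pose G (j : nat) := ('C(i, j)%:R * iter (i - j) d g * ('C(j, l)%:R * iter (j - l) d h) : R).
rewrite -(big_geq_mkord l n (fun j => (j <= i)%N) G) -(big_nat_widen l i.+1 n xpredT G) //.
rewrite -{1}[nat_of_ord l]add0n big_addn subSn // big_mkord.
apply: eq_bigr => j _; rewrite /G.
have jl : (j + l <= i)%N by have := ltn_ord j; rewrite ltnS leq_subRL // addnC.
rewrite addnK subnDA subnAC.
have e := bin_mul_swap l j (i - (l + j)); rewrite addnC in jl.
rewrite subnKC // in e.
have e2 : (j + (i - (l + j)) = i - l)%N by lia.
rewrite e2 in e.
rewrite [(j + l)%N]addnC.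
transitivity (('C(i, l + j) * 'C(l + j, l))%:R * (iter (i - l - j) d g * iter j d h)).
  by rewrite natrM; ring.
by rewrite e natrM; ring.
Qed.

Lemma cj01 P : cj 0 1 P = P.
Proof.
rewrite -[RHS]comp_mpoly_id /cj; congr comp_mpoly; apply: eq_mktuple => i.
rewrite gd_iter0 mpolyC0 add0r (bigD1 i) //= subnn binn mulr1 scale1r big1 ?addr0 // => j /andP[ji nji].
rewrite gd_iter1 subn_eq0 leqNgt ltn_neqAle ji andbT.
by rewrite nji /= mulr0 scale0r.
Qed.

Lemma cj_coef0 a g P : (cj a g P)@_0 = P.@[jet a].
Proof.
rewrite mcoeff0_meval /cj comp_mpoly_meval; apply: meval_eq => i.
rewrite tnth_mktuple mevalD mevalC (rmorph_sum (meval _)) /= big1 ?addr0 // => j _.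
by rewrite mevalZ mevalXU mulr0.
Qed.

Lemma cjD a g P Q : cj a g (P + Q) = cj a g P + cj a g Q. Proof. exact: comp_mpolyD. Qed.
Lemma cjZ a g c P : cj a g (c *: P) = c *: cj a g P. Proof. exact: comp_mpolyZ. Qed.
Lemma cj_sum a g (I : Type) (r : seq I) (p : pred I) (E : I -> {mpoly R[n]}) :
  cj a g (\sum_(i <- r | p i) E i) = \sum_(i <- r | p i) cj a g (E i).
Proof. by rewrite /cj (rmorph_sum (comp_mpoly _)). Qed.

(** The derivative of P(Y + t w) at t = 0: the tangent vector is the jet of [w]. It commutes with
    conjugation up to rescaling [w], and lowers the total degree. *)
Definition dird (w : R) P := dirv (jet w) P.

Lemma dird_cj a g w P : dird w (cj a g P) = cj a g (dird (g * w) P).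
Proof.
rewrite /dird /cj dirv_comp [in RHS]/dirv (rmorph_sum (comp_mpoly _)) /=; apply: eq_bigr => i _.
rewrite tnth_mktuple dirvD dirvC add0r dirv_sum comp_mpolyZ /jet Leibniz_n.
rewrite -mul_mpolyC [LHS]mulrC; congr (_ * _).
rewrite (raddf_sum (@mpolyC n R)) /=; apply: eq_bigr => j _.
by rewrite dirvZ dirvX -mul_mpolyC -mpolyCM mulrA.
Qed.

End Derivation.

Lemma map_cj (R S : comNzRingType) (f : {rmorphism R -> S}) (dR : R -> R) (dS : S -> S) n
    (a g : R) (P : {mpoly R[n]}) : injective f -> (forall x, f (dR x) = dS (f x)) ->
  map_mpoly f (cj dR a g P) = cj dS (f a) (f g) (map_mpoly f P).
Proof.
move=> fi fd; rewrite /cj map_mpoly_comp //; congr comp_mpoly.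
have fid k x : f (iter k dR x) = iter k dS (f x) by elim: k => //= k <-.
apply: eq_from_tnth => i; rewrite tnth_map !tnth_mktuple [LHS](rmorphD (map_mpoly f)) /= map_mpolyC.
congr (_%:MP + _); first exact: fid.
rewrite [LHS](rmorph_sum (map_mpoly f)) /=; apply: eq_bigr => j _.
by rewrite map_mpolyZ map_mpolyX (rmorphM f) (rmorph_nat f) fid.
Qed.

Lemma map_dird (R S : comNzRingType) (f : {rmorphism R -> S}) (dR : R -> R) (dS : S -> S) n
    (w : R) (P : {mpoly R[n]}) : injective f -> (forall x, f (dR x) = dS (f x)) ->
  map_mpoly f (dird dR w P) = dird dS (f w) (map_mpoly f P).
Proof.
move=> fi fd; have fid k x : f (iter k dR x) = iter k dS (f x) by elim: k => //= k <-.
rewrite /dird /dirv (rmorph_sum (map_mpoly f)) /=; apply: eq_bigr => i _.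
rewrite map_mpolyZ /jet fid; congr (_ *: _); apply/mpolyP => m.
by rewrite mcoeff_map_mpoly !mcoeff_mderiv mcoeff_map_mpoly /=; apply: (rmorphMn f).
Qed.

Lemma map_meval (R S : comNzRingType) (f : {rmorphism R -> S}) (dR : R -> R) (dS : S -> S) n
    (y : R) (P : {mpoly R[n]}) : (forall x, f (dR x) = dS (f x)) ->
  f P.@[jet dR y] = (map_mpoly f P).@[jet dS (f y)].
Proof.
move=> fd; have fid k x : f (iter k dR x) = iter k dS (f x) by elim: k => //= k <-.
elim/mpoly_ringind: P => [c|i|P Q h1 h2|P Q h1 h2].
- by rewrite map_mpolyC !mevalC.
- by rewrite map_mpolyX !mevalXU /jet fid.
- by rewrite (rmorphD (map_mpoly f)) /= !mevalD (rmorphD f) h1 h2.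
- by rewrite (rmorphM (map_mpoly f)) /= !mevalM (rmorphM f) h1 h2.
Qed.

(** * Norms and weights *)

Section MonomialFunctionals.

Variables (R : comNzRingType) (n : nat).
Implicit Types (P Q : {mpoly R[n]}) (c : nat -> nat).

(** [c = id] gives the weight, a constant 1 gives the degree, and step functions give the degree in
    the variables from a certain order on. *)
Definition Lf c (m : 'X_{1..n}) : nat := (\sum_(i < n) c i * m i)%N.

Lemma LfD c m1 m2 : Lf c (m1 + m2) = (Lf c m1 + Lf c m2)%N.
Proof. by rewrite /Lf -big_split /=; apply: eq_bigr => i _; rewrite mnmDE mulnDr. Qed.
Lemma Lf0 c : Lf c 0 = 0%N.
Proof. by rewrite /Lf big1 // => i _; rewrite mnm0E muln0. Qed.
Lemma LfU c i : Lf c U_(i) = c i.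
Proof.
rewrite /Lf (bigD1 i) //= mnm1E eqxx muln1 big1 ?addn0 // => j ji.
by rewrite mnm1E eq_sym (negPf ji) muln0.
Qed.
Lemma Lf_mdeg m : Lf (fun=> 1%N) m = mdeg m.
Proof. by rewrite /Lf mdegE; apply: eq_bigr => i _; rewrite mul1n. Qed.
Lemma Lf_le c c' m : (forall i : 'I_n, (c i <= c' i)%N) -> (Lf c m <= Lf c' m)%N.
Proof. by move=> h; apply: leq_sum => i _; rewrite leq_mul2r h orbT. Qed.

Lemma mcoeffM_supp P Q m : (P * Q)@_m != 0 ->
  exists m1 m2, [/\ P@_m1 != 0, Q@_m2 != 0 & m = (m1 + m2)%MM].
Proof.
rewrite {1}(mpolyE P) mulr_suml raddf_sum /= => h.
have [m1 m1P h1] : exists2 m1, m1 \in msupp P & (P@_m1 *: 'X_[m1] * Q)@_m != 0.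
  apply: contrapT => h1; move/eqP: h; apply; rewrite big_seq big1 // => m1 m1P.
  by apply/eqP/negPn/negP => h2; apply: h1; exists m1.
move: h1; rewrite -scalerAl mcoeffZ {1}(mpolyE Q) mulr_sumr raddf_sum /= => h1.
have [m2 m2P h2] : exists2 m2, m2 \in msupp Q & ('X_[m1] * (Q@_m2 *: 'X_[m2]))@_m != 0.
  apply: contrapT => h2; move/eqP: h1; apply.
  rewrite big_seq big1 ?mulr0 // => m2 m2P.
  by apply/eqP/negPn/negP => h3; apply: h2; exists m2.
exists m1, m2; rewrite -!mcoeff_msupp m1P m2P; split=> //.
move: h2; rewrite -scalerAr mcoeffZ -mpolyXD mcoeffX.
by case: ((m1 + m2)%MM =P m) => // _; rewrite mulr0 eqxx.
Qed.

Definition SL c B P := forall m, P@_m != 0 -> (Lf c m <= B)%N.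

Lemma SL_sum c B (I : Type) (r : seq I) (p : pred I) (E : I -> {mpoly R[n]}) :
  (forall i, p i -> SL c B (E i)) -> SL c B (\sum_(i <- r | p i) E i).
Proof.
move=> h; apply: (big_ind (SL c B)) => //; first by move=> m; rewrite mcoeff0 eqxx.
move=> P Q hP hQ m; rewrite mcoeffD => h1.
case: (eqVneq P@_m 0) h1 => [->|/hP //]; rewrite add0r; exact: hQ.
Qed.
Lemma SLD c B P Q : SL c B P -> SL c B Q -> SL c B (P + Q).
Proof.
move=> hP hQ m; rewrite mcoeffD => h1.
case: (eqVneq P@_m 0) h1 => [->|/hP //]; rewrite add0r; exact: hQ.
Qed.
Lemma SLZ c B a P : SL c B P -> SL c B (a *: P).
Proof. by move=> h m; rewrite mcoeffZ => h1; apply: h; apply: contraNneq h1 => ->; rewrite mulr0. Qed.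
Lemma SLM c B B' P Q : SL c B P -> SL c B' Q -> SL c (B + B') (P * Q).
Proof.
move=> hP hQ m /mcoeffM_supp[m1 [m2 [h1 h2 ->]]]; rewrite LfD leq_add ?hP ?hQ //.
Qed.
Lemma SLW c B B' P : (B <= B')%N -> SL c B P -> SL c B' P.
Proof. by move=> h hP m /hP h1; apply: leq_trans h1 h. Qed.
Lemma SLC c a : SL c 0 a%:MP.
Proof.
by move=> m; rewrite mcoeffC; case: (m =P 0%MM) => [->|]; rewrite ?Lf0 // mulr0 eqxx.
Qed.
Lemma SLX c (m : 'X_{1..n}) : SL c (Lf c m) 'X_[m].
Proof. by move=> m'; rewrite mcoeffX; case: (m =P m') => [->|]; rewrite ?eqxx. Qed.
Lemma SL_exp c B P k : SL c B P -> SL c (k * B) (P ^+ k).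
Proof.
move=> hP; elim: k => [|k IH]; first by rewrite expr0 mul0n -mpolyC1; apply: SLC.
by rewrite exprS mulSn; apply: SLM.
Qed.
Lemma SL_compX c (C : 'I_n -> nat) (s : n.-tuple {mpoly R[n]}) (m : 'X_{1..n}) :
  (forall i, SL c (C i) (tnth s i)) -> SL c (\sum_(i < n) m i * C i)%N ('X_[m] \mPo s).
Proof.
move=> h; rewrite comp_mpolyX.
apply: (big_ind2 (fun P B => SL c B P)) => [|P B Q B' hP hQ|i _].
- by rewrite -mpolyC1; apply: SLC.
- exact: SLM.
- exact: SL_exp.
Qed.

Lemma SL_mderiv c B P (i : 'I_n) : SL c B P -> SL c (B - c i) P^`M(i).
Proof.
move=> h m; rewrite mcoeff_mderiv => h1.
have : P@_(m + U_(i)) != 0 by apply: contraNneq h1 => ->; rewrite mul0rn.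
by move/h; rewrite LfD LfU; lia.
Qed.
Lemma SL_mderivW c B P (i : 'I_n) : SL c B P -> SL c B P^`M(i).
Proof. by move/(@SL_mderiv _ _ _ i); apply: SLW; apply: leq_subr. Qed.

Variable d : R -> R.
Hypothesis dP : (forall x y, d (x + y) = d x + d y) /\ (forall x y, d (x * y) = d x * y + x * d y).

Lemma SL_sb c a g (i : 'I_n) : {homo c : i j / (i <= j)%N} -> SL c (c i) (tnth (sb d n a g) i).
Proof.
move=> cm; rewrite tnth_mktuple; apply: SLD.
  by apply: (@SLW c 0%N); [rewrite leq0n|apply: SLC].
apply: SL_sum => j ji; apply: SLZ; apply: (@SLW _ (Lf c U_(j))); last exact: SLX.
by rewrite LfU cm.
Qed.

Definition cmon a g (m : 'X_{1..n}) : {mpoly R[n]} := 'X_[m] \mPo sb d n a g.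

Lemma cj_coef a g P t : (cj d a g P)@_t = \sum_(m <- msupp P) P@_m * (cmon a g m)@_t.
Proof.
rewrite /cj {1}(mpolyE P) (rmorph_sum (comp_mpoly _)) /= raddf_sum /=.
by apply: eq_bigr => m _; rewrite comp_mpolyZ mcoeffZ.
Qed.

Lemma cmon_SL c a g m : {homo c : i j / (i <= j)%N} -> SL c (Lf c m) (cmon a g m).
Proof.
move=> cm; rewrite /Lf; under eq_bigr do rewrite mulnC.
by apply: SL_compX => i; apply: SL_sb.
Qed.

(** The variable of order [i] is replaced by a combination of 1 and the variables of order at most
    [i], so a functional with nondecreasing coefficients cannot grow. Conjugation thus respects
    order, leading degree and total degree at once. *)
Lemma SL_cj c B a g P : {homo c : i j / (i <= j)%N} -> SL c B P -> SL c B (cj d a g P).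
Proof.
move=> cm hP; rewrite /cj (mpolyE P) (rmorph_sum (comp_mpoly _)) /= big_seq.
apply: SL_sum => m mP; rewrite comp_mpolyZ; apply: SLZ.
by apply: (@SLW c (Lf c m)); [apply: hP; rewrite -mcoeff_msupp|apply: cmon_SL].
Qed.

(* [hp e P] and, below, [hi P] and [nc P] are the homogeneous part of degree [e],
   the part of degree at least 2, and the nonconstant part of [P]. *)
Definition hp e P : {mpoly R[n]} := pihomog mdeg e P.

Lemma hp_coef e P m : (hp e P)@_m = if mdeg m == e then P@_m else 0.
Proof.
rewrite /hp pihomogE raddf_sum /=.
under eq_bigr => m' _ do rewrite mcoeffZ mcoeffX.
have [mP|mP] := boolP (m \in msupp P); last first.
  rewrite (memN_msupp_eq0 mP) if_same big_seq_cond big1 // => m' /andP[m'P _].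
  by case: eqP m'P mP => [->|]; rewrite ?mulr0 // => ->.
case: ifP => h.
  rewrite big_mkcond (bigD1_seq m) ?msupp_uniq //= h eqxx mulr1 big1 ?addr0 // => m' /negPf ->.
  by rewrite mulr0 if_same.
rewrite big1 // => m' h'; case: eqP => [e'|]; last by rewrite mulr0.
by move: h'; rewrite e' h.
Qed.

Lemma mpoly_hom P : P = \sum_(e < msize P) hp e P.
Proof. by rewrite /hp -pihomog_partitionE. Qed.

Lemma cmon0_mdeg h m t : (cmon 0 h m)@_t != 0 -> mdeg t = mdeg m.
Proof.
suff /(_ t) : forall t, (cmon 0 h m)@_t != 0 -> (mdeg t == mdeg m) by move=> H /H/eqP.
rewrite mdegE /cmon comp_mpolyX.
apply: (big_ind2 (fun P (B : nat) => forall t, P@_t != 0 -> mdeg t == B)) => [|P B Q B' hP hQ|i _].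
- by move=> t'; rewrite mcoeff1; case: (t' =P 0%MM) => [->|]; rewrite ?mdeg0 ?eqxx.
- by move=> t' /mcoeffM_supp[m1 [m2 [/hP/eqP h1 /hQ/eqP h2 ->]]]; rewrite mdegD h1 h2.
have hs t' : (tnth (sb d n 0 h) i)@_t' != 0 -> mdeg t' == 1%N.
  rewrite tnth_mktuple (gd_iter0 dP) mpolyC0 add0r raddf_sum /= => H.
  apply: contraNT H => H; apply/eqP; rewrite big1 // => j _.
  rewrite mcoeffZ mcoeffX; case: eqP => [e|]; last by rewrite mulr0.
  by move: H; rewrite -e mdeg1.
elim: (m i) => [|k IH] t'.
  by rewrite expr0 mcoeff1; case: (t' =P 0%MM) => [->|]; rewrite ?mdeg0 ?eqxx.
rewrite exprS => /mcoeffM_supp[m1 [m2 [/hs/eqP h1 /IH/eqP h2 ->]]].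
by rewrite mdegD h1 h2.
Qed.

Lemma hp_cj0 e h P : hp e (cj d 0 h P) = cj d 0 h (hp e P).
Proof.
apply/mpolyP => t; rewrite hp_coef.
rewrite /cj {1}(mpolyE P) /hp pihomogE !(rmorph_sum (comp_mpoly _)) /= !raddf_sum /=.
case: eqP => he.
  rewrite big_mkcond [RHS]big_mkcond; rewrite [LHS]/=.
  rewrite [LHS](eq_bigr (fun m => if true then P@_m * (cmon 0 h m)@_t else 0)); last first.
    by move=> m _; rewrite comp_mpolyZ mcoeffZ.
  apply: eq_bigr => m _; rewrite comp_mpolyZ mcoeffZ; case: eqP => // hm.
  case: (eqVneq (cmon 0 h m)@_t 0) => [->|/cmon0_mdeg hm2]; first by rewrite mulr0.
  by case: hm; rewrite -hm2.
rewrite big1 // => m /eqP hm; rewrite comp_mpolyZ mcoeffZ -/(cmon 0 h m).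
case: (eqVneq (cmon 0 h m)@_t 0) => [->|/cmon0_mdeg hm2]; first by rewrite mulr0.
by case: he; rewrite hm2.
Qed.

End MonomialFunctionals.

(** * Gauss norms, plain and weighted, under conjugation *)

Section Norms.

Variables (K : dhlField) (n : nat).
Implicit Types (P Q : {mpoly K[n]}) (a g h s c : K).

Lemma ddP : (forall x y : K, dd (x + y) = dd x + dd y) /\
  (forall x y : K, dd (x * y) = dd x * y + x * dd y).
Proof. by split; [apply: ddD|apply: ddM]. Qed.

Notation cj := (cj (@dd K)).
Notation wt := (Lf id).

Lemma nm_ex P : exists c, (forall m, dm P@_m c) /\ exists m, P@_m = c.
Proof.
have [->|P0] := eqVneq P 0.
  by exists 0; split=> [m|]; [rewrite mcoeff0 dmxx|exists 0%MM; rewrite mcoeff0].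
have [m0 h0] : exists m, m \in msupp P.
  case E : (msupp P) => [|m r]; last by exists m; rewrite mem_head.
  by move: P0; rewrite -msupp_eq0 E.
have [m mP H] := dm_max (fun m => P@_m) h0.
exists P@_m; split; last by exists m.
move=> m'; have [/H //|/memN_msupp_eq0 ->] := boolP (m' \in msupp P); exact: dm0.
Qed.

(** Instead of a value in the value group, a chosen coefficient of maximal dominance; it is
    meaningful only up to [asy]. *)
Definition nm P : K := sval (cid (nm_ex P)).
Lemma nm_ge P m : dm P@_m (nm P).
Proof. by rewrite /nm; case: cid => c /= [h _]. Qed.
Lemma nm_at P : exists m, P@_m = nm P.
Proof. by rewrite /nm; case: cid => c /= [_ h]. Qed.
Lemma nm_le P c : (forall m, dm P@_m c) -> dm (nm P) c.
Proof. by have [m <-] := nm_at P => h; apply: h. Qed.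
Lemma nm_lt P c : (forall m, sd P@_m c) -> sd (nm P) c.
Proof. by have [m <-] := nm_at P => h; apply: h. Qed.
Lemma nm0 : nm 0 = 0. Proof. by have [m <-] := nm_at 0; rewrite mcoeff0. Qed.
Lemma nm_eq0 P : (nm P == 0) = (P == 0).
Proof.
apply/eqP/eqP => [h|->]; last exact: nm0.
by apply/mpolyP => m; rewrite mcoeff0; apply/eqP; rewrite -dmx0 -h nm_ge.
Qed.
Lemma nmD_le P Q c : dm (nm P) c -> dm (nm Q) c -> dm (nm (P + Q)) c.
Proof.
move=> h1 h2; apply: nm_le => m; rewrite mcoeffD.
by apply: dmD; [apply: dm_trans h1|apply: dm_trans h2]; apply: nm_ge.
Qed.
Lemma nmD_lt P Q c : sd (nm P) c -> sd (nm Q) c -> sd (nm (P + Q)) c.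
Proof.
move=> h1 h2; apply: nm_lt => m; rewrite mcoeffD.
by apply: sdD; [apply: dm_sd_trans h1|apply: dm_sd_trans h2]; apply: nm_ge.
Qed.
Section Weighted.
Variable s : K.
Hypothesis s0 : s != 0.
(** A bound for the Gauss norm in which the variable of order [i] counts as [s ^+ i]. *)
Definition Wle c P := forall m, dm (P@_m * s ^+ wt m) c.

Lemma WleD c P Q : Wle c P -> Wle c Q -> Wle c (P + Q).
Proof. by move=> hP hQ m; rewrite mcoeffD mulrDl dmD. Qed.
Lemma Wle_sum c (I : Type) (r : seq I) (p : pred I) (E : I -> {mpoly K[n]}) :
  (forall i, p i -> Wle c (E i)) -> Wle c (\sum_(i <- r | p i) E i).
Proof.
move=> h; apply: (big_ind (Wle c)) => //; last by move=> P Q; apply: WleD.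
by move=> m; rewrite mcoeff0 mul0r dm0.
Qed.
Lemma WleM c c' P Q : Wle c P -> Wle c' Q -> Wle (c * c') (P * Q).
Proof.
move=> hP hQ; rewrite (mpolyE P) mulr_suml; apply: Wle_sum => m1 _.
rewrite (mpolyE Q) mulr_sumr; apply: Wle_sum => m2 _ m.
rewrite -scalerAl -scalerAr -mpolyXD !mcoeffZ mcoeffX.
case: eqP => [<-|_]; last by rewrite !mulr0 mul0r dm0.
rewrite LfD exprD mulr1 mulrACA; exact: dmM.
Qed.
Lemma WleC c : Wle c c%:MP.
Proof.
move=> m; rewrite mcoeffC; case: eqP => [->|]; last by rewrite mulr0 mul0r dm0.
by rewrite Lf0 expr0 !mulr1 dmxx.
Qed.
Lemma Wle_exp c P k : Wle c P -> Wle (c ^+ k) (P ^+ k).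
Proof.
move=> h; elim: k => [|k IH]; first by rewrite !expr0 -mpolyC1; apply: WleC.
by rewrite !exprS; apply: WleM.
Qed.
Lemma Wle_compX (C : 'I_n -> K) (t : n.-tuple {mpoly K[n]}) (m : 'X_{1..n}) :
  (forall i, Wle (C i) (tnth t i)) -> Wle (\prod_(i < n) C i ^+ m i) ('X_[m] \mPo t).
Proof.
move=> h; rewrite comp_mpolyX.
apply: (big_ind2 (fun P B => Wle B P)) => [|P B Q B' hP hQ|i _].
- by rewrite -mpolyC1; apply: WleC.
- exact: WleM.
- exact: Wle_exp.
Qed.
End Weighted.

Lemma dm_nat k : dm (k%:R : K) 1.
Proof. by case: k => [|k]; [rewrite dm0|case/andP: (asyMn (1 : K) k)]. Qed.

Lemma sb_Wle0 h s (i : 'I_n) : h != 0 -> dm 1 s -> dm (logder dd h) s ->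
  Wle s (h * s ^+ i) (tnth (sb dd n 0 h) i).
Proof.
move=> h0 s1 hs; rewrite tnth_mktuple (gd_iter0 ddP) mpolyC0 add0r.
apply: Wle_sum => j ji m; rewrite mcoeffZ mcoeffX.
case: eqP => [<-|_]; last by rewrite mulr0 mul0r dm0.
rewrite mulr1 LfU -[X in dm _ X]mul1r -mulrA; apply: dmM; first exact: dm_nat.
rewrite -{2}(subnK ji) exprD mulrA; apply: dmM => //.
exact: iter_dd_dm.
Qed.

(** In the weighted norm the polynomial substituted for the variable of order [i] is bounded by
    [h * s ^+ i], so conjugation by [h] multiplies a monomial by at most [h] to its degree, without
    loss in [s]. *)
Lemma cmon0_W h s (m t : 'X_{1..n}) : h != 0 -> dm 1 s -> dm (logder dd h) s ->
  dm ((cmon dd 0 h m)@_t * s ^+ wt t) (h ^+ mdeg m * s ^+ wt m).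
Proof.
move=> h0 s1 hs.
have -> : h ^+ mdeg m * s ^+ wt m = \prod_(i < n) (h * s ^+ i) ^+ m i.
  rewrite mdegE /Lf -!prodrXr -big_split /=; apply: eq_bigr => i _.
  by rewrite exprMn -exprM.
by apply: Wle_compX => i; apply: sb_Wle0.
Qed.

Lemma cmon_nm a g (m t : 'X_{1..n}) : dm a 1 -> dm g 1 -> dm (cmon dd a g m)@_t 1.
Proof.
move=> a1 g1.
have h i : Wle 1 1 (tnth (sb dd n a g) i).
  rewrite tnth_mktuple; apply: WleD.
    move=> m'; rewrite expr1n mulr1 mcoeffC; case: eqP => _; rewrite ?mulr1 ?mulr0 ?dm0 //.
    exact: dd_iter_O.
  apply: Wle_sum => j ji m'; rewrite expr1n mulr1 mcoeffZ mcoeffX.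
  case: eqP => _; rewrite ?mulr1 ?mulr0 ?dm0 //.
  by rewrite -[X in dm _ X]mulr1; apply: dmM; [apply: dm_nat|apply: dd_iter_O].
have := @Wle_compX 1 (fun=> 1) _ m h t; rewrite expr1n mulr1 big1 // => i _.
by rewrite expr1n.
Qed.

Lemma nm_cj a g P : dm a 1 -> dm g 1 -> dm (nm (cj a g P)) (nm P).
Proof.
move=> a1 g1; apply: nm_le => t; rewrite cj_coef; apply: dm_sum => m _.
by rewrite -[X in dm _ X]mulr1; apply: dmM; [apply: nm_ge|apply: cmon_nm].
Qed.

Lemma cj_inv h P : h != 0 -> cj 0 h^-1 (cj 0 h P) = P.
Proof. by move=> h0; rewrite cj_cj ?mulr0 ?addr0 ?mulfV ?cj01 //; apply: ddP. Qed.
Lemma nm_cj_asy h P : asy h 1 -> asy (nm (cj 0 h P)) (nm P).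
Proof.
move=> h1; have h0 : h != 0 by rewrite (asy_eq0 h1) oner_eq0.
rewrite /asy nm_cj ?dm0 //; last by case/andP: h1.
rewrite -{1}(cj_inv P h0) nm_cj ?dm0 //.
by case/andP: (asyV h0 h1); rewrite invr1.
Qed.

Definition homg e P := forall m, P@_m != 0 -> mdeg m = e.

Lemma homg_hp e P : homg e (hp e P).
Proof. by move=> m; rewrite hp_coef; case: (mdeg m =P e) => // _; rewrite eqxx. Qed.

Lemma homg_cj0 e h P : homg e P -> homg e (cj 0 h P).
Proof.
move=> hP; have -> : P = hp e P.
  apply/mpolyP => m; rewrite hp_coef; case: eqP => // hm.
  by apply/eqP/negPn/negP => /hP.
by rewrite -(hp_cj0 ddP); apply: homg_hp.
Qed.

(* Above the weight [k], the weighted norm scales like the [e]-th power. *)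
Lemma cj0_W e h s c k P : homg e P -> h != 0 -> dm 1 s -> dm (logder dd h) s ->
  (forall m, (k <= wt m)%N -> dm (P@_m * s ^+ wt m) c) ->
  forall t, (k <= wt t)%N -> dm ((cj 0 h P)@_t * s ^+ wt t) (c * h ^+ e).
Proof.
move=> hP h0 s1 hs hc t kt; rewrite cj_coef mulr_suml big_seq; apply: dm_sum => m mP.
have me : mdeg m = e by apply: hP; rewrite -mcoeff_msupp.
have s0 : s != 0 by apply: contraTneq s1 => ->; rewrite dmx0 oner_eq0.
have [->|tm] := eqVneq (cmon dd 0 h m)@_t 0; first by rewrite mulr0 mul0r dm0.
(* Conjugation does not raise weights, so the coefficient at [t] only receives contributions from
   monomials of weight at least that of [t]. *)
have km : (k <= wt m)%N by apply: leq_trans kt (@cmon_SL _ _ dd id 0 h m _ t tm).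
rewrite -(@dm_pM2r _ (s ^+ wt m)) ?expf_neq0 //.
have := dmM (hc m km) (cmon0_W m t h0 s1 hs); rewrite me.
by rewrite -[_ * s ^+ wt m * _]mulrA [s ^+ wt m * _]mulrC !mulrA.
Qed.
Lemma cj0_Wlt e h s c k P : homg e P -> h != 0 -> dm 1 s -> dm (logder dd h) s ->
  c != 0 ->
  (forall m, (k <= wt m)%N -> sd (P@_m * s ^+ wt m) c) ->
  forall t, (k <= wt t)%N -> sd ((cj 0 h P)@_t * s ^+ wt t) (c * h ^+ e).
Proof.
move=> hP h0 s1 hs c0 hc t kt; rewrite cj_coef mulr_suml big_seq; apply: sd_sum => [|m mP].
  by rewrite mulf_neq0 ?expf_neq0.
have me : mdeg m = e by apply: hP; rewrite -mcoeff_msupp.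
have s0 : s != 0 by apply: contraTneq s1 => ->; rewrite dmx0 oner_eq0.
have [->|tm] := eqVneq (cmon dd 0 h m)@_t 0.
  by rewrite mulr0 mul0r sd0 mulf_neq0 ?expf_neq0.
have km : (k <= wt m)%N by apply: leq_trans kt (@cmon_SL _ _ dd id 0 h m _ t tm).
rewrite -(@sd_pM2r _ (s ^+ wt m)) ?expf_neq0 //.
have := sd_dmM (hc m km) (cmon0_W m t h0 s1 hs); rewrite me mulf_neq0 ?expf_neq0 // => /(_ isT).
by rewrite -[_ * s ^+ wt m * _]mulrA [s ^+ wt m * _]mulrC !mulrA.
Qed.

Lemma wt_le e (m : 'X_{1..n}) : mdeg m = e -> (wt m <= n * e)%N.
Proof.
move=> <-; rewrite -Lf_mdeg /Lf big_distrr /=; apply: leq_sum => i _.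
by rewrite mul1n leq_mul2r ltnW ?orbT.
Qed.

Lemma dm_1X s k : dm 1 s -> dm 1 (s ^+ k).
Proof. by move=> s1; rewrite -[X in dm X _](expr1n _ k) dmX. Qed.
Lemma dm_X2 s k l : dm 1 s -> (k <= l)%N -> dm (s ^+ k) (s ^+ l).
Proof. by move=> s1 kl; rewrite -(subnK kl) exprD -[X in dm X _]mul1r dmM // dm_1X. Qed.

(** Weights of monomials of degree [e] lie between 0 and [n * e]; passing from the weighted to the
    plain norm loses that many factors [s]. *)
Lemma nm_cj0_le e h s P : homg e P -> h != 0 -> dm 1 s -> dm (logder dd h) s ->
  dm (nm (cj 0 h P)) (nm P * h ^+ e * s ^+ (n * e)).
Proof.
move=> hP h0 s1 hs; apply: nm_le => t.
have H m : (0 <= wt m)%N -> dm (P@_m * s ^+ wt m) (nm P * s ^+ (n * e)).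
  have [->|Pm] := eqVneq P@_m 0; first by rewrite mul0r dm0.
  by move=> _; apply: dmM; [apply: nm_ge|apply: dm_X2 => //; apply: wt_le; apply: hP].
have := cj0_W hP h0 s1 hs H (leq0n (wt t)); rewrite mulrAC; apply: dm_trans.
by rewrite -[X in dm X _]mulr1; apply: dmM => //; apply: dm_1X.
Qed.

(** The upper bound for the conjugation by [h^-1], whose logarithmic derivative is the opposite
    one. *)
Lemma nm_cj0_ge e h s P : homg e P -> h != 0 -> dm 1 s -> dm (logder dd h) s ->
  dm (nm P * h ^+ e) (nm (cj 0 h P) * s ^+ (n * e)).
Proof.
move=> hP h0 s1 hs.
have := @nm_cj0_le e h^-1 s (cj 0 h P); rewrite cj_inv // => H.
have := H (homg_cj0 hP); rewrite invr_eq0 h0 ldV // dmN => /(_ isT s1 hs).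
rewrite exprVn mulrAC dm_divr ?expf_neq0 //.
Qed.

End Norms.

(** * Quasilinear polynomials and their zeros *)

Section Roots.

Variable K : dhlField.
Notation cj := (cj (@dd K)).
Notation jet := (jet (@dd K)).
Notation ld := (logder (@dd K)).

Section N.
Variable n : nat.
Implicit Types (P Q L : {mpoly K[n]}) (a g h s c y z : K).

Lemma mnm1_inj : injective (fun i : 'I_n => U_(i)%MM).
Proof. by move=> i j /mnmP /(_ i); rewrite !mnm1E eqxx; case: eqP. Qed.

Definition hi P : {mpoly K[n]} := \sum_(m <- msupp P | (1 < mdeg m)%N) P@_m *: 'X_[m].

Lemma hi_coef P m : (hi P)@_m = if (1 < mdeg m)%N then P@_m else 0.
Proof.
rewrite /hi raddf_sum /=.
under eq_bigr => m' _ do rewrite mcoeffZ mcoeffX.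
have [mP|mP] := boolP (m \in msupp P); last first.
  rewrite (memN_msupp_eq0 mP) if_same big_seq_cond big1 // => m' /andP[m'P _].
  by case: eqP m'P mP => [->|]; rewrite ?mulr0 // => ->.
case: ifP => h.
  rewrite big_mkcond (bigD1_seq m) ?msupp_uniq //= h eqxx mulr1 big1 ?addr0 // => m' /negPf ->.
  by rewrite mulr0 if_same.
rewrite big1 // => m' h'; case: eqP => [e'|]; last by rewrite mulr0.
by move: h'; rewrite e' h.
Qed.
Lemma hiE P : hi P = P - hp 0 P - hp 1 P.
Proof.
apply/mpolyP => m; rewrite hi_coef !mcoeffB !hp_coef; case: (mdeg m) => [|[|k]] /=.
- by rewrite subrr subr0.
- by rewrite subr0 subrr.
- by rewrite !subr0.
Qed.
Lemma hiD P Q : hi (P + Q) = hi P + hi Q.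
Proof. by apply/mpolyP => m; rewrite mcoeffD !hi_coef mcoeffD; case: ifP => _; rewrite ?addr0. Qed.
Lemma hp0E P : hp 0 P = (P@_0)%:MP.
Proof.
apply/mpolyP => m; rewrite hp_coef mcoeffC mdeg_eq0; case: eqP => [->|_]; by rewrite ?mulr1 ?mulr0.
Qed.
Lemma split3 P : P = (P@_0)%:MP + hp 1 P + hi P.
Proof. by rewrite -hp0E hiE; ring. Qed.
Lemma nm_hp e P : dm (nm (hp e P)) (nm P).
Proof. by apply: nm_le => m; rewrite hp_coef; case: ifP => _; rewrite ?dm0 ?nm_ge. Qed.
Lemma nm_hi P : dm (nm (hi P)) (nm P).
Proof. by apply: nm_le => m; rewrite hi_coef; case: ifP => _; rewrite ?dm0 ?nm_ge. Qed.
Lemma hi_cj0 h P : hi (cj 0 h P) = cj 0 h (hi P).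
Proof.
rewrite !hiE !(hp_cj0 (@ddP K)) -!scaleN1r !cjD !cjZ //.
Qed.

Lemma ev_le P y : dm y 1 -> dm P.@[jet y] (nm P).
Proof.
move=> y1; rewrite mevalE; apply: dm_sum => m _.
rewrite -[X in dm _ X]mulr1; apply: dmM; first exact: nm_ge.
apply: (big_ind (fun x => dm x 1)) => [|x x' h h'|i _]; rewrite ?dmxx //.
  by rewrite -[1]mulr1; apply: dmM.
by rewrite -(expr1n _ (m i)); apply: dmX; apply: dd_iter_O.
Qed.

Lemma lin_eval L (v : 'I_n -> K) : homg 1 L -> L.@[v] = \sum_i L@_U_(i) * v i.
Proof.
move=> hL; have -> : L = \sum_i L@_U_(i) *: 'X_i.
  apply/mpolyP => m; rewrite raddf_sum /=.
  under eq_bigr => i _ do rewrite mcoeffZ mcoeffX.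
  have [h|h] := eqVneq (mdeg m) 1%N.
    move/eqP: h; rewrite mdeg_eq1 => /existsP[i /eqP ->].
    rewrite (bigD1 i) //= eqxx mulr1 big1 ?addr0 // => j ji.
    case: eqP => [e|]; last by rewrite mulr0.
    by move: ji; rewrite -(inj_eq mnm1_inj) e eqxx.
  rewrite big1 => [|i _]; first by apply/eqP; apply: contraNT h => /hL ->.
  by case: eqP => [e|]; rewrite ?mulr0 //; move: h; rewrite -e mdeg1.
rewrite (rmorph_sum (meval v)) /=; apply: eq_bigr => i _; rewrite mevalZ mevalXU.
by congr (_ * _); rewrite raddf_sum /= (bigD1 i) //= mcoeffZ mcoeffX eqxx mulr1 big1 ?addr0 // => j ji;
  rewrite mcoeffZ mcoeffX (inj_eq mnm1_inj) (negPf ji) mulr0.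
Qed.

(** The constant coefficient is left free; where a zero is sought it is compared with the linear
    part separately. *)
Definition ql P := sd (nm (hi P)) (nm (hp 1 P)).

Lemma ql_neq0 P : ql P -> nm (hp 1 P) != 0. Proof. exact: sd_neq0. Qed.

(** A shift moves linear coefficients only through the part of degree at least 2: constants
    contribute nothing and a linear form keeps its own coefficients. *)
Lemma cj1_lin c P i : dm c 1 ->
  dm ((cj c 1 P)@_U_(i) - P@_U_(i)) (nm (hi P)).
Proof.
move=> c1; rewrite {1}(split3 P) !cjD !mcoeffD.
have h1 : (cj c 1 (P@_0)%:MP)@_U_(i) = 0.
  by rewrite /cj comp_mpolyC mcoeffC -mdeg_eq0 mdeg1 mulr0.
have h2 : (cj c 1 (hp 1 P))@_U_(i) = P@_U_(i).
  rewrite cj_coef.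
  have hm j : (cmon dd c 1 U_(j))@_U_(i) = (j == i)%:R.
    rewrite /cmon comp_mpolyXU -tnth_nth tnth_mktuple mcoeffD mcoeffC -mdeg_eq0 mdeg1 mulr0 add0r.
    rewrite raddf_sum /= (bigD1 j) //= mcoeffZ mcoeffX subnn binn !mulr1 mul1r big1 ?addr0.
      by rewrite (inj_eq mnm1_inj).
    move=> l /andP[lj nlj]; rewrite mcoeffZ (gd_iter1 (@ddP K)) subn_eq0 leqNgt ltn_neqAle lj andbT.
    by rewrite nlj /= mulr0 mul0r.
  rewrite big_seq (eq_bigr (fun m => if m == U_(i)%MM then P@_U_(i) else 0)); last first.
    move=> m mP; have: mdeg m == 1%N.
      by apply/eqP; apply: (@homg_hp _ _ 1 P); rewrite -mcoeff_msupp.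
    rewrite mdeg_eq1 => /existsP[j /eqP ->]; rewrite hm hp_coef mdeg1 eqxx (inj_eq mnm1_inj).
    by case: eqP => [->|]; rewrite ?mulr1 ?mulr0.
  rewrite -big_seq -big_mkcond /=.
  have [h|h] := boolP (U_(i)%MM \in msupp (hp 1 P)).
    by rewrite (big_rem _ h) /= eqxx big_seq_cond big1 ?addr0 // => m /andP[];
     rewrite (rem_filter _ (msupp_uniq _)) mem_filter /= => /andP[/negPf ->].
  rewrite big_seq_cond big1 => [|m /andP[mP /eqP e]]; last by rewrite -e mP in h.
  by move: (memN_msupp_eq0 h); rewrite hp_coef mdeg1 eqxx.
rewrite h1 h2 add0r addrAC subrr add0r.
by apply: (dm_trans (nm_ge _ _)); apply: nm_cj; rewrite ?dmxx.
Qed.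

Lemma hp1_at P : nm (hp 1 P) != 0 -> exists i, P@_U_(i) = nm (hp 1 P).
Proof.
have [m e] := nm_at (hp 1 P); rewrite -e => h.
have := homg_hp h => /eqP; rewrite mdeg_eq1 => /existsP[i /eqP em].
by exists i; rewrite em hp_coef mdeg1 eqxx.
Qed.
Lemma nm_hp1_ge P i : dm P@_U_(i) (nm (hp 1 P)).
Proof. by have := nm_ge (hp 1 P) U_(i); rewrite hp_coef mdeg1 eqxx. Qed.

Lemma nm_hp1_cj1 c P : dm c 1 -> ql P -> asy (nm (hp 1 (cj c 1 P))) (nm (hp 1 P)).
Proof.
move=> c1 qP; have h0 := ql_neq0 qP; apply/andP; split.
  apply: nm_le => m; rewrite hp_coef; case: eqP => [/eqP|_]; last exact: dm0.
  rewrite mdeg_eq1 => /existsP[i /eqP ->].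
  rewrite -[X in dm X](subrK P@_U_(i)); apply: dmD; last exact: nm_hp1_ge.
  by apply: (dm_trans (cj1_lin P i c1)); apply: sdW.
have [i e] := hp1_at h0; apply: (dm_trans _ (nm_hp1_ge _ i)).
rewrite -e -[X in dm _ X](subrK P@_U_(i)) addrC.
suff /addr_sd_asy/andP[] : sd ((cj c 1 P)@_U_(i) - P@_U_(i)) P@_U_(i) by [].
rewrite {2}e; exact: dm_sd_trans (cj1_lin P i c1) qP.
Qed.

Lemma hi_lin P : ql P -> hi (hp 1 P) = 0.
Proof. by move=> _; apply/mpolyP => m; rewrite hi_coef hp_coef mcoeff0; case: (mdeg m) => [|[|k]]. Qed.

Lemma ql_shift c P : dm c 1 -> ql P -> ql (cj c 1 P).
Proof.
move=> c1 qP; rewrite /ql (asy_sdr _ (nm_hp1_cj1 c1 qP)).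
have -> : hi (cj c 1 P) = hi (cj c 1 (hi P)).
  rewrite {1}(split3 P) !cjD !hiD.
  have -> : hi (cj c 1 (P@_0)%:MP) = 0.
    by rewrite /cj comp_mpolyC; apply/mpolyP => m; rewrite hi_coef mcoeffC mcoeff0 -mdeg_eq0;
     case: (mdeg m) => [|[|k]]; rewrite ?mulr0.
  have -> : hi (cj c 1 (hp 1 P)) = 0.
    apply/mpolyP => m; rewrite hi_coef mcoeff0; case: ifP => // hm; apply/eqP/negPn/negP => h.
    have sl : SL (fun=> 1%N) 1 (hp 1 P) by move=> m' /homg_hp; rewrite Lf_mdeg => ->.
    by have := @SL_cj _ _ (@dd K) (fun=> 1%N) 1 c 1 _ (fun _ _ _ => leqnn 1) sl m h; rewrite Lf_mdeg leqNgt hm.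
  by rewrite !add0r.
by apply: dm_sd_trans qP; apply: (dm_trans (nm_hi _)); apply: nm_cj; rewrite ?dmxx.
Qed.

Lemma ldX_small h k : h != 0 -> sd h 1 -> sd (h * ld h ^+ k) 1.
Proof.
move=> h0 h1; have h2 : sd 1 h^-1 by rewrite -[1]invr1 sdV ?oner_neq0.
have := ldX_lt_inf k h2; rewrite ldV // -sd_abs normrX normrN -normrX sd_abs.
by rewrite -(sd_pM2l _ _ h0) mulfV.
Qed.

(** For infinitesimal [h] the linear part keeps the factor [h] up to [ld h ^+ n], while a part of
    degree [e > 1] has at most [h ^+ e] times a power of [ld h]. The spare factor [h] beats every
    power of [ld h]. *)
Lemma ql_scale h P : dm h 1 -> h != 0 -> ql P -> ql (cj 0 h P).
Proof.
move=> h1 h0 qP; rewrite /ql hi_cj0 (hp_cj0 (@ddP K)).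
have [h2|h2] := boolP (dm 1 h).
  have ha : asy h 1 by rewrite /asy h1 h2.
  by rewrite (asy_sdl _ (nm_cj_asy _ ha)) (asy_sdr _ (nm_cj_asy _ ha)).
have [s1 _] := ld_small h0 h2.
have L1 := nm_cj0_ge (@homg_hp _ _ 1 P) h0 (sdW s1) (dmxx _).
have s0 : ld h != 0 := sd_neq0 s1.
rewrite expr1 muln1 in L1.
have nl0 : nm (cj 0 h (hp 1 P)) != 0.
  apply: contraTneq L1 => ->; rewrite mul0r dmx0 mulf_neq0 //; exact: ql_neq0 qP.
rewrite -(@sd_pM2r _ (ld h ^+ n)) ?expf_neq0 //.
apply: (sd_dm_trans _ L1).
have -> : hi P = \sum_(e < msize (hi P)) hp e (hi P) by apply: mpoly_hom.
rewrite cj_sum.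
have sum_nm (I : Type) (r : seq I) (E : I -> {mpoly K[n]}) c : c != 0 ->
    (forall i, sd (nm (E i) * ld h ^+ n) c) -> sd (nm (\sum_(i <- r) E i) * ld h ^+ n) c.
  move=> c0 H; elim: r => [|i r IH]; first by rewrite big_nil nm0 mul0r sd0.
  rewrite big_cons -sd_divr ?expf_neq0 //; apply: nmD_lt; rewrite sd_divr ?expf_neq0 //; exact: H.
apply: sum_nm => [|e]; first by rewrite mulf_neq0 //; exact: ql_neq0 qP.
have [e2|e2] := leqP e 1.
  have -> : hp e (hi P) = 0.
    by apply/mpolyP => m; rewrite hp_coef hi_coef mcoeff0; case: (mdeg m =P e) => // ->; rewrite ltnNge e2.
  by rewrite /cj comp_mpoly0 nm0 mul0r sd0 mulf_neq0 //; exact: ql_neq0 qP.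
have L2 := nm_cj0_le (@homg_hp _ _ e (hi P)) h0 (sdW s1) (dmxx _).
apply: (dm_sd_trans (dmM L2 (dmxx _))).
rewrite -!mulrA; apply: sd_dmM => //; first by apply: dm_sd_trans (nm_hp _ _) qP.
rewrite -exprD -(subnK e2) (addnC _ 2%N) exprD -[X in dm _ X]mulr1 expr2 -!mulrA.
apply: dmM => //; rewrite [h ^+ _ * _]mulrC mulrA -[X in dm _ X]mulr1.
apply: dmM; last by rewrite -(expr1n _ (e - 2)); apply: dmX.
exact: sdW (ldX_small _ h0 h2).
Qed.

Lemma ql_cj c h P : dm c 1 -> dm h 1 -> h != 0 -> ql P -> ql (cj c h P).
Proof.
move=> c1 h1 h0 qP; have -> : cj c h P = cj 0 h (cj c 1 P).
  by rewrite cj_cj ?mulr0 ?addr0 ?mul1r //; apply: ddP.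
by apply: ql_scale => //; apply: ql_shift.
Qed.

End N.

(** Dividing by the norm of the linear part brings [P] into the shape required by
    differential-henselianity. *)
Lemma root_small r (P : {mpoly K[r.+1]}) : ql P -> sd P@_0 (nm (hp 1 P)) ->
  exists2 z, sd z 1 & P.@[jet z] = 0.
Proof.
move=> qP P0; have h0 := ql_neq0 qP; set l := nm _ in h0 P0.
case: (dhlP K) => _ [_ _ H] _ _.
have nP : dm (nm P) l.
  rewrite {1}(split3 P); apply: nmD_le; last exact: sdW.
  apply: nmD_le; last exact: dmxx.
  by apply: nm_le => m; rewrite mcoeffC; case: eqP => _; rewrite ?mulr1 ?mulr0 ?dm0 //; exact: sdW.
have coef_le m : dm (l^-1 *: P)@_m 1.
  rewrite mcoeffZ mulrC dm_div // mul1r; exact: dm_trans (nm_ge _ _) nP.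
have [||||z /sdomP z1 ez] := H r (l^-1 *: P).
- by move=> m; apply/dm_dom.
- move=> m; apply/sdomP; rewrite -/(hp 0 _) hp_coef mdeg_eq0; case: eqP => [->|_].
    by rewrite mcoeffZ mulrC sd_div // mul1r.
  by rewrite sd0 oner_eq0.
- by move=> m; apply/dm_dom; rewrite -/(hp 1 _) hp_coef; case: ifP => _; rewrite ?dm0.
- move=> h; have [i e] := hp1_at h0; have := h U_(i)%MM => /sdomP.
  by rewrite -/(hp 1 _) hp_coef mdeg1 eqxx mcoeffZ e -/l mulVf // sdxx.
exists z => //; move: ez; rewrite /dpoly_eval -/(jet z) mevalZ => /eqP.
by rewrite mulf_eq0 invr_eq0 (negPf h0) /= => /eqP.
Qed.

(** Linear surjectivity solves the linear approximation modulo infinitesimals; shifting to that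
    solution makes the constant coefficient small enough for [root_small]. *)
Lemma root_ball r (P : {mpoly K[r.+1]}) : ql P -> dm P@_0 (nm (hp 1 P)) ->
  exists2 z, dm z 1 & P.@[jet z] = 0.
Proof.
move=> qP P0; have h0 := ql_neq0 qP; set l := nm _ in h0 P0.
have [|||y y1 hy] := @linsurj K r (fun i => P@_U_(i) / l) (- (P@_0 / l)).
- by move=> i; rewrite dm_div // mul1r nm_hp1_ge.
- by have [i e] := hp1_at h0; exists i; rewrite e -/l divff // dmxx.
- by rewrite dmN dm_div // mul1r.
have [||z z1 ez] := @root_small r (cj y 1 P); first exact: ql_shift.
  rewrite (asy_sdr _ (nm_hp1_cj1 y1 qP)) cj_coef0 {1}(split3 P) !mevalD mevalC.
  apply: sdD; last by apply: dm_sd_trans qP; apply: ev_le.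
  rewrite lin_eval; last exact: homg_hp.
  rewrite -/l -[l]mul1r -sd_div //; congr (sd _ 1): hy.
  rewrite opprK mulrDl addrC mulr_suml; congr (_ + _); apply: eq_bigr => i _.
  by rewrite hp_coef mdeg1 eqxx mulrAC.
exists (y + z); first by apply: dmD => //; apply: sdW.
by move: ez; rewrite cj_eval ?mul1r //; apply: ddP.
Qed.

(** A [w] at which [L] is smaller than its norm at scale [w] is an approximate solution; after
    conjugation by [w] and a shift by 1, [root_small] supplies the relative correction. *)
Lemma lin_exceptional r (L : {mpoly K[r.+1]}) (w : K) : homg 1 L -> w != 0 ->
  sd L.@[jet w] (nm (cj 0 w L)) -> exists2 z, eqv z w & L.@[jet z] = 0.
Proof.
move=> hL w0 hw.
have hQ := @homg_cj0 _ _ _ w _ hL; set Q := cj 0 w L in hw hQ.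
have Q1 : hp 1 Q = Q.
  by apply/mpolyP => m; rewrite hp_coef; case: eqP => // h; apply/esym/eqP/negPn/negP => /hQ.
have qQ : ql Q.
  rewrite /ql -{1}Q1 hi_lin ?nm0 ?sd0; last first.
    rewrite /ql Q1 (_ : hi Q = 0) ?nm0 ?sd0; first exact: sd_neq0 hw.
    by rewrite -Q1; apply/mpolyP => m; rewrite hi_coef hp_coef mcoeff0; case: (mdeg m) => [|[|k]].
  by rewrite Q1; exact: sd_neq0 hw.
have [||z z1 ez] := @root_small r (cj 1 1 Q); first by apply: ql_shift; rewrite ?dmxx.
  rewrite (asy_sdr _ (nm_hp1_cj1 (dmxx 1) qQ)) cj_coef0 Q1.
  by rewrite /Q cj_eval ?mulr1 ?add0r //; apply: ddP.
exists (w * (1 + z)).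
  rewrite /eqv mulrDr mulr1 addrAC subrr add0r -[X in sd _ X]mulr1 sd_pM2l //.
by move: ez; rewrite /Q !cj_eval ?mul1r ?add0r //; apply: ddP.
Qed.

(* Dividing by the first solution lowers the order of the operator. *)
Lemma lin_kernel n (L : {mpoly K[n]}) (z : nat -> K) : homg 1 L ->
  (forall j, (j < n)%N -> z j != 0 /\ L.@[jet (z j)] = 0) ->
  (forall j, (j.+1 < n)%N -> sd (z j.+1) (z j)) -> L = 0.
Proof.
elim: n L z => [|n IH] L z hL hz zd.
  apply/mpolyP => m; rewrite mcoeff0; apply/eqP/negPn/negP => /hL.
  by rewrite mdegE big_ord0.
have [z0 Lz0] := hz 0%N isT.
have hQ := @homg_cj0 _ _ _ (z 0%N) _ hL; set Q := cj 0 (z 0%N) L in hQ.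
have Qev w : Q.@[jet w] = L.@[jet (z 0%N * w)] by rewrite /Q cj_eval ?add0r //; apply: ddP.
have Q0 : Q@_U_(ord0) = 0.
  have := Qev 1; rewrite mulr1 Lz0 lin_eval // big_ord_recl big1 ?addr0 /= ?mulr1 // => i _.
  by rewrite /jet (gd_iter1 (@ddP K)) mulr0.
pose B : {mpoly K[n]} := \sum_(i < n) Q@_U_(lift ord0 i) *: 'X_i.
have Bc i : B@_U_(i) = Q@_U_(lift ord0 i).
  rewrite /B raddf_sum /= (bigD1 i) //= mcoeffZ mcoeffX eqxx mulr1 big1 ?addr0 // => j ji.
  by rewrite mcoeffZ mcoeffX (inj_eq (@mnm1_inj n)) (negPf ji) mulr0.
have hB : homg 1 B.
  move=> m; rewrite /B raddf_sum /= => h; apply/eqP; apply: contraNT h => h.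
  apply/eqP; rewrite big1 // => i _; rewrite mcoeffZ mcoeffX; case: eqP => [e|]; last by rewrite mulr0.
  by move: h; rewrite -e mdeg1.
have Bev w : B.@[jet (dd w)] = Q.@[jet w].
  rewrite !lin_eval // big_ord_recl Q0 mul0r add0r; apply: eq_bigr => i _.
  by rewrite Bc /jet -iterSr.
have zz j : (j <= n)%N -> z j != 0 by move=> jn; case: (hz j).
have zs j : (j < n)%N -> sd (z j.+1 / z 0%N) 1.
  move=> jn; rewrite sd_div1 //.
  elim: j jn => [|j IHj] jn; first exact: zd.
  by apply: sd_trans (IHj (ltnW jn)); apply: zd.
have B0 : B = 0.
  apply: (IH B (fun j => dd (z j.+1 / z 0%N))) => // j jn.
    split; last by rewrite Bev Qev mulrC divfK //; case: (hz j.+1).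
    have f0 : z j.+1 / z 0%N != 0 by rewrite mulf_neq0 ?invr_eq0 ?zz.
    have [l1 _] := ld_small f0 (zs j jn).
    by rewrite dd_ld // mulf_neq0 //; exact: sd_neq0 l1.
  apply: dd_sd; last exact: zs (ltnW jn).
  by rewrite sd_pM2r ?invr_eq0 // zd.
have Qz : Q = 0.
  apply/mpolyP => m; rewrite mcoeff0; apply/eqP/negPn/negP => h.
  have /eqP := hQ m h; rewrite mdeg_eq1 => /existsP[i /eqP em]; move: h; rewrite em.
  have [j ->|->] := unliftP ord0 i; last by rewrite Q0 eqxx.
  by rewrite -Bc B0 mcoeff0 eqxx.
by rewrite -(cj_inv L z0) -/Q Qz /cj comp_mpoly0.
Qed.

(** If no zero lay in all balls, every zero could be improved, giving zeros with ever smaller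
    distance to [b]. Their differences to a fixed late zero are close to solutions of the linear
    part there, with distinct values, and too many for a nonzero operator. *)
Lemma root_cut r (P : {mpoly K[r.+1]}) b g0 (S : K -> Prop) : g0 != 0 -> S g0 ->
  ql (cj b g0 P) -> (forall g, S g -> exists2 y, dm (y - b) g & P.@[jet y] = 0) ->
  exists2 y, (forall g, S g -> dm (y - b) g) & P.@[jet y] = 0.
Proof.
move=> g00 Sg0 qP ball; apply: contrapT => no.
have step y : P.@[jet y] = 0 -> exists2 y', P.@[jet y'] = 0 & sd (y' - b) (y - b).
  move=> ey; have [g Sg h] : exists2 g, S g & ~~ dm (y - b) g.
    apply: contrapT => h; apply: no; exists y => // g Sg.
    by apply/negPn/negP => h'; apply: h; exists g.
  by have [y' h' ey'] := ball g Sg; exists y' => //; apply: dm_sd_trans h' h.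
have [y0 y0g ey0] := ball g0 Sg0.
pose rt := {y : K | P.@[jet y] = 0}.
have /choice[nx nxP] : forall y : rt, exists y' : rt, sd (sval y' - b) (sval y - b).
  by case=> y ey; have [y' ey' h] := step y ey; exists (exist _ y' ey').
pose ys k := sval (iter k nx (exist _ y0 ey0)).
have eys k : P.@[jet (ys k)] = 0 by rewrite /ys; case: (iter k nx _).
have dys k : sd (ys k.+1 - b) (ys k - b) by rewrite /ys /= nxP.
have dysl k l : (k < l)%N -> sd (ys l - b) (ys k - b).
  elim: l => // l IH; rewrite ltnS leq_eqVlt => /orP[/eqP->|/IH h]; first exact: dys.
  exact: sd_trans (dys l) h.
have yg k : dm (ys k - b) g0.
  case: k => [//|k]; exact: dm_trans (sdW (dysl 0%N k.+1 isT)) y0g.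
(* An operator in [r.+1] variables, that is of order [r], is zero once it has [r.+1] solutions of
   distinct value. *)
set N := r.+1; pose w k := ys k - ys N.
have wE k : (k < N)%N -> eqv (w k) (ys k - b).
  move=> kN; rewrite /eqv /w (_ : _ - _ - _ = - (ys N - b)); last by ring.
  by rewrite sdN dysl.
have w0 k : (k < N)%N -> w k != 0.
  by move=> kN; rewrite (asy_eq0 (eqv_asy (wE k kN))); exact: sd_neq0 (dys k).
pose L := hp 1 (cj (ys N) 1 P).
have hL : homg 1 L by apply: homg_hp.
have Lsol k : (k < N)%N -> exists z, eqv z (w k) /\ L.@[jet z] = 0.
  move=> kN; suff [z h1 h2] : exists2 z, eqv z (w k) & L.@[jet z] = 0 by exists z.
  apply: lin_exceptional => //; first exact: w0.
  have eQ : cj 0 (w k) L = hp 1 (cj (ys N) (w k) P).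
    by rewrite /L -(hp_cj0 (@ddP K)) cj_cj ?mulr0 ?addr0 ?mul1r //; apply: ddP.
  have qQ : ql (cj (ys N) (w k) P).
    have -> : cj (ys N) (w k) P = cj ((ys N - b) / g0) (w k / g0) (cj b g0 P).
      rewrite cj_cj; last exact: ddP.
      by rewrite [g0 * _]mulrC divfK // [g0 * (w k / _)]mulrC divfK // addrC subrK.
    apply: ql_cj => //; rewrite ?dm_div1 //; last by rewrite mulf_neq0 ?invr_eq0 ?w0.
    by rewrite (asy_dml _ (eqv_asy (wE k kN))).
  rewrite eQ; apply: dm_sd_trans qQ.
  (* Both [ys N] and [ys N + w k = ys k] are zeros of [P], so the linear part at [w k] equals minus
     the part of degree at least 2, which quasilinearity makes too small. *)
  have e1 : (cj (ys N) (w k) P).@[jet 1] = 0.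
    rewrite cj_eval ?mulr1; last exact: ddP.
    by rewrite /w addrC subrK.
  have e2 : (hp 1 (cj (ys N) (w k) P)).@[jet 1] = L.@[jet (w k)].
    by rewrite -eQ cj_eval ?add0r ?mulr1 //; apply: ddP.
  have := e1; rewrite {1}(split3 (cj (ys N) (w k) P)) !mevalD mevalC cj_coef0 eys add0r e2.
  move/eqP; rewrite addr_eq0 => /eqP ->; rewrite dmN; apply: ev_le; exact: dmxx.
have /choice[z hz] : forall k, exists z, (k < N)%N -> eqv z (w k) /\ L.@[jet z] = 0.
  move=> k; have [kN|_] := boolP (k < N)%N; last by exists 0.
  by have [z h] := Lsol k kN; exists z.
have L0 : L = 0.
  apply: (@lin_kernel _ L z) => // j jN.
    have [h1 h2] := hz j jN; split=> //.
    by rewrite (asy_eq0 (eqv_asy h1)) w0.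
  have [h1 _] := hz j (ltnW jN); have [h2 _] := hz j.+1 jN.
  rewrite (asy_sdl _ (eqv_asy h2)) (asy_sdr _ (eqv_asy h1)).
  by rewrite (asy_sdl _ (eqv_asy (wE _ jN))) (asy_sdr _ (eqv_asy (wE _ (ltnW jN)))) dys.
(* Quasilinearity persists at the centre [ys N], so the linear part cannot vanish there. *)
have : nm (hp 1 (cj 0 g0 (cj (ys N) 1 P))) != 0.
  apply: ql_neq0.
  have -> : cj 0 g0 (cj (ys N) 1 P) = cj ((ys N - b) / g0) 1 (cj b g0 P).
    rewrite !cj_cj; [|exact: ddP|exact: ddP].
    by rewrite mulr0 addr0 mul1r mulr1 [g0 * _]mulrC divfK // addrC subrK.
  by apply: ql_shift; rewrite ?dm_div1.
by rewrite (hp_cj0 (@ddP K)) -/L L0 /cj comp_mpoly0 nm0 eqxx.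
Qed.

End Roots.

(** * Settled polynomials *)

Section Settled.

Variable K : dhlField.
Notation cj := (cj (@dd K)).
Notation jet := (jet (@dd K)).

Section N.
Variable n : nat.
Implicit Types (P Q : {mpoly K[n]}) (a g h s c y z : K).

Definition nc P : {mpoly K[n]} := \sum_(m <- msupp P | m != 0%MM) P@_m *: 'X_[m].

Lemma nc_coef P m : (nc P)@_m = if m == 0%MM then 0 else P@_m.
Proof.
rewrite /nc raddf_sum /=.
under eq_bigr => m' _ do rewrite mcoeffZ mcoeffX.
have [mP|mP] := boolP (m \in msupp P); last first.
  rewrite (memN_msupp_eq0 mP) if_same big_seq_cond big1 // => m' /andP[m'P _].
  by case: eqP m'P mP => [->|]; rewrite ?mulr0 // => ->.
case: ifP => h.
  rewrite big1 // => m' h'; case: eqP => [e'|]; last by rewrite mulr0.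
  by move: h'; rewrite e' h.
rewrite big_mkcond (bigD1_seq m) ?msupp_uniq //= h /= eqxx mulr1 big1 ?addr0 // => m' /negPf ->.
by rewrite mulr0 if_same.
Qed.
Lemma ncE P : P = (P@_0)%:MP + nc P.
Proof.
apply/mpolyP => m; rewrite mcoeffD mcoeffC nc_coef; case: eqP => [->|_].
  by rewrite mulr1 addr0.
by rewrite mulr0 add0r.
Qed.
Definition settledAt P := sd (nm (nc P)) P@_0.

Lemma settledAt_cj c h P : dm c 1 -> dm h 1 -> settledAt P ->
  settledAt (cj c h P) /\ eqv (cj c h P)@_0 P@_0.
Proof.
move=> c1 h1 sP; have e : cj c h P = (P@_0)%:MP + cj c h (nc P).
  by rewrite {1}(ncE P) cjD /cj comp_mpolyC.
have l : sd (nm (cj c h (nc P))) P@_0 by apply: dm_sd_trans sP; apply: nm_cj.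
have ev : eqv (cj c h P)@_0 P@_0.
  rewrite /eqv e mcoeffD mcoeffC eqxx mulr1 addrAC subrr add0r.
  exact: dm_sd_trans (nm_ge _ _) l.
split=> //; rewrite /settledAt (asy_sdr _ (eqv_asy ev)); apply: dm_sd_trans l.
apply: nm_le => m; rewrite nc_coef; case: eqP => [_|/eqP m0]; first exact: dm0.
by rewrite e mcoeffD mcoeffC (negPf m0) mulr0 add0r nm_ge.
Qed.

Lemma settledAt_ev P z : dm z 1 -> settledAt P -> eqv P.@[jet z] P@_0.
Proof.
move=> z1 sP; rewrite /eqv {1}(ncE P) mevalD mevalC addrAC subrr add0r.
by apply: dm_sd_trans sP; apply: ev_le.
Qed.

Lemma Taylor_mderiv c P i : (cj c 1 P)^`M(i) = cj c 1 P^`M(i).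
Proof.
have dE Q : dirv (fun j => (j == i)%:R) Q = Q^`M(i).
  rewrite /dirv (bigD1 i) //= eqxx scale1r big1 ?addr0 // => j /negPf ->.
  by rewrite scale0r.
rewrite -[LHS]dE /cj dirv_comp (bigD1 i) //= big1 ?addr0.
  rewrite tnth_mktuple dirvD dirvC add0r dirv_sum (bigD1 i) //= dirvZ dirvX eqxx subnn binn !mulr1 scale1r.
  rewrite big1 ?addr0 ?mulr1 // => j /andP[_ ji]; rewrite dirvZ dirvX (negPf ji) mpolyC0 scaler0 //.
move=> j ji; rewrite tnth_mktuple dirvD dirvC add0r dirv_sum big1 ?mulr0 // => l lj.
rewrite dirvZ dirvX; case: eqP => [e|]; last by rewrite mpolyC0 scaler0.
rewrite (gd_iter1 (@ddP K)) subn_eq0 leqNgt ltn_neqAle lj andbT.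
by rewrite (_ : (l : nat) != j) ?mulr0 ?scale0r //; rewrite e eq_sym; exact: ji.
Qed.

Lemma mnm_split (m : 'X_{1..n}) k : mdeg m = k.+1 -> exists i m', m = (m' + U_(i))%MM /\ mdeg m' = k.
Proof.
move=> h; have [i hi] : exists i, (0 < m i)%N.
  apply: contrapT => h'; move: h; rewrite mdegE big1 // => i _.
  by apply/eqP; rewrite -leqn0 leqNgt; apply/negP => hi; apply: h'; exists i.
exists i, (m - U_(i))%MM.
have e : m = (m - U_(i) + U_(i))%MM.
  apply/mnmP => j; rewrite mnmDE mnmBE mnm1E; case: eqP => [<-|] /=; lia.
by split=> //; move: h; rewrite {1}e mdegD mdeg1 addn1 => -[].
Qed.

Lemma Taylor_mderivm c P (m : 'X_{1..n}) : (cj c 1 P)^`M[m] = cj c 1 P^`M[m].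
Proof.
move: {2}(mdeg m) (erefl (mdeg m)) => k; elim: k m P => [|k IH] m P h.
  by move/eqP: h; rewrite mdeg_eq0 => /eqP ->; rewrite !mderivm0m.
have [i [m' [-> h']]] := mnm_split h.
by rewrite !mderivmDm !mderivmU1m IH // Taylor_mderiv.
Qed.

(** Taylor expansion; the factorials are positive integers and have size 1. *)
Lemma Taylor_coef c P (m : 'X_{1..n}) :
  asy (cj c 1 P)@_m (P^`M[m]).@[jet c].
Proof.
rewrite -(@cj_coef0 _ (@dd K) n c 1) -Taylor_mderivm mcoeff_mderivm addm0.
have : (0 < \prod_(i < n) m i ^_ m i)%N.
  by rewrite prodn_gt0 // => i; rewrite ffactnn fact_gt0.
by case: (\prod_(i < n) _)%N => // k _; rewrite asy_sym asyMn.
Qed.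

Lemma hp_dird e w P : hp e (dird dd w P) = dird dd w (hp e.+1 P).
Proof.
rewrite /dird /dirv; apply/mpolyP => m; rewrite hp_coef !raddf_sum /= .
case: eqP => h; [|rewrite big1 // => i _]; last first.
  by rewrite mcoeffZ mcoeff_mderiv hp_coef mdegD mdeg1 addn1 eqSS (introF eqP h) mul0rn mulr0.
apply: eq_bigr => i _; rewrite !mcoeffZ !mcoeff_mderiv hp_coef mdegD mdeg1 addn1 eqSS h eqxx //.
Qed.

Lemma dird_coef0 w P : (dird dd w P)@_0 = \sum_(i < n) iter i dd w * P@_U_(i).
Proof.
rewrite /dird /dirv raddf_sum /=; apply: eq_bigr => i _.
by rewrite mcoeffZ mcoeff_mderiv add0m mnm0E.
Qed.

Lemma nm_dird w P : dm w 1 -> dm (nm (dird dd w P)) (nm P).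
Proof.
move=> w1; apply: nm_le => m; rewrite /dird /dirv raddf_sum /=; apply: dm_sum => i _.
rewrite mcoeffZ mcoeff_mderiv -[X in dm _ X]mul1r; apply: dmM; first exact: dd_iter_O.
by rewrite (asy_dml _ (asyMn _ _)) nm_ge.
Qed.

End N.

(** Take a monomial attaining the norm and remove one variable from it. The coefficient of the
    derivative at the remaining monomial is a linear differential operator applied to the direction,
    of norm 1 after scaling, and linear surjectivity makes its value a unit. Only the residue of the
    direction matters. *)
Lemma dir_unit n (P : {mpoly K[n]}) e : homg e.+1 P -> P != 0 ->
  exists2 u, asy u 1 & forall v, sd (v - u) 1 -> asy (nm (dird dd v P)) (nm P).
Proof.
move=> hP P0; have [m em] := nm_at P.
have c0 : nm P != 0 by rewrite nm_eq0.
have hm : mdeg m = e.+1 by apply: hP; rewrite em.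
have [i [m' [Em _]]] := mnm_split hm.
case: n P hP P0 m em c0 hm i m' Em => [|r] P hP P0 m em c0 hm i m' Em; first by case: i Em.
set c := nm P in em c0.
pose a j := (P^`M(j))@_m' / c.
have aO j : dm (a j) 1.
  by rewrite /a dm_div // mul1r mcoeff_mderiv (asy_dml _ (asyMn _ _)) nm_ge.
have ai : dm 1 (a i).
  by rewrite /a dm_divr // mul1r mcoeff_mderiv (asy_dmr _ (asyMn _ _)) -Em em dmxx.
have [||y y1 hy] := @linsurj K r a 1 aO; [by exists i|exact: dmxx|].
have key v : sd (v - y) 1 -> dm v 1 -> asy (nm (dird dd v P)) c.
  move=> vy v1; rewrite /asy nm_dird //=.
  apply: (dm_trans _ (nm_ge _ m')).
  have -> : (dird dd v P)@_m' = c * \sum_(j < r.+1) a j * iter j dd v.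
    rewrite /dird /dirv raddf_sum mulr_sumr /=; apply: eq_bigr => j _.
    by rewrite mcoeffZ /a /jet; field.
  rewrite -[X in dm X]mulr1 dm_pM2l //.
  suff /eqv_asy/andP[] : eqv (\sum_(j < r.+1) a j * iter j dd v) 1 by [].
  rewrite /eqv -(subrK (\sum_(j < r.+1) a j * iter j dd y) (\sum_(j < r.+1) _)) -addrA sdD //.
  rewrite -sumrB; apply: sd_sum => [|j _]; first exact: oner_neq0.
  rewrite -mulrBr -[X in sd _ X]mulr1; apply: dm_sdM => //; last exact: oner_neq0.
  have := dd_iter_small j vy; rewrite (gd_iterD (@ddP K)) (gd_iterN (@ddP K)) //.
(* If [y] were infinitesimal, the direction 0 would be admissible too, and its derivative is 0. *)
have y2 : dm 1 y.
  apply/negPn/negP => ys.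
  have := key 0; rewrite sub0r sdN => /(_ ys (dm0 _)).
  rewrite /dird /dirv big1 => [|j _]; last by rewrite /jet (gd_iter0 (@ddP K)) scale0r.
  by rewrite nm0 asy_sym asy0 (negPf c0).
exists y; first by rewrite /asy y1 y2.
move=> v vy; apply: key => //; rewrite -(subrK y v); apply: dmD => //; exact: sdW.
Qed.

End Settled.

(** * Balls with centre and radius in the subfield around an immediate cut *)

Section Cut.

Variables (F : fieldType) (dF : F -> F) (K : dhlField) (io : {rmorphism F -> K}).
Hypothesis iod : forall x, io (dF x) = dd (io x).
Variable b : K.
Hypothesis imm : forall a, exists2 f, f != 0 & asy (b - io a) (io f).
Hypothesis resF : forall u, dm u 1 -> exists x, sd (u - io x) 1.

Notation mp := (map_mpoly io).
Notation cjK := (cj (@dd K)).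
Notation cjF := (cj dF).
Notation jetK := (jet (@dd K)).

Lemma io_inj : injective io. Proof. exact: fmorph_inj. Qed.
Lemma io_eq0 x : (io x == 0) = (x == 0). Proof. exact: fmorph_eq0. Qed.
Lemma mp_cj n a g (P : {mpoly F[n]}) : mp (cjF a g P) = cjK (io a) (io g) (mp P).
Proof. by apply: map_cj => //; apply: io_inj. Qed.

Definition ball a g := g != 0 /\ dm (b - io a) (io g).
(** The radii of the cut. They are closed upwards and, by immediacy and [resF], have no smallest
    element. *)
Definition Sc g := exists a, ball a g.

Lemma b_neq a : b - io a != 0.
Proof. by have [f f0 h] := imm a; rewrite (asy_eq0 h) io_eq0. Qed.

(** The residue of [(b - a) / f] is represented in [F]; adding that multiple of [f] to [a] improves
    the approximation by a whole archimedean step of the valuation. *)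
Lemma better a : exists2 a', sd (b - io a') (b - io a) & dm (io a' - io a) (b - io a).
Proof.
have [f f0 h] := imm a; have f0' : io f != 0 by rewrite io_eq0.
have [|x hx] := @resF ((b - io a) / io f); first by rewrite dm_div1 //; case/andP: h.
exists (a + x * f).
  rewrite rmorphD rmorphM opprD addrA (asy_sdr _ h) -sd_div1 //.
  by rewrite mulrBl mulfK.
rewrite rmorphD rmorphM addrAC subrr add0r (asy_dmr _ h) -[X in dm _ X]mul1r dm_pM2r //.
rewrite -(subKr ((b - io a) / io f) (io x)).
by apply: dmB; [rewrite dm_div1 //; case/andP: h|exact: sdW].
Qed.

Lemma ball_ex : exists a g, ball a g.
Proof. by have [f f0 h] := imm 0; exists 0, f; split=> //; case/andP: h. Qed.

Lemma ball_smaller g : Sc g -> exists a' g', ball a' g' /\ sd (io g') (io g).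
Proof.
move=> [a [g0 h]]; have [a' h1 _] := better a; have [f f0 h2] := imm a'.
exists a', f; split; first by split=> //; case/andP: h2.
by rewrite -(asy_sdl _ h2); apply: sd_dm_trans h1 h.
Qed.
Lemma Sc_smaller g : Sc g -> exists2 g', Sc g' & sd (io g') (io g).
Proof. by move=> /ball_smaller[a' [g' [h1 h2]]]; exists g' => //; exists a'. Qed.
Lemma Sc_up g g' : Sc g -> g' != 0 -> dm (io g) (io g') -> Sc g'.
Proof. by move=> [a [g0 h]] g0' h'; exists a; split=> //; apply: dm_trans h h'. Qed.
Lemma Sc0 g : Sc g -> io g != 0. Proof. by move=> [a [h _]]; rewrite io_eq0. Qed.

Section N.
Variable n : nat.
Implicit Types P Q : {mpoly F[n]}.

Definition st P := exists a g, ball a g /\ settledAt (mp (cjF a g P)).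

Lemma cj_recenter a g a' g' P : g != 0 ->
  mp (cjF a' g' P) = cjK ((io a' - io a) / io g) (io g' / io g) (mp (cjF a g P)).
Proof.
move=> g0; have g0' : io g != 0 by rewrite io_eq0.
rewrite !mp_cj cj_cj; last exact: ddP.
by rewrite ![io g * _]mulrC !divfK // addrC subrK.
Qed.
Lemma cj_recenterb a g (g' : K) P : g != 0 ->
  cjK b g' (mp P) = cjK ((b - io a) / io g) (g' / io g) (mp (cjF a g P)).
Proof.
move=> g0; have g0' : io g != 0 by rewrite io_eq0.
rewrite !mp_cj cj_cj; last exact: ddP.
have e1 : io a + io g * ((b - io a) / io g) = b by rewrite [io g * _]mulrC divfK // addrC subrK.
have e2 : io g * (g' / io g) = g' by rewrite mulrC divfK.
by rewrite e1 e2.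
Qed.

Lemma ball_dist a g a' g' : ball a g -> ball a' g' -> dm (io g') (io g) ->
  dm (io a' - io a) (io g).
Proof.
move=> [g0 h] [g0' h'] gg; rewrite (_ : _ - _ = (b - io a) - (b - io a')); last by rewrite opprB [RHS]addrC addrA subrK.
by apply: dmB => //; apply: dm_trans h' gg.
Qed.

Lemma settled_smaller a g a' g' P : ball a g -> ball a' g' -> dm (io g') (io g) ->
  settledAt (mp (cjF a g P)) -> settledAt (mp (cjF a' g' P)).
Proof.
move=> B B' gg sP; have g0 : io g != 0 by rewrite io_eq0; case: B.
rewrite (cj_recenter a a' g' P (proj1 B)).
apply: (proj1 (settledAt_cj _ _ sP)); rewrite dm_div1 //.
exact: ball_dist B B' gg.
Qed.

Lemma settled_center a g P : ball a g -> settledAt (mp (cjF a g P)) ->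
  forall g' : K, dm g' (io g) -> settledAt (cjK b g' (mp P)).
Proof.
move=> B sP g' gg; have g0 : io g != 0 by rewrite io_eq0; case: B.
rewrite (cj_recenterb a g' P (proj1 B)).
by apply: (proj1 (settledAt_cj _ _ sP)); rewrite dm_div1 //; case: B.
Qed.

(** The centre lies in [F]; this is how values at [b] acquire a leading term in [F]. *)
Lemma settled_val a g P y : g != 0 -> dm (y - io a) (io g) -> settledAt (mp (cjF a g P)) ->
  eqv (mp P).@[jetK y] (io P.@[jet dF a]).
Proof.
move=> g0 h sP; have g0' : io g != 0 by rewrite io_eq0.
have := @settledAt_ev _ _ _ ((y - io a) / io g) _ sP; rewrite dm_div1 // => /(_ h).
rewrite mp_cj cj_eval; last exact: ddP.
rewrite [io g * _]mulrC divfK // addrC subrK cj_coef0 (map_meval (dS := @dd K)) //.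
Qed.

Lemma st_val P : st P -> exists2 f, f != 0 & eqv (mp P).@[jetK b] (io f).
Proof.
move=> [a [g [[g0 h] sP]]]; have e := settled_val g0 h sP.
by exists P.@[jet dF a] => //; rewrite -io_eq0; exact: eqv_neq0 e.
Qed.

Lemma st_common (Ps : seq {mpoly F[n]}) a0 g0 : ball a0 g0 -> (forall P, P \in Ps -> st P) ->
  exists a g, [/\ ball a g, dm (io g) (io g0) & forall P, P \in Ps -> settledAt (mp (cjF a g P))].
Proof.
move=> B0; elim: Ps => [|P Ps IH] h; first by exists a0, g0; split=> //; exact: dmxx.
have [|a [g [B gg0 H]]] := IH; first by move=> Q QP; apply: h; rewrite inE QP orbT.
have [a' [g' [B' sP]]] := h P (mem_head _ _).
have [gg|/sdW gg] := boolP (dm (io g) (io g')).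
  exists a, g; split; [exact: B|exact: gg0|].
  move=> Q; rewrite inE => /orP[/eqP->|QP]; last exact: (H Q QP).
  exact: settled_smaller B' B gg sP.
exists a', g'; split; [exact: B'|exact: dm_trans gg gg0|].
move=> Q; rewrite inE => /orP[/eqP->|QP]; first exact: sP.
exact: settled_smaller B B' gg (H Q QP).
Qed.

End N.
End Cut.

(** * Unsettled polynomials of minimal complexity *)

Opaque dm mcoeff comp_mpoly map_mpoly meval nm nc hp hi.

Lemma nat_min (T : nat -> Prop) : (exists k, T k) -> exists k, T k /\ forall l, T l -> (k <= l)%N.
Proof.
move=> [k0 h0]; have ex : exists k, `[< T k >] by exists k0; apply/asboolP.
exists (ex_minn ex); case: ex_minnP => k /asboolP h1 h2; split=> // l h.
by apply: h2; apply/asboolP.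
Qed.

(** * The vertex of a homogeneous part in the weighted norm *)

Section Vertex.

Variables (K : dhlField) (n e : nat) (H : {mpoly K[n]}).
Hypothesis hH : homg e H.
Implicit Types (g h s v : K).
Notation cj := (cj (@dd K)).
Notation wt := (Lf id).

(* [k] is the largest weight at which the weighted norm [max |H_m| s^(wt m)] of
   the multiplicative conjugate by [g] is attained, and [v] the norm of that part. *)
Definition Vx g s k v := [/\ v != 0,
  forall m : 'X_{1..n}, dm ((cj 0 g H)@_m * s ^+ wt m) (v * s ^+ k),
  forall m : 'X_{1..n}, (k < wt m)%N -> sd ((cj 0 g H)@_m * s ^+ wt m) (v * s ^+ k)
  & exists2 m : 'X_{1..n}, wt m = k & asy (cj 0 g H)@_m v].

Lemma dm1_neq0 s : dm 1 s -> s != 0.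
Proof. by apply: contraTneq => ->; rewrite dmx0 oner_eq0. Qed.

Lemma Vx_ex g s : H != 0 -> g != 0 -> dm 1 s -> exists k v, Vx g s k v.
Proof.
move=> H0 g0 s1; have s0 := dm1_neq0 s1; set Q := cj 0 g H.
have Q0 : Q != 0.
  by apply: contraNneq H0 => q0; rewrite -(cj_inv H g0) -/Q q0 /cj comp_mpoly0.
have [m0 h0] : exists m, m \in msupp Q.
  case E : (msupp Q) => [|m r]; last by exists m; rewrite mem_head.
  by move: Q0; rewrite -msupp_eq0 E.
have [m1 m1Q Hm1] := dm_max (fun m => Q@_m * s ^+ wt m) h0.
set c := Q@_m1 * s ^+ wt m1 in Hm1.
have c0 : c != 0 by rewrite mulf_neq0 ?expf_neq0 // -mcoeff_msupp.
have Hc m : dm (Q@_m * s ^+ wt m) c.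
  have [/Hm1 //|/memN_msupp_eq0 ->] := boolP (m \in msupp Q); by rewrite mul0r dm0.
pose att k := exists2 m, m \in msupp Q & wt m = k /\ asy (Q@_m * s ^+ wt m) c.
have [k [[m mQ [mk ma]] kmax]] : exists k, att k /\ forall l, att l -> (l <= k)%N.
  pose M := \max_(m <- msupp Q) wt m.
  have attM k : att k -> (k <= M)%N by move=> [m mQ [<- _]]; apply: leq_bigmax_seq.
  have [|l [[lM al] lmin]] := @nat_min (fun l => (l <= M)%N /\ att (M - l)%N).
    have h : att (wt m1) by exists m1 => //; split=> //; apply: asyxx.
    by exists (M - wt m1)%N; rewrite leq_subr subKn ?attM.
  exists (M - l)%N; split=> // k ak; have kM := attM k ak.
  have := lmin (M - k)%N; rewrite leq_subr subKn // => /(_ (conj isT ak)).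
  by move=> h; rewrite -(subKn kM) leq_sub2l.
have ca : asy c (Q@_m * s ^+ k) by rewrite -mk asy_sym.
have Qm0 : Q@_m != 0 by rewrite -mcoeff_msupp.
exists k, Q@_m; split=> //.
- by move=> m'; rewrite -(asy_dmr _ ca).
- move=> m' km'; rewrite -(asy_sdr _ ca) /sd; apply/negP => h.
  have: att (wt m').
    exists m'; last by split=> //; rewrite /asy Hc h.
    rewrite mcoeff_msupp; apply: contraTneq h => ->; by rewrite mul0r dmx0.
  by move/kmax; rewrite leqNgt km'.
- by exists m => //; apply: asyxx.
Qed.

(** The upper bounds are the weighted scaling. If no coefficient of weight [k] attained them, the
    strict estimate would hold from weight [k] on, and conjugating back by [h^-1] would make the
    original vertex strictly small. *)
Lemma Vx_inv g s k v h : g != 0 -> h != 0 -> dm 1 s -> dm (logder dd h) s ->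
  Vx g s k v -> Vx (g * h) s k (v * h ^+ e).
Proof.
move=> g0 h0 s1 hs [v0 H1 H2 [m mk ma]]; have s0 := dm1_neq0 s1.
have he : h ^+ e != 0 by rewrite expf_neq0.
have Eg : cj 0 (g * h) H = cj 0 h (cj 0 g H).
  by rewrite cj_cj ?mulr0 ?addr0 //; apply: ddP.
have hQ := @homg_cj0 _ _ _ g _ hH.
have hQh := @homg_cj0 _ _ _ (g * h) _ hH.
have vs0 : v * s ^+ k != 0 by rewrite mulf_neq0 ?expf_neq0.
have B1 m' : dm ((cj 0 (g * h) H)@_m' * s ^+ wt m') (v * h ^+ e * s ^+ k).
  rewrite Eg mulrAC; apply: (cj0_W hQ h0 s1 hs (k := 0%N)) => // m'' _; exact: H1.
have B2 m' : (k < wt m')%N -> sd ((cj 0 (g * h) H)@_m' * s ^+ wt m') (v * h ^+ e * s ^+ k).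
  by rewrite Eg mulrAC; apply: (cj0_Wlt hQ h0 s1 hs vs0) => m'' hm; apply: H2.
split=> //; first by rewrite mulf_neq0.
apply: contrapT => no.
have sk m' : (k <= wt m')%N -> sd ((cj 0 (g * h) H)@_m' * s ^+ wt m') (v * h ^+ e * s ^+ k).
  rewrite leq_eqVlt => /orP[/eqP hk|]; last exact: B2.
  rewrite /sd; apply/negP => B; apply: no; exists m'; first by rewrite hk.
  have sk0 : s ^+ k != 0 by rewrite expf_neq0.
  move: (B1 m') B; rewrite -hk (dm_pM2r _ _ sk0) (dm_pM2r _ _ sk0) => b1 b2.
  by apply/andP; split.
have vhs : v * h ^+ e * s ^+ k != 0 by rewrite !mulf_neq0 ?expf_neq0.
have hV : h^-1 != 0 by rewrite invr_eq0.
have hVs : dm (logder dd h^-1) s by rewrite ldV // dmN.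
have := cj0_Wlt hQh hV s1 hVs vhs sk (t := m); rewrite mk leqnn => /(_ isT).
rewrite Eg cj_inv // exprVn mulrAC mulfK // sd_pM2r ?expf_neq0 //.
by rewrite (asy_sdl _ ma) sdxx.
Qed.

(** A larger [s] favours higher weights: a vertex of higher weight for [s'] would also beat the
    vertex for [s]. *)
Lemma Vx_dec g s s' k k' v v' : dm 1 s' -> dm s' s -> Vx g s k v -> Vx g s' k' v' -> (k' <= k)%N.
Proof.
move=> s1' ss [v0 H1 H2 [m mk ma]] [v0' H1' H2' [m' mk' ma']].
have s0' := dm1_neq0 s1'; have s0 : s != 0 := dm1_neq0 (dm_trans s1' ss).
rewrite leqNgt; apply/negP => kk.
have := H2 m'; rewrite mk' => /(_ kk); rewrite (asy_sdl _ (asyM ma' (asyxx _))) => h1.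
have := H1' m; rewrite mk (asy_dml _ (asyM ma (asyxx _))) => h2.
move: h1; rewrite /sd => /negP; apply.
have [j ej] : exists j, k' = (j + k)%N by exists (k' - k)%N; rewrite subnK // ltnW.
have sk0 : s ^+ k != 0 by rewrite expf_neq0.
have sk0' : s' ^+ k != 0 by rewrite expf_neq0.
move: h2; rewrite ej exprD mulrA (dm_pM2r _ _ sk0') => h2.
rewrite exprD mulrA (dm_pM2r _ _ sk0); apply: (dm_trans h2); exact: dmM (dmxx _) (dmX _ ss).
Qed.

Lemma Vx_same g s s' k v v' : dm 1 s -> dm 1 s' -> Vx g s k v -> Vx g s' k v' -> asy v v'.
Proof.
move=> s1 s1' [v0 H1 H2 [m mk ma]] [v0' H1' H2' [m' mk' ma']].
have s0' := dm1_neq0 s1'; have s0 := dm1_neq0 s1.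
apply/andP; split.
  by have := H1' m; rewrite mk dm_pM2r ?expf_neq0 // (asy_dml _ ma).
by have := H1 m'; rewrite mk' dm_pM2r ?expf_neq0 // (asy_dml _ ma').
Qed.

Lemma Vx_asy g s k v v' : asy v v' -> Vx g s k v -> Vx g s k v'.
Proof.
move=> vv [v0 H1 H2 [m mk ma]]; split.
- by rewrite -(asy_eq0 vv).
- by move=> m'; rewrite -(asy_dmr _ (asyM vv (asyxx _))).
- by move=> m'; rewrite -(asy_sdr _ (asyM vv (asyxx _))); apply: H2.
- by exists m => //; apply: asy_trans ma vv.
Qed.

Lemma Vx_nm g s k v : g != 0 -> dm 1 s -> Vx g s k v ->
  dm v (nm (cj 0 g H)) /\ dm (nm (cj 0 g H)) (v * s ^+ (n * e)).
Proof.
move=> g0 s1 [v0 H1 H2 [m mk ma]]; have s0 := dm1_neq0 s1.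
have ke : (k <= n * e)%N.
  rewrite -mk; apply: wt_le; apply: (@homg_cj0 _ _ _ g _ hH).
  by rewrite (asy_eq0 ma).
split; first by rewrite -(asy_dml _ ma) nm_ge.
apply: nm_le => m'; apply: (@dm_trans _ ((cj 0 g H)@_m' * s ^+ wt m')).
  by rewrite -[X in dm X]mulr1; apply: dmM; [exact: dmxx|exact: dm_1X].
by apply: (dm_trans (H1 m')); apply: dmM; [exact: dmxx|exact: dm_X2].
Qed.

End Vertex.

(** * Directional derivatives of conjugates, and the balancing scale *)

Section DirectionScaling.

Variables (K : dhlField) (n : nat).
Implicit Types (M H : {mpoly K[n]}) (f g b : K).
Notation cjK := (cj (@dd K)).

Lemma mulKdiv f g : f != 0 -> f * (g / f) = g.
Proof. by move=> f0; rewrite mulrC divfK. Qed.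
Lemma mul_div_inv f g : f != 0 -> g != 0 -> g / f * (f / g) = 1.
Proof. by move=> f0 g0; rewrite mulrA divfK // divff. Qed.

Lemma cj0_div f g H : f != 0 -> cjK 0 (g / f) (cjK 0 f H) = cjK 0 g H.
Proof. by move=> f0; rewrite (cj_cj (@ddP K)) mulr0 addr0 mulKdiv. Qed.

Lemma dird_scale f g H : f != 0 -> g != 0 ->
  dird dd (f / g) (cjK 0 g H) = cjK 0 (g / f) (dird dd 1 (cjK 0 f H)).
Proof.
move=> f0 g0; rewrite -(cj0_div g H f0) (dird_cj (@ddP K)).
by rewrite mul_div_inv.
Qed.

(** Scaling by [f] turns the direction into 1: the part of degree [e] of the derivative at scale [g]
    is the conjugate by [g / f] of a polynomial that depends on [f] alone. *)
Lemma dird_center b f g M e : f != 0 -> g != 0 ->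
  hp e (cjK b g (dird dd f M)) = cjK 0 (g / f) (dird dd 1 (cjK 0 f (hp e.+1 (cjK b 1 M)))).
Proof.
move=> f0 g0.
have -> : cjK b g (dird dd f M) = dird dd (f / g) (cjK b g M).
  by rewrite (dird_cj (@ddP K)) mulKdiv.
rewrite hp_dird.
have -> : cjK b g M = cjK 0 g (cjK b 1 M).
  by rewrite (cj_cj (@ddP K)) mulr0 addr0 mul1r.
by rewrite (hp_cj0 (@ddP K)) dird_scale.
Qed.

Lemma dird_center0 b f g M : f != 0 ->
  (cjK b g (dird dd f M))@_0 = \sum_(i < n) iter i dd 1 * (cjK b f M)@_U_(i).
Proof.
move=> f0; rewrite cj_coef0 -(@cj_coef0 _ (@dd K) n b f).
by rewrite -{2}[f]mulr1 -(dird_cj (@ddP K)) dird_coef0.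
Qed.

Lemma homg_dird w H e : homg e.+1 H -> homg e (dird dd w H).
Proof.
move=> hH; have -> : H = hp e.+1 H.
  by apply/mpolyP => m; rewrite hp_coef; case: eqP => // h; apply/eqP/negPn/negP => /hH.
by rewrite -hp_dird; apply: homg_hp.
Qed.

Lemma nm_dird1_cj u H : asy u 1 -> asy (nm (dird dd u H)) (nm H) ->
  asy (nm (dird dd 1 (cjK 0 u H))) (nm (cjK 0 u H)).
Proof.
move=> u1 h; rewrite (dird_cj (@ddP K)) mulr1.
apply: asy_trans (nm_cj_asy _ u1) _; apply: asy_trans h _.
by rewrite asy_sym; apply: nm_cj_asy.
Qed.

Lemma cj0_neq0 f H : f != 0 -> H != 0 -> cjK 0 f H != 0.
Proof.
by move=> f0; apply: contraNneq => h; rewrite -(cj_inv H f0) h /cj comp_mpoly0.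
Qed.

(** Bookkeeping for [star]: the three estimates lose [n * d], [n * d.+1] and [n] factors [s], in all
    [2 * n * d.+1]. *)
Lemma star_arith (A Uf Ug Wg h s : K) d : h != 0 -> s != 0 ->
  sd (A * h ^+ d) (Uf * s ^+ (n * d)) -> dm Wg (A * h ^+ d.+1 * s ^+ (n * d.+1)) ->
  dm (Uf * h) (Ug * s ^+ n) -> sd Wg (Ug * s ^+ (2 * n * d.+1)).
Proof.
move=> h0 s0 C3 C4 C5; apply: (dm_sd_trans C4).
have -> : A * h ^+ d.+1 * s ^+ (n * d.+1) = A * h ^+ d * (h * s ^+ (n * d.+1)).
  by rewrite exprS; move: (h ^+ _) (s ^+ _) => x y; ring.
have hs0 : h * s ^+ (n * d.+1) != 0 by rewrite mulf_neq0 ?expf_neq0.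
have C6 : sd (A * h ^+ d * (h * s ^+ (n * d.+1))) (Uf * s ^+ (n * d) * (h * s ^+ (n * d.+1))).
  by rewrite (sd_pM2r _ _ hs0).
apply: (sd_dm_trans C6).
have -> : Uf * s ^+ (n * d) * (h * s ^+ (n * d.+1)) = Uf * h * (s ^+ (n * d) * s ^+ (n * d.+1)).
  by move: (s ^+ _) (s ^+ (n * d.+1)) => x y; ring.
apply: (dm_trans (dmM C5 (dmxx _))); rewrite -mulrA -!exprD.
have -> : (n + (n * d + n * d.+1) = 2 * n * d.+1)%N by lia.
exact: dmxx.
Qed.

(** [F0] is the scale at which [vL * (g / g0)] and [vd * (g / g0) ^+ e.+2] would have equal size. An
    inequality between the two at [g], up to a factor [S], locates [g] relative to [F0]. *)
Lemma equalize_le (vL vd F0 g0 g S : K) e : vL != 0 -> vd != 0 -> g0 != 0 -> g != 0 ->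
  asy (F0 ^+ e.+1) (vL / vd * g0 ^+ e.+1) ->
  dm (vL * (g / g0)) (vd * (g / g0) ^+ e.+2 * S) -> dm ((F0 / g) ^+ e.+1) S.
Proof.
move=> vL0 vd0 g00 gn0 hA; rewrite exprS expr_div_n => hyp; rewrite expr_div_n.
have ge0 : g ^+ e.+1 != 0 by rewrite expf_neq0.
have g0e : g0 ^+ e.+1 != 0 by rewrite expf_neq0.
rewrite (asy_dml _ (asyM hA (asyxx _))); move: hyp.
have p0 : vd * (g / g0 * (g ^+ e.+1 / g0 ^+ e.+1)) != 0 by rewrite !mulf_neq0 ?invr_eq0.
rewrite -(dm_pM2r _ S p0).
move: (g ^+ e.+1) (g0 ^+ e.+1) ge0 g0e {p0 hA} => p q p0 q0.
have -> : vL / vd * q / p * (vd * (g / g0 * (p / q))) = vL * (g / g0).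
  by field; rewrite ?p0 ?q0 ?vd0 ?g00.
by rewrite [S * _]mulrC.
Qed.
Lemma equalize_ge (vL vd F0 g0 g S : K) e : F0 != 0 -> vL != 0 -> vd != 0 -> g0 != 0 -> g != 0 ->
  asy (F0 ^+ e.+1) (vL / vd * g0 ^+ e.+1) ->
  dm (vd * (g / g0) ^+ e.+2) (vL * (g / g0) * S) -> dm ((g / F0) ^+ e.+1) S.
Proof.
move=> F00 vL0 vd0 g00 gn0 hA; rewrite exprS expr_div_n => hyp; rewrite expr_div_n.
have ge0 : g ^+ e.+1 != 0 by rewrite expf_neq0.
have g0e : g0 ^+ e.+1 != 0 by rewrite expf_neq0.
have Fe0 : F0 ^+ e.+1 != 0 by rewrite expf_neq0.
rewrite (asy_dml _ (asyM (asyxx _) (asyV Fe0 hA))); move: hyp.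
have p0 : vL * (g / g0) != 0 by rewrite !mulf_neq0 ?invr_eq0.
rewrite -(dm_pM2r _ S p0).
move: (g ^+ e.+1) (g0 ^+ e.+1) ge0 g0e {p0 hA} => p q p0 q0.
have -> : p / (vL / vd * q) * (vL * (g / g0)) = vd * (g / g0 * (p / q)).
  by field; rewrite ?p0 ?q0 ?vd0 ?vL0 ?g00.
by rewrite [S * _]mulrC.
Qed.

End DirectionScaling.

(** * Unsettled polynomials that are nowhere quasilinear do not exist *)

Section DHC.

Variables (F : fieldType) (dF : F -> F) (K : dhlField) (io : {rmorphism F -> K}).
Hypothesis iod : forall x, io (dF x) = dd (io x).
Variable b : K.
Hypothesis imm : forall a, exists2 f, f != 0 & asy (b - io a) (io f).
Hypothesis resF : forall u, dm u 1 -> exists x, sd (u - io x) 1.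
Hypothesis divF : forall (f : F) k, f != 0 -> exists2 f' : F, f' != 0 & asy (io f' ^+ k.+1) (io f).

Notation mp := (map_mpoly io).
Notation cjK := (cj (@dd K)).
Notation cjF := (cj dF).
Notation jetK := (jet (@dd K)).
Notation ld := (logder (@dd K)).
Notation Sc := (Sc io b).
Notation ball := (ball io b).
Notation st := (st dF io b).

Variables (n : nat) (P : {mpoly F[n]}).
Hypothesis P0 : P != 0.
Hypothesis nstP : ~ st P.
Hypothesis H1 : forall w, dird dF w P != 0 -> st (dird dF w P).
Hypothesis H2 : forall g (t : 'X_{1..n}), g != 0 -> t != 0%MM ->
  cjF 0 g^-1 (cjF 0 g P)^`M[t] != 0 -> st (cjF 0 g^-1 (cjF 0 g P)^`M[t]).
Hypothesis nql : forall a g, ball a g -> ~~ ql (mp (cjF a g P)).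

Variable G : {mpoly K[n]}.
Hypothesis GE : G = cjK b 1 (mp P).
Notation W e g := (nm (cjK 0 (io g) (hp e G))).

Lemma hG e : homg e (hp e G). Proof. exact: homg_hp. Qed.

Lemma cjbE (g : K) : cjK b g (mp P) = cjK 0 g G.
Proof. by rewrite GE cj_cj ?mulr0 ?addr0 ?mul1r //; apply: ddP. Qed.

Lemma WE e g : W e g = nm (hp e (cjK b (io g) (mp P))).
Proof. by rewrite cjbE (hp_cj0 (@ddP K)). Qed.

Lemma nqlb g : Sc g -> ~~ ql (cjK b (io g) (mp P)).
Proof.
move=> [a B]; apply/negP => q; have := nql B; rewrite mp_cj //.
have g0 : io g != 0 by apply: (@Sc0 F K io b); exists a.
have -> : cjK (io a) (io g) (mp P) = cjK ((io a - b) / io g) 1 (cjK b (io g) (mp P)).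
  rewrite (cj_cj (@ddP K)).
  have e1 : b + io g * ((io a - b) / io g) = io a.
    by rewrite [io g * _]mulrC divfK // addrC subrK.
  by rewrite e1 mulr1.
rewrite ql_shift //; rewrite dm_div1 // -dmN opprB; exact: (proj2 B).
Qed.

Lemma W_le e g g' s : io g != 0 -> io g' != 0 -> dm 1 s -> dm (ld (io g' / io g)) s ->
  dm (W e g') (W e g * (io g' / io g) ^+ e * s ^+ (n * e)).
Proof.
move=> g0 g0' s1 hs; have h0 : io g' / io g != 0 by rewrite mulf_neq0 ?invr_eq0.
have := nm_cj0_le (@homg_cj0 _ _ _ (io g) _ (@hG e)) h0 s1 hs.
rewrite cj_cj; last exact: ddP.
by rewrite mulr0 addr0 [io g * _]mulrC divfK.
Qed.
Lemma W_ge e g g' s : io g != 0 -> io g' != 0 -> dm 1 s -> dm (ld (io g' / io g)) s ->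
  dm (W e g * (io g' / io g) ^+ e) (W e g' * s ^+ (n * e)).
Proof.
move=> g0 g0' s1 hs; have h0 : io g' / io g != 0 by rewrite mulf_neq0 ?invr_eq0.
have := nm_cj0_ge (@homg_cj0 _ _ _ (io g) _ (@hG e)) h0 s1 hs.
rewrite cj_cj; last exact: ddP.
by rewrite mulr0 addr0 [io g * _]mulrC divfK.
Qed.
Lemma W_asy e g g' : io g != 0 -> asy (io g' / io g) 1 -> asy (W e g') (W e g).
Proof.
move=> g0 h; have := nm_cj_asy (cjK 0 (io g) (hp e G)) h.
rewrite cj_cj; last exact: ddP.
by rewrite mulr0 addr0 [io g * _]mulrC divfK.
Qed.

Lemma sd_pow (h : K) a c : h != 0 -> sd h 1 -> sd (h ^+ a.+1 * ld h ^+ c) 1.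
Proof.
move=> h0 h1; rewrite exprSr -mulrA -[X in sd _ X]mul1r; apply: dm_sdM; last exact: oner_neq0.
  by rewrite -(expr1n _ a); apply: dmX; apply: sdW.
exact: ldX_small.
Qed.

(** As in [ql_scale]: on shrinking the scale by [h], the part of degree [e > 1] gains an extra power
    of [h] over the linear part, which outweighs all powers of [ld h]. *)
Lemma W_mono e g g' : (1 < e)%N -> io g != 0 -> io g' != 0 -> dm (io g') (io g) ->
  sd (W e g) (W 1 g) -> sd (W e g') (W 1 g').
Proof.
move=> e1 g0 g0' gg hW; set h := io g' / io g.
have h0 : h != 0 by rewrite mulf_neq0 ?invr_eq0.
have h1 : dm h 1 by rewrite dm_div1.
have [h2|h2] := boolP (dm 1 h).
  have ha : asy h 1 by rewrite /asy h1 h2.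
  by rewrite (asy_sdl _ (W_asy _ g0 ha)) (asy_sdr _ (W_asy _ g0 ha)).
have [s1 _] := ld_small h0 h2; have s0 := sd_neq0 s1.
have U0 : W 1 g != 0 := sd_neq0 hW.
rewrite -(@sd_pM2r _ (ld h ^+ (n * 1))) ?expf_neq0 //.
apply: (sd_dm_trans _ (W_ge 1 g0 g0' (sdW s1) (dmxx _))).
apply: (dm_sd_trans (dmM (W_le e g0 g0' (sdW s1) (dmxx _)) (dmxx _))).
rewrite -/h expr1 -!mulrA; apply: sd_dmM => //.
have [a ea] : exists a, e = a.+2 by case: (e) e1 => [|[|a]] // _; exists a.
rewrite [in h ^+ e]ea exprS -mulrA -exprD -[X in dm _ X]mulr1 (dm_pM2l _ _ h0).
exact: sdW (sd_pow _ _ h0 h2).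
Qed.

(** Otherwise each degree above 1 falls below the linear part at some radius, and stays below by
    [W_mono]. Only finitely many degrees occur, so at a common radius [P] would be quasilinear. *)
Lemma deg_ex : exists d, [/\ (1 < d)%N, hp d G != 0 & forall g, Sc g -> dm (W 1 g) (W d g)].
Proof.
apply: contrapT => no.
have bad e : (1 < e)%N -> exists2 g, Sc g & hp e G = 0 \/ sd (W e g) (W 1 g).
  move=> e1; apply: contrapT => nb; apply: no; exists e; split; [exact: e1| |].
    have [a [g B]] := ball_ex imm.
    by apply/negP => /eqP h; apply: nb; exists g; [exists a; exact: B|left; exact: h].
  by move=> g Sg; apply/negPn/negP => h; apply: nb; exists g; [exact: Sg|right; exact: h].
have common N : exists2 g, Sc g & forall e, (1 < e < N)%N -> hp e G = 0 \/ sd (W e g) (W 1 g).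
  elim: N => [|N [g Sg IH]]; first by have [a [g B]] := ball_ex imm; exists g; [exists a; exact: B|by move=> e; rewrite ltn0 andbF].
  have [N1|N1] := leqP N 1.
    exists g; [exact: Sg|move=> e /andP[e1]]; rewrite ltnS => eN.
    by have h := leq_trans e1 (leq_trans eN N1); rewrite ltnn in h.
  have [g' Sg' h'] := bad N N1.
  have g0 := Sc0 Sg; have g0' := Sc0 Sg'.
  have [gg|/sdW gg] := boolP (dm (io g) (io g')).
    exists g; [exact: Sg|move=> e /andP[e1]]; rewrite ltnS leq_eqVlt => /orP[/eqP->|eN].
      by case: h' => h'; [left; exact: h'|right; exact: (W_mono N1 g0' g0 gg h')].
    by apply: IH; rewrite e1.
  exists g'; [exact: Sg'|move=> e /andP[e1]]; rewrite ltnS leq_eqVlt => /orP[/eqP->|eN]; first exact: h'.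
  have h := IH e; rewrite e1 eN in h; case: (h isT) => h2; [left; exact: h2|right].
  exact: (W_mono e1 g0 g0' gg h2).
have [g Sg Hg] := common (msize G).
set V := cjK b (io g) (mp P).
have := nqlb Sg; rewrite -/V /ql /sd negbK => hV.
have [m em] := nm_at (hi V).
(* Not being quasilinear and having no part of degree at least 2 forces the linear part to vanish as
   well; then [P] is a nonzero constant, which is settled. *)
have [h0|h0] := eqVneq (nm (hi V)) 0.
  have U0 : nm (hp 1 V) = 0 by move: hV; rewrite h0 dmx0 => /eqP.
  apply: nstP; case: Sg => a B; exists a, g; split=> //.
  have Vc : V = (V@_0)%:MP.
    rewrite {1}(split3 V); move/eqP: h0; rewrite nm_eq0 => /eqP ->.
    by move/eqP: U0; rewrite nm_eq0 => /eqP ->; rewrite !addr0.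
  have PC : mp P = (V@_0)%:MP.
    have g0 : io g != 0 by apply: (@Sc0 F K io b); exists a.
    have : cjK (- b / io g) (io g)^-1 V = mp P.
      have e1 : b + io g * (- b / io g) = 0 by rewrite [io g * _]mulrC divfK // subrr.
      by rewrite /V (cj_cj (@ddP K)) (mulfV g0) e1 (cj01 (@ddP K)).
    by rewrite {1}Vc /cj comp_mpolyC => <-.
  rewrite mp_cj // PC /cj comp_mpolyC /settledAt.
  have -> : nc (V@_0)%:MP_[n] = 0.
    by apply/mpolyP => m'; rewrite nc_coef mcoeffC mcoeff0; case: eqP => // _; rewrite mulr0.
  rewrite nm0 sd0 mcoeffC eqxx mulr1; apply: contraNneq P0 => v0.
  move: PC; rewrite v0 mpolyC0 => PC; apply/eqP/mpolyP => m'.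
  by apply: (fmorph_inj io); rewrite -mcoeff_map_mpoly PC !mcoeff0 rmorph0.
have hm : (1 < mdeg m)%N.
  by apply: contraNT h0 => hm; rewrite -em hi_coef (negPf hm).
have Vm : V@_m = nm (hi V) by rewrite -em hi_coef hm.
have GW : dm (nm (hi V)) (W (mdeg m) g).
  by rewrite WE -/V -Vm; have := nm_ge (hp (mdeg m) V) m; rewrite hp_coef eqxx.
have mG : (mdeg m < msize G)%N.
  rewrite ltnNge; apply/negP => hs.
  have : hp (mdeg m) G = 0.
    apply/mpolyP => m'; rewrite hp_coef mcoeff0; case: eqP => // h.
    by apply: memN_msupp_eq0; apply: (@mmeasure_mnm_ge _ _ mdeg) => /=; rewrite h.
  move=> h; move: GW; rewrite h /cj comp_mpoly0 nm0 dmx0; by rewrite (negPf h0).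
case: (Hg (mdeg m)) => [|h|]; first by rewrite hm mG.
  by move: GW; rewrite h /cj comp_mpoly0 nm0 dmx0 (negPf h0).
by rewrite [W 1 g]WE -/V => /(dm_sd_trans GW)/sd_dm_trans/(_ hV); rewrite sdxx.
Qed.

Variable d : nat.
Hypothesis d1 : (1 < d)%N.
Hypothesis Gd0 : hp d G != 0.
Hypothesis UW : forall g, Sc g -> dm (W 1 g) (W d g).

(** The derivative of [P] in direction [f1] is settled: near [b] its part of degree [d - 1], the
    differentiated part of degree [d] of [P], is strictly below its constant coefficient, and this
    is bounded by the linear part of [P] at scale [f1]. Moving both sides from scale [f1] to [g]
    costs only powers of [s]. *)
Lemma star f : f != 0 -> exists2 g1, Sc g1 & forall g, Sc g -> dm (io g) (io g1) ->
  forall s, dm 1 s -> dm (ld (io g / io f)) s -> sd (W d g) (W 1 g * s ^+ (2 * n * d)).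
Proof.
move=> f0; have if0 : io f != 0 by rewrite fmorph_eq0.
have [e ed] : exists e, d = e.+2 by case: (d) d1 => [|[|e]] // _; exists e.
have hQ0 := @homg_cj0 _ _ _ (io f) _ (@hG d).
have Q00 := cj0_neq0 if0 Gd0.
rewrite {1}ed in hQ0.
(* The direction must not lose norm. The unit [u] has this property for the part of degree [d] at
   scale [f], and so has every element of the same residue, in particular one from [F]. *)
have [u u1 hu] := dir_unit hQ0 Q00.
have [|x hx] := @resF u; first by case/andP: u1.
have vu : sd (io x - u) 1 by rewrite -sdN opprB.
have v1 : asy (io x) 1.
  by apply: (asy_trans _ u1); apply: eqv_asy; rewrite /eqv (asy_sdr _ u1).
have v0 : io x != 0 by rewrite (asy_eq0 v1) oner_eq0.
have x0 : x != 0 by rewrite -(fmorph_eq0 io).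
have [f1 f1E] : exists f1, f1 = f * x by exists (f * x).
have f1M : io f1 = io f * io x by rewrite f1E rmorphM.
have f10 : io f1 != 0 by rewrite f1M mulf_neq0.
have dGf : asy (nm (dird dd 1 (cjK 0 (io f1) (hp d G)))) (W d f1).
  have -> : cjK 0 (io f1) (hp d G) = cjK 0 (io x) (cjK 0 (io f) (hp d G)).
    by rewrite (cj_cj (@ddP K)) mulr0 addr0 f1M.
  apply: nm_dird1_cj; [exact: v1|exact: hu].
have mpd : mp (dird dF f1 P) = dird dd (io f1) (mp P).
  by apply: map_dird; [exact: fmorph_inj|exact: iod].
have E2 g : io g != 0 -> hp e.+1 (cjK b (io g) (dird dd (io f1) (mp P))) =
    cjK 0 (io g / io f1) (dird dd 1 (cjK 0 (io f1) (hp d G))).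
  by move=> g0; rewrite (dird_center b (mp P) e.+1 f10 g0) -GE -ed.
have hdG : homg e.+1 (dird dd 1 (cjK 0 (io f1) (hp d G))).
  by apply: homg_dird; rewrite -ed; apply: homg_cj0; apply: hG.
have P1n0 : dird dF f1 P != 0.
  apply/negP => /eqP p0; have := E2 f1 f10; rewrite -mpd p0 (rmorph0 (map_mpoly io)) (divff f10) (cj01 (@ddP K)).
  rewrite /cj comp_mpoly0 => /esym h.
  have h' : hp e.+1 (0 : {mpoly K[n]}) = 0 by apply/mpolyP => m; rewrite hp_coef mcoeff0 if_same.
  move: dGf; rewrite h' in h; rewrite [X in asy (nm X)]h nm0 asy_sym asy0 nm_eq0.
  by apply/negP; exact: cj0_neq0.
have [a1 [g1 [B1 sP1]]] := H1 P1n0.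
exists g1; first by exists a1; exact: B1.
move=> g Sg gg1 s s1 hs; have g0 := Sc0 Sg; have s0 := dm1_neq0 s1.
have := settled_center iod B1 sP1 gg1; rewrite mpd /settledAt => sT.
have TU : dm (cjK b (io g) (dird dd (io f1) (mp P)))@_0 (W 1 f1).
  rewrite (dird_center0 b (io g) (mp P) f10) WE.
  apply: dm_sum => i _; rewrite -[X in dm _ X]mul1r; apply: dmM.
    by apply: dd_iter_O; exact: dmxx.
  exact: nm_hp1_ge.
have Td : dm (nm (hp e.+1 (cjK b (io g) (dird dd (io f1) (mp P)))))
     (nm (nc (cjK b (io g) (dird dd (io f1) (mp P))))).
  apply: nm_le => m; rewrite hp_coef; case: eqP => [hm|_]; last exact: dm0.
  have m0 : m != 0%MM by rewrite -mdeg_eq0 hm.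
  by have := nm_ge (nc (cjK b (io g) (dird dd (io f1) (mp P)))) m; rewrite nc_coef (negPf m0).
have C1 : sd (nm (cjK 0 (io g / io f1) (dird dd 1 (cjK 0 (io f1) (hp d G))))) (W 1 f1).
  rewrite -(E2 g g0); exact: sd_dm_trans (dm_sd_trans Td sT) TU.
have h0 : io g / io f1 != 0 by rewrite mulf_neq0 ?invr_eq0.
have hs1 : dm (ld (io g / io f1)) s.
  have -> : io g / io f1 = io g / io f / io x by rewrite f1M invfM mulrA.
  rewrite ldf ?mulf_neq0 ?invr_eq0 //; apply: dmB; first exact: hs.
  by apply: dm_trans (ld_asy v1) s1.
have C2 := nm_cj0_ge hdG h0 s1 hs1.
rewrite (asy_dml _ (asyM dGf (asyxx _))) in C2.
have C3 : sd (W d f1 * (io g / io f1) ^+ e.+1) (W 1 f1 * s ^+ (n * e.+1)).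
  have sn0 : s ^+ (n * e.+1) != 0 by rewrite expf_neq0.
  by apply: (dm_sd_trans C2); rewrite (sd_pM2r _ _ sn0).
have C4 := W_le d f10 g0 s1 hs1; have C5 := W_ge 1 f10 g0 s1 hs1.
rewrite expr1 muln1 in C5.
have star := @star_arith K n _ _ (W 1 g) (W d g) _ _ e.+1 h0 s0 C3.
rewrite -ed in star; exact: star C4 C5.
Qed.

(** The right-hand side of a strict inequality is nonzero; [s] is the larger of 1 and the
    logarithmic derivative. *)
Lemma U_neq0 : hp 1 G != 0.
Proof.
have [g1 Sg1 h] := star (oner_neq0 F).
have g10 := Sc0 Sg1.
pose s := if dm (ld (io g1 / io 1)) 1 then 1 else ld (io g1 / io 1).
have s1 : dm 1 s by rewrite /s; case: ifPn => [_|/sdW]; [exact: dmxx|].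
have hs : dm (ld (io g1 / io 1)) s by rewrite /s; case: ifPn => [|_]; [|exact: dmxx].
have := h g1 Sg1 (dmxx _) s s1 hs => /sd_neq0 h1.
by apply: contraNneq h1 => ->; rewrite /cj comp_mpoly0 nm0 mul0r.
Qed.

Lemma W_neq0 e g : io g != 0 -> hp e G != 0 -> W e g != 0.
Proof. by move=> g0 h; rewrite nm_eq0 cj0_neq0. Qed.

(** The cube provides [g2] with [h = g2 / g] dominated by [g / f], so [ld h] may serve as [s] in
    [star] at [g]. From [g] to [g2] the part of degree [d] gains [h ^+ d] and the linear part only
    [h], up to powers of [ld h]. Hence the linear part wins at [g2], against [UW]. *)
Lemma T1_false f : Sc f ->
  (forall g, Sc g -> exists2 g2, Sc g2 & dm (io g2 / io f) ((io g / io f) ^+ 3)) -> False.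
Proof.
move=> Sf T1; have f0 := Sc0 Sf.
have [g1 Sg1 star1] := star (f := f) (ltac:(by rewrite -(fmorph_eq0 io))).
have [g [Sg gg1 gf]] : exists g, [/\ Sc g, dm (io g) (io g1) & sd (io g) (io f)].
  have [f' Sf' ff'] := Sc_smaller imm resF Sf.
  have [gg|/sdW gg] := boolP (dm (io f') (io g1)); first by exists f'.
  by exists g1; split; [|exact: dmxx|exact: dm_sd_trans gg ff'].
have g0 := Sc0 Sg; have [g2 Sg2 h2] := T1 g Sg; have g20 := Sc0 Sg2.
have xf0 : io g / io f != 0 by rewrite mulf_neq0 ?invr_eq0.
have x1 : sd (io g / io f) 1 by rewrite (sd_div1 _ f0).
have h0 : io g2 / io g != 0 by rewrite mulf_neq0 ?invr_eq0.
have hle : dm (io g2 / io g) (io g / io f).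
  have -> : io g2 / io g = io g2 / io f / (io g / io f) by field; rewrite f0 g0.
  rewrite (dm_div _ _ xf0); apply: (dm_trans h2).
  have -> : (io g / io f) ^+ 3 = io g / io f * (io g / io f) * (io g / io f) by ring.
  rewrite -[X in dm _ X]mulr1; apply: dmM; [exact: dmxx|exact: sdW].
have h1 : sd (io g2 / io g) 1 := dm_sd_trans hle x1.
have [s1 _] := ld_small xf0 x1; have [t1 _] := ld_small h0 h1.
have st := ld_mono_small h0 x1 hle.
have C1 := star1 g Sg gg1 _ (sdW t1) st.
have C4 := W_le d g0 g20 (sdW t1) (dmxx _); have C5 := W_ge 1 g0 g20 (sdW t1) (dmxx _).
have C6 := UW Sg2.
have U2 := W_neq0 g20 U_neq0; have U1 := W_neq0 g0 U_neq0.
have t0 := sd_neq0 t1.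
move: C1 C4 C5 C6 U1 U2 h0 h1 t0; move: (io g2 / io g) => h.
move: (W d g) (W 1 g) (W d g2) (W 1 g2) => Wg Ug Wg2 Ug2 C1 C4 C5 C6 U1 U2 h0 h1 t0.
rewrite expr1 muln1 in C5.
have [e ed] : exists e, d = e.+2 by case: (d) d1 => [|[|e]] // _; exists e.
have : sd Wg2 Ug2; last by rewrite /sd C6.
have tn0 : ld h ^+ n != 0 by rewrite expf_neq0.
rewrite -(sd_pM2r _ _ tn0); apply: (sd_dm_trans _ C5); apply: (dm_sd_trans (dmM C4 (dmxx _))).
have td0 : h ^+ d * ld h ^+ (n * d) * ld h ^+ n != 0 by rewrite !mulf_neq0 ?expf_neq0.
have C7 : sd (Wg * (h ^+ d * ld h ^+ (n * d) * ld h ^+ n))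
    (Ug * ld h ^+ (2 * n * d) * (h ^+ d * ld h ^+ (n * d) * ld h ^+ n)).
  by rewrite (sd_pM2r _ _ td0).
have -> : Wg * h ^+ d * ld h ^+ (n * d) * ld h ^+ n = Wg * (h ^+ d * ld h ^+ (n * d) * ld h ^+ n).
  by rewrite !mulrA.
apply: (sd_trans C7).
have -> : Ug * ld h ^+ (2 * n * d) * (h ^+ d * ld h ^+ (n * d) * ld h ^+ n) =
  Ug * h * (h ^+ e.+1 * ld h ^+ (2 * n * d + n * d + n)).
  rewrite {2}ed (exprS h e.+1) !exprD.
  by move: (h ^+ _) (ld h ^+ _) (ld h ^+ (n * d)) (ld h ^+ n) => x y z w; ring.
rewrite -[X in sd _ X]mulr1; apply: dm_sdM; [exact: dmxx|exact: sd_pow|by rewrite mulf_neq0].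
Qed.

(** [s] bounds the logarithmic derivatives of [g2 / g] for all sufficiently small radii [g2]; [g]
    itself may lie outside the radii. *)
Definition Adm g s := [/\ g != 0, dm 1 s & exists2 g1, Sc g1 &
  forall g2, Sc g2 -> dm (io g2) (io g1) -> dm (ld (io g2 / io g)) s].

Lemma Sc_min g g' : Sc g -> Sc g' -> exists2 g2, Sc g2 & dm (io g2) (io g) /\ dm (io g2) (io g').
Proof.
move=> Sg Sg'; have [h|/sdW h] := boolP (dm (io g) (io g')).
  by exists g; [exact: Sg|split; [exact: dmxx|]].
by exists g'; [exact: Sg'|split; [|exact: dmxx]].
Qed.

Lemma ld_div3 (x y z : K) s : x != 0 -> y != 0 -> z != 0 ->
  dm (ld (x / y)) s -> dm (ld (x / z)) s -> dm (ld (y / z)) s.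
Proof.
move=> x0 y0 z0; rewrite !ldf // => h1 h2.
have -> : ld y - ld z = (ld x - ld z) - (ld x - ld y) by ring.
exact: dmB.
Qed.

Lemma Adm_shift g g' s : Adm g s -> io g' != 0 -> dm (ld (io g' / io g)) s -> Adm g' s.
Proof.
move=> [g0 s1 [g1 Sg1 h1]] g0' hg; split; [by rewrite -(fmorph_eq0 io)|exact: s1|].
exists g1; first exact: Sg1.
have ig0 : io g != 0 by rewrite fmorph_eq0.
move=> g2 Sg2 h; have := h1 g2 Sg2 h; have g20 := Sc0 Sg2.
rewrite (ldf g20 ig0) (ldf g20 g0') => h2.
rewrite (ldf g0' ig0) in hg.
have -> : ld (io g2) - ld (io g') = (ld (io g2) - ld (io g)) - (ld (io g') - ld (io g)) by ring.
exact: dmB.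
Qed.

(** The coefficient at [t] has the size of a partial derivative at [b]. This derivative is taken
    after conjugating by [g] and conjugated back, so that [H2] applies and its value at [b] has a
    leading term in [F]. *)
Lemma coefF g (t : 'X_{1..n}) : g != 0 -> t != 0%MM -> (cjK b (io g) (mp P))@_t != 0 ->
  exists2 f, f != 0 & asy (cjK b (io g) (mp P))@_t (io f).
Proof.
move=> g0 t0 c0; have ig0 : io g != 0 by rewrite fmorph_eq0.
have E : cjK b (io g) (mp P) = cjK (b / io g) 1 (mp (cjF 0 g P)).
  by rewrite (mp_cj iod) (cj_cj (@ddP K)) rmorph0 add0r mulr1 mulKdiv.
have mpm : (mp (cjF 0 g P))^`M[t] = mp (cjF 0 g P)^`M[t].
  by apply/mpolyP => m; rewrite mcoeff_map_mpoly !mcoeff_mderivm mcoeff_map_mpoly /=; apply/esym/(rmorphMn io).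
have := Taylor_coef (b / io g) (mp (cjF 0 g P)) t; rewrite -E mpm => TC.
pose Q := cjF 0 g^-1 (cjF 0 g P)^`M[t].
have QE : (mp Q).@[jetK b] = (mp (cjF 0 g P)^`M[t]).@[jetK (b / io g)].
  by rewrite /Q (mp_cj iod) (cj_eval (@ddP K)) rmorph0 add0r fmorphV mulrC.
rewrite -QE in TC.
have Q0 : Q != 0.
  apply: contraNneq c0 => q0; move: TC; rewrite q0 (rmorph0 (map_mpoly io)) meval0 asy0; exact.
have [f f0 hf] := st_val iod (H2 g0 t0 Q0).
by exists f; [exact: f0|exact: asy_trans TC (eqv_asy hf)].
Qed.

Lemma Vx_F e g s k v : (0 < e)%N -> g != 0 -> Vx (hp e G) (io g) s k v ->
  exists2 f, f != 0 & asy v (io f).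
Proof.
move=> e0 g0 [v0 _ _ [m mk ma]].
have cm0 : (cjK 0 (io g) (hp e G))@_m != 0 by rewrite (asy_eq0 ma).
have hm : mdeg m = e := @homg_cj0 _ _ _ (io g) _ (@hG e) m cm0.
have E : (cjK 0 (io g) (hp e G))@_m = (cjK b (io g) (mp P))@_m.
  by rewrite cjbE -(hp_cj0 (@ddP K)) hp_coef hm eqxx.
have m0 : m != 0%MM by rewrite -mdeg_eq0 hm -lt0n.
rewrite E in cm0 ma; have [f f0 hf] := coefF g0 m0 cm0.
by exists f; [exact: f0|apply: asy_trans hf; rewrite asy_sym].
Qed.

(** If neither [x] nor [x^-1] exceeds a power of [s], monotonicity bounds [ld x] by a multiple of
    [ld s], hence by [s]. *)
Lemma ld_between (x s : K) a c : x != 0 -> dm 1 s -> dm (x ^+ a.+1) (s ^+ c) ->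
  dm (x^-1 ^+ a.+1) (s ^+ c) -> dm (ld x) s.
Proof.
move=> x0 s1; have s0 := dm1_neq0 s1.
have main y : y != 0 -> sd 1 y -> dm (y ^+ a.+1) (s ^+ c) -> dm (ld y) s.
  move=> y0 y1 h; have ys : dm y (s ^+ c).
    apply: (dm_trans _ h); rewrite exprS -[X in dm X]mulr1 (dm_pM2l _ _ y0).
    by rewrite -(expr1n _ a); apply: dmX; apply: sdW.
  apply: (dm_trans (ld_mono y1 ys)); rewrite ldX //.
  case: (c) => [|c']; first by rewrite mulr0n dm0.
  by rewrite (asy_dml _ (asyMn _ _)) ld_dm.
move=> h1 h2; case: (asyP x 1) => h.
- rewrite -dmN -ldV //; apply: main => //; first by rewrite invr_eq0.
  by rewrite -[X in sd X]invr1 sdV ?oner_neq0.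
- by apply: dm_trans (ld_asy h) s1.
- exact: main.
Qed.

Lemma sd_contra (x : K) a c : sd 1 x -> dm (x ^+ a.+1) (ld x ^+ c) -> False.
Proof.
move=> x1 h; have x0 := sd_neq0 x1; have := ldX_lt_inf c x1.
have xx : dm x (x ^+ a.+1).
  rewrite exprS -[X in dm X]mulr1 (dm_pM2l _ _ x0) -(expr1n _ a).
  by apply: dmX; apply: sdW.
by move=> h'; have := dm_sd_trans (dm_trans xx h) h'; rewrite sdxx.
Qed.

Section T2.

Hypothesis T2 : forall f, Sc f -> exists2 g, Sc g &
  forall g2, Sc g2 -> sd ((io g / io f) ^+ 3) (io g2 / io f).

(** For small radii [g2] the ratio [g2 / f] lies between [g' / f] and its cube, so its logarithmic
    derivative is at most three times that of [g' / f]. *)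
Lemma T2_adm f g1 : Sc f -> Sc g1 -> exists g', [/\ Sc g', dm (io g') (io g1), sd (io g') (io f)
  & Adm f (ld (io g' / io f))].
Proof.
move=> Sf Sg1; have f0 := Sc0 Sf; have [gA SgA hA] := T2 Sf.
have [f' Sf' ff'] := Sc_smaller imm resF Sf.
have [g3 Sg3 [h31 h3A]] := Sc_min Sg1 SgA.
have [g' Sg' [h'3 h'f]] := Sc_min Sg3 Sf'.
have g'f : sd (io g') (io f) := dm_sd_trans h'f ff'.
exists g'; split; [exact: Sg'|exact: dm_trans h'3 h31|exact: g'f|].
have g'0 := Sc0 Sg'; have x0 : io g' / io f != 0 by rewrite mulf_neq0 ?invr_eq0.
have x1 : sd (io g' / io f) 1 by rewrite (sd_div1 _ f0).
split; [by rewrite -(fmorph_eq0 io)|exact: sdW (proj1 (ld_small x0 x1))|].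
exists g'; first exact: Sg'.
move=> g2 Sg2 h2; have g20 := Sc0 Sg2.
have y1 : sd (io g2 / io f) 1 by rewrite (sd_div1 _ f0); exact: dm_sd_trans h2 g'f.
have x30 : (io g' / io f) ^+ 3 != 0 by rewrite expf_neq0.
have fi0 : (io f)^-1 != 0 by rewrite invr_eq0.
have le : dm ((io g' / io f) ^+ 3) (io g2 / io f).
  apply: (dm_trans _ (sdW (hA g2 Sg2))); apply: dmX.
  by rewrite (dm_pM2r _ _ fi0); exact: dm_trans h'3 h3A.
apply: (dm_trans (ld_mono_small x30 y1 le)); rewrite (ldX _ x0).
by case/andP: (asyMn (ld (io g' / io f)) 2).
Qed.

Lemma T2_false : False.
Proof.
have d0 : (0 < d)%N := ltnW d1.
have [e ed] : exists e, d = e.+2 by case: (d) d1 => [|[|e]] // _; exists e.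
(* An admissible pair is chosen for which the vertex weights of the linear part and of the part of
   degree [d] have least sum. *)
pose T k := exists g s kL kd vL vd, [/\ Adm g s, Vx (hp 1 G) (io g) s kL vL,
  Vx (hp d G) (io g) s kd vd & k = (kL + kd)%N].
have [k0 [[g0 [s0 [kL [kd [vL [vd [A0 VL Vd Ek]]]]]]] kmin]] : exists k, T k /\ forall l, T l -> (k <= l)%N.
  apply: nat_min; have [a [f B]] := ball_ex imm.
  have Sf : Sc f by exists a; exact: B.
  have [g' [Sg' _ _ Af]] := T2_adm Sf Sf; have f0 := Sc0 Sf.
  have [_ s1 _] := Af.
  have [kL [vL VL]] := Vx_ex U_neq0 f0 s1.
  have [kd [vd Vd]] := Vx_ex Gd0 f0 s1.
  exists (kL + kd)%N; exists f, (ld (io g' / io f)), kL, kd, vL, vd.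
  by split; [exact: Af|exact: VL|exact: Vd|].
have [g00 s01 _] := A0; have ig0 : io g0 != 0 by rewrite fmorph_eq0.
have vL0 : vL != 0 by case: VL.
have vd0 : vd != 0 by case: Vd.
(* A smaller [s] can only lower each vertex weight, so by minimality both stay fixed and the vertex
   values scale exactly with exponents 1 and [d]. *)
have claim g s : Adm g s -> dm s s0 ->
  Vx (hp 1 G) (io g) s kL (vL * (io g / io g0)) /\ Vx (hp d G) (io g) s kd (vd * (io g / io g0) ^+ d).
  move=> A ss; have [gn0 s1 [g1 Sg1 h1]] := A; have [_ _ [g1' Sg1' h1']] := A0.
  have ig : io g != 0 by rewrite fmorph_eq0.
  have h0 : io g / io g0 != 0 by rewrite mulf_neq0 ?invr_eq0.
  have hh : dm (ld (io g / io g0)) s0.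
    have [g2 Sg2 [l1 l2]] := Sc_min Sg1 Sg1'.
    apply: (ld_div3 (Sc0 Sg2) ig ig0); last exact: h1' l2.
    by apply: dm_trans ss; exact: h1 l1.
  have EL := Vx_inv (@hG 1) ig0 h0 s01 hh VL; have Ed := Vx_inv (@hG d) ig0 h0 s01 hh Vd.
  rewrite (mulKdiv _ ig0) in EL; rewrite (mulKdiv _ ig0) in Ed; rewrite expr1 in EL.
  have [kL' [vL' VL']] := Vx_ex U_neq0 ig s1.
  have [kd' [vd' Vd']] := Vx_ex Gd0 ig s1.
  have lL := Vx_dec s1 ss EL VL'; have ld' := Vx_dec s1 ss Ed Vd'.
  have km : (kL + kd <= kL' + kd')%N.
    rewrite -Ek; apply: kmin; exists g, s, kL', kd', vL', vd'.
    by split; [exact: A|exact: VL'|exact: Vd'|].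
  have eL : kL' = kL by apply/eqP; rewrite eqn_leq lL /= -(leq_add2r kd) (leq_trans km) // leq_add2l.
  have ed' : kd' = kd by apply/eqP; rewrite eqn_leq ld' /= -(leq_add2l kL) (leq_trans km) // leq_add2r.
  rewrite eL in VL'; rewrite ed' in Vd'; split.
    by apply: (Vx_asy _ VL'); rewrite asy_sym; exact: (Vx_same s01 s1 EL VL').
  by apply: (Vx_asy _ Vd'); rewrite asy_sym; exact: (Vx_same s01 s1 Ed Vd').
have [l l0 hl] := Vx_F (ltnSn 0) g00 VL; have [m m0 hm] := Vx_F d0 g00 Vd.
(* [fs] is the balancing scale. It can be taken in [F] because [vL] and [vd] have sizes from [F] and
   the value group is divisible. *)
have [|fs fs0 hfs] := @divF (l / m * g0 ^+ e.+1) e.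
  by rewrite !mulf_neq0 ?invr_eq0 ?expf_neq0.
have ifs : io fs != 0 by rewrite fmorph_eq0.
have hA : asy (io fs ^+ e.+1) (vL / vd * io g0 ^+ e.+1).
  apply: (asy_trans hfs); rewrite rmorphM fmorph_div rmorphXn asy_sym.
  apply: asyM; last exact: asyxx.
  by apply: asyM; [exact: hl|exact: asyV].
have i1 g s : Sc g -> Adm g s -> dm s s0 -> dm ((io fs / io g) ^+ e.+1) (s ^+ (n * d)).
  move=> Sg A ss; have [VLg Vdg] := claim g s A ss; have [_ s1 _] := A; have gn := Sc0 Sg.
  apply: (equalize_le vL0 vd0 ig0 gn hA); rewrite -ed.
  apply: (dm_trans (proj1 (Vx_nm (@hG 1) gn s1 VLg))); apply: (dm_trans (UW Sg)).
  exact: (proj2 (Vx_nm (@hG d) gn s1 Vdg)).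
have i2 g s sf : Sc g -> Adm g s -> dm s s0 -> sd (W d g) (W 1 g * sf ^+ (2 * n * d)) ->
    dm ((io g / io fs) ^+ e.+1) (s ^+ n * sf ^+ (2 * n * d)).
  move=> Sg A ss hW; have [VLg Vdg] := claim g s A ss; have [_ s1 _] := A; have gn := Sc0 Sg.
  apply: (equalize_ge ifs vL0 vd0 ig0 gn hA); rewrite -ed.
  apply: (dm_trans (proj1 (Vx_nm (@hG d) gn s1 Vdg))); apply: (dm_trans (sdW hW)).
  rewrite mulrA; apply: dmM; last exact: dmxx.
  by have := proj2 (Vx_nm (@hG 1) gn s1 VLg); rewrite muln1.
(* Close to the cut, [g / fs] lies between powers of [s0]. So its logarithmic derivative is bounded
   by [s0] and can itself take the role of [s]. *)
have [gi Sgi stepi] : exists2 g1, Sc g1 & forall g, Sc g -> dm (io g) (io g1) -> dm (ld (io g / io fs)) s0.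
  have [ga Sga sta] := star g00; have [_ _ [gb Sgb hb]] := A0.
  have [g1 Sg1 [l1 l2]] := Sc_min Sga Sgb; exists g1; first exact: Sg1.
  move=> g Sg gg1; have gn := Sc0 Sg.
  have hg0 : dm (ld (io g / io g0)) s0 by apply: hb; [exact: Sg|exact: dm_trans gg1 l2].
  have A : Adm g s0 := Adm_shift A0 gn hg0.
  have j1 := i1 g s0 Sg A (dmxx _).
  have hW : sd (W d g) (W 1 g * s0 ^+ (2 * n * d)).
    by apply: sta; [exact: Sg|exact: dm_trans gg1 l1|exact: s01|exact: hg0].
  have j2 := i2 g s0 s0 Sg A (dmxx _) hW; rewrite -exprD in j2.
  have x0 : io g / io fs != 0 by rewrite mulf_neq0 ?invr_eq0.
  apply: (@ld_between (io g / io fs) s0 e (n * d + (n + 2 * n * d)) x0 s01).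
    by apply: (dm_trans j2); apply: dm_X2 => //; apply: leq_addl.
  by rewrite invf_div; apply: (dm_trans j1); apply: dm_X2 => //; apply: leq_addr.
(* If some radius is below [fs], then [UW] bounds [fs / g3] by a power of its own logarithmic
   derivative. *)
have [[gs Sgs gfs]|noA] := pselect (exists2 g, Sc g & sd (io g) (io fs)).
  have Sfs : Sc fs by apply: (Sc_up Sgs fs0); exact: sdW.
  have [g3 [Sg3 l3 g3f A3]] := T2_adm Sfs Sgi.
  have gn := Sc0 Sg3.
  have ss := stepi g3 Sg3 l3.
  have Ag3 := Adm_shift A3 gn (dmxx _).
  have j1 := i1 g3 _ Sg3 Ag3 ss.
  have x0 : io fs / io g3 != 0 by rewrite mulf_neq0 ?invr_eq0.
  have x1 : sd 1 (io fs / io g3) by rewrite (sd1_div _ gn).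
  apply: (@sd_contra (io fs / io g3) e (n * d) x1); apply: (dm_trans j1).
  apply: dmX; rewrite -(invf_div (io fs)) (ldV x0) dmN; exact: dmxx.
(* If [fs] is below all radii, [star] at [fs] gives the same absurdity for [g / fs]. *)
have [gf Sgf stf] := star fs0.
have [g Sg [l1 l2]] := Sc_min Sgf Sgi; have gn := Sc0 Sg.
have big g' : Sc g' -> sd (io fs) (io g').
  move=> Sg'; have [g'' Sg'' h] := Sc_smaller imm resF Sg'.
  apply: (dm_sd_trans _ h); apply/negPn/negP => h'; apply: noA; exists g''; [exact: Sg''|exact: h'].
have x1 : sd 1 (io g / io fs) by rewrite (sd1_div _ ifs); exact: big.
have ss := stepi g Sg l2.
have s1 : dm 1 (ld (io g / io fs)) := sdW (proj1 (ld_inf x1)).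
have As : Adm fs (ld (io g / io fs)).
  split; [exact: fs0|exact: s1|]; exists g; first exact: Sg.
  move=> g2 Sg2 h; apply: ld_mono; first by rewrite (sd1_div _ ifs); exact: big.
  have fi0 : (io fs)^-1 != 0 by rewrite invr_eq0.
  by rewrite (dm_pM2r _ _ fi0).
have Ag := Adm_shift As gn (dmxx _).
have hW := stf g Sg l1 _ s1 (dmxx _).
have j2 := i2 g _ _ Sg Ag ss hW; rewrite -exprD in j2.
exact: (sd_contra x1 j2).
Qed.

End T2.

(** The dichotomy is whether, relative to some radius [f], every radius has another one below its
    cube. If so, the degrees separate along the cut; if not, the logarithmic derivatives of small
    ratios are under common control. *)
Lemma DHC_false : False.
Proof.
have [[f [Sf T1]]|noT1] := pselect (exists f, Sc f /\
  forall g, Sc g -> exists2 g2, Sc g2 & dm (io g2 / io f) ((io g / io f) ^+ 3)).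
  exact: (T1_false Sf T1).
apply: T2_false => f Sf; apply: contrapT => no; apply: noT1; exists f; split; first exact: Sf.
move=> g Sg; apply: contrapT => no'; apply: no; exists g; first exact: Sg.
move=> g2 Sg2; apply/negP => h; apply: no'; exists g2; [exact: Sg2|exact: h].
Qed.

End DHC.

Section DHCTheorem.

Variables (F : fieldType) (dF : F -> F) (K : dhlField) (io : {rmorphism F -> K}).
Hypothesis iod : forall x, io (dF x) = dd (io x).
Variable b : K.
Hypothesis imm : forall a, exists2 f, f != 0 & asy (b - io a) (io f).
Hypothesis resF : forall u, dm u 1 -> exists x, sd (u - io x) 1.
Hypothesis divF : forall (f : F) k, f != 0 -> exists2 f' : F, f' != 0 & asy (io f' ^+ k.+1) (io f).

Theorem minimal_quasilinear n (P : {mpoly F[n]}) : P != 0 -> ~ st dF io b P ->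
  (forall w, dird dF w P != 0 -> st dF io b (dird dF w P)) ->
  (forall g (t : 'X_{1..n}), g != 0 -> t != 0%MM ->
    cj dF 0 g^-1 (cj dF 0 g P)^`M[t] != 0 -> st dF io b (cj dF 0 g^-1 (cj dF 0 g P)^`M[t])) ->
  exists a g, ball io b a g /\ ql (map_mpoly io (cj dF a g P)).
Proof.
move=> P0 nst h1 h2; apply: contrapT => no.
have nql a g : ball io b a g -> ~~ ql (map_mpoly io (cj dF a g P)).
  by move=> B; apply/negP => q; apply: no; exists a, g; split; [exact: B|exact: q].
have [d [d1 Gd0 UW]] := deg_ex iod imm P0 nst nql (erefl _).
exact: (DHC_false iod imm resF divF h1 h2 (erefl _) d1 Gd0 UW).
Qed.

End DHCTheorem.

(** * Reduction of differential terms *)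

(** The type of variables is arbitrary, so that parameters from a field, unknowns and variables of
    the lift can be combined by sum and option types. *)
Inductive dterm (X : Type) : Type :=
| DVar (x : X)
| DZero | DOne
| DOpp (t : dterm X)
| DDer (t : dterm X)
| DAdd (t s : dterm X)
| DMul (t s : dterm X).
Arguments DZero {X}.
Arguments DOne {X}.

Fixpoint dev (X : Type) (M : dhlField) (v : X -> M) (t : dterm X) : M :=
  match t with
  | DVar x => v x
  | DZero => 0
  | DOne => 1
  | DOpp t => - dev v t
  | DDer t => dd (dev v t)
  | DAdd t s => dev v t + dev v s
  | DMul t s => dev v t * dev v s
  end.

Definition asn (F : Type) (M : dhlField) (j : F -> M) (y : M) (o : option F) : M :=
  if o is Some c then j c else y.

Section OrderInd.

Variables (R : comNzRingType) (n : nat).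
Implicit Types P Q : {mpoly R[n]}.

(* [Lf (tl o)] is the degree in the variables of order at least [o], so
   [SL (tl o) 0 P] says that [P] has order less than [o]. *)
Definition tl (o i : nat) : nat := (o <= i)%N.
Notation tlS o := (fun i => tl o i).

Lemma tl_homo o : {homo (tl o) : i j / (i <= j)%N}.
Proof.
move=> i j ij; rewrite /tl; case: (leqP o i) => // oi.
by rewrite (leq_trans oi ij).
Qed.

Lemma tl_split o (m : 'X_{1..n}) (i : 'I_n) : i = o :> nat -> Lf (tl o) m = (m i + Lf (tl o.+1) m)%N.
Proof.
move=> io; rewrite /Lf (bigD1 i) //= [in RHS](bigD1 i) //= /tl io leqnn mul1n ltnn mul0n add0n.
congr (_ + _)%N; apply: eq_bigr => j ji; congr (_ * _)%N.
by rewrite leq_eqVlt -io (inj_eq val_inj) eq_sym (negPf ji).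
Qed.

Lemma tl_mono o o' (m : 'X_{1..n}) : (o <= o')%N -> (Lf (tl o') m <= Lf (tl o) m)%N.
Proof.
move=> oo; apply: Lf_le => i; rewrite /tl; case: (leqP o' i) => // h.
by rewrite (leq_trans oo h).
Qed.

Lemma ord_ind o (T : {mpoly R[n]} -> Prop) :
  (forall c, T c%:MP) -> (forall i : 'I_n, (i < o)%N -> T 'X_i) ->
  (forall P Q, T P -> T Q -> T (P + Q)) ->
  (forall P Q, T P -> T Q -> T (P * Q)) -> forall P, SL (tl o) 0 P -> T P.
Proof.
move=> TC TX TD TM P hP; rewrite (mpolyE P) big_seq; apply: (big_ind T) => //.
  by rewrite -mpolyC0.
move=> m mP; rewrite -mul_mpolyC; apply: (TM) => //.
have hm : (Lf (tl o) m <= 0)%N by apply: hP; rewrite -mcoeff_msupp.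
rewrite mpolyXE_id; apply: (big_ind T) => //; first by rewrite -mpolyC1.
move=> i _; have [io|oi] := ltnP i o; last first.
  have -> : m i = 0%N.
    move: hm; rewrite leqn0 /Lf sum_nat_eq0 => /forallP/(_ i).
    by rewrite implyTb /tl oi mul1n => /eqP.
  by rewrite expr0 -mpolyC1.
move: (m i) => e; elim: e => [|k IH]; first by rewrite expr0 -mpolyC1.
by rewrite exprS; apply: (TM) => //; apply: TX.
Qed.

Lemma SL_mderivm c B P (t : 'X_{1..n}) : SL c B P -> SL c (B - Lf c t) P^`M[t].
Proof.
move: {2}(mdeg t) (erefl (mdeg t)) => k; elim: k t P B => [|k IH] t P B h hP.
  by move/eqP: h; rewrite mdeg_eq0 => /eqP ->; rewrite mderivm0m Lf0 subn0.
have [i [t' [-> h']]] := mnm_split h.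
rewrite mderivmDm mderivmU1m LfD LfU subnDA; apply: SL_mderiv.
exact: IH.
Qed.

Lemma SL_dirv c B P (w : 'I_n -> R) : SL c B P -> SL c B (dirv w P).
Proof. by move=> hP; apply: SL_sum => i _; apply: SLZ; apply: SL_mderivW. Qed.

Lemma SL_dirv1 B P (w : 'I_n -> R) : SL (fun=> 1%N) B P -> SL (fun=> 1%N) (B - 1) (dirv w P).
Proof. by move=> hP; apply: SL_sum => i _; apply: SLZ; apply: SL_mderiv hP. Qed.

Lemma SLN c B P : SL c B P -> SL c B (- P).
Proof. by move=> hP; rewrite -scaleN1r; apply: SLZ. Qed.

(** [J] is the coefficient of the power [k.+1] of the leading variable, the initial if that power
    occurs. *)
Lemma top_dec o (i : 'I_n) k P : i = o :> nat -> SL (tl o.+1) 0 P -> SL (tl o) k.+1 P ->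
  exists J P', [/\ SL (tl o) 0 J, SL (tl o.+1) 0 P', SL (tl o) k P' & P = J * 'X_i ^+ k.+1 + P'].
Proof.
move=> io h0 h1.
have tlm m : P@_m != 0 -> Lf (tl o) m = m i /\ (m i <= k.+1)%N.
  move=> mP; have := h0 m mP; rewrite leqn0 => /eqP e.
  by have := h1 m mP; rewrite (tl_split m io) e addn0.
pose J := \sum_(m <- msupp P | m i == k.+1) P@_m *: 'X_[(m - U_(i) *+ k.+1)] : {mpoly R[n]}.
pose P' := \sum_(m <- msupp P | m i != k.+1) P@_m *: 'X_[m] : {mpoly R[n]}.
exists J, P'; split.
- rewrite /J big_seq_cond; apply: SL_sum => m /andP[mP /eqP hm]; apply: SLZ.
  move=> m'; rewrite mcoeffX; case: (_ =P m') => [<- _|_]; last by rewrite eqxx.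
  have mP' : P@_m != 0 by rewrite -mcoeff_msupp.
  have [e1 _] := tlm m mP'.
  have : (Lf (tl o) (m - U_(i) *+ k.+1 + U_(i) *+ k.+1)%MM <= k.+1)%N.
    have -> : (m - U_(i) *+ k.+1 + U_(i) *+ k.+1 = m)%MM.
      apply/mnmP => j; rewrite mnmDE mnmBE mulmnE mnm1E; case: eqP => [<-|_]; lia.
    by rewrite e1 hm.
  have -> : Lf (tl o) (m - U_(i) *+ k.+1 + U_(i) *+ k.+1)%MM = (Lf (tl o) (m - U_(i) *+ k.+1)%MM + k.+1)%N.
    rewrite LfD; congr (_ + _)%N.
    rewrite /Lf (bigD1 i) //= mulmnE mnm1E eqxx /tl io leqnn !mul1n big1 ?addn0 // => j ji.
    by rewrite mulmnE mnm1E eq_sym (negPf ji) mul0n muln0.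
  lia.
- rewrite /P' big_seq_cond; apply: SL_sum => m /andP[mP hm]; apply: SLZ.
  apply: (@SLW _ _ _ (Lf (tl o.+1) m)); [by apply: h0; rewrite -mcoeff_msupp|exact: SLX].
- rewrite /P' big_seq_cond; apply: SL_sum => m /andP[mP hm]; apply: SLZ.
  have mP' : P@_m != 0 by rewrite -mcoeff_msupp.
  have [e1 hk] := tlm m mP'.
  apply: (@SLW _ _ _ (Lf (tl o) m)); last exact: SLX.
  by rewrite e1 -ltnS ltn_neqAle hm.
- rewrite {1}(mpolyE P) (bigID (fun m : 'X_{1..n} => m i == k.+1)) /=; congr (_ + _).
  rewrite /J mulr_suml; apply: eq_bigr => m /eqP hm; rewrite -scalerAl; congr (_ *: _).
  rewrite mpolyXn -mpolyXD; congr 'X_[_]; apply/mnmP => j.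
  rewrite mnmDE mnmBE mulmnE mnm1E; case: eqP => [<-|_]; lia.
Qed.

(** Pseudo-division: multiplying [A] by [J] and subtracting a multiple of the divisor cancels the
    highest power of the leading variable. *)
Lemma pseudo_reduce o (i : 'I_n) e (J P' : {mpoly R[n]}) : i = o :> nat ->
  SL (tl o) 0 J -> SL (tl o.+1) 0 P' -> SL (tl o) e P' ->
  forall k A, SL (tl o.+1) 0 A -> SL (tl o) k A ->
  exists j Q B, [/\ SL (tl o.+1) 0 B, SL (tl o) e B & J ^+ j * A = Q * (J * 'X_i ^+ e.+1 + P') + B].
Proof.
move=> io hJ hP1 hP2; elim=> [|k IH] A hA1 hA2.
  by exists 0%N, 0, A; split=> //; [apply: SLW hA2|rewrite expr0 mul1r mul0r add0r].
have [ke|ek] := leqP k.+1 e.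
  by exists 0%N, 0, A; split=> //; [apply: SLW hA2|rewrite expr0 mul1r mul0r add0r].
have [J1 [A' [h1 h2 h3 EA]]] := top_dec io hA1 hA2.
have J1S (c : {mpoly R[n]}) : SL (tl o) 0 c -> SL (tl o.+1) 0 c.
  by move=> hc m /hc; rewrite !leqn0 => /eqP h; have := tl_mono m (leqnSn o); rewrite h leqn0.
have XS k' : SL (tl o) k' ('X_i ^+ k' : {mpoly R[n]}).
  apply: (@SLW _ _ _ (k' * Lf (tl o) U_(i)%MM)%N); last by apply: SL_exp; apply: SLX.
  by rewrite LfU /tl io leqnn muln1.
have XS1 k' : SL (tl o.+1) 0 ('X_i ^+ k' : {mpoly R[n]}).
  have -> : 0%N = (k' * Lf (tl o.+1) U_(i))%N by rewrite LfU /tl io ltnn muln0.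
  by apply: SL_exp; apply: SLX.
pose B1 := J * A' - J1 * 'X_i ^+ (k - e) * P'.
have B1a : SL (tl o.+1) 0 B1.
  apply: SLD; first by rewrite -[0%N]addn0; apply: SLM => //; apply: J1S.
  apply: SLN; rewrite -[0%N]addn0; apply: SLM => //; rewrite -[0%N]addn0; apply: SLM => //; exact: J1S.
have B1b : SL (tl o) k B1.
  apply: SLD; first by rewrite -[k]add0n; apply: SLM.
  apply: SLN; rewrite ltnS in ek; rewrite -{1}(subnK ek); apply: SLM => //.
  by rewrite -[X in SL _ X]add0n; apply: SLM.
have [j [Q [B [b1 b2 EB]]]] := IH B1 B1a B1b.
exists j.+1, (J ^+ j * J1 * 'X_i ^+ (k - e) + Q), B; split=> //.
have -> : J ^+ j.+1 * A = J ^+ j * B1 + J ^+ j * J1 * 'X_i ^+ (k - e) * (J * 'X_i ^+ e.+1 + P').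
  rewrite ltnS in ek; rewrite EA /B1 exprSr.
  have -> : 'X_i ^+ k.+1 = 'X_i ^+ (k - e) * 'X_i ^+ e.+1 :> {mpoly R[n]}.
    by rewrite -exprD addnS subnK.
  move: (J ^+ j) ('X_i ^+ (k - e)) ('X_i ^+ e.+1) => x y z; ring.
by rewrite EB; ring.
Qed.

End OrderInd.

(** The quotient rule with denominators cleared. The derivatives of [a] and of [a ^+ l * x] occur
    only multiplied by [a], the form in which [term_reduce] knows them. *)
Lemma dd_expM (M : dhlField) (a x : M) l :
  a ^+ l.+2 * dd x = a * dd (a ^+ l * x) * a - (a ^+ l * x * (a * dd a)) *+ l.
Proof.
have dX i : dd (a ^+ i) = a ^+ i.-1 * dd a *+ i.
  case: i => [|i]; first by rewrite expr0 dd1 mulr0n.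
  elim: i => [|i IHi]; first by rewrite expr1 expr0 mul1r mulr1n.
  by rewrite exprS ddM IHi /= mulrnAr mulrA -exprS [dd a * _]mulrC -mulrS.
rewrite ddM dX; move: (dd a) (dd x) => da dx; case: l => [|l] /=.
  by rewrite !mulr0n mul0r add0r subr0 expr0 mul1r; ring.
rewrite mulrnAl mulrDr mulrDl mulrnAr mulrnAl addrAC -mulrnBl !exprS; move: (a ^+ l) => p.
by rewrite (_ : _ - _ = 0) ?mul0rn ?add0r; ring.
Qed.

(** * Terms in one unknown as differential polynomials, and modulo a polynomial *)

Section TermPolynomials.

Variables (F : fieldType) (dF : F -> F).

(* Statements about differential polynomials over [F] are made in all
   differential extensions at once. *)
Definition dext (M : dhlField) (j : {rmorphism F -> M}) := forall x, j (dF x) = dd (j x).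

Definition pev (M : dhlField) (j : F -> M) n (P : {mpoly F[n]}) (y : M) : M :=
  (map_mpoly j P).@[jet (@dd M) y].

Section Ev.
Variables (M : dhlField) (j : {rmorphism F -> M}).
Hypothesis jd : dext j.
Variable n : nat.
Implicit Types (P Q : {mpoly F[n]}) (y : M).
Lemma pevC c y : pev j (c%:MP : {mpoly F[n]}) y = j c.
Proof. by rewrite /pev map_mpolyC mevalC. Qed.
Lemma pevX (i : 'I_n) y : pev j ('X_i : {mpoly F[n]}) y = iter i dd y.
Proof. by rewrite /pev map_mpolyX mevalXU. Qed.
Lemma pevD P Q y : pev j (P + Q) y = pev j P y + pev j Q y.
Proof. by rewrite /pev (rmorphD (map_mpoly j)) /= mevalD. Qed.
Lemma pevM P Q y : pev j (P * Q) y = pev j P y * pev j Q y.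
Proof. by rewrite /pev (rmorphM (map_mpoly j)) /= mevalM. Qed.
Lemma pevN P y : pev j (- P) y = - pev j P y.
Proof. by rewrite /pev (rmorphN (map_mpoly j)) /= mevalN. Qed.
Lemma pevXn P k y : pev j (P ^+ k) y = pev j P y ^+ k.
Proof.
elim: k => [|k IH]; last by rewrite !exprS pevM IH.
by rewrite !expr0 -mpolyC1 pevC rmorph1.
Qed.
Lemma pev0 y : pev j (0 : {mpoly F[n]}) y = 0.
Proof. by rewrite /pev (rmorph0 (map_mpoly j)) /= meval0. Qed.
End Ev.

Definition same_ev n n' (P : {mpoly F[n]}) (Q : {mpoly F[n']}) :=
  forall (M : dhlField) (j : {rmorphism F -> M}), dext j -> forall y, pev j P y = pev j Q y.

Lemma poly_widen n n' (P : {mpoly F[n]}) : (n <= n')%N -> exists Q : {mpoly F[n']}, same_ev P Q.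
Proof.
move=> nn; elim/mpoly_ringind: P => [c|i|P Q [P1 h1] [Q1 h2]|P Q [P1 h1] [Q1 h2]].
- by exists c%:MP => M j jd y; rewrite !pevC.
- by exists 'X_(widen_ord nn i) => M j jd y; rewrite !pevX.
- by exists (P1 + Q1) => M j jd y; rewrite !pevD h1 // h2.
- by exists (P1 * Q1) => M j jd y; rewrite !pevM h1 // h2.
Qed.

Lemma poly_der n (P : {mpoly F[n]}) : exists Q : {mpoly F[n.+1]},
  forall (M : dhlField) (j : {rmorphism F -> M}), dext j -> forall y, pev j Q y = dd (pev j P y).
Proof.
elim/mpoly_ringind: P => [c|i|P Q [P1 h1] [Q1 h2]|P Q [P1 h1] [Q1 h2]].
- by exists (dF c)%:MP => M j jd y; rewrite !pevC jd.
- by exists 'X_(lift ord0 i) => M j jd y; rewrite !pevX.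
- by exists (P1 + Q1) => M j jd y; rewrite !pevD h1 // h2 // ddD.
- have [P2 h3] := poly_widen P (leqnSn n); have [Q2 h4] := poly_widen Q (leqnSn n).
  exists (P1 * Q2 + P2 * Q1) => M j jd y.
  by rewrite pevD !pevM h1 // h2 // -h3 // -h4 // ddM.
Qed.

Lemma term_poly (t : dterm (option F)) : exists n (P : {mpoly F[n]}),
  forall (M : dhlField) (j : {rmorphism F -> M}), dext j -> forall y, dev (asn j y) t = pev j P y.
Proof.
elim: t => [[c|]|||t [n [P h]]|t [n [P h]]|t [n [P h]] s [n' [Q h']]|t [n [P h]] s [n' [Q h']]].
- by exists 0%N, c%:MP => M j jd y; rewrite pevC.
- by exists 1%N, 'X_ord0 => M j jd y; rewrite pevX.
- by exists 0%N, 0 => M j jd y; rewrite pev0.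
- by exists 0%N, 1 => M j jd y; rewrite -mpolyC1 pevC rmorph1.
- by exists n, (- P) => M j jd y; rewrite pevN /= h.
- have [Q hQ] := poly_der P.
  by exists n.+1, Q => M j jd y; rewrite hQ //= h.
- have [P1 h1] := poly_widen P (leq_maxl n n'); have [Q1 h2] := poly_widen Q (leq_maxr n n').
  by exists (maxn n n'), (P1 + Q1) => M j jd y; rewrite pevD /= h // h' // h1 // h2.
- have [P1 h1] := poly_widen P (leq_maxl n n'); have [Q1 h2] := poly_widen Q (leq_maxr n n').
  by exists (maxn n n'), (P1 * Q1) => M j jd y; rewrite pevM /= h // h' // h1 // h2.
Qed.

Section Reduction.
Variables (n o : nat) (io : 'I_n).
Hypothesis ioE : io = o :> nat.

(** The derivative of an expression of order [o] is linear in the next derivative of [y], with the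
    partial derivative in the leading variable as coefficient. *)
Lemma poly_der_top (P : {mpoly F[n]}) : SL (tl o.+1) 0 P -> exists2 Q : {mpoly F[n]}, SL (tl o.+1) 0 Q &
  forall (M : dhlField) (j : {rmorphism F -> M}), dext j -> forall y,
  dd (pev j P y) = pev j Q y + pev j P^`M(io) y * iter o.+1 dd y.
Proof.
move=> hP; suff [] : SL (tl o.+1) 0 P /\ exists2 Q : {mpoly F[n]}, SL (tl o.+1) 0 Q &
  forall (M : dhlField) (j : {rmorphism F -> M}), dext j -> forall y,
  dd (pev j P y) = pev j Q y + pev j P^`M(io) y * iter o.+1 dd y by [].
move: P hP; apply: ord_ind => [c|i ilt|P Q [sP [P1 s1 h1]] [sQ [Q1 s2 h2]]|P Q [sP [P1 s1 h1]] [sQ [Q1 s2 h2]]].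
- split; first exact: SLC.
  exists (dF c)%:MP; first exact: SLC.
  by move=> M j jd y; rewrite !pevC jd mderivC pev0 mul0r addr0.
- have sX (l : 'I_n) : (l < o.+1)%N -> SL (tl o.+1) 0 ('X_l : {mpoly F[n]}).
    move=> ll; apply: (@SLW _ _ _ (Lf (tl o.+1) U_(l)%MM)); last exact: SLX.
    by rewrite LfU /tl leqn0 eqb0 -leqNgt.
  split; first exact: sX.
  have [ei|ni] := eqVneq (i : nat) o.
    exists 0; first by move=> m; rewrite mcoeff0 eqxx.
    move=> M j jd y; have -> : i = io by apply: ord_inj; rewrite ei ioE.
    by rewrite mderivX mnm1E eqxx mnm_subxx mpolyX0 scale1r pev0 add0r -mpolyC1 pevC rmorph1 mul1r pevX ioE.
  have io1 : (i.+1 < o.+1)%N by rewrite ltnS ltn_neqAle ni -ltnS.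
  have i1n : (i.+1 < n)%N by apply: leq_trans io1 _; rewrite -ioE.
  exists 'X_(Ordinal i1n); first exact: sX.
  move=> M j jd y; rewrite mderivX mnm1E (_ : (i == io) = false); last first.
    by apply: contraNF ni => /eqP ->; rewrite ioE.
  by rewrite scale0r pev0 mul0r addr0 !pevX.
- split; first exact: SLD.
  exists (P1 + Q1); first exact: SLD.
  by move=> M j jd y; rewrite mderivD !pevD ddD (h1 M j jd y) (h2 M j jd y) mulrDl addrACA.
- split; first by rewrite -[0%N]addn0; apply: SLM.
  exists (P1 * Q + P * Q1).
    by apply: SLD; rewrite -[0%N]addn0; apply: SLM.
  move=> M j jd y; rewrite mderivM !pevD !pevM ddM (h1 M j jd y) (h2 M j jd y).
  have rl (a1 a2 q p q1 q2 u : M) :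
    (a1 + a2 * u) * q + p * (q1 + q2 * u) = a1 * q + p * q1 + (a2 * q + p * q2) * u by ring.
  exact: rl.
Qed.

Variables (P E : {mpoly F[n]}).
Hypothesis hP : SL (tl o.+1) 0 P.
Hypothesis hE : SL (tl o.+1) 0 E.
Variable I : {mpoly F[n]}.
Hypothesis hI : SL (tl o.+1) 0 I.
Hypothesis EIS : E = I * P^`M(io).

Definition goodroot (M : dhlField) (j : F -> M) (y : M) := pev j P y = 0 /\ pev j E y != 0.

(** At a zero of [P], differentiating [P(y) = 0] expresses the separant times the derivative of
    order [o.+1] through lower ones. As [E] is a multiple of the separant, each derivation costs two
    factors [E] and the order stays at most [o]. *)
Lemma term_reduce (t : dterm (option F)) : exists k (A : {mpoly F[n]}), SL (tl o.+1) 0 A /\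
  forall (M : dhlField) (j : {rmorphism F -> M}), dext j -> forall y, goodroot j y ->
  pev j E y ^+ k * dev (asn j y) t = pev j A y.
Proof.
have sE k : SL (tl o.+1) 0 (E ^+ k) by rewrite -[0%N](muln0 k); apply: SL_exp.
have sM (A B : {mpoly F[n]}) : SL (tl o.+1) 0 A -> SL (tl o.+1) 0 B -> SL (tl o.+1) 0 (A * B).
  by move=> h1 h2; rewrite -[0%N]addn0; apply: SLM.
elim: t => [[c|]|||t [k [A [sA h]]]|t [k [A [sA h]]]|t [k [A [sA h]]] s [k' [A' [sA' h']]]|t [k [A [sA h]]] s [k' [A' [sA' h']]]].
- by exists 0%N, c%:MP; split; [exact: SLC|move=> M j jd y _; rewrite expr0 mul1r pevC].
- have n0 : (0 < n)%N by apply: leq_ltn_trans (ltn_ord io).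
  exists 0%N, 'X_(Ordinal n0); split; last by move=> M j jd y _; rewrite expr0 mul1r pevX.
  by apply: (@SLW _ _ _ (Lf (tl o.+1) U_(Ordinal n0)%MM)); [rewrite LfU /tl|exact: SLX].
- by exists 0%N, 0; split; [move=> m; rewrite mcoeff0 eqxx|move=> M j jd y _; rewrite mulr0 pev0].
- by exists 0%N, 1; split; [rewrite -mpolyC1; exact: SLC|move=> M j jd y _; rewrite expr0 mul1r -mpolyC1 pevC rmorph1].
- by exists k, (- A); split; [exact: SLN|move=> M j jd y gr; rewrite pevN /= mulrN h].
- have [A1 sA1 hA1] := poly_der_top sA; have [P1 sP1 hP1] := poly_der_top hP.
  have [E1 sE1 hE1] := poly_der_top hE.
  have sd1 (Q : {mpoly F[n]}) : SL (tl o.+1) 0 Q -> SL (tl o.+1) 0 Q^`M(io) by apply: SL_mderivW.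
  (* [X] and [Y] evaluate to [E] times the derivatives of [A] and of [E]; in both, [E] times the
     derivative of order [o.+1] is replaced by [- I * P1]. *)
  pose X := A1 * E - A^`M(io) * (P1 * I).
  pose Y := E1 * E - E^`M(io) * (P1 * I).
  exists k.+2, (X * E - A * Y *+ k); split.
    have sX : SL (tl o.+1) 0 X by apply: SLD; [apply: sM|apply: SLN; apply: (sM) => //; [apply: sd1|apply: sM]].
    have sY : SL (tl o.+1) 0 Y by apply: SLD; [apply: sM|apply: SLN; apply: (sM) => //; [apply: sd1|apply: sM]].
    apply: SLD; first exact: sM.
    apply: SLN; rewrite -scaler_nat; apply: SLZ; exact: sM.
  move=> M j jd y gr; have ht := h M j jd y gr; case: gr => Py Ey.
  have dE := hE1 M j jd y; have dA := hA1 M j jd y; have dP := hP1 M j jd y.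
  rewrite Py dd0 in dP.
  have EIy : pev j E y = pev j I y * pev j P^`M(io) y by rewrite -pevM -EIS.
  set u := iter o.+1 dd y in dE dA dP.
  have rl (a1 p s u' a2 c : M) : a1 * (c * s) - a2 * (- (s * u') * c) = c * s * (a1 + a2 * u') by ring.
  have Xy : pev j X y = pev j E y * dd (pev j A y).
    rewrite dA /X pevD pevN !pevM.
    have -> : pev j P1 y = - (pev j P^`M(io) y * u) by apply/eqP; rewrite -addr_eq0 -dP.
    by rewrite EIy; exact: (rl _ 0).
  have Yy : pev j Y y = pev j E y * dd (pev j E y).
    rewrite dE /Y pevD pevN !pevM.
    have -> : pev j P1 y = - (pev j P^`M(io) y * u) by apply/eqP; rewrite -addr_eq0 -dP.
    by rewrite EIy; exact: (rl _ 0).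
  rewrite pevD pevN pevM.
  have -> : pev j (A * Y *+ k) y = (pev j A y * pev j Y y) *+ k.
    by rewrite -pevM; elim: (k) => [|l IHl]; rewrite ?mulr0n ?pev0 // !mulrSr pevD IHl.
  rewrite Xy Yy -ht /=.
  exact: dd_expM.
- exists (k + k')%N, (A * E ^+ k' + A' * E ^+ k); split; first by apply: SLD; apply: sM.
  move=> M j jd y gr.
  have rl (p q a b : M) : p * q * (a + b) = p * a * q + q * b * p by ring.
  rewrite pevD !pevM !pevXn -(h M j jd y gr) -(h' M j jd y gr) /= exprD.
  exact: rl.
- exists (k + k')%N, (A * A'); split; first exact: sM.
  move=> M j jd y gr.
  have rl (p q a b : M) : p * q * (a * b) = p * a * (q * b) by ring.
  rewrite pevM -(h M j jd y gr) -(h' M j jd y gr) /= exprD.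
  exact: rl.
Qed.

End Reduction.
End TermPolynomials.

(** * Elements of immediate cuts *)

Lemma SL_bnd (R : comNzRingType) n c (Q : {mpoly R[n]}) : exists B, SL c B Q.
Proof.
exists (\max_(m <- msupp Q) Lf c m) => m; rewrite -mcoeff_msupp => mQ.
by rewrite (big_rem m) //= leq_maxl.
Qed.

Lemma eqvV (K : dhlField) (f g : K) : eqv f g -> eqv f^-1 g^-1.
Proof.
move=> h; have g0 : g != 0 by apply: sd_neq0 h.
have f0 : f != 0 by rewrite (asy_eq0 (eqv_asy h)).
rewrite /eqv -(sd_pM2r _ _ (mulf_neq0 f0 g0)) mulrBl mulKf // [f * g]mulrC mulKf //.
by rewrite -sdN opprB (asy_sdr _ (eqv_asy h)).
Qed.

Section TermMatch.

Variables (F : fieldType) (K Ks : dhlField) (io : F -> K) (js : F -> Ks).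

(** The copy [bs] may depend on the terms; their signs and dominance relations decide every
    quantifier-free formula built from them. *)
Definition tmatch (b : K) := forall n (ts : 'I_n -> dterm (option F)), exists bs : Ks,
  (forall i, (0 < dev (asn io b) (ts i)) = (0 < dev (asn js bs) (ts i))) /\
  (forall i j, dm (dev (asn io b) (ts i)) (dev (asn io b) (ts j)) =
               dm (dev (asn js bs) (ts i)) (dev (asn js bs) (ts j))).

End TermMatch.

Section Sim.

Variables (F : fieldType) (K Ks : dhlField) (io : {rmorphism F -> K}) (js : {rmorphism F -> Ks}).
Hypothesis posE : forall x, (0 < io x) = (0 < js x).
Hypothesis dmE : forall x y, dm (io x) (io y) = dm (js x) (js y).

(** A common leading term in [F], or common vanishing, fixes sign and size in either model. *)
Definition sim (x : K) (xs : Ks) := exists f, [/\ f = 0, x = 0 & xs = 0] \/ eqv x (io f) /\ eqv xs (js f).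

Lemma eqv_pos (M : dhlField) (x y : M) : eqv x y -> (0 < x) = (0 < y).
Proof. by move/eqv_sg => h; rewrite -sgr_gt0 h sgr_gt0. Qed.

Lemma sim_pos x xs : sim x xs -> (0 < x) = (0 < xs).
Proof.
move=> [f [[_ -> ->]|[h1 h2]]]; first by rewrite !ltxx.
by rewrite (eqv_pos h1) (eqv_pos h2).
Qed.

Lemma sim_asy x xs : sim x xs -> exists f, asy x (io f) /\ asy xs (js f).
Proof.
move=> [f [[_ -> ->]|[h1 h2]]]; last by exists f; split; apply: eqv_asy.
by exists 0; rewrite !rmorph0.
Qed.

Lemma sim_dm x xs y ys : sim x xs -> sim y ys -> dm x y = dm xs ys.
Proof.
move=> /sim_asy[f [h1 h2]] /sim_asy[g [h3 h4]].
by rewrite (asy_dml _ h1) (asy_dmr _ h3) (asy_dml _ h2) (asy_dmr _ h4).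
Qed.

Lemma sim_div c cs x xs f : eqv c (io f) -> eqv cs (js f) -> sim (c * x) (cs * xs) -> sim x xs.
Proof.
move=> hc hcs [h H].
have f0 : f != 0 by rewrite -(fmorph_eq0 io); apply: sd_neq0 hc.
have c0 : c != 0 by rewrite (asy_eq0 (eqv_asy hc)) fmorph_eq0.
have cs0 : cs != 0 by rewrite (asy_eq0 (eqv_asy hcs)) fmorph_eq0.
exists (f^-1 * h); case: H => [[-> e1 e2]|[e1 e2]]; [left|right].
  split; first by rewrite mulr0.
    by apply/eqP; move/eqP: e1; rewrite mulf_eq0 (negPf c0).
  by apply/eqP; move/eqP: e2; rewrite mulf_eq0 (negPf cs0).
rewrite !rmorphM !fmorphV; split.
  by rewrite -[x](mulKf c0); apply: eqvM => //; apply: eqvV.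
by rewrite -[xs](mulKf cs0); apply: eqvM => //; apply: eqvV.
Qed.

Lemma sim_match b bs n (ts : 'I_n -> dterm (option F)) :
  (forall i, sim (dev (asn io b) (ts i)) (dev (asn js bs) (ts i))) ->
  (forall i, (0 < dev (asn io b) (ts i)) = (0 < dev (asn js bs) (ts i))) /\
  (forall i j, dm (dev (asn io b) (ts i)) (dev (asn io b) (ts j)) =
               dm (dev (asn js bs) (ts i)) (dev (asn js bs) (ts j))).
Proof. by move=> h; split=> [i|i j]; [apply: sim_pos|apply: sim_dm]. Qed.

(** Norms are chosen elements of each field, so the condition is restated by comparisons of
    coefficients, which any embedding preserving dominance transports. The next two lemmas serve the
    same end. *)
Lemma settledAtP (M : dhlField) n (P : {mpoly M[n]}) :
  settledAt P <-> P@_0 != 0 /\ forall m : 'X_{1..n}, m != 0%MM -> sd P@_m P@_0.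
Proof.
split=> [h|[h0 h]].
  split; first exact: sd_neq0 h.
  move=> m m0; apply: dm_sd_trans h.
  by have := nm_ge (nc P) m; rewrite nc_coef (negPf m0).
by apply: nm_lt => m; rewrite nc_coef; case: eqP => [_|/eqP /h //]; rewrite /sd dmx0.
Qed.

Lemma qlP (M : dhlField) n (P : {mpoly M[n]}) :
  ql P <-> exists2 i, P@_U_(i) != 0 & forall m : 'X_{1..n}, (1 < mdeg m)%N -> sd P@_m P@_U_(i).
Proof.
split=> [h|[i h0 h]].
  have h0 := ql_neq0 h; have [i e] := hp1_at h0; exists i; first by rewrite e.
  move=> m hm; rewrite e; apply: dm_sd_trans h.
  by have := nm_ge (hi P) m; rewrite hi_coef hm.
apply: sd_dm_trans (nm_hp1_ge P i).
by apply: nm_lt => m; rewrite hi_coef; case: ifP => [/h //|_]; rewrite /sd dmx0.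
Qed.

Lemma lin_domP (M : dhlField) n (P : {mpoly M[n]}) : ql P ->
  dm P@_0 (nm (hp 1 P)) <-> exists i, dm P@_0 P@_U_(i).
Proof.
move=> q; split=> [h|[i h]]; last exact: dm_trans h (nm_hp1_ge P i).
by have [i e] := hp1_at (ql_neq0 q); exists i; rewrite e.
Qed.

Lemma sdE x y : sd (io x) (io y) = sd (js x) (js y).
Proof. by rewrite /sd dmE. Qed.

Variable n : nat.
Implicit Types P : {mpoly F[n]}.

Lemma settledAt_transfer P : settledAt (map_mpoly io P) -> settledAt (map_mpoly js P).
Proof.
move=> /settledAtP[h0 h]; apply/settledAtP; split.
  by move: h0; rewrite !mcoeff_map_mpoly !fmorph_eq0.
by move=> m /h; rewrite !mcoeff_map_mpoly sdE.
Qed.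

Lemma ql_transfer P : ql (map_mpoly io P) -> ql (map_mpoly js P).
Proof.
move=> /qlP[i h0 h]; apply/qlP; exists i.
  by move: h0; rewrite !mcoeff_map_mpoly !fmorph_eq0.
by move=> m /h; rewrite !mcoeff_map_mpoly sdE.
Qed.

Lemma lin_dom_transfer P : ql (map_mpoly io P) ->
  dm (map_mpoly io P)@_0 (nm (hp 1 (map_mpoly io P))) ->
  dm (map_mpoly js P)@_0 (nm (hp 1 (map_mpoly js P))).
Proof.
move=> q /(lin_domP q)[i h]; apply/(lin_domP (ql_transfer q)); exists i.
by move: h; rewrite !mcoeff_map_mpoly dmE.
Qed.

End Sim.

Lemma nc_split (M : dhlField) n (P : {mpoly M[n]}) : nc P = hp 1 P + hi P.
Proof.
apply/mpolyP => m; rewrite nc_coef mcoeffD hp_coef hi_coef -mdeg_eq0.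
by case: (mdeg m) => [|[|k]] /=; rewrite ?addr0 ?add0r.
Qed.

Lemma ql_unsettled (M : dhlField) n (P : {mpoly M[n]}) : ql P -> ~ settledAt P ->
  dm P@_0 (nm (hp 1 P)).
Proof.
move=> q ns; apply/negPn/negP => h; apply: ns.
rewrite /settledAt nc_split; apply: nmD_lt => //.
exact: sd_trans q h.
Qed.

(** * Adjoining an element of an immediate cut *)

Section Immediate.

Variables (F : fieldType) (dF : F -> F) (K Ks : dhlField).
Variables (io : {rmorphism F -> K}) (js : {rmorphism F -> Ks}).
Hypothesis iod : forall x, io (dF x) = dd (io x).
Hypothesis jsd : forall x, js (dF x) = dd (js x).
Hypothesis posE : forall x, (0 < io x) = (0 < js x).
Hypothesis dmE : forall x y, dm (io x) (io y) = dm (js x) (js y).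
Variable b : K.
Hypothesis imm : forall a, exists2 f, f != 0 & asy (b - io a) (io f).
Hypothesis resF : forall u, dm u 1 -> exists x, sd (u - io x) 1.
Hypothesis divF : forall (f : F) k, f != 0 -> exists2 f' : F, f' != 0 & asy (io f' ^+ k.+1) (io f).

Notation stb := (st dF io b).
Notation ballb := (ball io b).

(** The centre of a ball that settles all polynomials involved already behaves like [b], so the copy
    can be taken in the image of [F]. *)
Lemma all_settled_match :
  (forall r (P : {mpoly F[r.+1]}), P != 0 -> stb P) -> tmatch io js b.
Proof.
move=> H n ts; have [ns hns] := choice (fun i => term_poly dF (ts i)).
pose r := \max_(i < n) ns i.
have /choice[P hP] : forall i, exists P : {mpoly F[r.+1]},
    forall (M : dhlField) (j : {rmorphism F -> M}), dext dF j ->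
    forall y, dev (asn j y) (ts i) = pev j P y.
  move=> i; have [P0 h0] := hns i.
  have [|Q hQ] := @poly_widen F dF _ r.+1 P0.
    by apply: leqW; apply: (@leq_bigmax _ ns).
  by exists Q => M j jd y; rewrite h0 // hQ.
have [a0 [g0 B0]] := ball_ex imm.
have [|a [g [B gg st]]] := @st_common _ _ _ _ iod _ _ [seq P i | i <- enum 'I_n & P i != 0] _ _ B0.
  by move=> Q /mapP[i]; rewrite mem_filter => /andP[h _] ->; apply: H.
exists (js a); apply: (sim_match posE dmE) => i.
rewrite (hP i K io iod) (hP i Ks js jsd).
have [e|P0] := eqVneq (P i) 0.
  by exists 0; left; rewrite e !pev0.
exists (P i).@[jet dF a]; right.
have e : eqv (pev io (P i) b) (io (P i).@[jet dF a]).
  case: B => g00 h; apply: (settled_val iod g00 h); apply: st.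
  by apply/mapP; exists i => //; rewrite mem_filter P0 mem_enum.
split=> //; rewrite /pev -(map_meval _ _ jsd); apply: eqvxx.
by rewrite fmorph_eq0 -(fmorph_eq0 io); apply: sd_neq0 e.
Qed.

Section Unsettled.
Variable r : nat.
Implicit Types P Q : {mpoly F[r.+1]}.

Lemma const_settled P : SL (fun=> 1%N) 0 P -> P != 0 -> stb P.
Proof.
move=> h P0; have [a [g B]] := ball_ex imm; exists a, g; split=> //.
have e : P = (P@_0)%:MP.
  apply/mpolyP => m; rewrite mcoeffC; case: (m =P 0%MM) => [->|/eqP m0]; first by rewrite mulr1.
  rewrite mulr0; apply/eqP/negPn/negP => /h; rewrite Lf_mdeg leqn0 mdeg_eq0.
  by rewrite (negPf m0).
rewrite e /cj comp_mpolyC map_mpolyC; apply/settledAtP; rewrite mcoeffC eqxx mulr1.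
have c0 : io P@_0 != 0.
  by rewrite fmorph_eq0; apply: contraNneq P0 => c0; rewrite e c0 mpolyC0.
by split=> // m /negPf m0; rewrite mcoeffC m0 mulr0 /sd dmx0.
Qed.

(** Complexity is lexicographic: order, degree in the leading variable, total degree. None of the
    three minima is 0, since that would give a constant or a polynomial of lower order; hence the
    successors. *)
Lemma minimal_unsettled P : P != 0 -> ~ stb P ->
  exists o e D Q, [/\ Q != 0 /\ ~ stb Q, (o < r.+1)%N,
    [/\ SL (tl o.+1) 0 Q, SL (tl o) e.+1 Q & SL (fun=> 1%N) D.+1 Q],
    forall Q', Q' != 0 -> SL (tl o) 0 Q' -> stb Q' &
    (forall Q', Q' != 0 -> SL (tl o.+1) 0 Q' -> SL (tl o) e Q' -> stb Q') /\
    (forall Q', Q' != 0 -> SL (tl o.+1) 0 Q' -> SL (tl o) e.+1 Q' -> SL (fun=> 1%N) D Q' -> stb Q')].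
Proof.
move=> P0 nP.
have [|o1 [[P1 [P10 nP1 sP1]] mino]] :=
    @nat_min (fun o => exists Q, [/\ Q != 0, ~ stb Q & SL (tl o) 0 Q]).
  exists r.+1, P; split=> // m _; rewrite leqn0 /Lf big1 // => i _.
  by rewrite /tl leqNgt ltn_ord mul0n.
case: o1 sP1 mino => [|o] sP1 mino.
  by case: nP1; apply: const_settled.
have setO Q' : Q' != 0 -> SL (tl o) 0 Q' -> stb Q'.
  move=> h0 h; apply: contrapT => h'; have := mino o; rewrite ltnn => F'.
  by suff : false by []; apply: F'; exists Q'.
have or : (o < r.+1)%N.
  have := mino r.+1; apply; exists P; split=> // m _; rewrite leqn0 /Lf big1 // => i _.
  by rewrite /tl leqNgt ltn_ord mul0n.
have [|e1 [[P2 [P20 nP2 sP2 tP2]] mine]] :=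
    @nat_min (fun e => exists Q, [/\ Q != 0, ~ stb Q, SL (tl o.+1) 0 Q & SL (tl o) e Q]).
  by have [B hB] := SL_bnd (tl o) P1; exists B, P1.
case: e1 tP2 mine => [|e] tP2 mine; first by case: nP2; apply: setO.
have setE Q' : Q' != 0 -> SL (tl o.+1) 0 Q' -> SL (tl o) e Q' -> stb Q'.
  move=> h0 h1 h2; apply: contrapT => h'; have := mine e; rewrite ltnn => F'.
  by suff : false by []; apply: F'; exists Q'.
have [|D1 [[P3 [[P30 nP3 sP3] tP3 uP3]] minD]] :=
    @nat_min (fun D => exists Q, [/\ [/\ Q != 0, ~ stb Q & SL (tl o.+1) 0 Q], SL (tl o) e.+1 Q & SL (fun=> 1%N) D Q]).
  by have [B hB] := SL_bnd (fun=> 1%N) P2; exists B, P2.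
case: D1 uP3 minD => [|D] uP3 minD; first by case: nP3; apply: const_settled.
exists o, e, D, P3; split=> //; split=> // Q' h0 h1 h2 h3.
apply: contrapT => h'; have := minD D; rewrite ltnn => F'.
by suff : false by []; apply: F'; exists Q'.
Qed.

Variables (P : {mpoly F[r.+1]}) (a : F) (g : F).
Hypothesis nP : ~ stb P.
Hypothesis Bag : ballb a g.
Hypothesis qP : ql (map_mpoly io (cj dF a g P)).

Lemma ql_smaller a' g' : ballb a' g' -> dm (io g') (io g) ->
  ql (map_mpoly io (cj dF a' g' P)) /\
  dm (map_mpoly io (cj dF a' g' P))@_0 (nm (hp 1 (map_mpoly io (cj dF a' g' P)))).
Proof.
move=> B gg; have g0 : io g != 0 by rewrite fmorph_eq0; case: Bag.
have g0' : io g' != 0 by rewrite fmorph_eq0; case: B.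
have q : ql (map_mpoly io (cj dF a' g' P)).
  rewrite (cj_recenter iod a a' g' P (proj1 Bag)); apply: ql_cj => //.
  - by rewrite dm_div1 //; apply: ball_dist Bag B gg.
  - by rewrite dm_div1.
  - by rewrite mulf_neq0 ?invr_eq0.
split=> //; apply: ql_unsettled => // s.
by apply: nP; exists a', g'.
Qed.

Lemma root_in_ball (M : dhlField) (j : {rmorphism F -> M}) a' g' : dext dF j -> g' != 0 ->
  ql (map_mpoly j (cj dF a' g' P)) ->
  dm (map_mpoly j (cj dF a' g' P))@_0 (nm (hp 1 (map_mpoly j (cj dF a' g' P)))) ->
  exists2 y, dm (y - j a') (j g') & pev j P y = 0.
Proof.
move=> jd g0 q c; have [z z1 hz] := root_ball q c.
exists (j a' + j g' * z).
  rewrite addrAC subrr add0r -[X in dm _ X]mulr1; exact: dmM.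
rewrite -hz (mp_cj jd) (cj_eval (@ddP M)) //.
Qed.

Lemma cut_root : exists2 bt, pev io P bt = 0 &
  forall a' g', ballb a' g' -> dm (io g') (io g) -> dm (bt - io a') (io g').
Proof.
have g0 : io g != 0 by rewrite fmorph_eq0; case: Bag.
have [||||bt hbt e] := @root_cut K r (map_mpoly io P) b (io g)
  (fun y => exists a' g', [/\ ballb a' g', dm (io g') (io g) & y = io g']).
- exact: g0.
- by exists a, g; split=> //; exact: dmxx.
- have := cj_recenterb iod b a (io g) P (proj1 Bag).
  rewrite (divff g0) => ->; apply: ql_shift; last exact: qP.
  by rewrite (dm_div1 _ g0); case: Bag.
- move=> _ [a' [g' [B gg ->]]]; have [q c] := ql_smaller B gg.
  have [y h1 h2] := root_in_ball iod (proj1 B) q c; exists y => //.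
  have -> : y - b = (y - io a') - (b - io a') by rewrite opprB addrA subrK.
  by apply: dmB => //; case: B.
exists bt => // a' g' B gg.
have -> : bt - io a' = (bt - b) + (b - io a') by rewrite addrA subrK.
apply: dmD; last by case: B.
by apply: hbt; exists a', g'.
Qed.

End Unsettled.

Theorem immediate_step : exists2 b', (forall x, b' != io x) & tmatch io js b'.
Proof.
have [H|] := pselect (forall r (P : {mpoly F[r.+1]}), P != 0 -> stb P).
  exists b; last exact: all_settled_match.
  by move=> x; rewrite -subr_eq0; apply: b_neq.
move=> /existsNP[r /existsNP[P1 /not_implyP[P10 nP1]]].
have [o [e [D [P [[P0 nP] or [s1 s2 s3] setO [setE setD]]]]]] := minimal_unsettled P10 nP1.
have one_homo : {homo (fun=> 1%N) : i j / (i <= j)%N} by [].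
(* Directional and partial derivatives raise neither order nor leading degree and lower the total
   degree, so minimality in the third component settles them. *)
have [||a [g [Bag qP]]] := minimal_quasilinear iod imm resF divF P0 nP.
- move=> w h; apply: setD => //; [exact: SL_dirv|exact: SL_dirv|].
  by have := @SL_dirv1 _ _ _ _ (jet dF w) s3; rewrite subn1.
- move=> h t h0 t0 ne; apply: setD => //.
  + apply: SL_cj; first exact: tl_homo.
    apply: (@SLW _ _ _ (0 - Lf (tl o.+1) t)%N); first exact: leq_subr.
    by apply: SL_mderivm; apply: SL_cj => //; exact: tl_homo.
  + apply: SL_cj; first exact: tl_homo.
    apply: (@SLW _ _ _ (e.+1 - Lf (tl o) t)%N); first exact: leq_subr.
    by apply: SL_mderivm; apply: SL_cj => //; exact: tl_homo.
  + apply: SL_cj; first exact: one_homo.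
    apply: (@SLW _ _ _ (D.+1 - Lf (fun=> 1%N) t)%N).
      by rewrite Lf_mdeg leq_subLR; move: t0; rewrite -mdeg_eq0 -lt0n => h1; rewrite -add1n leq_add2r.
    by apply: SL_mderivm; apply: SL_cj => //; exact: one_homo.
have [bt rbt hbt] := cut_root nP Bag qP.
exists bt.
  (* No element of [F] lies in all balls of the cut: immediacy provides a ball whose radius is below
     the distance of [x] to [b]. *)
  move=> x; apply/eqP => ebt.
  have [f f0 hf] := imm x.
  have Bx : ballb x f by split=> //; case/andP: hf.
  have [a1 [g1 [B1 g1f]]] := ball_smaller imm resF (ex_intro _ x Bx).
  have key a2 g2 : ballb a2 g2 -> dm (io g2) (io g) -> dm (io g2) (io g1) -> False.
    move=> B2 l1 l2; have := hbt a2 g2 B2 l1; rewrite ebt => h.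
    have : dm (b - io x) (io g2).
      have -> : b - io x = (b - io a2) - (io x - io a2) by rewrite opprB addrA subrK.
      by apply: dmB => //; case: B2.
    rewrite (asy_dml _ hf) => h'; have := dm_trans h' l2.
    by apply/negP.
  have [l|/sdW l] := boolP (dm (io g1) (io g)); first by apply: (key a1 g1) => //; exact: dmxx.
  by apply: (key a g) => //; exact: dmxx.
pose io' := Ordinal or.
have ioE : io' = o :> nat by [].
have [I [P' [sI sP1 sP2 PE]]] := top_dec ioE s1 s2.
have up Q : SL (tl o) 0 Q -> SL (tl o.+1) 0 (Q : {mpoly F[r.+1]}).
  by move=> hQ m /hQ; rewrite !leqn0 => /eqP h; have := tl_mono m (leqnSn o); rewrite h leqn0.
have I0 : I != 0.
  apply/eqP => I0; apply: nP; apply: setE => //.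
  by rewrite PE I0 mul0r add0r.
pose S := P^`M(io').
have S0 : S != 0.
  apply/eqP => e0; apply: nP; apply: (setO) => // m hm.
  have := s1 m hm; rewrite leqn0 => /eqP hm1.
  rewrite (tl_split m ioE) hm1 addn0 leqn0; apply/eqP; case E1 : (m io') => [//|k].
  have em : m = (m - U_(io') + U_(io'))%MM.
    apply/mnmP => l; rewrite mnmDE mnmBE mnm1E; case: (io' =P l) => [<-|_] /=; last by rewrite subn0 addn0.
    by rewrite E1 subn1 addn1.
  have : S@_(m - U_(io')) = 0 by rewrite e0 mcoeff0.
  rewrite mcoeff_mderiv -em => /(congr1 io) /eqP; rewrite rmorphMn rmorph0.
  by rewrite mulrn_eq0 /= fmorph_eq0 (negPf hm).
(* The product of initial and separant: the initial has lower order, so [E] has leading degree at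
   most [e] and is settled; in particular it does not vanish near the cut. *)
pose E := I * S.
have sS1 : SL (tl o.+1) 0 S by apply: SL_mderivW.
have sS2 : SL (tl o) e S.
  by have := @SL_mderiv _ _ _ _ _ io' s2; rewrite /tl ioE leqnn subn1.
have sE1 : SL (tl o.+1) 0 E by rewrite -[0%N]addn0; apply: SLM => //; apply: up.
have sE2 : SL (tl o) e E by rewrite -[e]add0n; apply: SLM.
have E0 : E != 0 by rewrite mulf_neq0.
(* Up to factors that do not vanish, each term becomes a polynomial of smaller complexity than [P],
   hence zero or settled. *)
have red (t : dterm (option F)) : exists k l (B : {mpoly F[r.+1]}),
    [/\ SL (tl o.+1) 0 B, SL (tl o) e B &
     forall (M : dhlField) (j : {rmorphism F -> M}), dext dF j -> forall y, goodroot P E j y ->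
     pev j I y ^+ l * pev j E y ^+ k * dev (asn j y) t = pev j B y].
  have [k [A [sA hA]]] := term_reduce dF ioE s1 sE1 (up _ sI) (erefl E) t.
  have [k' sA'] := SL_bnd (tl o) A.
  have [l [Q [B [b1 b2 EB]]]] := pseudo_reduce ioE sI sP1 sP2 sA sA'.
  exists k, l, B; split=> // M j jd y gr.
  rewrite -mulrA (hA M j jd y gr) -pevXn -pevM EB -PE pevD pevM.
  by case: gr => -> _; rewrite mulr0 add0r.
move=> n ts.
have [k /choice[l /choice[B hB]]] := choice (fun i => red (ts i)).
have [|a1 [g1 [B1 gg ST]]] := @st_common _ _ _ _ iod _ _
    [:: E, I & [seq B i | i <- enum 'I_n & B i != 0]] _ _ Bag.
  move=> Q; rewrite !inE => /or3P[/eqP ->|/eqP ->|].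
  - exact: setE.
  - exact: setO.
  - move=> /mapP[i]; rewrite mem_filter => /andP[h _] ->.
    by have [h1 h2 _] := hB i; apply: setE.
have [q1 c1] := ql_smaller nP Bag qP B1 gg.
have [bs hbs rbs] := root_in_ball jsd (proj1 B1) (ql_transfer dmE q1) (lin_dom_transfer dmE q1 c1).
have hbt1 := hbt a1 g1 B1 gg.
have val Q : Q \in [:: E, I & [seq B i | i <- enum 'I_n & B i != 0]] ->
    eqv (pev io Q bt) (io Q.@[jet dF a1]) /\ eqv (pev js Q bs) (js Q.@[jet dF a1]).
  move=> h; have h1 := ST Q h; split.
    exact: (settled_val iod (proj1 B1) hbt1 h1).
  exact: (settled_val jsd (proj1 B1) hbs (settledAt_transfer dmE h1)).
have [vE1 vE2] := val E (mem_head _ _).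
have [vI1 vI2] : eqv (pev io I bt) (io I.@[jet dF a1]) /\ eqv (pev js I bs) (js I.@[jet dF a1]).
  by apply: val; rewrite !inE eqxx orbT.
have nE1 : pev io E bt != 0 by rewrite (asy_eq0 (eqv_asy vE1)); apply: sd_neq0 vE1.
have nE2 : pev js E bs != 0 by rewrite (asy_eq0 (eqv_asy vE2)); apply: sd_neq0 vE2.
exists bs; apply: (sim_match posE dmE) => i.
have [h1 h2 hB'] := hB i.
apply: (@sim_div _ _ _ io js (pev io I bt ^+ l i * pev io E bt ^+ k i)
  (pev js I bs ^+ l i * pev js E bs ^+ k i) _ _ (I.@[jet dF a1] ^+ l i * E.@[jet dF a1] ^+ k i)).
- by rewrite rmorphM !rmorphXn; apply: eqvM; apply: eqvX.
- by rewrite rmorphM !rmorphXn; apply: eqvM; apply: eqvX.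
rewrite (hB' K io iod bt) // (hB' Ks js jsd bs) //.
have [e0|Bi0] := eqVneq (B i) 0.
  by exists 0; left; rewrite e0 !pev0.
exists (B i).@[jet dF a1]; right; apply: val.
rewrite !inE; apply/or3P; constructor 3.
by apply/mapP; exists i => //; rewrite mem_filter Bi0 mem_enum.
Qed.

End Immediate.

(** * New values *)

Lemma sum_dominant (M : dhlField) (I : eqType) (s : seq I) (E : I -> M) i0 :
  uniq s -> i0 \in s -> E i0 != 0 -> (forall i, i \in s -> i != i0 -> sd (E i) (E i0)) ->
  eqv (\sum_(i <- s) E i) (E i0).
Proof.
move=> us i0s E0 h; rewrite /eqv (bigD1_seq i0) //= addrAC subrr add0r big_seq_cond.
by apply: sd_sum => // i /andP[i1 i2]; apply: h.
Qed.

Lemma dm_add_nasy (M : dhlField) (y z : M) : ~~ asy y z -> dm y (y + z).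
Proof.
move=> na; case: (asyP y z) => [h||h]; last 2 first.
- by rewrite (negPf na).
- by have /andP[] := addr_sd_asy h.
by rewrite addrC; apply: (dm_trans (sdW h)); have /andP[] := addr_sd_asy h.
Qed.

Lemma ld_case (M : dhlField) (x w : M) : x != 0 -> eqv (logder (@dd M) x) w -> sd 1 w ->
  if 0 < w then sd 1 x else sd x 1.
Proof.
move=> x0 e w1; have h1 : sd 1 (logder (@dd M) x) by rewrite (asy_sdr _ (eqv_asy e)).
have s := eqv_pos e; case: ifP => w0; first by rewrite sd1_ld // h1 s.
by rewrite ld_sd1 // h1 lt_neqAle (sd_neq0 h1) leNgt s w0.
Qed.

Lemma asy_int (M : dhlField) (d : int) : d != 0 -> asy (d%:~R : M) 1.
Proof.
have nat_asy k : asy (k.+1%:R : M) 1 by apply: asyMn.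
case: d => [[|k] //|k] _; first exact: nat_asy.
by rewrite NegzE rmorphN /asy dmN dmNr; apply: nat_asy.
Qed.

Section Monomials.

Variables (F : fieldType) (K Ks : dhlField) (io : {rmorphism F -> K}) (js : {rmorphism F -> Ks}).
Hypothesis posE : forall x, (0 < io x) = (0 < js x).
Hypothesis dmE : forall x y, dm (io x) (io y) = dm (js x) (js y).

(** Different monomials have different values, so each term is equivalent to its largest monomial,
    and monomials compare alike in both models. *)
Lemma monomial_match (X : eqType) (mu : X -> K) (mus : X -> Ks) b bs n
    (ts : 'I_n -> dterm (option F)) (s : 'I_n -> seq X) (a : 'I_n -> X -> F) :
  (forall m, 0 < mu m) -> (forall m, 0 < mus m) ->
  (forall i, uniq (s i)) -> (forall i m, m \in s i -> a i m != 0) ->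
  (forall i, dev (asn io b) (ts i) = \sum_(m <- s i) io (a i m) * mu m) ->
  (forall i, dev (asn js bs) (ts i) = \sum_(m <- s i) js (a i m) * mus m) ->
  (forall i m i' m', m \in s i -> m' \in s i' -> m != m' ->
    ~~ asy (io (a i m) * mu m) (io (a i' m') * mu m') /\
    dm (io (a i m) * mu m) (io (a i' m') * mu m') = dm (js (a i m) * mus m) (js (a i' m') * mus m')) ->
  (forall i, (0 < dev (asn io b) (ts i)) = (0 < dev (asn js bs) (ts i))) /\
  (forall i j, dm (dev (asn io b) (ts i)) (dev (asn io b) (ts j)) =
               dm (dev (asn js bs) (ts i)) (dev (asn js bs) (ts j))).
Proof.
move=> mu0 mus0 us a0 Hb Hbs H.
have dmA i m i' m' : m \in s i -> m' \in s i' ->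
    dm (io (a i m) * mu m) (io (a i' m') * mu m') = dm (js (a i m) * mus m) (js (a i' m') * mus m').
  have [<-|ne] := eqVneq m m'; last by move=> h h'; case: (H i m i' m' h h' ne).
  by move=> _ _; rewrite !dm_pM2r ?gt_eqF ?dmE.
have rep i : (dev (asn io b) (ts i) = 0 /\ dev (asn js bs) (ts i) = 0) \/
    exists2 m, m \in s i & eqv (dev (asn io b) (ts i)) (io (a i m) * mu m) /\
                           eqv (dev (asn js bs) (ts i)) (js (a i m) * mus m).
  rewrite Hb Hbs; case E : (s i) => [|m0 s']; first by left; rewrite !big_nil.
  right; rewrite -E; have m0s : m0 \in s i by rewrite E mem_head.
  have [m ms hm] := dm_max (fun m => io (a i m) * mu m) m0s.
  exists m => //; split; apply: sum_dominant => //.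
  - by apply: mulf_neq0; [rewrite fmorph_eq0 a0|rewrite gt_eqF].
  - move=> m' m's ne; have [na _] := H i m' i m m's ms ne.
    by move: na; rewrite /asy hm //= /sd.
  - by apply: mulf_neq0; [rewrite fmorph_eq0 a0|rewrite gt_eqF].
  - move=> m' m's ne; have [na _] := H i m' i m m's ms ne.
    by rewrite /sd -dmA //; move: na; rewrite /asy hm.
have sg1 i m : (0 < io (a i m) * mu m) = (0 < js (a i m) * mus m).
  by rewrite !pmulr_lgt0 ?posE.
split=> [i|i j].
  case: (rep i) => [[-> ->]|[m ms [h1 h2]]]; first by rewrite !ltxx.
  by rewrite (eqv_pos h1) (eqv_pos h2).
case: (rep i) => [[-> ->]|[m ms [h1 h2]]]; first by rewrite !dm0.
case: (rep j) => [[-> ->]|[m' ms' [h1' h2']]].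
  rewrite !dmx0 (asy_eq0 (eqv_asy h1)) (asy_eq0 (eqv_asy h2)).
  by rewrite !mulf_eq0 !fmorph_eq0 (gt_eqF (mu0 m)) (gt_eqF (mus0 m)).
rewrite (asy_dml _ (eqv_asy h1)) (asy_dmr _ (eqv_asy h1')).
by rewrite (asy_dml _ (eqv_asy h2)) (asy_dmr _ (eqv_asy h2')) dmA.
Qed.

End Monomials.

(** * Terms in an element with logarithmic derivative in the subfield *)

Section UniPoly.

Variables (F : fieldType) (dF : F -> F).

Definition pe (M : dhlField) (j : {rmorphism F -> M}) (A : {poly F}) (y : M) := (map_poly j A).[y].

Section Ev.
Variables (M : dhlField) (j : {rmorphism F -> M}) (y : M).
Lemma peC c : pe j c%:P y = j c. Proof. by rewrite /pe map_polyC hornerC. Qed.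
Lemma peX : pe j 'X y = y. Proof. by rewrite /pe map_polyX hornerX. Qed.
Lemma peD A B : pe j (A + B) y = pe j A y + pe j B y. Proof. by rewrite /pe rmorphD hornerD. Qed.
Lemma peM A B : pe j (A * B) y = pe j A y * pe j B y. Proof. by rewrite /pe rmorphM hornerM. Qed.
Lemma peN A : pe j (- A) y = - pe j A y. Proof. by rewrite /pe rmorphN hornerN. Qed.
Lemma pe_sum A : pe j A y = \sum_(m <- [seq m <- iota 0 (size A) | A`_m != 0]) j A`_m * y ^+ m.
Proof.
rewrite /pe horner_coef size_map_poly big_filter [RHS]big_mkcond /=.
rewrite -(big_mkord xpredT (fun i => (map_poly j A)`_i * y ^+ i)) /index_iota subn0.
by apply: eq_bigr => i _; rewrite coef_map; case: eqP => //= ->; rewrite rmorph0 mul0r.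
Qed.
End Ev.

Variable e : F.

Lemma poly_ld (A : {poly F}) : exists B : {poly F}, forall (M : dhlField) (j : {rmorphism F -> M}),
  dext dF j -> forall y, dd y = y * j e -> dd (pe j A y) = pe j B y.
Proof.
elim/poly_ind: A => [|A c [B h]].
  by exists 0 => M j jd y hy; rewrite /pe rmorph0 horner0 dd0.
exists (B * 'X + A * ('X * e%:P) + (dF c)%:P) => M j jd y hy.
by rewrite !peD !peM !peX !peC ddD ddM hy (h M j jd y hy) jd.
Qed.

Lemma term_upoly (t : dterm (option F)) : exists A : {poly F}, forall (M : dhlField) (j : {rmorphism F -> M}),
  dext dF j -> forall y, dd y = y * j e -> dev (asn j y) t = pe j A y.
Proof.
elim: t => [[c|]|||t [A h]|t [A h]|t [A h] s [B h']|t [A h] s [B h']].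
- by exists c%:P => M j jd y _; rewrite peC.
- by exists 'X => M j jd y _; rewrite peX.
- by exists 0 => M j jd y _; rewrite -polyC0 peC rmorph0.
- by exists 1 => M j jd y _; rewrite -polyC1 peC rmorph1.
- by exists (- A) => M j jd y hy; rewrite peN /= (h M j jd y hy).
- have [B hB] := poly_ld A.
  by exists B => M j jd y hy; rewrite /= (h M j jd y hy) (hB M j jd y hy).
- by exists (A + B) => M j jd y hy; rewrite peD /= (h M j jd y hy) (h' M j jd y hy).
- by exists (A * B) => M j jd y hy; rewrite peM /= (h M j jd y hy) (h' M j jd y hy).
Qed.

End UniPoly.

Section Values.

Variables (F : fieldType) (dF : F -> F) (K Ks : dhlField).
Variables (io : {rmorphism F -> K}) (js : {rmorphism F -> Ks}).
Hypothesis iod : dext dF io.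
Hypothesis jsd : dext dF js.
Hypothesis posE : forall x, (0 < io x) = (0 < js x).
Hypothesis dmE : forall x y, dm (io x) (io y) = dm (js x) (js y).
Notation ldK := (logder (@dd K)).
Notation ldS := (logder (@dd Ks)).

Definition newv (x : K) := x != 0 /\ forall f, f != 0 -> ~~ asy x (io f).

Lemma newv_asy x y : asy x y -> newv x -> newv y.
Proof.
move=> h [x0 hx]; split=> [|f f0]; first by rewrite -(asy_eq0 h).
by apply: contra (hx f f0); apply: asy_trans.
Qed.

Lemma newv_notin x f : newv x -> x != io f.
Proof.
move=> [x0 h]; apply/eqP => e; have := h f; rewrite -(fmorph_eq0 io) -e => /(_ x0).
by rewrite asyxx.
Qed.

Lemma newv1 x : newv x -> ~~ asy x 1.
Proof. by move=> [_ /(_ 1)]; rewrite rmorph1 oner_neq0; apply. Qed.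

Lemma newv_div x f : f != 0 -> newv x -> newv (x / io f).
Proof.
move=> f0 [x0 h]; have f0' : io f != 0 by rewrite fmorph_eq0.
split=> [|g g0]; first by rewrite mulf_neq0 ?invr_eq0.
have := h (g * f); rewrite mulf_neq0 // => /(_ isT); apply: contra.
by rewrite rmorphM -(asy_pM2r _ _ f0') divfK.
Qed.

Lemma newv_sd x f : newv x -> sd (io f) x \/ sd x (io f).
Proof.
move=> [x0 h]; have [->|f0] := eqVneq f 0; first by left; rewrite rmorph0 /sd dmx0.
by case: (asyP (io f) x) => [||]; [left| rewrite asy_sym (negPf (h f f0)) |right].
Qed.

Definition lF (q : F) := dF q / q.
Lemma ld_io (M : dhlField) (j : {rmorphism F -> M}) q : dext dF j -> logder (@dd M) (j q) = j (lF q).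
Proof. by move=> jd; rewrite /logder /lF rmorphM fmorphV jd. Qed.

Lemma ld_transfer x xs z : x != 0 -> xs != 0 -> ldK x = io z -> ldS xs = js z -> dm x 1 = dm xs 1.
Proof.
move=> x0 xs0 h hs; have E (M : dhlField) (w : M) : dm w 1 = ~~ sd 1 w by rewrite /sd negbK.
rewrite (E K) (E Ks) (sd1_ld x0) (sd1_ld xs0) h hs posE.
by rewrite -(rmorph1 io) -(rmorph1 js) (sdE dmE).
Qed.

(** The passage from [A] to [B] covers two cases: division by a binomial when [c] is a root of an
    element of [F], and no change when all positive powers of [c] have new values. *)
Lemma ld_match c cs e : 0 < c -> 0 < cs -> ldK c = io e -> ldS cs = js e ->
  (forall A : {poly F}, exists B : {poly F}, [/\ forall i, (0 < i < size B)%N -> newv (c ^+ i),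
     pe io A c = pe io B c & pe js A cs = pe js B cs]) ->
  tmatch io js c.
Proof.
move=> c0 cs0 hc hcs red n ts; exists cs.
have c1 : c != 0 by rewrite gt_eqF.
have cs1 : cs != 0 by rewrite gt_eqF.
have dc : dd c = c * io e by rewrite -hc dd_ld.
have dcs : dd cs = cs * js e by rewrite -hcs dd_ld.
have /choice[B hB] : forall i, exists B : {poly F}, [/\ forall l, (0 < l < size B)%N -> newv (c ^+ l),
    dev (asn io c) (ts i) = pe io B c & dev (asn js cs) (ts i) = pe js B cs].
  move=> i; have [A hA] := term_upoly dF e (ts i); have [B [h1 h2 h3]] := red A.
  by exists B; split=> //; [rewrite (hA K io iod c dc)|rewrite (hA Ks js jsd cs dcs)].
have nasy q q' k l : q != 0 -> q' != 0 -> (k < l)%N -> newv (c ^+ (l - k)) ->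
    ~~ asy (io q * c ^+ k) (io q' * c ^+ l).
  move=> q0 q0' kl [_ /(_ (q / q'))]; rewrite mulf_neq0 ?invr_eq0 // => /(_ isT).
  apply: contra => h; rewrite rmorphM fmorphV asy_sym -(@asy_pM2r _ (io q' * c ^+ k)); last first.
    by rewrite mulf_neq0 ?fmorph_eq0 ?expf_neq0.
  have -> : io q / io q' * (io q' * c ^+ k) = io q * c ^+ k by rewrite mulrA divfK ?fmorph_eq0.
  by rewrite mulrCA -exprD subnK // ltnW.
apply: (@monomial_match _ _ _ _ _ posE dmE nat (fun m => c ^+ m) (fun m => cs ^+ m) _ _ _ _
  (fun i => [seq m <- iota 0 (size (B i)) | (B i)`_m != 0]) (fun i m => (B i)`_m)).
- by move=> m; rewrite exprn_gt0.
- by move=> m; rewrite exprn_gt0.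
- by move=> i; rewrite filter_uniq // iota_uniq.
- by move=> i m; rewrite mem_filter => /andP[].
- by move=> i; rewrite -pe_sum; case: (hB i).
- by move=> i; rewrite -pe_sum; case: (hB i).
move=> i k i' l; rewrite !mem_filter !mem_iota !add0n /= => /andP[q0 sk] /andP[q0' sl] kl.
split.
  move: kl; rewrite neq_ltn => /orP[h|h].
    apply: nasy => //; have [hh _ _] := hB i'; apply: hh.
    by rewrite subn_gt0 h (leq_ltn_trans (leq_subr _ _)).
  rewrite asy_sym; apply: nasy => //; have [hh _ _] := hB i; apply: hh.
  by rewrite subn_gt0 h (leq_ltn_trans (leq_subr _ _)).
set q := (B i)`_k in q0 *; set q' := (B i')`_l in q0' *.
have x0 : io q * c ^+ k != 0 by rewrite mulf_neq0 ?fmorph_eq0 ?expf_neq0.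
have x0' : io q' * c ^+ l != 0 by rewrite mulf_neq0 ?fmorph_eq0 ?expf_neq0.
have y0 : js q * cs ^+ k != 0 by rewrite mulf_neq0 ?fmorph_eq0 ?expf_neq0.
have y0' : js q' * cs ^+ l != 0 by rewrite mulf_neq0 ?fmorph_eq0 ?expf_neq0.
rewrite -(dm_div1 _ x0') -(dm_div1 _ y0').
have gen (M : dhlField) (j : {rmorphism F -> M}) y : dext dF j -> y != 0 -> logder (@dd M) y = j e ->
    logder (@dd M) (j q * y ^+ k / (j q' * y ^+ l)) = j (lF q + e *+ k - (lF q' + e *+ l)).
  move=> jd hy ly; rewrite ldf ?mulf_neq0 ?fmorph_eq0 ?expf_neq0 //.
  rewrite !ldM ?fmorph_eq0 ?expf_neq0 // !ldX // !ld_io // ly.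
  by rewrite rmorphB !rmorphD !rmorphMn.
apply: (@ld_transfer _ _ (lF q + e *+ k - (lF q' + e *+ l))).
- by rewrite mulf_neq0 ?invr_eq0.
- by rewrite mulf_neq0 ?invr_eq0.
- exact: gen.
- exact: gen.
Qed.

Lemma root_step f0 k0 : f0 != 0 -> (forall f, f != 0 -> ~~ asy (io f ^+ k0.+1) (io f0)) ->
  exists2 b, (forall x, b != io x) & tmatch io js b.
Proof.
move=> f00 nof; have f00' : io f0 != 0 by rewrite fmorph_eq0.
have [|c0 c00 ec0] := @rootK K `|io f0| k0; first by rewrite normr_gt0.
have c0n : c0 != 0 by rewrite gt_eqF.
have Vc0 : newv c0.
  split=> // f fn; apply: contra (nof f fn) => h.
  have := asyX k0.+1 h; rewrite ec0 asy_sym => h1.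
  by apply: (asy_trans h1); rewrite /asy dm_abs dm_absr dmxx.
(* The least power of [c0] with value from [F] may be smaller than [k0.+1]; minimality keeps the
   lower powers new. *)
have [|n [[n0 nV] minn]] := @nat_min (fun n => (0 < n)%N /\ ~ newv (c0 ^+ n)).
  exists k0.+1; split=> // -[_ /(_ f0 f00)]; rewrite ec0 /asy dm_abs dm_absr dmxx //.
(* [h] is chosen positive so that its root exists in both models. *)
have [h h0 ph] : exists2 h, 0 < io h & asy (c0 ^+ n) (io h).
  have [f fn hf] : exists2 f, f != 0 & asy (c0 ^+ n) (io f).
    apply: contrapT => no; apply: nV; split=> [|f fn]; first by rewrite expf_neq0.
    by apply/negP => hf; apply: no; exists f.
  have [p|p] := ltP 0 (io f); first by exists f.
  exists (- f); last by rewrite rmorphN /asy dmN dmNr.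
  by rewrite rmorphN oppr_gt0 lt_neqAle p fmorph_eq0 fn.
case: n n0 nV minn ph => // n _ nV minn ph.
have hn : h != 0 by rewrite -(fmorph_eq0 io) gt_eqF.
have [c c1 ec] := rootK n h0.
have [cs cs1 ecs] := @rootK Ks (js h) n (etrans (esym (posE h)) h0).
have cn : c != 0 by rewrite gt_eqF.
have csn : cs != 0 by rewrite gt_eqF.
have ac : asy c0 c by rewrite -(asyXK _ _ n) ec.
have Vi i : (0 < i < n.+1)%N -> newv (c ^+ i).
  move=> /andP[i0 ilt]; apply: (newv_asy (asyX i ac)); apply: contrapT => no.
  by have := minn i (conj i0 no); rewrite leqNgt ilt.
exists c.
  by move=> x; apply: newv_notin; apply: newv_asy ac Vc0.
pose e := lF h / n.+1%:R.
have lde (M : dhlField) (j : {rmorphism F -> M}) y : dext dF j -> y != 0 -> y ^+ n.+1 = j h ->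
    logder (@dd M) y = j e.
  move=> jd y0 ey; have := @ldX M y n.+1 y0; rewrite ey ld_io // => E.
  rewrite /e rmorphM fmorphV rmorph_nat E -[logder _ _ *+ _]mulr_natr mulfK // pnatr_eq0 //.
apply: (@ld_match c cs e) => //; [exact: lde|exact: lde|].
move=> A; pose Q := ('X : {poly F}) ^+ n.+1 - h%:P.
have sQ : size Q = n.+2.
  by rewrite /Q size_polyDl ?size_polyXn // size_polyN (leq_ltn_trans (size_polyC_leq1 _)).
have Q0 : Q != 0 by rewrite -size_poly_eq0 sQ.
have pv (M : dhlField) (j : {rmorphism F -> M}) y : y ^+ n.+1 = j h -> pe j A y = pe j (A %% Q) y.
  move=> ey; rewrite {1}(divp_eq A Q) peD peM.
  have -> : pe j Q y = 0.
    rewrite /Q peD peN peC; have -> : pe j (('X : {poly F}) ^+ n.+1) y = y ^+ n.+1 by rewrite /pe map_polyXn hornerXn.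
    by rewrite ey subrr.
  by rewrite mulr0 add0r.
exists (A %% Q); split; [|exact: pv|exact: pv].
move=> i /andP[i0 ilt]; apply: Vi; rewrite i0 /=.
by apply: (leq_trans ilt); rewrite -ltnS -sQ ltn_modp.
Qed.

Hypothesis divF : forall (f : F) k, f != 0 -> exists2 f' : F, f' != 0 & asy (io f' ^+ k.+1) (io f).

(** Since the value group of [F] is divisible, all positive powers of a new element are new, and the
    absolute value of any exponential integral of the image of [e] is a suitable copy. *)
Lemma expint_step x e : newv x -> ldK x = io e -> exists2 b, (forall x, b != io x) & tmatch io js b.
Proof.
move=> Vx lx; have x0 : x != 0 by case: Vx.
have Vc : newv `|x| by apply: newv_asy Vx; rewrite /asy dm_abs dm_absr dmxx.
exists `|x|; first by move=> y; apply: newv_notin.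
have [y y0 ly] := expint_exists (js e).
apply: (@ld_match _ `|y| e); rewrite ?normr_gt0 ?ld_abs // => A.
exists A; split=> // i /andP[i0 _]; split=> [|f fn]; first by rewrite expf_neq0 // normr_eq0.
case: i i0 => // i _; have [f' f0' hf] := divF i fn.
apply: contra (proj2 Vc f' f0') => h; rewrite -(asyXK _ _ i).
by apply: (asy_trans h); rewrite asy_sym.
Qed.

(** * Chains of iterated logarithmic derivatives *)

Section Chain.

Variable f : nat -> F.
Hypothesis f0 : forall i, f i != 0.

Definition agree (q : F) (c : K) (cs : Ks) :=
  (sd (io q) c /\ sd (js q) cs) \/ (sd c (io q) /\ sd cs (js q)).

(** The logarithmic derivative of [x] is equivalent to the larger of [z] and the integer multiple of
    [c]. Since [c] and [cs] lie on the same side of [z] and have the same sign, [x] and [xs] fall on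
    the same side of 1. *)
Lemma cmp_ld x xs z (d : int) c cs r rs : x != 0 -> xs != 0 -> d != 0 ->
  ldK x = io z + d%:~R * c + r -> ldS xs = js z + d%:~R * cs + rs -> sd r c -> sd rs cs ->
  agree z c cs -> (0 < c) = (0 < cs) -> sd 1 c -> sd 1 cs ->
  (sd 1 x /\ sd 1 xs) \/ (sd x 1 /\ sd xs 1).
Proof.
move=> x0 xs0 d0 hx hxs rc rcs ag sg c1 cs1.
have c0 := sd_neq0 c1; have cs0 := sd_neq0 cs1.
have key (M : dhlField) (y c' z' r' : M) : y != 0 -> logder (@dd M) y = z' + d%:~R * c' + r' ->
    sd r' c' -> sd 1 c' -> (sd z' c' -> if 0 < d%:~R * c' then sd 1 y else sd y 1) /\
                           (sd c' z' -> if 0 < z' then sd 1 y else sd y 1).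
  move=> y0 hy hr c1'; have ad : asy (d%:~R * c') c'.
    by rewrite -{2}[c']mul1r asy_pM2r ?(sd_neq0 c1') // asy_int.
  split=> hz.
    apply: ld_case => //; last by rewrite (asy_sdr _ ad).
    rewrite /eqv hy (asy_sdr _ ad).
    have -> : z' + d%:~R * c' + r' - d%:~R * c' = z' + r' by ring.
    exact: sdD.
  apply: ld_case => //; last exact: sd_trans c1' hz.
  rewrite /eqv hy; have -> : z' + d%:~R * c' + r' - z' = d%:~R * c' + r' by ring.
  by apply: sdD; [rewrite (asy_sdl _ ad)|apply: sd_trans hz].
have [k1 k2] := key K x c (io z) r x0 hx rc c1.
have [k3 k4] := key Ks xs cs (js z) rs xs0 hxs rcs cs1.
case: ag => [[h1 h2]|[h1 h2]].
  move: (k1 h1) (k3 h2).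
  have -> : (0 < d%:~R * c) = (0 < d%:~R * cs).
    have [p|p|p] := ltrgt0P d; last by rewrite p eqxx in d0.
      by rewrite !pmulr_rgt0 ?ltr0z.
    by rewrite !nmulr_rgt0 ?ltrz0 // !lt_neqAle c0 cs0 /= !leNgt sg.
  by case: ifP => _; [left|right].
move: (k2 h1) (k4 h2); rewrite posE.
by case: ifP => _; [left|right].
Qed.

Lemma cut_copy c (T : seq F) : newv c -> sd 1 c ->
  exists cs, [/\ (0 < c) = (0 < cs), sd 1 cs & forall q, q \in T -> agree q c cs].
Proof.
move=> Vc c1; have c0 := sd_neq0 c1.
have sdE' := sdE dmE.
suff [cs [hcs hsd hT]] : exists cs, [/\ 0 < cs, sd 1 cs & forall q, q \in T -> agree q c cs].
  have [p|p] := ltP 0 c; first by exists cs; rewrite hcs.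
  exists (- cs); split.
  - by rewrite oppr_gt0 ltNge ltW.
  - by rewrite sdNr.
  - by move=> q /hT [[h1 h2]|[h1 h2]]; [left|right]; rewrite ?sdN ?sdNr.
(* 1 is added to the lower bounds so that the copy becomes infinite. *)
pose Lo := [seq q <- 1 :: T | sd (io q) c].
pose Hi := [seq q <- T | sd c (io q)].
have oneL : 1 \in Lo by rewrite /Lo /= rmorph1 c1 mem_head.
have [q1 q1L hq1] := dm_max (fun q => js q) oneL.
have q1c : sd (io q1) c by move: q1L; rewrite mem_filter => /andP[].
have q10 : js q1 != 0.
  by have := hq1 1 oneL; rewrite rmorph1; apply: contraTneq => ->; rewrite dmx0 oner_eq0.
have one1 : dm 1 (js q1) by rewrite -(rmorph1 js); apply: hq1.
have fin cs : 0 < cs -> sd (js q1) cs -> (forall q, q \in Hi -> sd cs (js q)) ->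
    exists cs, [/\ 0 < cs, sd 1 cs & forall q, q \in T -> agree q c cs].
  move=> h1 h2 h3; exists cs; split=> //; first exact: dm_sd_trans one1 h2.
  move=> q qT; case: (newv_sd q Vc) => h; [left|right]; split=> //.
    by apply: dm_sd_trans h2; apply: hq1; rewrite mem_filter h inE qT orbT.
  by apply: h3; rewrite mem_filter h qT.
case E : Hi => [|q0 H'].
  (* Without upper bounds, an infinite multiple of the largest lower bound will do. *)
  have [y y1] := inf_exists Ks; apply: (fin (`|js q1 * y|)).
  - by rewrite normr_gt0 mulf_neq0 // (sd_neq0 y1).
  - by rewrite /sd dm_abs -/(sd _ _) -{1}[js q1]mulr1 sd_pM2l.
  - by rewrite E.
have q0H : q0 \in Hi by rewrite E mem_head.
have [q2 q2H hq2] := dm_max (fun q => (js q)^-1) q0H.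
have cH q : q \in Hi -> sd c (io q) by rewrite mem_filter => /andP[].
have H0 q : q \in Hi -> js q != 0.
  by move=> /cH/sd_neq0; rewrite !fmorph_eq0.
have q12 : sd (js q1) (js q2) by rewrite -sdE'; apply: sd_trans q1c (cH _ q2H).
(* Otherwise the geometric mean of the two nearest bounds lies strictly between them. *)
have [|cs cs0 ecs] := @rootK Ks `|js q1 * js q2| 1.
  by rewrite normr_gt0 mulf_neq0 // H0.
apply: (fin cs) => //.
  rewrite -(sdXK _ _ 1) ecs /sd dm_abs -/(sd _ _) expr2 sd_pM2l //.
move=> q qH; apply: (@sd_dm_trans _ (js q2)); last by rewrite -dmV ?H0 // hq2.
by rewrite -(sdXK _ _ 1) ecs /sd dm_absr -/(sd _ _) expr2 sd_pM2r // H0.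
Qed.

Variable b : nat -> K.
Hypothesis b_gt0 : forall i, 0 < b i.
Hypothesis Vb : forall i, newv (b i).
Notation c i := (ldK (b i)).
Hypothesis Vc : forall i, newv (c i).
Hypothesis cS : forall i, c i = b i.+1 * io (f i.+1).

Lemma c_sd1 i : sd 1 (c i).
Proof.
have := newv1 (Vb i); rewrite asy1_ld // gt_eqF //.
Qed.

(** Without cancellation the logarithmic derivative of [x] is bounded by that of [x * g], which is
    below [x * g] because the product is infinite. *)
Lemma ld_next (M : dhlField) (x g : M) : x != 0 -> g != 0 -> sd 1 (x * g) ->
  ~~ asy (logder (@dd M) x) (logder (@dd M) g) -> sd (logder (@dd M) x) (x * g).
Proof.
move=> x0 g0 h na; apply: (@dm_sd_trans _ (logder (@dd M) (x * g))); last exact: ld_lt_inf.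
by rewrite ldM //; apply: dm_add_nasy.
Qed.

Lemma agree_nasy q x xs : agree q x xs -> ~~ asy x (io q) /\ ~~ asy xs (js q).
Proof. by rewrite !asyNsd => -[[-> ->]|[-> ->]]; rewrite /= ?andbF. Qed.

Lemma c_dec i : sd (c i.+1) (c i).
Proof.
have b0 := gt_eqF (b_gt0 i.+1).
rewrite [X in sd _ X]cS; apply: ld_next; rewrite -?cS ?b0 ?fmorph_eq0 ?f0 ?c_sd1 //.
rewrite ld_io //; case: (newv_sd (lF (f i.+1)) (Vc i.+1)) => h; rewrite asyNsd h ?andbF //.
Qed.

Definition okc (R : seq F) (bs cs : nat -> Ks) (i : nat) :=
  [/\ 0 < bs i, ldS (bs i) = cs i, (0 < c i) = (0 < cs i), sd 1 (cs i)
    & forall q, q \in R -> agree q (c i) (cs i)].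

(** A segment is copied from its far end: [cut_copy] places the last logarithmic derivative, and
    each earlier element is an exponential integral of the product of its successor with the next
    [f]. *)
Lemma chain_copy k l (R : seq F) : exists bs cs : nat -> Ks,
  forall i, (l <= i <= l + k)%N -> okc R bs cs i /\
   ((i < l + k)%N -> cs i = bs i.+1 * js (f i.+1) /\ sd (cs i.+1) (cs i)).
Proof.
elim: k l R => [|k IH] l R.
  have [cs [h1 h2 h3]] := cut_copy R (Vc l) (c_sd1 l).
  have [y y0 ly] := expint_exists cs.
  exists (fun=> `|y|), (fun=> cs) => i; rewrite addn0 -eqn_leq => /eqP <-; rewrite ltnn; split=> //.
  by split=> //; rewrite ?normr_gt0 ?ld_abs.
pose g := f l.+1.
(* Comparing [q] with [c l] amounts to locating [c l.+1] relative to the logarithmic derivative of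
   [q / g], so the tests are translated one step along the chain. The test against [lF g] excludes
   cancellation in [ld_next]. *)
have [bs [cs H]] := IH l.+1 (R ++ lF g :: [seq lF (q / g) | q <- 1 :: R]).
have [|[p1 p2 p3 p4 p5] _] := H l.+1; first by rewrite leqnn leq_addr.
have gn : g != 0 := f0 l.+1.
have bs0 : bs l.+1 != 0 by rewrite gt_eqF.
have b0 : b l.+1 != 0 by rewrite gt_eqF.
pose u := bs l.+1 * js g.
have cl0 : c l != 0 by apply: sd_neq0 (c_sd1 l).
have u0 : u != 0 by rewrite mulf_neq0 ?fmorph_eq0.
have agu q : q \in 1 :: R -> agree q (c l) u.
  move=> qR; have [->|q0] := eqVneq q 0; first by left; rewrite !rmorph0 /sd !dmx0.
  have qn : io q != 0 by rewrite fmorph_eq0.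
  have qn' : js q != 0 by rewrite fmorph_eq0.
  have x0 : io q / c l != 0 by rewrite mulf_neq0 ?invr_eq0.
  have xs0 : js q / u != 0 by rewrite mulf_neq0 ?invr_eq0.
  have [||||||||[h1 h2]|[h1 h2]] := @cmp_ld (io q / c l) (js q / u) (lF (q / g)) (-1) (c l.+1) (cs l.+1) 0 0 x0 xs0 isT.
  - rewrite ldf // cS ldM ?fmorph_eq0 // addr0 mulN1r -!ld_io // rmorphM fmorphV ldf ?fmorph_eq0 //.
    by rewrite opprD addrA addrAC -/g.
  - rewrite ldf // /u ldM ?fmorph_eq0 // p2 addr0 mulN1r -!ld_io // rmorphM fmorphV ldf ?fmorph_eq0 //.
    by rewrite opprD addrA addrAC.
  - by rewrite /sd dmx0 (sd_neq0 (c_sd1 _)).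
  - by rewrite /sd dmx0 (sd_neq0 p4).
  - by apply: p5; rewrite mem_cat inE; apply/orP; right; apply/orP; right; apply/mapP; exists q.
  - exact: p3.
  - exact: c_sd1.
  - exact: p4.
  - by right; move: h1 h2; rewrite !sd1_div.
  - by left; move: h1 h2; rewrite !sd_div1.
have u1 : sd 1 u.
  have := agu 1 (mem_head _ _); rewrite /agree !rmorph1 => -[[]//|[h _]].
  by have := sd_trans h (c_sd1 l); rewrite /sd dmxx.
have dec : sd (cs l.+1) u.
  rewrite -p2; apply: ld_next; rewrite ?fmorph_eq0 // p2 ld_io //.
  by apply: (proj2 (agree_nasy (p5 _ _))); rewrite mem_cat inE eqxx orbT.
have [y y0 ly] := expint_exists u.
exists (fun i => if i == l then `|y| else bs i), (fun i => if i == l then u else cs i) => i.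
have [-> _|il] := eqVneq i l.
  split.
    split; rewrite ?eqxx ?normr_gt0 ?ld_abs //.
      by rewrite cS !pmulr_rgt0 ?posE.
    by move=> q qR; apply: agu; rewrite inE qR orbT.
  by move=> _; rewrite (gtn_eqF (ltnSn l)).
rewrite leq_eqVlt eq_sym (negPf il) /= addnS -addSn => hi.
have [[q1 q2 q3 q4 q5] h2] := H i hi.
have li : (l < i)%N by case/andP: hi.
split.
  split; rewrite ?(negPf il) // => q qR.
  by apply: q5; rewrite mem_cat qR.
by move=> /h2; rewrite (gtn_eqF (leqW li)).
Qed.

Definition sysn (M : dhlField) (j : F -> M) (x : nat -> M) n :=
  forall i, (i.+1 < n)%N -> dd (x i) = x i * (x i.+1 * j (f i.+1)).

Definition pv (M : dhlField) (j : F -> M) n (P : {mpoly F[n]}) (x : nat -> M) : M :=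
  (map_mpoly j P).@[fun i : 'I_n => x i].

Section Ev.
Variables (M : dhlField) (j : {rmorphism F -> M}) (x : nat -> M) (n : nat).
Implicit Types P Q : {mpoly F[n]}.
Lemma pvC a : pv j (a%:MP : {mpoly F[n]}) x = j a.
Proof. by rewrite /pv map_mpolyC mevalC. Qed.
Lemma pvX (i : 'I_n) : pv j ('X_i : {mpoly F[n]}) x = x i.
Proof. by rewrite /pv map_mpolyX mevalXU. Qed.
Lemma pvD P Q : pv j (P + Q) x = pv j P x + pv j Q x.
Proof. by rewrite /pv (rmorphD (map_mpoly j)) /= mevalD. Qed.
Lemma pvM P Q : pv j (P * Q) x = pv j P x * pv j Q x.
Proof. by rewrite /pv (rmorphM (map_mpoly j)) /= mevalM. Qed.
Lemma pvN P : pv j (- P) x = - pv j P x.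
Proof. by rewrite /pv (rmorphN (map_mpoly j)) /= mevalN. Qed.
End Ev.

Lemma pv_widen n n' (P : {mpoly F[n]}) : (n <= n')%N -> exists Q : {mpoly F[n']},
  forall (M : dhlField) (j : {rmorphism F -> M}) x, pv j P x = pv j Q x.
Proof.
move=> nn; elim/mpoly_ringind: P => [a|i|P Q [P1 h1] [Q1 h2]|P Q [P1 h1] [Q1 h2]].
- by exists a%:MP => M j x; rewrite !pvC.
- by exists 'X_(widen_ord nn i) => M j x; rewrite !pvX.
- by exists (P1 + Q1) => M j x; rewrite !pvD h1 h2.
- by exists (P1 * Q1) => M j x; rewrite !pvM h1 h2.
Qed.

Lemma pv_der n (P : {mpoly F[n]}) : exists Q : {mpoly F[n.+1]},
  forall (M : dhlField) (j : {rmorphism F -> M}), dext dF j -> forall x, sysn j x n.+1 ->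
  dd (pv j P x) = pv j Q x.
Proof.
elim/mpoly_ringind: P => [a|i|P Q [P1 h1] [Q1 h2]|P Q [P1 h1] [Q1 h2]].
- by exists (dF a)%:MP => M j jd x _; rewrite !pvC jd.
- exists ('X_(widen_ord (leqnSn n) i) * ('X_(lift ord0 i) * (f i.+1)%:MP)) => M j jd x hx.
  by rewrite !pvM !pvX pvC hx //= ltnS.
- by exists (P1 + Q1) => M j jd x hx; rewrite !pvD ddD (h1 M j jd x hx) (h2 M j jd x hx).
- have [P2 h3] := pv_widen P (leqnSn n); have [Q2 h4] := pv_widen Q (leqnSn n).
  exists (P1 * Q2 + P2 * Q1) => M j jd x hx.
  by rewrite pvD !pvM ddM (h1 M j jd x hx) (h2 M j jd x hx) h3 h4.
Qed.

Lemma term_chain (t : dterm (option F)) : exists n (P : {mpoly F[n]}),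
  forall (M : dhlField) (j : {rmorphism F -> M}), dext dF j -> forall x, sysn j x n ->
  dev (asn j (x 0%N)) t = pv j P x.
Proof.
have sysW (M : dhlField) (j : F -> M) x n n' : (n <= n')%N -> sysn j x n' -> sysn j x n.
  by move=> nn h i hi; apply: h; apply: leq_trans nn.
elim: t => [[a|]|||t [n [P h]]|t [n [P h]]|t [n [P h]] s [n' [Q h']]|t [n [P h]] s [n' [Q h']]].
- by exists 0%N, a%:MP => M j jd x _; rewrite pvC.
- by exists 1%N, 'X_ord0 => M j jd x _; rewrite pvX.
- by exists 0%N, 0 => M j jd x _; rewrite -mpolyC0 pvC rmorph0.
- by exists 0%N, 1 => M j jd x _; rewrite -mpolyC1 pvC rmorph1.
- by exists n, (- P) => M j jd x hx; rewrite pvN /= (h M j jd x hx).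
- have [Q hQ] := pv_der P; exists n.+1, Q => M j jd x hx.
  by rewrite /= (h M j jd x (sysW _ _ _ _ _ (leqnSn n) hx)) (hQ M j jd x hx).
- have [P1 h1] := pv_widen P (leq_maxl n n'); have [Q1 h2] := pv_widen Q (leq_maxr n n').
  exists (maxn n n'), (P1 + Q1) => M j jd x hx.
  rewrite pvD /= (h M j jd x (sysW _ _ _ _ _ (leq_maxl _ _) hx)).
  by rewrite (h' M j jd x (sysW _ _ _ _ _ (leq_maxr _ _) hx)) h1 h2.
- have [P1 h1] := pv_widen P (leq_maxl n n'); have [Q1 h2] := pv_widen Q (leq_maxr n n').
  exists (maxn n n'), (P1 * Q1) => M j jd x hx.
  rewrite pvM /= (h M j jd x (sysW _ _ _ _ _ (leq_maxl _ _) hx)).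
  by rewrite (h' M j jd x (sysW _ _ _ _ _ (leq_maxr _ _) hx)) h1 h2.
Qed.

Definition mu (M : dhlField) n (x : nat -> M) (m : 'X_{1..n}) : M := \prod_(i < n) x i ^+ m i.

Lemma ld_mu (M : dhlField) n (x : nat -> M) (m : 'X_{1..n}) :
  (forall i, (i < n)%N -> x i != 0) ->
  logder (@dd M) (mu x m) = \sum_(i < n) logder (@dd M) (x i) *+ m i.
Proof.
move=> hx; rewrite /mu; suff [] : \prod_(i < n) x i ^+ m i != 0 /\
  logder (@dd M) (\prod_(i < n) x i ^+ m i) = \sum_(i < n) logder (@dd M) (x i) *+ m i by [].
apply: (big_rec2 (fun p s => p != 0 /\ logder (@dd M) p = s)).
  by rewrite oner_neq0 ld1.
move=> i s p _ [p0 E]; have xi : x i != 0 by apply: hx.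
by rewrite mulf_neq0 ?expf_neq0 // ldM ?expf_neq0 // ldX // E.
Qed.

(** The exponents before [i0] cancel in the quotient, and the later logarithmic derivatives are
    smaller than that of [x i0]. *)
Lemma mono_ld (M : dhlField) (j : {rmorphism F -> M}) n (x : nat -> M) q q' (m m' : 'X_{1..n}) (i0 : 'I_n) :
  dext dF j -> (forall i, (i < n)%N -> x i != 0) ->
  (forall i, (i0 < i < n)%N -> sd (logder (@dd M) (x i)) (logder (@dd M) (x i0))) ->
  logder (@dd M) (x i0) != 0 ->
  q != 0 -> q' != 0 -> (forall i : 'I_n, (i < i0)%N -> m i = m' i) ->
  exists r, sd r (logder (@dd M) (x i0)) /\
    logder (@dd M) (j q * mu x m / (j q' * mu x m')) =
    j (lF q - lF q') + ((m i0)%:Z - (m' i0)%:Z)%:~R * logder (@dd M) (x i0) + r.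
Proof.
move=> jd x0 dec l0 q0 q0' eqm.
have mu0 (m1 : 'X_{1..n}) : mu x m1 != 0.
  by apply/prodf_neq0 => i _; rewrite expf_neq0 // x0.
pose y i := logder (@dd M) (x i).
exists (\sum_(i < n | i != i0) (y i *+ m i - y i *+ m' i)); split.
  apply: sd_sum => // i ne.
  have [ii|ii|ii] := ltngtP i i0.
  - by rewrite eqm // subrr /sd dmx0.
  - apply: sdB; rewrite -mulr_natl -[X in sd _ X]mul1r; apply: dm_sdM; rewrite ?dm_nat ?oner_neq0 //;
      by apply: dec; rewrite ii ltn_ord.
  - by case/eqP: ne; apply: ord_inj.
rewrite ldf ?mulf_neq0 ?fmorph_eq0 // !ldM ?fmorph_eq0 // !ld_mu // !ld_io // rmorphB.
have -> : \sum_(i < n | i != i0) (y i *+ m i - y i *+ m' i) =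
   \sum_(i < n) y i *+ m i - \sum_(i < n) y i *+ m' i - (y i0 *+ m i0 - y i0 *+ m' i0).
  by rewrite -sumrB [in RHS](bigD1 i0) //= [RHS]addrAC subrr add0r.
rewrite rmorphB /= mulrBl -!pmulrn !mulr_natl -/(y i0).
move: (\sum_(i < n) _) (\sum_(i < n) _) (y i0 *+ _) (y i0 *+ _) (j _) (j _) => A B C D E G.
ring.
Qed.

Lemma c_dec_lt i k : (i < k)%N -> sd (c k) (c i).
Proof.
elim: k => // k IH; rewrite ltnS leq_eqVlt => /orP[/eqP ->|/IH h]; first exact: c_dec.
exact: sd_trans (c_dec k) h.
Qed.

(** Finitely many terms involve only a finite segment of the chain, and the order between two
    monomials is decided at the first index where their exponents differ. *)
Lemma chain_match : tmatch io js (b 0%N).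
Proof.
move=> n ts; have [ns hns] := choice (fun i => term_chain (ts i)).
pose N := \max_(i < n) ns i.
have /choice[P hP] : forall i, exists P : {mpoly F[N.+1]},
    forall (M : dhlField) (j : {rmorphism F -> M}), dext dF j -> forall x, sysn j x N.+1 ->
    dev (asn j (x 0%N)) (ts i) = pv j P x.
  move=> i; have [P0 h0] := hns i.
  have le : (ns i <= N.+1)%N by apply: leqW; apply: (@leq_bigmax _ ns).
  have [Q hQ] := pv_widen P0 le.
  exists Q => M j jd x hx; rewrite -hQ; apply: h0 => // k hk.
  by apply: hx; apply: leq_trans le.
pose cf := flatten [seq [seq (P i)@_m | m <- msupp (P i)] | i <- enum 'I_n].
have cfP i m : m \in msupp (P i) -> (P i)@_m \in cf.
  move=> h; apply/flattenP; exists [seq (P i)@_m | m <- msupp (P i)]; last exact: map_f.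
  by apply/mapP; exists i => //; rewrite mem_enum.
have [bs [cs H]] := chain_copy N 0 [seq lF q - lF q' | q <- cf, q' <- cf].
have Hi i : (i <= N)%N -> okc [seq lF q - lF q' | q <- cf, q' <- cf] bs cs i.
  by move=> iN; have [] := H i iN.
have Hn i : (i < N)%N -> cs i = bs i.+1 * js (f i.+1) /\ sd (cs i.+1) (cs i).
  by move=> iN; have [_] := H i (ltnW iN); apply.
have sysK : sysn io b N.+1.
  by move=> i _; rewrite -cS dd_ld // gt_eqF.
have sysS : sysn js bs N.+1.
  move=> i; rewrite ltnS => iN; have [e _] := Hn i iN; have [p1 p2 _ _ _] := Hi i (ltnW iN).
  by rewrite -e -p2 dd_ld // gt_eqF.
exists (bs 0%N).
have bsn i : (i < N.+1)%N -> bs i != 0 by rewrite ltnS => /Hi[p _ _ _ _]; rewrite gt_eqF.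
have bn i : (i < N.+1)%N -> b i != 0 by move=> _; rewrite gt_eqF.
have csdec i k : (i < k < N.+1)%N -> sd (cs k) (cs i).
  elim: k => // k IH /andP[]; rewrite ltnS leq_eqVlt => /orP[/eqP ->|h] kN.
    by case: (Hn k kN).
  by apply: sd_trans (proj2 (Hn k kN)) _; apply: IH; rewrite h ltnW.
have ldbs i : (i < N.+1)%N -> ldS (bs i) = cs i by rewrite ltnS => /Hi[].
have pvE (M : dhlField) (j : {rmorphism F -> M}) x i :
    pv j (P i) x = \sum_(m <- msupp (P i)) j (P i)@_m * mu x m.
  rewrite /pv {1}(mpolyE (P i)) (raddf_sum (map_mpoly j)) /= (rmorph_sum (meval _)) /=.
  apply: eq_bigr => m _.
  by rewrite -mul_mpolyC (rmorphM (map_mpoly j)) /= map_mpolyC map_mpolyX mevalM mevalC mevalX.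
(* The case distinction makes positivity of the copied monomials immediate; its condition holds for
   [bs]. *)
apply: (@monomial_match _ _ _ _ _ posE dmE _ (@mu K N.+1 b) (fun m => if [forall i : 'I_N.+1, 0 < bs i] then @mu Ks N.+1 bs m else 1) _ _ _ _
  (fun i => msupp (P i)) (fun i m => (P i)@_m)).
- by move=> m; apply: prodr_gt0 => i _; rewrite exprn_gt0.
- move=> m; case: ifP => // /forallP h; apply: prodr_gt0 => i _; rewrite exprn_gt0 //.
- by move=> i; apply: msupp_uniq.
- by move=> i m; rewrite mcoeff_msupp.
- by move=> i; rewrite (hP i K io iod b sysK) pvE.
- move=> i; rewrite (hP i Ks js jsd bs sysS) pvE.
  rewrite (_ : [forall i : 'I_N.+1, 0 < bs i]) //; apply/forallP => k.
  by have [] := Hi k (ltn_ord k).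
move=> i m i' m' ms ms' ne.
rewrite (_ : [forall i : 'I_N.+1, 0 < bs i]); last first.
  by apply/forallP => k; have [] := Hi k (ltn_ord k).
have q0 : (P i)@_m != 0 by rewrite -mcoeff_msupp.
have q0' : (P i')@_m' != 0 by rewrite -mcoeff_msupp.
have agR : (lF (P i)@_m - lF (P i')@_m') \in [seq lF q - lF q' | q <- cf, q' <- cf].
  by apply/allpairsP; exists ((P i)@_m, (P i')@_m'); split=> //=; apply: cfP.
have [k0 k0P mink] : exists2 k0 : 'I_N.+1, m k0 != m' k0 & forall k : 'I_N.+1, (k < k0)%N -> m k = m' k.
  have [|k [[kN hk] mk]] := @nat_min (fun k => exists kN : (k < N.+1)%N, m (Ordinal kN) != m' (Ordinal kN)).
    apply: contrapT => no; case/eqP: ne; apply/mnmP => k; apply/eqP/negPn/negP => hk; apply: no.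
    by exists k, (ltn_ord k); rewrite (_ : Ordinal _ = k) //; apply: ord_inj.
  exists (Ordinal kN) => // l lk; apply/eqP/negPn/negP => hl.
  have kl : (k <= l)%N.
    by apply: mk; exists (ltn_ord l); rewrite (_ : Ordinal _ = l) //; apply: ord_inj.
  by have := leq_trans lk kl; rewrite ltnn.
have k0N : (k0 <= N)%N := ltn_ord k0.
have [o1 o2 o3 o4 o5] := Hi k0 k0N.
have [|||||r [r1 E1]] := @mono_ld K io N.+1 b (P i)@_m (P i')@_m' m m' k0 iod bn.
- by move=> k /andP[h _]; apply: c_dec_lt.
- exact: sd_neq0 (c_sd1 k0).
- exact: q0.
- exact: q0'.
- exact: mink.
have [|||||rs [rs1 Es]] := @mono_ld Ks js N.+1 bs (P i)@_m (P i')@_m' m m' k0 jsd bsn.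
- by move=> k hk; rewrite !ldbs //; [apply: csdec|case/andP: hk].
- by rewrite ldbs //; apply: sd_neq0 o4.
- exact: q0.
- exact: q0'.
- exact: mink.
rewrite !ldbs // in rs1 Es.
have muK (m1 : 'X_{1..N.+1}) : mu b m1 != 0.
  by apply/prodf_neq0 => k _; rewrite expf_neq0 // gt_eqF.
have muS (m1 : 'X_{1..N.+1}) : mu bs m1 != 0.
  by apply/prodf_neq0 => k _; rewrite expf_neq0 // bsn.
have d0 : ((m k0)%:Z - (m' k0)%:Z)%R != 0 by rewrite subr_eq0; apply: contra k0P => /eqP [->].
have vK : io (P i)@_m * mu b m != 0 by rewrite mulf_neq0 ?fmorph_eq0.
have vK' : io (P i')@_m' * mu b m' != 0 by rewrite mulf_neq0 ?fmorph_eq0.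
have vS : js (P i)@_m * mu bs m != 0 by rewrite mulf_neq0 ?fmorph_eq0.
have vS' : js (P i')@_m' * mu bs m' != 0 by rewrite mulf_neq0 ?fmorph_eq0.
have dK0 : io (P i)@_m * mu b m / (io (P i')@_m' * mu b m') != 0 by rewrite mulf_neq0 ?invr_eq0.
have dS0 : js (P i)@_m * mu bs m / (js (P i')@_m' * mu bs m') != 0 by rewrite mulf_neq0 ?invr_eq0.
rewrite -(asy_div1 _ vK') -(dm_div1 _ vK') -(dm_div1 _ vS').
have := cmp_ld dK0 dS0 d0 E1 Es r1 rs1 (o5 _ agR) o3 (c_sd1 k0) o4.
move: (io _ * _ / _) (js _ * _ / _) => X Xs [[h1 h2]|[h1 h2]].
  by rewrite asyNsd h1 andbF; split=> //; rewrite (negPf h1) (negPf h2).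
by rewrite asyNsd h1; split=> //; rewrite (sdW h1) (sdW h2).
Qed.

End Chain.

(** For new [x] the logarithmic derivative is outside [F], so it becomes new after subtracting some
    [a]. An exponential integral [u] of [a] has the size of some [f] in [F], and dividing [x] by [f]
    instead of [u] changes the logarithmic derivative by at most size 1, which is negligible. So
    [x / f] has a new logarithmic derivative, and the construction repeats. *)
Lemma chain_step x0 : newv x0 -> (forall x e, newv x -> ldK x != io e) ->
  (forall x, (forall a, x != io a) -> exists a, newv (x - io a)) ->
  exists2 b, (forall x, b != io x) & tmatch io js b.
Proof.
move=> V0 noexp noimm.
have step x : exists f, newv x -> [/\ f != 0, 0 < x / io f & newv (ldK (x / io f))].
  have [Vx|] := pselect (newv x); last by exists 0.
  have [a Va] := noimm _ (fun e => noexp x e Vx).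
  have [u u0 lu] := expint_exists (io a).
  have [f fn uf] : exists2 f, f != 0 & asy u (io f).
    apply: contrapT => no.
    have Vu : newv u by split=> // f fn; apply/negP => h; apply: no; exists f.
    by have := noexp u a Vu; rewrite lu eqxx.
  have xn : x != 0 by case: Vx.
  have fn' : io f != 0 by rewrite fmorph_eq0.
  have good g : g != 0 -> asy (io g) (io f) -> newv (ldK (x / io g)).
    move=> gn gf; have gn' : io g != 0 by rewrite fmorph_eq0.
    have h1 : sd 1 (ldK (x / io g)).
      by have := newv1 (newv_div gn Vx); rewrite asy1_ld // mulf_neq0 ?invr_eq0.
    have w1 : dm (ldK (u / io g)) 1.
      by rewrite -asy1_ld ?mulf_neq0 ?invr_eq0 // asy_div1 // (asy_trans uf) // asy_sym.
    have E : ldK x - io a = ldK (x / io g) - ldK (u / io g).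
      by rewrite !ldf // lu; ring.
    apply: newv_asy Va; rewrite E; apply: addr_sd_asy.
    by rewrite sdN; apply: dm_sd_trans w1 h1.
  have [p|p] := ltP 0 (x / io f).
    by exists f => _; split=> //; apply: good.
  exists (- f) => _; split; rewrite ?oppr_eq0 //.
    rewrite rmorphN invrN mulrN oppr_gt0 lt_neqAle p andbT mulf_neq0 ?invr_eq0 //.
  by apply: good; rewrite ?oppr_eq0 // rmorphN /asy dmN dmNr dmxx.
have [g hg] := choice step.
pose nx (x : K) := ldK (x / io (g x)).
pose x i := iter i nx x0.
have Vx i : newv (x i) by elim: i => //= i IH; have [] := hg _ IH.
pose b i := x i / io (g (x i)).
have bP i : [/\ g (x i) != 0, 0 < b i & newv (ldK (b i))] := hg _ (Vx i).
exists (b 0%N).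
  by move=> y; apply: newv_notin; apply: newv_div; [case: (bP 0%N)|exact: Vx].
apply: (@chain_match (fun i => g (x i)) _ b).
- by move=> i; case: (bP i).
- by move=> i; case: (bP i).
- by move=> i; apply: newv_div; [case: (bP i)|exact: Vx].
- by move=> i; case: (bP i).
- move=> i; rewrite /b divfK // fmorph_eq0; by case: (bP i.+1).
Qed.

End Values.

Theorem extension_step (F : fieldType) (dF : F -> F) (K Ks : dhlField)
  (io : {rmorphism F -> K}) (js : {rmorphism F -> Ks}) :
  dext dF io -> dext dF js ->
  (forall x, (0 < io x) = (0 < js x)) ->
  (forall x y, dm (io x) (io y) = dm (js x) (js y)) ->
  (forall u, dm u 1 -> exists x, sd (u - io x) 1) ->
  (exists b, forall x, b != io x) ->
  exists2 b, (forall x, b != io x) & tmatch io js b.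
Proof.
move=> iod jsd posE dmE resF [b0 hb0].
have [divF|] := pselect (forall (f : F) k, f != 0 -> exists2 f' : F, f' != 0 & asy (io f' ^+ k.+1) (io f)); last first.
  move=> /existsNP[f /existsNP[k /not_implyP[fn no]]].
  apply: (root_step iod jsd posE dmE fn (k0 := k)) => f' fn'; apply/negP => h.
  by apply: no; exists f'.
have [[b imm]|noimm] := pselect (exists b, forall a, exists2 f, f != 0 & asy (b - io a) (io f)).
  exact: (immediate_step iod jsd posE dmE imm resF divF).
(* If all differences [x - io a] had sizes from [F], then [x] would define an immediate cut. *)
have NI x : (forall a, x != io a) -> exists a, newv io (x - io a).
  move=> hx; apply: contrapT => no; apply: noimm; exists x => a.
  apply: contrapT => no'; apply: no; exists a; split; first by rewrite subr_eq0.
  by move=> f fn; apply/negP => h; apply: no'; exists f.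
have [a Va] := NI _ hb0.
have [[x [e [Vx ex]]]|noexp] := pselect (exists x e, newv io x /\ logder (@dd K) x = io e).
  exact: (expint_step iod jsd posE dmE divF Vx ex).
apply: (chain_step iod jsd posE dmE Va) => // x e Vx; apply/eqP => ex; apply: noexp.
by exists x, e.
Qed.

(** * Ultraproducts *)

Record lmod := LMod {
  lK :> dhlField;
  lk : {pred lK};
  lkP : residue_lift (@dd lK) (dO lK) lk }.
Arguments lk : clear implicits.
Arguments lkP : clear implicits.

Section UltraFilterFacts.

Variables (I : Type) (U : set_system I).
Hypothesis UU : UltraFilter U.
Implicit Types P Q : I -> Prop.

Lemma uF : Filter U. Proof. exact: (@filter_filter _ _ (@ultra_proper _ _ UU)). Qed.
Lemma uT P : (forall i, P i) -> U P.
Proof. by move=> h; apply: (@filterS _ _ uF setT) => //; apply: (@filterT _ _ uF). Qed.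
Lemma uS P Q : (forall i, P i -> Q i) -> U P -> U Q. Proof. exact: (@filterS _ _ uF). Qed.
Lemma uI P Q : U P -> U Q -> U (fun i => P i /\ Q i).
Proof. by move=> h1 h2; apply: (@filterI _ _ uF P Q). Qed.
Lemma uS2 P Q R : (forall i, P i -> Q i -> R i) -> U P -> U Q -> U R.
Proof. by move=> h h1 h2; apply: uS (uI h1 h2) => i []; apply: h. Qed.
Lemma uN P : ~ U P -> U (fun i => ~ P i).
Proof. by move=> h; case: (in_ultra_setVsetC P UU) => //. Qed.
Lemma uex P : U P -> exists i, P i.
Proof.
move=> h; apply: contrapT => no; apply: (@filter_not_empty _ _ (@ultra_proper _ _ UU)).
by apply: uS h => i hi; apply: no; exists i.
Qed.
Lemma uall (X : eqType) (s : seq X) (P : X -> I -> Prop) :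
  (forall x, x \in s -> U (P x)) -> U (fun i => forall x, x \in s -> P x i).
Proof.
elim: s => [|a s IH] h; first by apply: uT.
have h1 : U (P a) by apply: h; rewrite mem_head.
have h2 := IH (fun x (xs : x \in s) => h x (@mem_behead _ (a :: s) x xs)).
by apply: uS2 h1 h2 => i h3 h4 x; rewrite inE => /predU1P[->|/h4].
Qed.
Lemma uallF (X : finType) (P : X -> I -> Prop) :
  (forall x, U (P x)) -> U (fun i => forall x, P x i).
Proof.
move=> h; apply: uS (@uall X (enum X) P (fun x _ => h x)) => i hi x.
by apply: hi; rewrite mem_enum.
Qed.

End UltraFilterFacts.

Section Ultraproduct.

Variables (I : Type) (U : set_system I).
Hypothesis UU : UltraFilter U.
Variable Ms : I -> lmod.
Local Notation pt := (forall i, Ms i).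

Definition eqU (f g : pt) : Prop := U (fun i => f i = g i).

Lemma eqU_eq f g : eqU f g -> eqU f = eqU g.
Proof.
move=> h; apply/funext => k; apply/propext; split=> h'.
  by apply: (uS2 UU) h h' => i -> .
by apply: (uS2 UU) h h' => i ->.
Qed.

(** Classes are represented as predicates. The ultrafilter is an argument of the type so that the
    field structure, which depends on it, can be attached. *)
Definition upt (u : UltraFilter U) : Type := {C : pt -> Prop | exists f, C = eqU f}.
Local Notation T := (upt UU).
Definition cl (f : pt) : T := exist _ (eqU f) (ex_intro _ f erefl).

Lemma cl_eq f g : cl f = cl g <-> U (fun i => f i = g i).
Proof.
split=> [[e]|h]; last by apply: eq_exist; apply: eqU_eq.
by rewrite -/(eqU f g) e; apply: (uT UU).
Qed.

Lemma clP (x : T) : exists f, x = cl f.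
Proof. by case: x => C hC; case: (hC) => f e; exists f; apply: eq_exist. Qed.

Definition rep (x : T) : pt := sval (cid (clP x)).
Lemma repK x : cl (rep x) = x. Proof. by rewrite /rep; case: cid. Qed.
Lemma rep_cl f : U (fun i => rep (cl f) i = f i). Proof. by apply/cl_eq; rewrite repK. Qed.

Lemma uchoice (P : forall i, Ms i -> Prop) : U (fun i => exists x, P i x) ->
  exists f : pt, U (fun i => P i (f i)).
Proof.
move=> h; pose f i : Ms i := if pselect (exists x, P i x) is left e then sval (cid e) else 0.
exists f; apply: (uS UU) h => i e; rewrite /f; case: pselect => // e'.
by case: cid.
Qed.

Definition op1 (h : forall i, Ms i -> Ms i) (x : T) : T := cl (fun i => h i (rep x i)).
Definition op2 (h : forall i, Ms i -> Ms i -> Ms i) (x y : T) : T := cl (fun i => h i (rep x i) (rep y i)).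
Definition rl1 (R : forall i, Ms i -> Prop) (x : T) : Prop := U (fun i => R i (rep x i)).
Definition rl2 (R : forall i, Ms i -> Ms i -> Prop) (x y : T) : Prop := U (fun i => R i (rep x i) (rep y i)).

Lemma op1E h f : op1 h (cl f) = cl (fun i => h i (f i)).
Proof. by apply/cl_eq; apply: (uS UU) (rep_cl f) => i ->. Qed.
Lemma op2E h f g : op2 h (cl f) (cl g) = cl (fun i => h i (f i) (g i)).
Proof. by apply/cl_eq; apply: (uS2 UU) (rep_cl f) (rep_cl g) => i -> ->. Qed.
Lemma rl1E R f : rl1 R (cl f) <-> U (fun i => R i (f i)).
Proof. by split=> h; apply: (uS2 UU) (rep_cl f) h => i ->. Qed.
Lemma rl2E R f g : rl2 R (cl f) (cl g) <-> U (fun i => R i (f i) (g i)).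
Proof.
have h := uI UU (rep_cl f) (rep_cl g).
by split=> h'; apply: (uS2 UU) h h' => i [-> ->].
Qed.

HB.instance Definition _ := gen_eqMixin T.
HB.instance Definition _ := gen_choiceMixin T.

Definition uadd := op2 (fun i a b => a + b).
Definition umul := op2 (fun i a b => a * b).
Definition uopp := op1 (fun i a => - a).
Definition uinv := op1 (fun i a => a^-1).
Ltac fe := congr cl; apply: functional_extensionality_dep => i.

Lemma uaddA : associative uadd.
Proof.
move=> x y z; have [f ->] := clP x; have [g ->] := clP y; have [h ->] := clP z.
by rewrite /uadd !op2E; fe; rewrite addrA.
Qed.
Lemma uaddC : commutative uadd.
Proof.
move=> x y; have [f ->] := clP x; have [g ->] := clP y.
by rewrite /uadd !op2E; fe; rewrite addrC.
Qed.
Lemma uadd0 : left_id (cl (fun i => 0)) uadd.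
Proof. by move=> x; have [f ->] := clP x; rewrite /uadd op2E; fe; rewrite add0r. Qed.
Lemma uaddN : left_inverse (cl (fun i => 0)) uopp uadd.
Proof. by move=> x; have [f ->] := clP x; rewrite /uopp op1E /uadd op2E; fe; rewrite addNr. Qed.
HB.instance Definition _ := GRing.isZmodule.Build T uaddA uaddC uadd0 uaddN.

Lemma umulA : associative umul.
Proof.
move=> x y z; have [f ->] := clP x; have [g ->] := clP y; have [h ->] := clP z.
by rewrite /umul !op2E; fe; rewrite mulrA.
Qed.
Lemma umulC : commutative umul.
Proof.
move=> x y; have [f ->] := clP x; have [g ->] := clP y.
by rewrite /umul !op2E; fe; rewrite mulrC.
Qed.
Lemma umul1 : left_id (cl (fun i => 1)) umul.
Proof. by move=> x; have [f ->] := clP x; rewrite /umul op2E; fe; rewrite mul1r. Qed.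
Lemma umulD : left_distributive umul (@GRing.add T).
Proof.
move=> x y z; have [f ->] := clP x; have [g ->] := clP y; have [h ->] := clP z.
rewrite /GRing.add /= /umul /uadd !op2E; fe; by rewrite mulrDl.
Qed.
Lemma uone0 : cl (fun i => 1) != 0 :> T.
Proof.
apply/eqP => /cl_eq /(uex UU)[i] /eqP; by rewrite oner_eq0.
Qed.
HB.instance Definition _ := GRing.Zmodule_isComNzRing.Build T umulA umulC umul1 umulD uone0.

Lemma umulV (x : T) : x != 0 -> uinv x * x = 1.
Proof.
have [f ->] := clP x; move=> f0; rewrite /uinv op1E /GRing.mul /= /umul op2E; apply/cl_eq.
have /(uN UU) : ~ U (fun i => f i = 0) by move=> h; case/eqP: f0; apply/cl_eq.
by apply: (uS UU) => i /eqP h; rewrite mulVf.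
Qed.
Lemma uinv0 : uinv 0 = 0.
Proof. by rewrite /uinv /GRing.zero /= op1E; fe; rewrite invr0. Qed.
HB.instance Definition _ := GRing.ComNzRing_isField.Build T umulV uinv0.

Lemma clD f g : cl f + cl g = cl (fun i => f i + g i). Proof. exact: op2E. Qed.
Lemma clM f g : cl f * cl g = cl (fun i => f i * g i). Proof. exact: op2E. Qed.
Lemma clN f : - cl f = cl (fun i => - f i). Proof. exact: op1E. Qed.
Lemma clV f : (cl f)^-1 = cl (fun i => (f i)^-1). Proof. exact: op1E. Qed.
Lemma cl0 : 0 = cl (fun i => 0). Proof. by []. Qed.
Definition ule (x y : T) : bool := `[< rl2 (fun i a b => a <= b) x y >].
Definition unorm : T -> T := op1 (fun i a => `|a|).
Lemma uleE f g : ule (cl f) (cl g) <-> U (fun i => f i <= g i).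
Proof. by rewrite /ule; split=> [/asboolP /rl2E //|h]; apply/asboolP/rl2E. Qed.

Lemma ule0_add (x y : T) : ule 0 x -> ule 0 y -> ule 0 (x + y).
Proof.
have [f ->] := clP x; have [g ->] := clP y; rewrite clD cl0 => /uleE h1 /uleE h2; apply/uleE.
by apply: (uS2 UU) h1 h2 => i h3 h4; rewrite addr_ge0.
Qed.
Lemma ule0_mul (x y : T) : ule 0 x -> ule 0 y -> ule 0 (x * y).
Proof.
have [f ->] := clP x; have [g ->] := clP y; rewrite clM cl0 => /uleE h1 /uleE h2; apply/uleE.
by apply: (uS2 UU) h1 h2 => i h3 h4; rewrite mulr_ge0.
Qed.
Lemma ule0_anti (x : T) : ule 0 x -> ule x 0 -> x = 0.
Proof.
have [f ->] := clP x; rewrite cl0 => /uleE h1 /uleE h2; apply/cl_eq.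
by apply: (uS2 UU) h1 h2 => i h3 h4; apply/eqP; rewrite eq_le h3 h4.
Qed.
Lemma usub_ge0 (x y : T) : ule 0 (y - x) = ule x y.
Proof.
have [f ->] := clP x; have [g ->] := clP y; rewrite clN clD cl0.
by apply/idP/idP => /uleE h; apply/uleE; apply: (uS UU) h => i; rewrite subr_ge0.
Qed.
Lemma ule0_total (x : T) : ule 0 x || ule x 0.
Proof.
have [f ->] := clP x; rewrite cl0; apply/orP.
have [h|/(uN UU) h] := pselect (U (fun i => 0 <= f i)); [left|right]; apply/uleE => //.
by apply: (uS UU) h => i /negP; rewrite -ltNge => /ltW.
Qed.
Lemma unormN (x : T) : unorm (- x) = unorm x.
Proof. by have [f ->] := clP x; rewrite clN /unorm !op1E; fe; rewrite normrN. Qed.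
Lemma uge0_norm (x : T) : ule 0 x -> unorm x = x.
Proof.
have [f ->] := clP x; rewrite cl0 /unorm op1E => /uleE h; apply/cl_eq.
by apply: (uS UU) h => i; apply: ger0_norm.
Qed.
HB.instance Definition _ := Num.IntegralDomain_isLeReal.Build T
  ule0_add ule0_mul ule0_anti usub_ge0 ule0_total unormN uge0_norm (fun _ _ => erefl).

Definition uK : realFieldType := T.

Lemma le_cl f g : (cl f <= cl g :> uK) <-> U (fun i => f i <= g i).
Proof. exact: uleE. Qed.
Lemma lt_cl f g : (cl f < cl g :> uK) <-> U (fun i => f i < g i).
Proof.
rewrite ltNge; split=> [/negP h|h].
  have /(uN UU) : ~ U (fun i => g i <= f i) by move/le_cl.
  by apply: (uS UU) => i /negP; rewrite -ltNge.
apply/negP => /le_cl h'; have [i []] := uex UU (uI UU h h').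
by rewrite leNgt => ->.
Qed.
Lemma eq_cl f g : (cl f = cl g :> uK) <-> U (fun i => f i = g i). Proof. exact: cl_eq. Qed.
Lemma neq_cl f g : (cl f != cl g :> uK) <-> U (fun i => f i != g i).
Proof.
split=> [/eqP h|h].
  by apply: (uS UU) (uN UU (P := fun i => f i = g i) _) => [i /eqP //|]; move/eq_cl.
by apply/eqP => /eq_cl h'; have [i [/eqP]] := uex UU (uI UU h h').
Qed.

Definition uD : uK -> uK := op1 (fun i => @dd (Ms i)).
Definition uO : {pred uK} := fun x : uK => `[< rl1 (fun i a => a \in dO (Ms i)) x >].
Definition uk : {pred uK} := fun x : uK => `[< rl1 (fun i a => a \in lk (Ms i)) x >].
Lemma uDE f : uD (cl f) = cl (fun i => dd (f i)). Proof. exact: op1E. Qed.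
Lemma uOE f : (cl f \in uO) <-> U (fun i => f i \in dO (Ms i)).
Proof. by split=> [/asboolP /rl1E //|h]; apply/asboolP/rl1E. Qed.
Lemma ukE f : (cl f \in uk) <-> U (fun i => f i \in lk (Ms i)).
Proof. by split=> [/asboolP /rl1E //|h]; apply/asboolP/rl1E. Qed.

Lemma dom_cl f g : dominated uO (cl f) (cl g) <-> U (fun i => dm (f i) (g i)).
Proof.
split=> [[c]|h].
  have [h ->] := clP c => /uOE hO; rewrite clM => /eq_cl e.
  by apply: (uS2 UU) hO e => i h1 h2; apply/dm_dom; exists (h i).
have [c /(uS UU) hc] := @uchoice (fun i c => c \in dO (Ms i) /\ f i = c * g i)
   (uS UU (fun i => (fun hi => let: ex_intro2 c h1 h2 := proj2 (dm_dom _ _) hi in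
       ex_intro _ c (conj h1 h2))) h).
exists (cl c); first by apply/uOE; apply: hc => i [].
by rewrite clM; apply/eq_cl; apply: hc => i [].
Qed.
Lemma sdom_cl f g : strictly_dominated uO (cl f) (cl g) <-> U (fun i => sd (f i) (g i)).
Proof.
split=> [[_ h]|h].
  have /(uN UU) : ~ U (fun i => dm (g i) (f i)) by move/dom_cl.
  by apply: (uS UU) => i /negP.
split; first by apply/dom_cl; apply: (uS UU) h => i /sdW.
by move=> /dom_cl h'; have [i []] := uex UU (uI UU h h'); rewrite /sd => /negP.
Qed.
Lemma one_cl : (1 : uK) = cl (fun i => 1). Proof. by []. Qed.
Lemma logder_cl f : logder uD (cl f) = cl (fun i => logder (@dd (Ms i)) (f i)).
Proof. by rewrite /logder uDE clV clM. Qed.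
Lemma iter_cl f n : iter n uD (cl f) = cl (fun i => iter n dd (f i)).
Proof. by elim: n => //= n ->; rewrite uDE. Qed.
Lemma sum_cl (X : Type) (s : seq X) (P : pred X) (E : X -> pt) :
  \sum_(x <- s | P x) cl (E x) = cl (fun i => \sum_(x <- s | P x) E x i) :> uK.
Proof.
elim: s => [|a s IH]; first by rewrite big_nil; fe; rewrite big_nil.
rewrite big_cons; case: ifP => Pa; rewrite IH ?clD; fe; by rewrite big_cons Pa.
Qed.
Lemma prod_cl (X : Type) (s : seq X) (P : pred X) (E : X -> pt) :
  \prod_(x <- s | P x) cl (E x) = cl (fun i => \prod_(x <- s | P x) E x i) :> uK.
Proof.
elim: s => [|a s IH]; first by rewrite big_nil; fe; rewrite big_nil.
rewrite big_cons; case: ifP => Pa; rewrite IH ?clM; fe; by rewrite big_cons Pa.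
Qed.
Lemma exp_cl f n : (cl f : uK) ^+ n = cl (fun i => f i ^+ n).
Proof.
elim: n => [|n IH]; first by rewrite expr0; fe; rewrite expr0.
by rewrite exprS IH clM; fe; rewrite exprS.
Qed.

Lemma u_preH : pre_H_field uD uO.
Proof.
have rp (x : uK) : exists f, x = cl f := clP x.
split.
- split=> x y; have [f ->] := rp x; have [g ->] := rp y.
    by rewrite clD !uDE clD; fe; rewrite ddD.
  by rewrite clM !uDE !clM clD; fe; rewrite ddM.
- split.
    split.
    + by apply/uOE; apply: (uT UU) => i; rewrite -dm1.
    + move=> x y; have [f ->] := rp x; have [g ->] := rp y => /uOE h1 /uOE h2.
      rewrite clN clD; apply/uOE; apply: (uS2 UU) h1 h2 => i; rewrite -!dm1; exact: dmB.
    + move=> x y; have [f ->] := rp x; have [g ->] := rp y => /uOE h1 /uOE h2.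
      rewrite clM; apply/uOE; apply: (uS2 UU) h1 h2 => i; rewrite -!dm1 -{3}[1]mulr1; exact: dmM.
  move=> x; have [f ->] := rp x; rewrite clV => _.
  have [h|/(uN UU) h] := pselect (U (fun i => f i \in dO (Ms i))); [left|right]; apply/uOE => //.
  apply: (uS UU) h => i /negP; rewrite -!dm1 => h; have f0 : f i != 0 by apply: sd_neq0 (h : sd 1 (f i)).
  by rewrite -[X in dm _ X]invr1 dmV ?oner_neq0 // sdW.
- move=> a b x; have [f ->] := rp a; have [g ->] := rp b; have [h ->] := rp x.
  move=> /uOE h1 /uOE h2 /andP[/le_cl h3 /le_cl h4]; apply/uOE.
  apply: (uS2 UU) (uI UU h1 h2) (uI UU h3 h4) => i [h5 h6] [h7 h8].
  by apply: cvO h5 h6 _; rewrite h7 h8.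
- move=> x; have [f ->] := rp x => H; rewrite uDE; apply/lt_cl.
  apply: contrapT => /(uN UU) no.
  have ex : U (fun i => exists a, a \in dO (Ms i) /\ ~ (a < f i)).
    apply: (uS UU) no => i no; apply: contrapT => no'; apply: no.
    case: (dhlP (Ms i)) => -[_ _ _ h _] _ _ _; apply: h => a aO.
    by apply: contrapT => na; apply: no'; exists a.
  have [a ha] := uchoice ex.
  have /H /lt_cl h' : cl a \in uO by apply/uOE; apply: (uS UU) ha => i [].
  by have [i [[_ h1] h2]] := uex UU (uI UU ha h').
- move=> x y; have [f ->] := rp x; have [g ->] := rp y => /neq_cl h1 /neq_cl h2.
  move=> /dom_cl h3 /sdom_cl h4; rewrite uDE logder_cl; apply/sdom_cl.
  apply: (uS2 UU) (uI UU h1 h2) (uI UU h3 h4) => i [h5 h6] [h7 h8].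
  exact: preH.
Qed.

(** The sum runs over the finite support of [P], so that conditions on the coefficients hold
    simultaneously in almost all components. *)
Definition ulift n (P : {mpoly uK[n]}) i : {mpoly (Ms i)[n]} :=
  \sum_(m <- msupp P) rep (P@_m) i *: 'X_[m].

Lemma ulift_coef n (P : {mpoly uK[n]}) i m :
  (ulift P i)@_m = if m \in msupp P then rep (P@_m) i else 0.
Proof.
rewrite /ulift raddf_sum /=; under eq_bigr => m' _ do rewrite mcoeffZ mcoeffX.
case: ifP => mP.
  rewrite (bigD1_seq m) ?msupp_uniq //= eqxx mulr1 big1 ?addr0 // => m' /negPf ->.
  by rewrite mulr0.
rewrite big_seq big1 // => m' m'P; case: (m' =P m) => [e|]; last by rewrite mulr0.
by rewrite e mP in m'P.
Qed.

Lemma ulift_eval n (P : {mpoly uK[n]}) (v : 'I_n -> pt) :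
  P.@[fun l => cl (v l)] = cl (fun i => (ulift P i).@[fun l => v l i]).
Proof.
rewrite mevalE.
have e (m : 'X_{1..n}) : P@_m * \prod_(l < n) cl (v l) ^+ m l =
    cl (fun i => rep P@_m i * \prod_(l < n) v l i ^+ m l) :> uK.
  rewrite -{1}(repK P@_m); under eq_bigr do rewrite exp_cl.
  by rewrite prod_cl clM.
under eq_bigr do rewrite e.
rewrite sum_cl; fe; rewrite /ulift (rmorph_sum (meval _)) /=; apply: eq_bigr => m _.
by rewrite mevalZ mevalX.
Qed.

Lemma u_dh : differential_henselian uD uO.
Proof.
have rp (x : uK) : exists f, x = cl f := clP x.
split.
- move=> x; have [f ->] := rp x => /sdom_cl h; rewrite uDE; apply/sdom_cl.
  by apply: (uS UU) h => i; apply: dd_small.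
- move=> r a b aO [l0 hl0] bO.
  have [f ef] := choice (fun l => rp (a l)); have [g eg] := rp b.
  have fO : U (fun i => forall l, f l i \in dO (Ms i)).
    by apply: (uallF UU) => l; apply/uOE; rewrite -ef.
  have gO : U (fun i => g i \in dO (Ms i)) by apply/uOE; rewrite -eg.
  have l0P : U (fun i => dm 1 (f l0 i)).
    have /(uN UU) : ~ U (fun i => sd (f l0 i) 1).
      by move=> h; apply: hl0; rewrite ef; apply/sdom_cl.
    by apply: (uS UU) => i /negP /negPn.
  have ex : U (fun i => exists y, dm y 1 /\ sd (\sum_(l < r.+1) f l i * iter l dd y - g i) 1).
    apply: (uS2 UU) (uI UU fO gO) l0P => i [h1 h2] h3.
    have [|||y h4 h5] := @linsurj (Ms i) r (fun l => f l i) (g i); last by exists y.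
    - by move=> l; rewrite dm1.
    - by exists l0.
    - by rewrite dm1.
  have [y hy] := uchoice ex; exists (cl y).
    by apply/uOE; apply: (uS UU) hy => i []; rewrite dm1.
  under eq_bigr => l _ do rewrite ef iter_cl clM.
  by rewrite sum_cl eg clN clD; apply/sdom_cl; apply: (uS UU) hy => i [].
- move=> r P h1 h2 h3 h4.
  have cE m : P@_m = cl (rep P@_m) by rewrite repK.
  have homE d m : (homogeneous_part d P)@_m = if mdeg m == d then P@_m else 0 by apply: hp_coef.
  have homEi d i m : (homogeneous_part d (ulift P i))@_m = if mdeg m == d then (ulift P i)@_m else 0.
    by apply: hp_coef.
  have a1 : U (fun i => forall m, m \in msupp P -> dm (rep P@_m i) 1).
    by apply: (uall UU) => m _; apply/(dom_cl _ (fun i => 1)); rewrite -cE.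
  have a2 : U (fun i => forall m, m \in msupp P -> mdeg m = 0%N -> sd (rep P@_m i) 1).
    apply: (uall UU) => m _; have [m0|m0] := eqVneq (mdeg m) 0%N; last first.
      by apply: (uT UU) => i e; rewrite e eqxx in m0.
    have /(sdom_cl _ (fun i => 1)) : strictly_dominated uO (cl (rep P@_m)) 1.
      by rewrite -cE; have := h2 m; rewrite homE m0 eqxx.
    by apply: (uS UU).
  have [m [mP m1 a3]] : exists m, [/\ m \in msupp P, mdeg m = 1%N & U (fun i => dm 1 (rep P@_m i))].
    apply: contrapT => no; apply: h4 => m; rewrite homE.
    have z : strictly_dominated uO 0 1.
      rewrite cl0; apply/(sdom_cl _ (fun i => 1)); apply: (uT UU) => i.
      by rewrite /sd dmx0 oner_eq0.
    case: eqP => // m1; have [mP|mP] := boolP (m \in msupp P); last by rewrite (memN_msupp_eq0 mP).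
    rewrite cE; apply/(sdom_cl _ (fun i => 1)).
    have /(uN UU) : ~ U (fun i => dm 1 (rep P@_m i)) by move=> h; apply: no; exists m.
    by apply: (uS UU) => i /negP.
  have ex : U (fun i => exists y, sd y 1 /\ dpoly_eval (@dd (Ms i)) (ulift P i) y = 0).
    apply: (uS2 UU) (uI UU a1 a2) a3 => i [b1 b2] b3.
    case: (dhlP (Ms i)) => _ [_ _ H] _ _.
    have cO m' : dm (ulift P i)@_m' 1.
      by rewrite ulift_coef; case: ifP => [/b1 //|_]; exact: dm0.
    have [||||y y1 y2] := H r (ulift P i); last by exists y; split=> //; apply/sdomP.
    + by move=> m'; apply/dm_dom.
    + move=> m'; apply/sdomP; rewrite homEi; case: eqP => [e|_]; last by rewrite /sd dmx0 oner_eq0.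
      by rewrite ulift_coef; case: ifP => [/b2 h|_]; [exact: h|rewrite /sd dmx0 oner_eq0].
    + by move=> m'; apply/dm_dom; rewrite homEi; case: eqP.
    + move=> /(_ m) /sdomP; rewrite homEi m1 eqxx ulift_coef mP.
      by apply/negP; rewrite /sd negbK.
  have [y hy] := uchoice ex; exists (cl y).
    by rewrite one_cl; apply/sdom_cl; apply: (uS UU) hy => i [].
  rewrite /dpoly_eval.
  have -> : P.@[fun i : 'I_r.+1 => iter i uD (cl y)] = P.@[fun l => cl (fun i => iter l dd (y i))].
    by apply: meval_eq => l; rewrite iter_cl.
  by rewrite ulift_eval cl0; apply/eq_cl; apply: (uS UU) hy => i [].
Qed.

Lemma u_Liouville : Liouville_closed uD.
Proof.
have rp (x : uK) : exists f, x = cl f := clP x.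
split.
- move=> p a b; have [f ->] := rp a; have [g ->] := rp b => /le_cl ab /andP[].
  pose q i : {poly (Ms i)} := \poly_(l < size p) rep p`_l i.
  have ev x : p.[cl x] = cl (fun i => (q i).[x i]).
    rewrite horner_coef; have e (l : 'I_(size p)) : p`_l * (cl x : uK) ^+ l = cl (fun i => rep p`_l i * x i ^+ l).
      by rewrite -{1}(repK p`_l) exp_cl clM.
    under eq_bigr do rewrite e.
    by rewrite sum_cl; fe; rewrite horner_poly.
  rewrite !ev cl0 => /le_cl h1 /le_cl h2.
  have ex : U (fun i => exists x, f i <= x <= g i /\ root (q i) x).
    apply: (uS2 UU) ab (uI UU h1 h2) => i h3 [h4 h5].
    case: (dhlP (Ms i)) => _ _ [H _ _] _.
    have [|x] := H (q i) (f i) (g i) h3; first by rewrite h4 h5.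
    by exists x.
  have [x hx] := uchoice ex; exists (cl x).
    by apply/andP; split; apply/le_cl; apply: (uS UU) hx => i [/andP[]].
  by apply/rootP; rewrite ev cl0; apply/eq_cl; apply: (uS UU) hx => i [_ /rootP].
- move=> a; have [f ->] := rp a.
  have [y hy] := @uchoice (fun i y => dd y = f i) (uT UU (fun i => int_exists (f i))).
  by exists (cl y); rewrite uDE; apply/eq_cl.
- move=> a; have [f ->] := rp a.
  have [|y hy] := @uchoice (fun i y => y != 0 /\ logder (@dd (Ms i)) y = f i).
    by apply: (uT UU) => i; have [y y0 ly] := expint_exists (f i); exists y.
  exists (cl y); first by rewrite cl0; apply/neq_cl; apply: (uS UU) hy => i [].
  by rewrite logder_cl; apply/eq_cl; apply: (uS UU) hy => i [].
Qed.

Lemma u_dhl : dhl uD uO.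
Proof.
split; [exact: u_preH|exact: u_dh|exact: u_Liouville|].
have [x hx] := @uchoice (fun i x => sd 1 x) (uT UU (fun i => inf_exists (Ms i))).
exists (cl x); apply/negP => /uOE h; have [i []] := uex UU (uI UU hx h).
by rewrite /sd dm1 => /negP.
Qed.

Lemma u_lift : residue_lift uD uO uk.
Proof.
have rp (x : uK) : exists f, x = cl f := clP x.
have kP i := lkP (Ms i).
split.
- split.
  + by apply/ukE; apply: (uT UU) => i; case: (kP i) => -[].
  + move=> x y; have [f ->] := rp x; have [g ->] := rp y => /ukE h1 /ukE h2.
    rewrite clN clD; apply/ukE; apply: (uS2 UU) h1 h2 => i; case: (kP i) => -[_ h _] _ _ _ _; exact: h.
  + move=> x y; have [f ->] := rp x; have [g ->] := rp y => /ukE h1 /ukE h2.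
    rewrite clV clM; apply/ukE; apply: (uS2 UU) h1 h2 => i; case: (kP i) => -[_ _ h] _ _ _ _; exact: h.
- move=> x; have [f ->] := rp x => /ukE h; rewrite uDE; apply/ukE.
  by apply: (uS UU) h => i; case: (kP i) => _ h _ _ _; exact: h.
- move=> x; have [f ->] := rp x => /ukE h; apply/uOE.
  by apply: (uS UU) h => i; case: (kP i) => _ _ h _ _; exact: h.
- move=> x y; have [f ->] := rp x; have [g ->] := rp y => /ukE h1 /ukE h2.
  rewrite clN clD one_cl => /sdom_cl h3; apply/eq_cl.
  apply: (uS2 UU) (uI UU h1 h2) h3 => i [h4 h5] h6.
  by case: (kP i) => _ _ _ h _; apply: h => //; apply/sdomP.
- move=> x; have [f ->] := rp x => /uOE h.
  have [u hu] := @uchoice (fun i u => u \in lk (Ms i) /\ sd (f i - u) 1)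
    (uS UU (fun i hi => let: And5 _ _ _ _ H := kP i in let: ex_intro2 u h1 h2 := H _ hi in
      ex_intro _ u (conj h1 (proj1 (sdomP _ _) h2))) h).
  exists (cl u); first by apply/ukE; apply: (uS UU) hu => i [].
  by rewrite clN clD one_cl; apply/sdom_cl; apply: (uS UU) hu => i [].
Qed.

Definition ulm : lmod := @LMod (DhlField u_dhl) uk u_lift.
Definition ucl (f : pt) : ulm := cl f.

Lemma ucl_surj (x : ulm) : exists f, x = ucl f. Proof. exact: clP. Qed.
Lemma ucl_k f : (ucl f \in lk ulm) <-> U (fun i => f i \in lk (Ms i)). Proof. exact: ukE. Qed.
Lemma ucl_pos f : (0 < ucl f) <-> U (fun i => 0 < f i). Proof. exact: lt_cl. Qed.
Lemma ucl_dm f g : dm (ucl f) (ucl g) <-> U (fun i => dm (f i) (g i)).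
Proof. rewrite -dm_dom; exact: dom_cl. Qed.
Lemma ucl_dev (V : Type) (v : forall i, V -> Ms i) (t : dterm V) :
  dev (fun x => ucl (fun i => v i x)) t = ucl (fun i => dev (v i) t).
Proof.
elim: t => [x|||t IH|t IH|t IH s IH'|t IH s IH'] //=.
- by rewrite IH; exact: clN.
- by rewrite IH; exact: uDE.
- by rewrite IH IH'; exact: clD.
- by rewrite IH IH'; exact: clM.
Qed.

End Ultraproduct.

(** * Elimination of a quantifier over the field *)

Inductive qfm (X : Type) : Type :=
| QT
| QPos (t : dterm X)
| QDm (t s : dterm X)
| QNot (a : qfm X)
| QAnd (a b : qfm X).
Arguments QT {X}.

Definition QOr X (a b : qfm X) := QNot (QAnd (QNot a) (QNot b)).
Definition QEq X (t s : dterm X) :=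
  QAnd (QNot (QPos (DAdd t (DOpp s)))) (QNot (QPos (DAdd s (DOpp t)))).

Fixpoint qsat (X : Type) (M : dhlField) (v : X -> M) (a : qfm X) : bool :=
  match a with
  | QT => true
  | QPos t => 0 < dev v t
  | QDm t s => dm (dev v t) (dev v s)
  | QNot a => ~~ qsat v a
  | QAnd a b => qsat v a && qsat v b
  end.

Fixpoint tsub (X Y : Type) (f : X -> dterm Y) (t : dterm X) : dterm Y :=
  match t with
  | DVar x => f x
  | DZero => DZero
  | DOne => DOne
  | DOpp t => DOpp (tsub f t)
  | DDer t => DDer (tsub f t)
  | DAdd t s => DAdd (tsub f t) (tsub f s)
  | DMul t s => DMul (tsub f t) (tsub f s)
  end.

Fixpoint qsub (X Y : Type) (f : X -> dterm Y) (a : qfm X) : qfm Y :=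
  match a with
  | QT => QT
  | QPos t => QPos (tsub f t)
  | QDm t s => QDm (tsub f t) (tsub f s)
  | QNot a => QNot (qsub f a)
  | QAnd a b => QAnd (qsub f a) (qsub f b)
  end.

Definition qmap X Y (f : X -> Y) := qsub (fun x => DVar (f x)).

Fixpoint tvs (X : Type) (t : dterm X) : seq X :=
  match t with
  | DVar x => [:: x]
  | DZero | DOne => [::]
  | DOpp t | DDer t => tvs t
  | DAdd t s | DMul t s => tvs t ++ tvs s
  end.

Fixpoint qvs (X : Type) (a : qfm X) : seq X :=
  match a with
  | QT => [::]
  | QPos t => tvs t
  | QDm t s => tvs t ++ tvs s
  | QNot a => qvs a
  | QAnd a b => qvs a ++ qvs b
  end.

Fixpoint qts (X : Type) (a : qfm X) : seq (dterm X) :=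
  match a with
  | QT => [::]
  | QPos t => [:: t]
  | QDm t s => [:: t; s]
  | QNot a => qts a
  | QAnd a b => qts a ++ qts b
  end.

Section QfLemmas.

Variable M : dhlField.

Lemma qsat_or X (v : X -> M) a b : qsat v (QOr a b) = qsat v a || qsat v b.
Proof. by rewrite /= negb_and !negbK. Qed.

Lemma qsat_eq X (v : X -> M) t s : qsat v (QEq t s) = (dev v t == dev v s).
Proof. by rewrite /= !subr_gt0 -!leNgt eq_le. Qed.

Lemma dev_sub X Y (v : Y -> M) (f : X -> dterm Y) t :
  dev v (tsub f t) = dev (fun x => dev v (f x)) t.
Proof. by elim: t => //= [t ->|t ->|t -> s ->|t -> s ->]. Qed.

Lemma qsat_sub X Y (v : Y -> M) (f : X -> dterm Y) a :
  qsat v (qsub f a) = qsat (fun x => dev v (f x)) a.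
Proof. by elim: a => //= [t|t s|a ->|a -> b ->] //; rewrite !dev_sub. Qed.

Lemma qsat_map X Y (v : Y -> M) (f : X -> Y) a : qsat v (qmap f a) = qsat (fun x => v (f x)) a.
Proof. exact: qsat_sub. Qed.

Lemma dev_ext (X : eqType) (v w : X -> M) t : {in tvs t, v =1 w} -> dev v t = dev w t.
Proof.
elim: t => //= [x h|t IH h|t IH h|t IH s IH' h|t IH s IH' h].
- by apply: h; rewrite mem_head.
- by rewrite IH.
- by rewrite IH.
- by rewrite IH ?IH' // => x xs; apply: h; rewrite mem_cat xs ?orbT.
- by rewrite IH ?IH' // => x xs; apply: h; rewrite mem_cat xs ?orbT.
Qed.

Lemma qsat_ext (X : eqType) (v w : X -> M) a : {in qvs a, v =1 w} -> qsat v a = qsat w a.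
Proof.
elim: a => //= [t h|t s h|a IH h|a IH b IH' h].
- by rewrite (dev_ext h).
- rewrite (@dev_ext _ v w t) ?(@dev_ext _ v w s) // => x xs; apply: h; by rewrite mem_cat xs ?orbT.
- by rewrite IH.
- by rewrite IH ?IH' // => x xs; apply: h; rewrite mem_cat xs ?orbT.
Qed.

End QfLemmas.

Lemma qsat_terms X (M N : dhlField) (v : X -> M) (w : X -> N) a :
  (forall t, List.In t (qts a) -> (0 < dev v t) = (0 < dev w t)) ->
  (forall t s, List.In t (qts a) -> List.In s (qts a) -> dm (dev v t) (dev v s) = dm (dev w t) (dev w s)) ->
  qsat v a = qsat w a.
Proof.
elim: a => //= [t h _|t s _ h|a IH h h'|a IH b IH' h h'].
- by apply: h; left.
- by apply: h; [left|right; left].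
- by rewrite IH.
- rewrite IH ?IH' // => [t ht|t s ht hs|t ht|t s ht hs].
  + by apply: h; apply/List.in_app_iff; right.
  + by apply: h'; apply/List.in_app_iff; right.
  + by apply: h; apply/List.in_app_iff; left.
  + by apply: h'; apply/List.in_app_iff; left.
Qed.

Lemma In_nth (X : Type) (x0 x : X) s : List.In x s -> exists2 i, (i < size s)%N & nth x0 s i = x.
Proof.
elim: s => //= a s IH [->|/IH[i h e]]; first by exists 0%N.
by exists i.+1.
Qed.

Definition sm (A B M : Type) (x : A -> M) (y : B -> M) (s : A + B) : M :=
  match s with inl a => x a | inr b => y b end.

Definition cond (V : Type) := forall M : lmod, (V -> M) -> Prop.
(** Compactness is applied to such semantic conditions in place of sets of formulas. *)
Definition uclosed (V : Type) (C : cond V) :=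
  forall (I : Type) (U : set_system I) (UU : UltraFilter U) (Ms : I -> lmod) (v : forall i, V -> Ms i),
  U (fun i => C (Ms i) (v i)) -> C (ulm UU Ms) (fun x => ucl UU (fun i => v i x)).

Lemma ucl_qsat (I : Type) (U : set_system I) (UU : UltraFilter U) (Ms : I -> lmod) (V : Type)
    (v : forall i, V -> Ms i) (a : qfm V) :
  qsat (fun x => ucl UU (fun i => v i x)) a <-> U (fun i => qsat (v i) a).
Proof.
elim: a => /= [|t|t s|a IH|a IH b IH'].
- by split=> // _; apply: (uT UU).
- by rewrite ucl_dev; exact: ucl_pos.
- by rewrite !ucl_dev; exact: ucl_dm.
- split=> [/negP h|h].
    have /(uN UU) : ~ U (fun i => qsat (v i) a) by move/IH.
    by apply: (uS UU) => i /negP.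
  apply/negP => /IH h'; have [i [h1 h2]] := uex UU (uI UU h h').
  by rewrite h2 in h1.
- split=> [/andP[/IH h1 /IH' h2]|h].
    by apply: (uS2 UU) h1 h2 => i -> ->.
  by apply/andP; split; [apply/IH|apply/IH']; apply: (uS UU) h => i /andP[].
Qed.

Lemma uclosed_qsat V (a : qfm V) : uclosed (fun M v => qsat v a).
Proof. by move=> I U UU Ms v h; apply/ucl_qsat. Qed.

(** The flag [D] tells whether the tuple ranges over the lift or over the whole field; both cases
    occur below. *)
Lemma uclosed_nex V m (D : bool) (a : qfm ('I_m + V)) :
  uclosed (fun M v => forall z : 'I_m -> M, (D -> forall i, z i \in lk M) -> ~~ qsat (sm z v) a).
Proof.
move=> I U UU Ms v h z hz; apply/negP => hq.
have [f ef] := choice (fun l => ucl_surj (z l)).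
have hk : U (fun i => D -> forall l, f l i \in lk (Ms i)).
  case: D h hz => [h hz|_ _]; last by apply: (uT UU).
  apply: (uS UU) (uallF UU (P := fun l i => f l i \in lk (Ms i)) _) => [i hi _ //|l].
  by apply/ucl_k; rewrite -ef; apply: hz.
have e : sm z (fun x => ucl UU (fun i => v i x)) = fun x => ucl UU (fun i => sm (fun l => f l i) (v i) x).
  by apply/funext => -[l|x] /=; rewrite ?ef.
rewrite e in hq; have /ucl_qsat hq' := hq.
have [i [[h1 h2] h3]] := uex UU (uI UU (uI UU h hk) hq').
by move/negP: (h1 (fun l => f l i) h2).
Qed.

(** The index set consists of the finite lists of conditions, and the ultrafilter extends the filter
    generated by the lists containing a given one. *)
Lemma compactness V J (C : J -> cond V) : (forall j, uclosed (C j)) ->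
  (forall s : seq J, exists (M : lmod) (v : V -> M), forall j, List.In j s -> C j M v) ->
  exists (M : lmod) (v : V -> M), forall j, C j M v.
Proof.
move=> uc fin.
have /choice[p hp] : forall s : seq J, exists p : {M : lmod & V -> M},
    forall j, List.In j s -> C j (projT1 p) (projT2 p).
  by move=> s; have [M [v h]] := fin s; exists (existT _ M v).
pose F : set_system (seq J) := fun A => exists s0, forall s, (forall j, List.In j s0 -> List.In j s) -> A s.
have PF : ProperFilter F.
  apply: Build_ProperFilter; first by move=> [s0 /(_ s0 (fun _ => id))].
  apply: Build_Filter.
  - by exists [::].
  - move=> A B [s1 h1] [s2 h2]; exists (s1 ++ s2) => s h.
    by split; [apply: h1|apply: h2] => j hj; apply: h; apply/List.in_app_iff; [left|right].
  - by move=> A B AB [s0 h0]; exists s0 => s /h0; apply: AB.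
have [U [UU FU]] := ultraFilterLemma PF.
exists (ulm UU (fun s => projT1 (p s))), (fun x => ucl UU (fun s => projT2 (p s) x)) => j.
apply: uc; apply: FU; exists [:: j] => s h; apply: hp; apply: h.
by left.
Qed.

Definition efm n := {m : nat & qfm ('I_m + 'I_n)}.
Definition esat n (e : efm n) (M : lmod) (y : 'I_n -> M) : Prop :=
  exists2 x : 'I_(projT1 e) -> M, forall i, x i \in lk M & qsat (sm x y) (projT2 e).
Arguments esat [n] e M y.

Lemma lk0 (M : lmod) : 0 \in lk M.
Proof.
case: (lkP M) => -[h1 h2 _] _ _ _ _; rewrite -(subrr 1); exact: h2.
Qed.

(** The two blocks of variables are kept disjoint, and the idle block is filled with 0, which lies
    in the lift. *)
Lemma esat_or n (e1 e2 : efm n) : exists e, forall M y, esat e M y <-> esat e1 M y \/ esat e2 M y.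
Proof.
case: e1 e2 => m1 a1 [m2 a2].
pose r1 (s : 'I_m1 + 'I_n) : 'I_(m1 + m2) + 'I_n := match s with inl i => inl (lshift m2 i) | inr l => inr l end.
pose r2 (s : 'I_m2 + 'I_n) : 'I_(m1 + m2) + 'I_n := match s with inl i => inl (rshift m1 i) | inr l => inr l end.
exists (existT _ (m1 + m2)%N (QOr (qmap r1 a1) (qmap r2 a2))) => M y.
have q1 (x : 'I_(m1 + m2) -> M) : qsat (sm x y) (qmap r1 a1) = qsat (sm (fun i => x (lshift m2 i)) y) a1.
  by rewrite qsat_map; congr qsat; apply/funext => -[].
have q2 (x : 'I_(m1 + m2) -> M) : qsat (sm x y) (qmap r2 a2) = qsat (sm (fun i => x (rshift m1 i)) y) a2.
  by rewrite qsat_map; congr qsat; apply/funext => -[].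
split=> [[x xk]|[[x xk h]|[x xk h]]].
- by rewrite qsat_or q1 q2 => /orP[h|h]; [left; exists (fun i => x (lshift m2 i))|right; exists (fun i => x (rshift m1 i))].
- pose X (i : 'I_(m1 + m2)) : M := match split i with inl l => x l | inr _ => 0 end.
  exists X; first by move=> i; rewrite /X; case: (split i) => [l //|_]; exact: lk0.
  suff : qsat (sm X y) (qmap r1 a1) || qsat (sm X y) (qmap r2 a2) by rewrite -qsat_or.
  rewrite q1; apply/orP; left; rewrite (_ : sm _ y = sm x y) // /X.
  by apply/funext => -[i|//] /=; case: splitP => [l e|l e]; [congr x; apply: ord_inj|have := ltn_ord i; rewrite /= in e; rewrite e ltnNge leq_addr].
- pose X (i : 'I_(m1 + m2)) : M := match split i with inl _ => 0 | inr l => x l end.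
  exists X; first by move=> i; rewrite /X; case: (split i) => [_|l //]; exact: lk0.
  suff : qsat (sm X y) (qmap r1 a1) || qsat (sm X y) (qmap r2 a2) by rewrite -qsat_or.
  rewrite q2; apply/orP; right; rewrite (_ : sm _ y = sm x y) // /X.
  by apply/funext => -[i|//] /=; case: splitP => [l e|l e]; [have := ltn_ord l; rewrite /= in e; rewrite -e ltnNge leq_addr|congr x; apply: ord_inj; rewrite /= in e; apply/eqP; rewrite -(eqn_add2l m1) e].
Qed.

Section Subfield.
Variables (K : fieldType) (S : {pred K}) (hS : GRing.divring_closed S).
Definition sfp (h : GRing.divring_closed S) : {pred K} := S.
HB.instance Definition _ := GRing.isDivringClosed.Build K (sfp hS) hS.
Record sf := SF { sfval : K; sfP : sfval \in sfp hS }.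
HB.instance Definition _ := [isSub for sfval].
HB.instance Definition _ := [Choice of sf by <:].
HB.instance Definition _ := [SubChoice_isSubIntegralDomain of sf by <:].
HB.instance Definition _ := [SubIntegralDomain_isSubField of sf by <:].
End Subfield.

(** * Maximal partial embeddings into a model refuting the formula *)

Section Core.

Variables (n : nat) (phi : qfm (option 'I_n)).
Variables (K : lmod) (y0 : 'I_n -> K).

Definition refutes (M : lmod) (y : 'I_n -> M) := forall b, ~~ qsat (asn y b) phi.

(* No finite part of the quantifier-free type of [X] obstructs an embedding of
   [X] into a model refuting [phi]. *)
Definition afin (X : K -> Prop) := forall a : qfm (K + 'I_n), (forall z, inl z \in qvs a -> X z) ->
  qsat (sm id y0) a -> exists (M : lmod) (i : K -> M) (y : 'I_n -> M), qsat (sm i y) a /\ refutes y.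

Lemma afin_mono (X Y : K -> Prop) : (forall z, Y z -> X z) -> afin X -> afin Y.
Proof. by move=> h hX a ha; apply: hX => z /ha /h. Qed.

Section Maximal.

Variable F : K -> Prop.
Hypothesis kF : forall z, z \in lk K -> F z.
Hypothesis Fmax : forall z, afin (fun w => F w \/ w = z) -> F z.
Variables (M : lmod) (v : K + 'I_n -> M).
Hypothesis vref : refutes (fun l => v (inr l)).
Hypothesis vsat : forall a, (forall z, inl z \in qvs a -> F z) -> qsat (sm id y0) a -> qsat v a.
Notation v0 := (sm id y0).
Notation i := (fun z => v (inl z)).
Notation ys := (fun l => v (inr l)).

Definition overF (t : dterm (K + 'I_n)) := forall z, inl z \in tvs t -> F z.

Lemma vsatE a : (forall z, inl z \in qvs a -> F z) -> qsat v0 a = qsat v a.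
Proof.
move=> h; apply/idP/idP => [/(vsat h) //|]; apply: contraTT => hn.
exact: (@vsat (QNot a)).
Qed.

Lemma v_eq t s : overF t -> overF s -> dev v0 t = dev v0 s -> dev v t = dev v s.
Proof.
move=> ht hs e; apply/eqP; rewrite -qsat_eq -vsatE ?qsat_eq ?e //= => z.
by rewrite !mem_cat => /orP[/orP[/ht|/hs]|/orP[/hs|/ht]].
Qed.

Lemma v_pos t : overF t -> (0 < dev v0 t) = (0 < dev v t).
Proof. by move=> ht; have := @vsatE (QPos t) ht. Qed.

Lemma v_dm t s : overF t -> overF s -> dm (dev v0 t) (dev v0 s) = dm (dev v t) (dev v s).
Proof.
move=> ht hs; apply: (@vsatE (QDm t s)) => z /=.
by rewrite mem_cat => /orP[/ht|/hs].
Qed.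

(** A formula with the value of [t] as extra parameter is a formula over [F] after substituting [t],
    so it holds in [M] and maximality applies. *)
Lemma F_term t : overF t -> F (dev v0 t).
Proof.
move=> ht; apply: Fmax => a ha sa; set z := dev v0 t.
pose s (x : K + 'I_n) := if x == inl z then t else DVar x.
exists M, (fun w => if w == z then dev v t else v (inl w)), ys; split=> //.
have e : qsat v (qsub s a).
  apply: vsat => [w|]; last first.
    rewrite qsat_sub (_ : (fun x => _) = v0) //; apply/funext => x; rewrite /s.
    by case: eqP => [->|].
  move=> hw; have : forall a, inl w \in qvs (qsub s a) -> (inl w \in tvs t) || ((inl w \in qvs a) && (w != z)).
    have tm r : inl w \in tvs (tsub s r) -> (inl w \in tvs t) || ((inl w \in tvs r) && (w != z)).
      elim: r => //= [x|r IH r' IH'|r IH r' IH'].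
      - rewrite /s; case: (x =P inl z) => [_ -> //|ne]; rewrite /= !inE => /eqP e.
        by rewrite -e eqxx /= orbC; apply/orP; left; apply/eqP => wz; apply: ne; rewrite -e wz.
      - by rewrite !mem_cat => /orP[/IH|/IH'] /orP[->//|/andP[-> ->]]; rewrite ?orbT.
      - by rewrite !mem_cat => /orP[/IH|/IH'] /orP[->//|/andP[-> ->]]; rewrite ?orbT.
    elim=> //= [r r'|b IH b' IH'].
      by rewrite !mem_cat => /orP[/tm|/tm] /orP[->//|/andP[-> ->]]; rewrite ?orbT.
    by rewrite !mem_cat => /orP[/IH|/IH'] /orP[->//|/andP[-> ->]]; rewrite ?orbT.
  move=> /(_ a hw) /orP[/ht //|/andP[/ha[//|->]]].
  by rewrite eqxx.
move: e; rewrite qsat_sub; congr (is_true (qsat _ _)); apply/funext => -[w|l] /=; rewrite /s.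
  rewrite (inj_eq (inl_inj (B := _))) //; by case: eqP.
by [].
Qed.

Let dv z : dterm (K + 'I_n) := DVar (inl z).
Lemma overF_var z : F z -> overF (dv z).
Proof. by move=> hz w; rewrite inE => /eqP[->]. Qed.
Lemma overF_y l : overF (DVar (inr l)). Proof. by move=> w; rewrite inE. Qed.
Lemma overF2 (op : dterm (K + 'I_n) -> dterm (K + 'I_n) -> dterm (K + 'I_n)) z w :
  (forall t s, tvs (op t s) = tvs t ++ tvs s) -> F z -> F w -> overF (op (dv z) (dv w)).
Proof.
move=> e hz hw u; rewrite e mem_cat => /orP[]; [exact: overF_var|exact: overF_var].
Qed.

Lemma FD z w : F z -> F w -> F (z + w).
Proof. by move=> hz hw; apply: (@F_term (DAdd (dv z) (dv w))); apply: (overF2 (op := @DAdd _)). Qed.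
Lemma FM z w : F z -> F w -> F (z * w).
Proof. by move=> hz hw; apply: (@F_term (DMul (dv z) (dv w))); apply: (overF2 (op := @DMul _)). Qed.
Lemma FN z : F z -> F (- z).
Proof. by move=> hz; apply: (@F_term (DOpp (dv z))); apply: overF_var. Qed.
Lemma Fd z : F z -> F (dd z).
Proof. by move=> hz; apply: (@F_term (DDer (dv z))); apply: overF_var. Qed.
Lemma F0 : F 0. Proof. by apply: (@F_term DZero). Qed.
Lemma F1 : F 1. Proof. by apply: (@F_term DOne). Qed.
Lemma Fy l : F (y0 l). Proof. by apply: (@F_term (DVar (inr l))); apply: overF_y. Qed.

Lemma iD z w : F z -> F w -> i (z + w) = i z + i w.
Proof.
move=> hz hw; apply: (@v_eq (dv (z + w)) (DAdd (dv z) (dv w))) => //.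
  by apply: overF_var; apply: FD.
exact: (overF2 (op := @DAdd _)).
Qed.
Lemma iM z w : F z -> F w -> i (z * w) = i z * i w.
Proof.
move=> hz hw; apply: (@v_eq (dv (z * w)) (DMul (dv z) (dv w))) => //.
  by apply: overF_var; apply: FM.
exact: (overF2 (op := @DMul _)).
Qed.
Lemma iN z : F z -> i (- z) = - i z.
Proof.
move=> hz; apply: (@v_eq (dv (- z)) (DOpp (dv z))) => //; apply: overF_var => //.
exact: FN.
Qed.
Lemma i_d z : F z -> i (dd z) = dd (i z).
Proof.
move=> hz; apply: (@v_eq (dv (dd z)) (DDer (dv z))) => //; apply: overF_var => //.
exact: Fd.
Qed.
Lemma i0 : i 0 = 0. Proof. by apply: (@v_eq (dv 0) DZero) => //; apply: overF_var; apply: F0. Qed.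
Lemma i1 : i 1 = 1. Proof. by apply: (@v_eq (dv 1) DOne) => //; apply: overF_var; apply: F1. Qed.
Lemma iy l : i (y0 l) = ys l.
Proof. by apply: (@v_eq (dv (y0 l)) (DVar (inr l))); [apply: overF_var; apply: Fy|apply: overF_y|]. Qed.
Lemma ipos z : F z -> (0 < z) = (0 < i z).
Proof. by move=> hz; apply: (@v_pos (dv z)); apply: overF_var. Qed.
Lemma idm z w : F z -> F w -> dm z w = dm (i z) (i w).
Proof. by move=> hz hw; apply: (@v_dm (dv z) (dv w)); apply: overF_var. Qed.
Lemma ieq0 z : F z -> (i z == 0) = (z == 0).
Proof. by move=> hz; rewrite -!dmx0 -i0 -idm //; exact: F0. Qed.

Definition quo (w : K) (p : K * K) := [/\ F p.1, F p.2, p.2 != 0 & w = p.1 / p.2].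
(** The partial embedding extended to quotients, with default value 0 elsewhere. *)
Definition jq (w : K) : M := if pselect (exists p, quo w p) is left h then
  let p := sval (cid h) in i p.1 / i p.2 else 0.

Lemma jqE a b : F a -> F b -> b != 0 -> jq (a / b) = i a / i b.
Proof.
move=> ha hb b0; rewrite /jq; case: pselect => [h|[]]; last by exists (a, b).
case: cid => -[c d] [/= hc hd d0 e].
have ib : i b != 0 by rewrite ieq0.
have id : i d != 0 by rewrite ieq0.
apply/eqP; rewrite eqr_div // -!iM //; apply/eqP; congr (v (inl _)).
by apply/eqP; rewrite -eqr_div // e.
Qed.

Lemma quo_dev t : (forall z, inl z \in tvs t -> exists p, quo z p) ->
  exists2 p, quo (dev v0 t) p & dev (sm jq ys) t = i p.1 / i p.2.
Proof.
elim: t => /= [[z|l]|||t IH|t IH|t IH s IH'|t IH s IH'] h.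
- have [|p qp] := h z; first by rewrite inE.
  by exists p => //; case: qp => h1 h2 h3 ->; apply: jqE.
- exists (y0 l, 1); first by split; rewrite ?oner_neq0 ?divr1 //; [apply: Fy|apply: F1].
  by rewrite /= i1 divr1 iy.
- exists (0, 1); first by split; rewrite ?oner_neq0 ?divr1 //; [apply: F0|apply: F1].
  by rewrite /= i1 divr1 i0.
- exists (1, 1); first by split; rewrite ?oner_neq0 ?divr1 //; apply: F1.
  by rewrite /= i1 divr1.
- have [[a b] [/= h1 h2 h3 e1] e2] := IH h; exists (- a, b).
    by split=> //=; [apply: FN|rewrite e1 mulNr].
  by rewrite /= e2 iN // mulNr.
- have [[a b] [/= h1 h2 h3 e1] e2] := IH h.
  have qd (N : dhlField) (x z : N) : z != 0 -> dd (x / z) = (dd x * z - x * dd z) / (z * z).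
    move=> z0; have := ddM (x / z) z; rewrite divfK // => E.
    have -> : dd (x / z) = (dd x - x / z * dd z) / z.
      by rewrite E addrK mulfK.
    by field.
  exists (dd a * b - a * dd b, b * b).
    split=> /=; [|by apply: FM|by rewrite mulf_neq0|by rewrite e1 qd].
    by apply: FD; [apply: FM => //; apply: Fd|apply: FN; apply: FM => //; apply: Fd].
  have ib : i b != 0 by rewrite ieq0.
  have [da db] : F (dd a) /\ F (dd b) by split; apply: Fd.
  rewrite /= e2 qd // iD ?iN ?iM ?i_d //; [exact: FM|exact: FM|].
  by apply: FN; apply: FM.
- have [|[a b] [/= h1 h2 h3 e1] e2] := IH; first by move=> z hz; apply: h; rewrite mem_cat hz.
  have [|[c d] [/= g1 g2 g3 f1] f2] := IH'; first by move=> z hz; apply: h; rewrite mem_cat hz orbT.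
  have ib : i b != 0 by rewrite ieq0.
  have id : i d != 0 by rewrite ieq0.
  have [ad cb] : F (a * d) /\ F (c * b) by split; apply: FM.
  exists (a * d + c * b, b * d).
    split=> /=; [by apply: FD|by apply: FM|by rewrite mulf_neq0|].
    by rewrite e1 f1 addf_div.
  by rewrite /= e2 f2 addf_div // iD // !iM.
- have [|[a b] [/= h1 h2 h3 e1] e2] := IH; first by move=> z hz; apply: h; rewrite mem_cat hz.
  have [|[c d] [/= g1 g2 g3 f1] f2] := IH'; first by move=> z hz; apply: h; rewrite mem_cat hz orbT.
  exists (a * c, b * d).
    split=> /=; [by apply: FM|by apply: FM|by rewrite mulf_neq0|].
    by rewrite e1 f1 mulf_div.
  by rewrite /= e2 f2 mulf_div !iM.
Qed.

Lemma div_pos (N : dhlField) (a b : N) : b != 0 -> (0 < a / b) = (0 < a * b).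
Proof.
move=> b0; have e : a * b = a / b * b ^+ 2 by rewrite expr2 mulrA divfK.
have b2 : 0 < b ^+ 2 by rewrite exprn_even_gt0 //= b0.
by rewrite e (pmulr_lgt0 _ b2).
Qed.

Lemma div_dm (N : dhlField) (a b c d : N) : b != 0 -> d != 0 -> dm (a / b) (c / d) = dm (a * d) (c * b).
Proof. by move=> b0 d0; rewrite dm_div // mulrAC dm_divr. Qed.

(** Sign and dominance of quotients are decided after clearing denominators, so adding quotients
    keeps finite satisfiability. *)
Lemma F_quo z p : quo z p -> F z.
Proof.
move=> qz; apply: Fmax; apply: (@afin_mono (fun w => exists p, quo w p)).
  move=> w [hw|->]; last by exists p.
  by exists (w, 1); split; rewrite ?oner_neq0 ?divr1 //; apply: F1.
move=> a ha sa; exists M, jq, ys; split=> //; move: ha sa.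
suff H : (forall z, inl z \in qvs a -> exists p, quo z p) -> qsat v0 a = qsat (sm jq ys) a.
  by move=> /H ->.
elim: a => //= [t h|t s h|a IH h|a IH b IH' h].
- have [[a b] [/= h1 h2 h3 ->] ->] := quo_dev h.
  have ib : i b != 0 by rewrite ieq0.
  by rewrite !div_pos // ipos ?iM //; apply: FM.
- have [|[a b] [/= h1 h2 h3 ->] ->] := @quo_dev t; first by move=> w hw; apply: h; rewrite mem_cat hw.
  have [|[c d] [/= g1 g2 g3 ->] ->] := @quo_dev s; first by move=> w hw; apply: h; rewrite mem_cat hw orbT.
  have ib : i b != 0 by rewrite ieq0.
  have id : i d != 0 by rewrite ieq0.
  by rewrite !div_dm // idm ?iM //; apply: FM.
- by rewrite IH.
- by rewrite IH ?IH' // => w hw; apply: h; rewrite mem_cat hw ?orbT.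
Qed.

Definition SF_pred : {pred K} := fun z => `[< F z >].
Lemma SFE z : (z \in SF_pred) <-> F z. Proof. by split=> [/asboolP|h]; last apply/asboolP. Qed.
Lemma SF_closed : GRing.divring_closed SF_pred.
Proof.
split; first by apply/SFE; apply: F1.
  by move=> z w /SFE hz /SFE hw; apply/SFE; apply: FD => //; apply: FN.
move=> z w /SFE hz /SFE hw; apply/SFE.
have [->|w0] := eqVneq w 0; first by rewrite invr0 mulr0; apply: F0.
by apply: (@F_quo _ (z, w)).
Qed.

(** By now [F] is a subfield and [i] embeds it. A proper extension element with all finite sets of
    terms matched in [M] is exactly what [afin] allows, against maximality. *)
Lemma F_all b : F b.
Proof.
apply: contrapT => nb.
pose L := sf SF_closed.
have LF (x : L) : F (val x) by apply/SFE; exact: (valP x).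
pose mkL z (hz : F z) : L := @SF K _ SF_closed z (proj2 (SFE z) hz).
pose dL (x : L) : L := mkL _ (Fd (LF x)).
pose io : {rmorphism L -> K} := GRing.RMorphism.clone _ _ (val : L -> K) _.
pose jf (x : L) : M := i (val x).
have jB : zmod_morphism jf.
  by move=> x y; rewrite /jf rmorphB /= (iD (LF x) (FN (LF y))) (iN (LF y)).
have jM : monoid_morphism jf.
  by split; [rewrite /jf /= i1|move=> x y; rewrite /jf rmorphM /= (iM (LF x) (LF y))].
pose js : {rmorphism L -> M} := HB.pack jf (GRing.isZmodMorphism.Build _ _ jf jB)
  (GRing.isMonoidMorphism.Build _ _ jf jM).
have [||||||b' hb' tm] := @extension_step L dL K M io js.
- by [].
- by move=> x; exact: (i_d (LF x)).
- by move=> x; exact: (ipos (LF x)).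
- by move=> x y; exact: (idm (LF x) (LF y)).
- move=> u u1; case: (lkP K) => _ _ _ _ h; have [|x xk hx] := h u; first by rewrite -dm1.
  by exists (mkL x (kF xk)); apply/sdomP.
- by exists b => x; apply/eqP => e; apply: nb; rewrite e; apply: LF.
have nb' : ~ F b' by move=> h; have := hb' (mkL _ h); rewrite eqxx.
apply: nb'; apply: Fmax => a ha sa.
(* Variables are read over the subfield, with [None] for the new element; parameters outside both do
   not occur in [a]. *)
pose rho (x : K + 'I_n) : option L := match x with
  | inl w => if w == b' then None else if pselect (F w) is left h then Some (mkL w h) else None
  | inr l => Some (mkL _ (Fy l)) end.
pose T := [seq tsub (fun x => DVar (rho x)) t | t <- qts a].
have [bs [hp hd]] := tm (size T) (fun l => nth DZero T l).
exists M, (fun w => if w == b' then bs else v (inl w)), ys; split=> //.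
have e0 : {in qvs a, v0 =1 fun x => asn io b' (rho x)}.
  move=> [w|l] hx //=; case: eqP => [-> //|ne]; case: pselect => //= nF.
  by case: (ha w hx).
have e1 : {in qvs a, sm (fun w => if w == b' then bs else v (inl w)) ys =1 fun x => asn js bs (rho x)}.
  move=> [w|l] hx /=; last by rewrite /jf /= iy.
  case: eqP => // ne; case: pselect => //= nF.
  by case: (ha w hx).
rewrite (qsat_ext e1); rewrite (qsat_ext e0) in sa.
suff <- : qsat (fun x => asn io b' (rho x)) a = qsat (fun x => asn js bs (rho x)) a by [].
apply: qsat_terms.
  move=> t ht.
  have ht' : List.In (tsub (fun x => DVar (rho x)) t) T by apply: List.in_map.
  have [l hl el] := In_nth DZero ht'.
  by have := hp (Ordinal hl); rewrite /= el !dev_sub.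
move=> t s ht hs.
have ht' : List.In (tsub (fun x => DVar (rho x)) t) T by apply: List.in_map.
have hs' : List.In (tsub (fun x => DVar (rho x)) s) T by apply: List.in_map.
have [l hl el] := In_nth DZero ht'; have [l' hl' el'] := In_nth DZero hs'.
by have := hd (Ordinal hl) (Ordinal hl'); rewrite /= el el' !dev_sub.
Qed.

Lemma max_false b : ~~ qsat (asn y0 b) phi.
Proof.
apply/negP => h.
pose r (o : option 'I_n) : K + 'I_n := if o is Some l then inr l else inl b.
have e (N : lmod) (w : K + 'I_n -> N) : qsat w (qmap r phi) = qsat (asn (fun l => w (inr l)) (w (inl b))) phi.
  by rewrite qsat_map; congr qsat; apply/funext => -[].
have : qsat v (qmap r phi) by apply: vsat => [z _|]; [apply: F_all|rewrite e].
by rewrite e; apply/negP; apply: vref.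
Qed.

End Maximal.

(** A formula has finitely many parameters, so finite satisfiability passes to unions of chains and
    Zorn's lemma applies. Compactness then realizes the whole type of the maximal set in one
    refuting model. *)
Lemma afin_refutes : afin (fun z => z \in lk K) -> refutes y0.
Proof.
move=> A0.
have [|A [PA mA]] := @Zorn_bigcup K (fun X => afin (fun z => X z \/ z \in lk K)).
  move=> C CP tot a ha.
  have fin (s : seq K) : (forall z, z \in s -> (\bigcup_(X in C) X)%classic z \/ z \in lk K) ->
      (forall z, z \in s -> z \in lk K) \/ exists2 X, C X & forall z, z \in s -> X z \/ z \in lk K.
    elim: s => [|x s IH] h; first by left.
    have [|H|[X CX H]] := IH.
    - by move=> z zs; apply: h; rewrite inE zs orbT.
    - case: (h x (mem_head _ _)) => [[X CX Xx]|xk].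
        right; exists X => // z; rewrite inE => /predU1P[->|/H]; [by left|by right].
      by left=> z; rewrite inE => /predU1P[->|/H].
    - right; case: (h x (mem_head _ _)) => [[Y CY Yx]|xk]; last first.
        by exists X => // z; rewrite inE => /predU1P[->|/H]; [right|].
      case: (tot X Y CX CY) => XY.
        exists Y => // z; rewrite inE => /predU1P[->|/H [/XY|]]; [by left|by left|by right].
      exists X => // z; rewrite inE => /predU1P[->|/H //]; left; exact: XY.
  pose s' := pmap (fun x : K + 'I_n => if x is inl z then Some z else None) (qvs a).
  have hs' z : (z \in s') = (inl z \in qvs a).
    rewrite /s'; elim: (qvs a) => //= -[w|l] r IH /=; rewrite !inE IH //.
  have [|H|[X CX H]] := fin s'.
  - by move=> z; rewrite hs'; apply: ha.
  - by apply: A0 => z; rewrite -hs'; apply: H.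
  - by apply: (CP X CX) => z; rewrite -hs'; apply: H.
pose F z := A z \/ z \in lk K.
have Fmax z : afin (fun w => F w \/ w = z) -> F z.
  move=> h; apply: contrapT => nF; apply: (mA (fun w => A w \/ w = z)).
    split; first by move=> w; left.
    by move=> /(_ z (or_intror erefl)) Az; apply: nF; left.
  by apply: afin_mono h => w [[|]|]; rewrite /F; tauto.
pose J := {a : qfm (K + 'I_n) | (forall z, inl z \in qvs a -> F z) /\ qsat (sm id y0) a}.
(* The condition for [None] says that [phi] fails at every element of the field, as a universal
   statement in one unrestricted variable. *)
pose C (j : option J) : cond (K + 'I_n) := fun M v => match j with
  | None => forall z : 'I_1 -> M, (false -> forall l, z l \in lk M) ->
      ~~ qsat (sm z v) (qmap (fun o : option 'I_n => if o is Some l then inr (inr l) else inl ord0) phi)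
  | Some a => qsat v (sval a) end.
have [||M [v hv]] := @compactness _ _ C.
- by move=> [a|]; [apply: uclosed_qsat|apply: uclosed_nex].
- move=> s.
  have [a [ha1 ha2 ha3]] : exists a : qfm (K + 'I_n), [/\ forall z, inl z \in qvs a -> F z, qsat (sm id y0) a &
      forall (M : lmod) (v : K + 'I_n -> M), qsat v a -> forall j, List.In (Some j) s -> qsat v (sval j)].
    elim: s => [|[j|] s [a [h1 h2 h3]]]; first by exists QT.
      case: (svalP j) => g1 g2; exists (QAnd (sval j) a); split.
      - by move=> z /=; rewrite mem_cat => /orP[/g1|/h1].
      - by rewrite /= g2 h2.
      - by move=> M v /= /andP[q1 q2] l [[<-]|/(h3 M v q2)].
    exists a; split=> // M v hq l [//|]; exact: h3.
  have [M [i [y [q r]]]] := PA a ha1 ha2.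
  exists M, (sm i y) => -[j|] hj; first exact: ha3 q j hj.
  move=> z _; rewrite qsat_map; have := r (z ord0); congr (is_true (~~ qsat _ _)).
  by apply/funext => -[].
apply: (@max_false F _ Fmax M v).
- by move=> z hz; right.
- move=> b; have := hv None (fun=> b); rewrite /C qsat_map => /(_ (fun h => match h : false = true with end)).
  by congr (is_true (~~ qsat _ _)); apply/funext => -[].
- by move=> a h1 h2; apply: (hv (Some (exist _ a (conj h1 h2)))).
Qed.

End Core.

(** Otherwise compactness yields a solution [b0] over some [y0] at which every existential formula
    over the lift that implies solvability fails. Then each formula true of elements of the lift and
    [y0] is satisfied in some model without solutions, and [afin_refutes] contradicts [b0]. *)
Theorem core n (phi : qfm (option 'I_n)) : exists e : efm n, forall (M : lmod) (y : 'I_n -> M),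
  (exists b, qsat (asn y b) phi) <-> esat e M y.
Proof.
apply: contrapT => no.
pose good (e : efm n) := forall (M : lmod) (y : 'I_n -> M), esat e M y -> exists b, qsat (asn y b) phi.
pose J := {e : efm n | good e}.
pose C (j : option J) : cond (option 'I_n) := fun M v => match j with
  | None => qsat v phi
  | Some e => forall z : 'I_(projT1 (sval e)) -> M, (true -> forall l, z l \in lk M) ->
      ~~ qsat (sm z v) (qmap (fun x : 'I_(projT1 (sval e)) + 'I_n => match x with inl l => inl l | inr l => inr (Some l) end) (projT2 (sval e))) end.
have [||K [v hv]] := @compactness _ _ C.
- by move=> [e|]; [apply: uclosed_nex|apply: uclosed_qsat].
- move=> s.
  have [e ge he] : exists2 e : efm n, good e &
      forall (M : lmod) (y : 'I_n -> M) j, List.In (Some j) s -> esat (sval j) M y -> esat e M y.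
    elim: s => [|[j|] s [e h1 h2]].
    - exists (existT _ 0%N (QNot QT)); last by [].
      by move=> M y [].
    - have [e' he'] := esat_or (sval j) e; exists e'.
        by move=> M y /he' [/(svalP j)|/h1].
      move=> M y l [[<-]|/(h2 M y) hl] hh; apply/he'; [by left|by right; apply: hl].
    - by exists e => // M y j [//|]; apply: h2.
  have [M [y [[b hb] ns]]] : exists (M : lmod) (y : 'I_n -> M), (exists b, qsat (asn y b) phi) /\ ~ esat e M y.
    apply: contrapT => no'; apply: no; exists e => M y; split; last exact: ge.
    by move=> hb; apply: contrapT => ns; apply: no'; exists M, y.
  exists M, (asn y b) => -[j|] hj //= z hz; apply/negP; rewrite qsat_map => hq.
  apply: ns; apply: (he M y j hj); exists z; first exact: hz.
  by move: hq; congr (is_true (qsat _ _)); apply/funext => -[].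
pose y0 l := v (Some l); pose b0 := v None.
have ev : v = asn y0 b0 by apply/funext => -[].
have h0 : qsat (asn y0 b0) phi by rewrite -ev; apply: (hv None).
have := @afin_refutes n phi K y0 _ b0; rewrite h0 => F'; suff : false by []; apply: F'.
move=> a ha sa.
pose s := pmap (fun x : K + 'I_n => if x is inl z then Some z else None) (qvs a).
have hs z : (z \in s) = (inl z \in qvs a).
  by rewrite /s; elim: (qvs a) => //= -[w|l] r IH /=; rewrite !inE IH.
(* The successor makes [inord] available when there are no parameters. *)
pose m := (size s).+1.
pose rho (x : K + 'I_n) : 'I_m + 'I_n := match x with inl z => inl (inord (index z s)) | inr l => inr l end.
pose x (l : 'I_m) : K := nth 0 s l.
have xk l : x l \in lk K.
  have [h|h] := ltnP l (size s); last by rewrite /x nth_default // lk0.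
  by apply: ha; rewrite -hs mem_nth.
have sat0 : esat (existT _ m (qmap rho a)) K y0.
  exists x => //=; rewrite qsat_map; rewrite -(@qsat_ext _ _ (sm id y0)) // => -[z|l] // hz.
  have zs : z \in s by rewrite hs.
  rewrite /= /x inordK ?nth_index // ltnS ltnW // index_mem //.
have [[M [y [sy ny]]]|no'] := pselect (exists (M : lmod) (y : 'I_n -> M),
    esat (existT _ m (qmap rho a)) M y /\ ~ exists b, qsat (asn y b) phi).
  case: sy => xs xsk hq; exists M, (fun z => xs (inord (index z s))), y; split.
    move: hq; rewrite /= qsat_map; congr (is_true (qsat _ _)); by apply/funext => -[].
  by move=> b; apply/negP => hb; apply: ny; exists b.
(* Otherwise [a], with its parameters quantified over the lift, implies solvability and belongs to
   the formulas failing at [y0]. *)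
have gd : good (existT _ m (qmap rho a)).
  by move=> M y hy; apply: contrapT => nb; apply: no'; exists M, y.
have := hv (Some (exist _ _ gd)); case: sat0 => z zk hz /(_ z (fun _ => zk)) /=.
rewrite qsat_map (_ : (fun _ => _) = sm z y0); last by apply/funext => -[].
by rewrite hz.
Qed.

(** * Valuation bases *)

Section ValuationBasis.

Variable S : lmod.
Notation k := (lk S).
Implicit Types (c e r u z : S) (es : seq S).

Lemma k0 : 0 \in k. Proof. exact: lk0. Qed.
Lemma k1 : 1 \in k. Proof. by case: (lkP S) => -[]. Qed.
Lemma kB u z : u \in k -> z \in k -> u - z \in k.
Proof. by case: (lkP S) => -[_ h _] _ _ _ _; apply: h. Qed.
Lemma kN u : u \in k -> - u \in k. Proof. by move=> h; rewrite -sub0r kB ?k0. Qed.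
Lemma kD u z : u \in k -> z \in k -> u + z \in k.
Proof. by move=> h h'; rewrite -[z]opprK kB ?kN. Qed.
Lemma kV u : u \in k -> u^-1 \in k.
Proof. by case: (lkP S) => -[h1 _ h] _ _ _ _ hu; rewrite -[u^-1]mul1r; apply: h. Qed.
Lemma kM u z : u \in k -> z \in k -> u * z \in k.
Proof.
move=> hu hz; have := kV hz; case: (lkP S) => -[_ _ h] _ _ _ _ h'.
by have := h _ _ hu h'; rewrite invrK.
Qed.
Lemma kd u : u \in k -> dd u \in k.
Proof. by case: (lkP S) => _ h _ _ _; apply: h. Qed.
Lemma k_dm u : u \in k -> dm u 1.
Proof. by case: (lkP S) => _ _ h _ _ /h; rewrite -dm1. Qed.
Lemma k_sd0 u : u \in k -> sd u 1 -> u = 0.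
Proof.
move=> hu h; case: (lkP S) => _ _ _ H _; apply: H => //; first exact: k0.
by apply/sdomP; rewrite subr0.
Qed.
Lemma k_asy u : u \in k -> u != 0 -> asy u 1.
Proof.
move=> hu u0; rewrite /asy k_dm //=; apply/negPn/negP => h.
by rewrite (k_sd0 hu h) eqxx in u0.
Qed.
Lemma k_dev (X : Type) (x : X -> S) (t : dterm X) : (forall y, x y \in k) -> dev x t \in k.
Proof.
move=> hx; elim: t => [y|||t h|t h|t h s h'|t h s h'] /=.
- exact: hx.
- exact: k0.
- exact: k1.
- exact: kN.
- exact: kd.
- exact: kD.
- exact: kM.
Qed.

Definition span es z := exists2 a : S -> S, forall e, a e \in k & z = \sum_(e <- es) a e * e.

Lemma span0 es : span es 0.
Proof. by exists (fun=> 0); [move=> _; exact: k0|rewrite big1 // => e _; rewrite mul0r]. Qed.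
Lemma spanD es z w : span es z -> span es w -> span es (z + w).
Proof.
move=> [a ha ->] [b hb ->]; exists (fun e => a e + b e); first by move=> e; apply: kD.
by rewrite -big_split; apply: eq_bigr => e _; rewrite mulrDl.
Qed.
Lemma spanZ es u z : u \in k -> span es z -> span es (u * z).
Proof.
move=> hu [a ha ->]; exists (fun e => u * a e); first by move=> e; apply: kM.
by rewrite mulr_sumr; apply: eq_bigr => e _; rewrite mulrA.
Qed.
Lemma span_in es e : uniq es -> e \in es -> span es e.
Proof.
move=> ue he; exists (fun e' => (e' == e)%:R).
  by move=> e'; case: eqP => _; [exact: k1|exact: k0].
rewrite (bigD1_seq e) //= eqxx mul1r big1 ?addr0 // => e' /negPf ->.
by rewrite mul0r.
Qed.
Lemma span_perm es es' z : perm_eq es es' -> span es z -> span es' z.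
Proof. by move=> h [a ha ->]; exists a => //; apply: perm_big. Qed.
Lemma span_cons e es z : e \notin es -> span es z -> span (e :: es) z.
Proof.
move=> ne [a ha ->]; exists (fun e' => if e' == e then 0 else a e').
  by move=> e'; case: eqP => // _; exact: k0.
rewrite big_cons eqxx mul0r add0r !big_seq; apply: eq_bigr => e' he'.
by case: eqP => // ee; rewrite -ee he' in ne.
Qed.

Definition gt_dom : rel S := fun e e' => sd e' e.
Lemma gt_dom_trans : transitive gt_dom.
Proof. by move=> y x z h1 h2; apply: sd_trans h2 h1. Qed.

(** Residues are represented in [k], so when [c] has the size of a list element, subtracting a
    multiple of that element lowers the size. As the list is decreasing, one pass suffices. *)
Lemma reduce es c : sorted gt_dom es -> all (fun e => 0 < e) es ->
  exists g, [/\ span es g, dm (c - g) c & c - g != 0 -> all (fun e => ~~ asy (c - g) e) es].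
Proof.
elim: es c => [|e es IH] c; first by exists 0; rewrite subr0; split=> //; exact: span0.
rewrite /= (path_sortedE gt_dom_trans) => /andP[he ses] /andP[e0 pes].
have ue : e \notin es by apply/negP => /(allP he); rewrite /gt_dom /sd dmxx.
have en : e != 0 by rewrite gt_eqF.
case: (asyP c e) => [ce|ce|ec].
- have [g [h1 h2 h3]] := IH c ses pes; exists g; split=> //; first exact: span_cons.
  by move=> nz; rewrite h3 // andbT asyNsd (dm_sd_trans h2 ce).
- case: (lkP S) => _ _ _ _ H.
  have [|u uk hu] := H (c / e); first by rewrite -dm1 dm_div1 //; case/andP: ce.
  have ce' : sd (c - u * e) e.
    by rewrite -(sd_div1 _ en) mulrBl mulfK //; apply/sdomP.
  have [g [h1 h2 h3]] := IH (c - u * e) ses pes; exists (u * e + g).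
  rewrite opprD addrA; split.
  + apply: spanD; last exact: span_cons.
    exists (fun e' => if e' == e then u else 0).
      by move=> e'; case: eqP => // _; exact: k0.
    rewrite big_cons eqxx big_seq big1 ?addr0 // => e' he'.
    by case: eqP => [ee|_]; [rewrite -ee he' in ue|rewrite mul0r].
  + apply: (dm_trans h2); apply: (dm_trans (sdW ce')); by case/andP: ce.
  + by move=> nz; rewrite h3 // andbT asyNsd (dm_sd_trans h2 ce').
- exists 0; rewrite subr0; split; [exact: span0|exact: dmxx|move=> _].
  rewrite asyNsd ec andbF /=; apply/allP => e' /(allP he) ee'.
  by rewrite asyNsd (sd_trans ee' ec) andbF.
Qed.

(** The elements are treated one by one: what [reduce] leaves of the next one is 0 or has a size of
    its own. That the basis is in turn spanned by the [C l] lets finitely many elements of [k]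
    describe it. *)
Lemma vbasis N (C : 'I_N -> S) : exists s (e : 'I_s -> S) (a : 'I_N -> 'I_s -> S) (m : 'I_s -> 'I_N -> S),
  [/\ (s <= N)%N, forall l j, a l j \in k /\ m j l \in k, forall j, 0 < e j,
      forall j j' : 'I_s, (j < j')%N -> sd (e j') (e j) &
      (forall l, C l = \sum_j a l j * e j) /\ (forall j, e j = \sum_l m j l * C l)].
Proof.
pose cspan z := exists2 m : 'I_N -> S, forall l, m l \in k & z = \sum_l m l * C l.
have csD z w : cspan z -> cspan w -> cspan (z + w).
  move=> [a ha ->] [b hb ->]; exists (fun l => a l + b l); first by move=> e; apply: kD.
  by rewrite -big_split; apply: eq_bigr => e _; rewrite mulrDl.
have csZ u z : u \in k -> cspan z -> cspan (u * z).
  move=> hu [a ha ->]; exists (fun l => u * a l); first by move=> e; apply: kM.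
  by rewrite mulr_sumr; apply: eq_bigr => e _; rewrite mulrA.
have cs0 : cspan 0.
  by exists (fun=> 0); [move=> _; exact: k0|rewrite big1 // => e _; rewrite mul0r].
have csC l : cspan (C l).
  exists (fun l' => (l' == l)%:R); first by move=> e'; case: eqP => _; [exact: k1|exact: k0].
  by rewrite (bigD1 l) //= eqxx mul1r big1 ?addr0 // => e' /negPf ->; rewrite mul0r.
have cs_span es z : {in es, forall e, cspan e} -> span es z -> cspan z.
  move=> h [a ha ->]; rewrite big_seq; apply: (big_ind cspan) => // e he.
  by apply: csZ => //; apply: h.
have main n : (n <= N)%N -> exists es, [/\ (size es <= n)%N, sorted gt_dom es, all (fun e => 0 < e) es,
    {in es, forall e, cspan e} & forall l : 'I_N, (l < n)%N -> span es (C l)].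
  elim: n => [_|n IH nN]; first by exists [::].
  have [es [h1 h2 h3 h4 h5]] := IH (ltnW nN).
  pose l0 := Ordinal nN; have [g [g1 g2 g3]] := reduce (C l0) h2 h3.
  have [z|nz] := eqVneq (C l0 - g) 0.
    exists es; split=> //; first exact: leqW.
    move=> l; rewrite ltnS leq_eqVlt => /orP[/eqP el|/h5 //].
    have -> : l = l0 by apply: ord_inj.
    by move/eqP: z; rewrite subr_eq0 => /eqP ->.
  (* Basis elements have to be positive; the sign removed here is an element of [k]. *)
  pose r := `|C l0 - g|; have r0 : 0 < r by rewrite normr_gt0.
  have na : all (fun e => ~~ asy r e) es.
    by apply: sub_all (g3 nz) => e; rewrite /asy dm_abs dm_absr.
  have rn : r \notin es by apply/negP => /(allP na); rewrite asyxx.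
  have sgr : exists2 u, u \in k & C l0 - g = u * r /\ r = u * (C l0 - g).
    have [p|p] := lerP 0 (C l0 - g).
      by exists 1; [exact: k1|rewrite !mul1r /r ger0_norm].
    by exists (-1); [apply: kN; exact: k1|rewrite !mulN1r /r ltr0_norm // opprK].
  pose les := fun e e' : S => dm e' e.
  have ptot : total les by move=> x y; rewrite /les orbC dm_total.
  pose es' := sort les (r :: es).
  have pm : perm_eq (r :: es) es' by rewrite perm_sym perm_sort.
  have ues : uniq es by apply: sorted_uniq h2; [exact: gt_dom_trans|move=> x; rewrite /gt_dom /sd dmxx].
  have ues' : uniq es' by rewrite sort_uniq /= rn.
  have pw : {in r :: es &, forall x y, x != y -> ~~ asy x y}.
    have es_na : {in es &, forall x y, x != y -> ~~ asy x y}.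
      move=> x y xs ys xy; have ltx : forall a b, (a < b)%N -> (b < size es)%N -> sd (nth 0 es b) (nth 0 es a).
        by move=> a b ab bs; apply: (sorted_ltn_nth gt_dom_trans 0 h2) => //; rewrite inE // (ltn_trans ab).
      rewrite -(nth_index 0 xs) -(nth_index 0 ys) asyNsd.
      have ixy : index x es != index y es.
        by apply: contra xy => /eqP e; rewrite -(nth_index 0 xs) -(nth_index 0 ys) e.
      move: ixy; rewrite neq_ltn => /orP[h|h].
        by rewrite (ltx _ _ h) ?index_mem // andbF.
      by rewrite (ltx _ _ h) ?index_mem.
    move=> x y; rewrite !inE => /predU1P[->|xs] /predU1P[->|ys] xy.
    - by rewrite eqxx in xy.
    - exact: (allP na).
    - by rewrite asy_sym; apply: (allP na).
    - exact: es_na.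
  exists es'; split.
  - by rewrite size_sort /= ltnS.
  - have : sorted les es' by apply: sort_sorted.
    have pw' : {in es' &, forall x y, x != y -> ~~ asy x y}.
      by move=> x y; rewrite -!(perm_mem pm); apply: pw.
    move: (es') ues' pw' => E; elim: E => // x [|y E] IHE //= /andP[xn un] pE /andP[xy pth].
    apply/andP; split; last first.
      by apply: IHE => // a b ha hb; apply: pE; rewrite inE ?ha ?hb orbT.
    rewrite /gt_dom; have := pE x y; rewrite !inE !eqxx orbT => /(_ isT isT).
    have nxy : x != y by apply: contraNneq xn => ->; rewrite mem_head.
    by move=> /(_ nxy); rewrite /asy (xy : dm y x) andbT.
  - by rewrite (all_sort) /= r0.
  - move=> e; rewrite -(perm_mem pm) inE => /predU1P[->|/h4 //].
    case: sgr => u uk [_ ->]; apply: (csZ) => //; apply: (csD) => //.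
    by rewrite -mulN1r; apply: csZ; [apply: kN; exact: k1|apply: cs_span g1].
  - move=> l; rewrite ltnS leq_eqVlt => /orP[/eqP el|/h5 sl].
      have -> : l = l0 by apply: ord_inj.
      apply: (span_perm pm); rewrite -(subrK g (C l0)); apply: spanD; last exact: span_cons.
      case: sgr => u uk [-> _]; apply: spanZ => //; apply: span_in; rewrite /= ?rn ?mem_head //.
    by apply: (span_perm pm); apply: span_cons.
have [es [h1 h2 h3 h4 h5]] := main N (leqnn N).
have ues : uniq es by apply: sorted_uniq h2; [exact: gt_dom_trans|move=> x; rewrite /gt_dom /sd dmxx].
have /choice[a ha] : forall l, exists a : S -> S, (forall e, a e \in k) /\ C l = \sum_(e <- es) a e * e.
  by move=> l; have [a a1 a2] := h5 l (ltn_ord l); exists a.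
have /choice[m hm] : forall j : 'I_(size es), exists m : 'I_N -> S, (forall l, m l \in k) /\ nth 0 es j = \sum_l m l * C l.
  by move=> j; have [|m m1 m2] := h4 (nth 0 es j); [exact: mem_nth|exists m].
exists (size es), (fun j => nth 0 es j), (fun l j => a l (nth 0 es j)), m; split.
- exact: h1.
- by move=> l j; split; [case: (ha l)|case: (hm j)].
- by move=> j; apply: (allP h3); apply: mem_nth.
- move=> j j' jj; apply: (sorted_ltn_nth gt_dom_trans 0 h2) => //; rewrite inE //.
- split=> [l|j]; last by case: (hm j).
  by case: (ha l) => _ ->; rewrite (big_nth 0) big_mkord.
Qed.

(** Nonzero elements of [k] have size 1, so the first nonzero coordinate dominates. *)
Lemma basis_lead s (e : 'I_s -> S) (b : 'I_s -> S) : (forall j, 0 < e j) ->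
  (forall j j' : 'I_s, (j < j')%N -> sd (e j') (e j)) -> (forall j, b j \in k) ->
  (forall j, b j = 0) \/
  exists2 j0, b j0 != 0 /\ (forall j : 'I_s, (j < j0)%N -> b j = 0) & eqv (\sum_j b j * e j) (b j0 * e j0).
Proof.
move=> e0 de bk.
have [H|no] := pselect (forall j, b j = 0); [by left|right].
have [|j0 [[js bj] mj]] := @nat_min (fun j => exists js : (j < s)%N, b (Ordinal js) != 0).
  apply: contrapT => no'; apply: no => j; apply/eqP/negPn/negP => bj; apply: no'.
  by exists j, (ltn_ord j); rewrite (_ : Ordinal _ = j) //; apply: ord_inj.
pose J := Ordinal js.
have z (j : 'I_s) : (j < J)%N -> b j = 0.
  move=> jJ; apply/eqP/negPn/negP => hj.
  have h : (j0 <= j)%N.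
    by apply: mj; exists (ltn_ord j); rewrite (_ : Ordinal _ = j) //; apply: ord_inj.
  by have := leq_trans jJ h; rewrite ltnn.
exists J => //; have bJ := k_asy (bk J) bj.
have aJ : asy (b J * e J) (e J).
  by rewrite -{2}[e J]mul1r asy_pM2r // gt_eqF.
rewrite /eqv (bigD1 J) //= addrAC subrr add0r (asy_sdr _ aJ).
apply: sd_sum => [|j jJ]; first by rewrite gt_eqF.
have [h|h|h] := ltngtP j J.
- by rewrite z // mul0r /sd dmx0 gt_eqF.
- rewrite -[e J]mul1r; apply: dm_sdM; rewrite ?oner_neq0 //; [exact: k_dm|exact: de].
- by case/eqP: jJ; apply: ord_inj.
Qed.

Lemma basis_pos s (e b : 'I_s -> S) : (forall j, 0 < e j) ->
  (forall j j' : 'I_s, (j < j')%N -> sd (e j') (e j)) -> (forall j, b j \in k) ->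
  0 < \sum_j b j * e j <-> exists2 j, 0 < b j & forall j' : 'I_s, (j' < j)%N -> b j' = 0.
Proof.
move=> e0 de bk; case: (basis_lead e0 de bk) => [H|[j0 [bj z] E]].
  rewrite big1 ?ltxx; last by move=> j _; rewrite H mul0r.
  by split=> // -[j]; rewrite H ltxx.
rewrite (eqv_pos E) pmulr_lgt0 //; split=> [h|[j pj hj]]; first by exists j0.
have [h|h|h] := ltngtP j j0.
- by rewrite z // ltxx in pj.
- by rewrite hj // eqxx in bj.
- by have -> : j0 = j by apply: ord_inj.
Qed.

Lemma basis_dm s (e b c : 'I_s -> S) : (forall j, 0 < e j) ->
  (forall j j' : 'I_s, (j < j')%N -> sd (e j') (e j)) -> (forall j, b j \in k) -> (forall j, c j \in k) ->
  dm (\sum_j b j * e j) (\sum_j c j * e j) <->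
  forall j, b j != 0 -> exists2 j' : 'I_s, (j' <= j)%N & c j' != 0.
Proof.
move=> e0 de bk ck.
have asyL (b' : 'I_s -> S) j0 : b' j0 \in k -> b' j0 != 0 -> eqv (\sum_j b' j * e j) (b' j0 * e j0) ->
    asy (\sum_j b' j * e j) (e j0).
  move=> h1 h2 h3; apply: (asy_trans (eqv_asy h3)).
  by rewrite -{2}[e j0]mul1r asy_pM2r ?gt_eqF // k_asy.
case: (basis_lead e0 de bk) => [H|[j0 [bj z] E]].
  rewrite big1 ?dm0; last by move=> j _; rewrite H mul0r.
  by split=> // _ j; rewrite H eqxx.
rewrite (asy_dml _ (asyL b j0 (bk j0) bj E)).
case: (basis_lead e0 de ck) => [H|[j1 [cj z'] E']].
  have -> : \sum_j c j * e j = 0 by rewrite big1 // => j _; rewrite H mul0r.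
  rewrite dmx0 gt_eqF //; split=> // /(_ j0 bj)[j' _]; by rewrite H eqxx.
rewrite (asy_dmr _ (asyL c j1 (ck j1) cj E')); split=> [h j hj|h].
  exists j1 => //; apply: (@leq_trans j0).
    rewrite leqNgt; apply/negP => jj; have := de _ _ jj; by rewrite /sd h.
  by rewrite leqNgt; apply/negP => jj; rewrite z ?eqxx in hj.
have [j' jj cj'] := h j0 bj.
have j1j : (j1 <= j0)%N.
  apply: (leq_trans _ jj); rewrite leqNgt; apply/negP => hh; by rewrite z' ?eqxx in cj'.
move: j1j; rewrite leq_eqVlt => /orP[/eqP ee|/de /sdW //].
by have -> : j1 = j0 by apply: ord_inj.
Qed.

End ValuationBasis.

Definition dsum (I : finType) (X : Type) (F : I -> dterm X) : dterm X :=
  foldr (fun i t => DAdd (F i) t) DZero (enum I).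
Lemma dev_dsum (I : finType) (X : Type) (M : dhlField) (v : X -> M) (F : I -> dterm X) :
  dev v (dsum F) = \sum_i dev v (F i).
Proof. by rewrite /dsum -big_enum; elim: (enum I) => [|i s IH] /=; rewrite ?big_nil // big_cons IH. Qed.

Definition qconj (I : finType) (X : Type) (F : I -> qfm X) : qfm X :=
  foldr (fun i t => QAnd (F i) t) QT (enum I).
Lemma qsat_conj (I : finType) (X : Type) (M : dhlField) (v : X -> M) (F : I -> qfm X) :
  qsat v (qconj F) <-> forall i, qsat v (F i).
Proof.
have -> : qsat v (qconj F) = all (fun i => qsat v (F i)) (enum I).
  by rewrite /qconj; elim: (enum I) => //= i s ->.
by split=> [/allP h i|h]; [apply: h; rewrite mem_enum|apply/allP].
Qed.

(** * Separating the variables of the lift from the others *)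

Section TermSplit.
Variables Y X : Type.

Fixpoint tsp (t : dterm (Y + X)) : seq (dterm Y * dterm X) :=
  match t with
  | DVar (inl y) => [:: (DVar y, DOne)]
  | DVar (inr x) => [:: (DOne, DVar x)]
  | DZero => [::]
  | DOne => [:: (DOne, DOne)]
  | DOpp t => [seq (DOpp pc.1, pc.2) | pc <- tsp t]
  | DDer t => [seq (DDer pc.1, pc.2) | pc <- tsp t] ++ [seq (pc.1, DDer pc.2) | pc <- tsp t]
  | DAdd t s => tsp t ++ tsp s
  | DMul t s => [seq (DMul pc.1 qd.1, DMul pc.2 qd.2) | pc <- tsp t, qd <- tsp s]
  end.

Lemma dev_tsp (M : dhlField) (x : Y -> M) (v : X -> M) t :
  dev (sm x v) t = \sum_(pc <- tsp t) dev x pc.1 * dev v pc.2.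
Proof.
elim: t => [[y|z]|||t IH|t IH|t IH s IH'|t IH s IH'] /=.
- by rewrite big_seq1 /= mulr1.
- by rewrite big_seq1 /= mul1r.
- by rewrite big_nil.
- by rewrite big_seq1 /= mulr1.
- by rewrite big_map IH -sumrN; apply: eq_bigr => pc _ /=; rewrite mulNr.
- rewrite big_cat /= !big_map IH dd_sum -big_split /=; apply: eq_bigr => pc _; by rewrite ddM.
- by rewrite big_cat IH IH'.
- rewrite big_allpairs_dep IH IH' mulr_suml; apply: eq_bigr => pc _.
  by rewrite mulr_sumr; apply: eq_bigr => qd _ /=; rewrite mulrACA.
Qed.

(** By the Leibniz rule a term is a sum of products of a term in the first variables and one in the
    second. The second factors are listed jointly for all terms, with zero coefficients as
    padding. *)
Lemma rep_terms (ts : seq (dterm (Y + X))) : exists N (c : 'I_N -> dterm X), forall t, List.In t ts ->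
  exists p : 'I_N -> dterm Y, forall (M : dhlField) (x : Y -> M) (v : X -> M),
  dev (sm x v) t = \sum_l dev x (p l) * dev v (c l).
Proof.
elim: ts => [|t ts [N [c h]]]; first by exists 0%N, (fun=> DZero).
pose s := tsp t; pose n := size s.
pose d0 : dterm Y * dterm X := (DZero, DZero).
pose c' (l : 'I_(n + N)) := match split l with inl i => (nth d0 s i).2 | inr i => c i end.
exists (n + N)%N, c' => t' [<-|/h[p hp]].
  exists (fun l => match split l with inl i => (nth d0 s i).1 | inr i => DZero end) => M x v.
  rewrite big_split_ord /= dev_tsp (big_nth d0) big_mkord.
  rewrite [X in _ = _ + X]big1 ?addr0; last first.
    by move=> i _; rewrite (unsplitK (inr i : 'I_n + 'I_N)) mul0r.
  by apply: eq_bigr => i _; rewrite /c' (unsplitK (inl i : 'I_n + 'I_N)).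
exists (fun l => match split l with inl i => DZero | inr i => p i end) => M x v.
rewrite big_split_ord /= [X in _ = X + _]big1 ?add0r; last first.
  by move=> i _; rewrite (unsplitK (inl i : 'I_n + 'I_N)) mul0r.
by rewrite hp; apply: eq_bigr => i _; rewrite /c' (unsplitK (inr i : 'I_n + 'I_N)).
Qed.

End TermSplit.

(** * Semantics of renamings, reducts and translated terms *)

Section Syntax.

Lemma scons0 (T : Type) n (a : T) (v : 'I_n -> T) : scons a v ord0 = a.
Proof. by rewrite /scons unlift_none. Qed.
Lemma sconsS (T : Type) n (a : T) (v : 'I_n -> T) i : scons a v (lift ord0 i) = v i.
Proof. by rewrite /scons liftK. Qed.
Lemma sconsP (T : Type) n (f g : 'I_n.+1 -> T) : f ord0 = g ord0 -> (forall i, f (lift ord0 i) = g (lift ord0 i)) -> f = g.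
Proof. by move=> h0 h; apply/funext => i; case: (unliftP ord0 i) => [j ->|->]. Qed.

Lemma eval_tmap (L L' : language) (h : language_map L L') (M : structure L') n (v : 'I_n -> M) (t : term L n) :
  eval v (tmap h t) = eval (M := reduct h M) v t.
Proof. by elim: t => //= k f a IH; congr fint; apply/funext => i. Qed.

Lemma sat_fmap (L L' : language) (h : language_map L L') (M : structure L') n (phi : formula L n) (v : 'I_n -> M) :
  sat (fmap h phi) v <-> sat (M := reduct h M) phi v.
Proof.
elim: phi v => //= {n}.
- by move=> n s t v; rewrite !eval_tmap.
- move=> n k r a v; rewrite (_ : (fun i => _) = fun i => eval (M := reduct h M) v (a i)) //.
  by apply/funext => i; rewrite eval_tmap.
- by move=> n phi IH v; split=> h1 /IH.
- by move=> n phi IH psi IH' v; split=> -[/IH h1 /IH' h2].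
- by move=> n phi IH psi IH' v; split=> -[/IH|/IH']; [left|right|left|right].
- by move=> n phi IH v; split=> -[a /IH ha]; exists a.
- by move=> n phi IH v; split=> h1 a; apply/IH; apply: h1.
Qed.

Lemma eval_trename (L : language) (M : structure L) m n (s : 'I_m -> 'I_n) (v : 'I_n -> M) (t : term L m) :
  eval v (trename s t) = eval (v \o s) t.
Proof. by elim: t => //= k f a IH; congr fint; apply/funext => i. Qed.

Lemma sat_frename (L : language) (M : structure L) m (phi : formula L m) n (s : 'I_m -> 'I_n) (v : 'I_n -> M) :
  sat (frename s phi) v <-> sat phi (v \o s).
Proof.
have up k l (s' : 'I_k -> 'I_l) (w : 'I_l -> M) (a : M) :
    scons a w \o scons ord0 (lift ord0 \o s') = scons a (w \o s').
  apply: sconsP => [|i] /=; first by rewrite !scons0.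
  by rewrite !sconsS.
elim: phi n s v => //= {m}.
- by move=> m s t n r v; rewrite !eval_trename.
- move=> m k r a n s v; rewrite (_ : (fun i => _) = fun i => eval (v \o s) (a i)) //.
  by apply/funext => i; rewrite eval_trename.
- by move=> m phi IH n s v; split=> h1 /IH.
- by move=> m phi IH psi IH' n s v; split=> -[/IH h1 /IH' h2].
- by move=> m phi IH psi IH' n s v; split=> -[/IH|/IH']; [left|right|left|right].
- move=> m phi IH n s v; split=> -[a ha]; exists a; first by rewrite -up; apply/IH.
  by apply/IH; rewrite up.
- move=> m phi IH n s v; split=> h1 a; first by rewrite -up; apply/IH.
  by apply/IH; rewrite up.
Qed.

Definition ar2 (T : Type) (a b : T) : 'I_2 -> T := fun i => if i == ord0 then a else b.
Definition ar0 (T : Type) : 'I_0 -> T := fun i => False_rect _ (notF (ltn_ord i)).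

Fixpoint d2t (L : language) (g : forall k, odr_fsym k -> fsym L k) (n : nat) (X : Type)
    (r : X -> 'I_n) (t : dterm X) : term L n :=
  match t with
  | DVar x => Var (r x)
  | DZero => App (g 0%N SZero) (@ar0 _)
  | DOne => App (g 0%N SOne) (@ar0 _)
  | DOpp t => App (g 1%N SOpp) (fun=> d2t g r t)
  | DDer t => App (g 1%N SDer) (fun=> d2t g r t)
  | DAdd t s => App (g 2%N SAdd) (ar2 (d2t g r t) (d2t g r s))
  | DMul t s => App (g 2%N SMul) (ar2 (d2t g r t) (d2t g r s))
  end.

Lemma eval_d2t (L : language) (g : forall k, odr_fsym k -> fsym L k) (K : dhlField) (I : interpretation L K) n
    (X : Type) (r : X -> 'I_n) (v : 'I_n -> K) (t : dterm X) :
  (forall k (f : odr_fsym k) a, fint I (g k f) a = fint (odr_interp (@dd K)) f a) ->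
  eval (M := Structure I) v (d2t g r t) = dev (fun x => v (r x)) t.
Proof.
move=> H; elim: t => [x|||t IH|t IH|t IH s IH'|t IH s IH'] //=; rewrite H //=.
- by rewrite IH.
- by rewrite IH.
- exact: (f_equal2 (fun a b => a + b) IH IH').
- exact: (f_equal2 (fun a b => a * b) IH IH').
Qed.

Fixpoint q2f (n : nat) (X : Type) (r : X -> 'I_n) (a : qfm X) : formula lang_L n :=
  let d := @d2t lang_L (fun _ => inl) n X r in
  match a with
  | QT => FTrue
  | QPos t => FNot (FRel (L := lang_L) (inl SLe) (ar2 (d t) (d DZero)))
  | QDm t s => FRel (L := lang_L) (inr SDom) (ar2 (d t) (d s))
  | QNot a => FNot (q2f r a)
  | QAnd a b => FAnd (q2f r a) (q2f r b)
  end.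

Lemma q2f_qf n X (r : X -> 'I_n) a : quantifier_free (q2f r a).
Proof. by elim: a => //= a -> b ->. Qed.

Lemma sat_q2f (K : dhlField) n X (r : X -> 'I_n) a (v : 'I_n -> K) :
  sat (M := Structure (L := lang_L) (interp_sum (odr_interp (@dd K)) (dom_interp (dO K)))) (q2f r a) v
  <-> qsat (fun x => v (r x)) a.
Proof.
elim: a => //= [t|t s|a IH|a IH b IH'].
- rewrite eval_d2t // ltNge; by split=> [/negP|/negP].
- by rewrite !eval_d2t //; exact: dm_dom.
- by rewrite IH; split=> /negP.
- by rewrite IH IH'; split=> /andP.
Qed.

End Syntax.

(** * Special formulas *)

Section Special.

Variables (E : language) (Tres : theory (lang_res E)).

Record lstr := LStr {
  sM :> lmod;
  sI : interpretation E sM;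
  sT : trivial_off (lk sM) sI;
  sC : lift_models (@dd sM) (dO sM) (lk sM) sI Tres }.
Arguments sI : clear implicits.
Implicit Type S : lstr.

Definition str (S : lstr) : structure (lang_lift E) := lift_structure (@dd S) (dO S) (lk S) (sI S).

Definition rpred (Y : Type) := forall S : lstr, (Y -> S) -> Prop.

(* Definability on tuples from the residue field, for every choice of
   the free variables; this makes renaming of variables trivial. *)
Definition Rr (Y : Type) (Th : rpred Y) := forall N (r : Y -> 'I_N), exists th : formula (lang_lift E) N,
  r_relative th /\ forall (S : lstr) (x : 'I_N -> S), (forall y, x (r y) \in lk S) ->
    (sat (M := str S) th x <-> Th S (fun y => x (r y))).

Lemma Rr_ext Y (Th Th' : rpred Y) : Rr Th ->
  (forall S (x : Y -> S), (forall y, x y \in lk S) -> (Th S x <-> Th' S x)) -> Rr Th'.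
Proof.
move=> h e N r; have [th [h1 h2]] := h N r; exists th; split=> // S x hx.
by rewrite h2 //; apply: e.
Qed.

Lemma Rr_map Y Y' (f : Y -> Y') (Th : rpred Y) : Rr Th -> Rr (fun S x => Th S (fun y => x (f y))).
Proof.
move=> h N r; have [th [h1 h2]] := h N (fun y => r (f y)); exists th; split=> // S x hx.
by rewrite h2.
Qed.

Lemma Rr_not Y (Th : rpred Y) : Rr Th -> Rr (fun S x => ~ Th S x).
Proof.
move=> h N r; have [th [h1 h2]] := h N r; exists (FNot th); split; first exact: RRnot.
by move=> S x hx; rewrite /= h2.
Qed.

Lemma Rr_and Y (Th Th' : rpred Y) : Rr Th -> Rr Th' -> Rr (fun S x => Th S x /\ Th' S x).
Proof.
move=> h h' N r; have [th [h1 h2]] := h N r; have [th' [h1' h2']] := h' N r.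
exists (FAnd th th'); split; first exact: RRand.
by move=> S x hx; rewrite /= h2 // h2'.
Qed.

Lemma Rr_or Y (Th Th' : rpred Y) : Rr Th -> Rr Th' -> Rr (fun S x => Th S x \/ Th' S x).
Proof.
move=> h h' N r; have [th [h1 h2]] := h N r; have [th' [h1' h2']] := h' N r.
exists (FOr th th'); split; first exact: RRor.
by move=> S x hx; rewrite /= h2 // h2'.
Qed.

Lemma Rr_qf Y (Th : rpred Y) :
  (forall N (r : Y -> 'I_N), exists2 phi : formula (lang_res E) N, quantifier_free phi &
    forall (S : lstr) (x : 'I_N -> S), sat (M := reduct (res_to_lift E) (str S)) phi x <-> Th S (fun y => x (r y))) ->
  Rr Th.
Proof.
move=> h N r; have [phi qf hphi] := h N r; exists (fmap (res_to_lift E) phi); split; first exact: RRqf.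
by move=> S x _; rewrite sat_fmap.
Qed.

Lemma Rr_true Y : Rr (fun S (x : Y -> S) => True).
Proof. by apply: Rr_qf => N r; exists FTrue. Qed.

Lemma Rr_pos Y (t : dterm Y) : Rr (fun S (x : Y -> S) => 0 < dev x t).
Proof.
apply: Rr_qf => N r.
pose d := @d2t (lang_res E) (fun _ => inl) N Y r.
exists (FNot (FRel (L := lang_res E) (inl SLe) (ar2 (d t) (d DZero)))) => // S x /=.
by rewrite !eval_d2t //= ltNge; split=> /negP.
Qed.

Lemma Rr_eq0 Y (t : dterm Y) : Rr (fun S (x : Y -> S) => dev x t = 0).
Proof.
apply: (Rr_ext (Rr_and (Rr_not (Rr_pos t)) (Rr_not (Rr_pos (DOpp t))))) => S x _ /=.
rewrite oppr_gt0; split=> [[/negP h1 /negP h2]|->]; last by rewrite ltxx.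
by apply/eqP; rewrite eq_le !leNgt h1 h2.
Qed.

Lemma Rr_ffun j (f : fsym E j) : Rr (fun S (x : option 'I_j -> S) => x None = fint (sI S) f (fun i => x (Some i))).
Proof.
apply: Rr_qf => N r.
by exists (FEq (L := lang_res E) (Var (r None)) (App (L := lang_res E) (inr f) (fun i => Var (r (Some i))))).
Qed.

Lemma Rr_rel j (R : rsym E j) : Rr (fun S (x : 'I_j -> S) => rint (sI S) R x).
Proof.
by apply: Rr_qf => N r; exists (FRel (L := lang_res E) (inr R) (fun i => Var (r i))).
Qed.

Lemma Rr_exU Y (Th : rpred (option Y)) : Rr Th ->
  Rr (fun S (x : Y -> S) => exists2 u : S, u \in lk S & Th S (asn x u)).
Proof.
move=> h N r; pose r' (o : option Y) : 'I_N.+1 := if o is Some y then lift ord0 (r y) else ord0.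
have [th [h1 h2]] := h N.+1 r'; exists (FExU th); split; first exact: RRex.
move=> S x hx.
have e (u : S) : (fun o => scons u x (r' o)) = asn (fun y => x (r y)) u.
  by apply/funext => -[y|] /=; rewrite ?sconsS ?scons0.
have hk (u : S) : u \in lk S -> forall o, scons u x (r' o) \in lk S.
  by move=> uk [y|] /=; rewrite ?sconsS ?scons0.
split=> [[u [/= uk su]]|[u uk su]]; exists u.
- by move: uk; rewrite scons0.
- by rewrite scons0 in uk; rewrite -e; apply/h2 => //; apply: hk.
- by split; [rewrite /= scons0|apply/h2; [apply: hk|rewrite e]].
Qed.

Lemma Rr_exs n Y (Th : rpred ('I_n + Y)) : Rr Th ->
  Rr (fun S (x : Y -> S) => exists2 z : 'I_n -> S, forall i, z i \in lk S & Th S (sm z x)).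
Proof.
elim: n Y Th => [|n IH] Y Th h.
  pose f (s : 'I_0 + Y) : Y := match s with inl i => False_rect _ (notF (ltn_ord i)) | inr y => y end.
  apply: (Rr_ext (Rr_map f h)) => S x _.
  have e (z : 'I_0 -> S) : sm z x = fun y => x (f y) by apply/funext => -[[]|].
  split=> [hh|[z _]]; last by rewrite e.
  by exists (@ar0 S); [case|rewrite e].
pose f (s : 'I_n.+1 + Y) : option ('I_n + Y) := match s with
  | inl i => if unlift ord0 i is Some j then Some (inl j) else None | inr y => Some (inr y) end.
have e S (z : 'I_n -> S) (x : Y -> S) (u : S) : (fun s => asn (sm z x) u (f s)) = sm (scons u z) x :> (_ -> S).
  by apply/funext => -[i|y] //=; rewrite /scons; case: (unlift ord0 i).
apply: (Rr_ext (IH _ _ (Rr_exU (Rr_map f h)))) => S x _; split=> [[z hz [u uk]]|[z hz hT]].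
  rewrite e => hT; exists (scons u z) => // i; case: (unliftP ord0 i) => [j ->|->].
    by rewrite sconsS.
  by rewrite scons0.
exists (fun i => z (lift ord0 i)) => //; exists (z ord0) => //; rewrite e.
by rewrite (_ : scons _ _ = z) //; apply: sconsP => [|i]; rewrite ?scons0 ?sconsS.
Qed.

Lemma Rr_exsF (Z : finType) Y (Th : rpred (Z + Y)) : Rr Th ->
  Rr (fun S (x : Y -> S) => exists2 z : Z -> S, forall i, z i \in lk S & Th S (sm z x)).
Proof.
move=> h; pose f (s : Z + Y) : 'I_#|Z| + Y := match s with inl z => inl (enum_rank z) | inr y => inr y end.
apply: (Rr_ext (Rr_exs (Rr_map f h))) => S x _.
have e (z : 'I_#|Z| -> S) : (fun s => sm z x (f s)) = sm (fun i => z (enum_rank i)) x by apply/funext => -[].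
split=> [[z hz]|[z hz hT]]; first by rewrite e => hT; exists (fun i => z (enum_rank i)).
exists (fun i => z (enum_val i)) => //; rewrite e.
by rewrite (_ : (fun i => _) = z) //; apply/funext => i; rewrite enum_rankK.
Qed.

Lemma Rr_all (I : finType) Y (Th : I -> rpred Y) : (forall i, Rr (Th i)) -> Rr (fun S x => forall i, Th i S x).
Proof.
move=> h; suff H (s : seq I) : Rr (fun S x => forall i, i \in s -> Th i S x).
  apply: (Rr_ext (H (enum I))) => S x _; split=> hh i; last by move=> _; apply: hh.
  by apply: hh; rewrite mem_enum.
elim: s => [|a s IH]; first by apply: (Rr_ext (@Rr_true Y)).
apply: (Rr_ext (Rr_and (h a) IH)) => S x _; split=> [[h1 h2] i|hh].
  by rewrite inE => /predU1P[->|/h2].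
by split=> [|i hi]; apply: hh; rewrite inE ?eqxx ?hi ?orbT.
Qed.

Lemma Rr_ex (I : finType) Y (Th : I -> rpred Y) : (forall i, Rr (Th i)) -> Rr (fun S x => exists i, Th i S x).
Proof.
move=> h; apply: (Rr_ext (Rr_not (Rr_all (fun i => Rr_not (h i))))) => S x _.
split=> [H|[i hi] H]; last exact: (H i).
by apply: contrapT => no; apply: H => i hi; apply: no; exists i.
Qed.

Lemma Rr_const (b : bool) Y (Th : rpred Y) : Rr Th -> Rr (fun S x => b -> Th S x).
Proof.
case: b => h; first by apply: (Rr_ext h) => S x _; split=> [? //|]; apply.
by apply: (Rr_ext (@Rr_true Y)).
Qed.

(** Special formulas seen semantically and uniformly in all models, with any finite type of
    variables for the lift; [Sp_special] recovers the syntax. *)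
Definition Sp (X : Type) (Q : rpred X) := exists (Y : finType) (Th : rpred Y) (q : qfm (Y + X)),
  Rr Th /\ forall (S : lstr) (v : X -> S), Q S v <->
    exists x : Y -> S, [/\ forall y, x y \in lk S, Th S x & qsat (sm x v) q].

Lemma Sp_ext X (Q Q' : rpred X) : Sp Q -> (forall S v, Q S v <-> Q' S v) -> Sp Q'.
Proof. by move=> [Y [Th [q [h1 h2]]]] e; exists Y, Th, q; split=> // S v; rewrite -e. Qed.

Lemma Sp_map X X' (f : X -> X') (Q : rpred X) : Sp Q -> Sp (fun S v => Q S (fun x => v (f x))).
Proof.
move=> [Y [Th [q [h1 h2]]]].
pose g (s : Y + X) : Y + X' := match s with inl y => inl y | inr x => inr (f x) end.
exists Y, Th, (qmap g q); split=> // S v; rewrite h2.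
have e (x : Y -> S) : qsat (sm x v) (qmap g q) = qsat (sm x (fun y => v (f y))) q.
  by rewrite qsat_map; congr qsat; apply/funext => -[].
by split=> -[x [a b c]]; exists x; split=> //; rewrite ?e // -e.
Qed.

Lemma Sp_qf X (a : qfm X) : Sp (fun S v => qsat v a).
Proof.
exists 'I_0, (fun _ _ => True), (qmap inr a); split; first exact: Rr_true.
move=> S v; have e (x : 'I_0 -> S) : qsat (sm x v) (qmap inr a) = qsat v a by rewrite qsat_map.
split=> [h|[x [_ _]]]; last by rewrite e.
by exists (@ar0 S); split; [case|by []|rewrite e].
Qed.

Lemma Sp_and X (Q Q' : rpred X) : Sp Q -> Sp Q' -> Sp (fun S v => Q S v /\ Q' S v).
Proof.
move=> [Y1 [T1 [q1 [a1 b1]]]] [Y2 [T2 [q2 [a2 b2]]]].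
pose g1 (s : Y1 + X) : (Y1 + Y2) + X := match s with inl y => inl (inl y) | inr x => inr x end.
pose g2 (s : Y2 + X) : (Y1 + Y2) + X := match s with inl y => inl (inr y) | inr x => inr x end.
exists (Y1 + Y2)%type, (fun S x => T1 S (fun y => x (inl y)) /\ T2 S (fun y => x (inr y))),
  (QAnd (qmap g1 q1) (qmap g2 q2)); split.
  by apply: Rr_and; [apply: (Rr_map inl a1)|apply: (Rr_map inr a2)].
move=> S v; rewrite b1 b2.
have e1 (x : Y1 + Y2 -> S) : qsat (sm x v) (qmap g1 q1) = qsat (sm (fun y => x (inl y)) v) q1.
  by rewrite qsat_map; congr qsat; apply/funext => -[].
have e2 (x : Y1 + Y2 -> S) : qsat (sm x v) (qmap g2 q2) = qsat (sm (fun y => x (inr y)) v) q2.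
  by rewrite qsat_map; congr qsat; apply/funext => -[].
split=> [[[x1 [c1 d1 f1]] [x2 [c2 d2 f2]]]|[x [c [d1 d2] /= /andP[]]]].
  exists (sm x1 x2); split; [by case|by []|by rewrite /= e1 e2 f1 f2].
rewrite e1 e2 => f1 f2; split; [by exists (fun y => x (inl y))|by exists (fun y => x (inr y))].
Qed.

(** A disjunction of conjunctions of a condition on the lift with a quantifier-free one is not of
    the same shape. An extra variable over the lift, whose sign selects the disjunct, separates the
    two kinds again. *)
Lemma Sp_or X (Q Q' : rpred X) : Sp Q -> Sp Q' -> Sp (fun S v => Q S v \/ Q' S v).
Proof.
move=> [Y1 [T1 [q1 [a1 b1]]]] [Y2 [T2 [q2 [a2 b2]]]].
pose i1 (y : Y1) : option (Y1 + Y2) := Some (inl y); pose i2 (y : Y2) : option (Y1 + Y2) := Some (inr y).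
pose g1 (s : Y1 + X) : option (Y1 + Y2) + X := match s with inl y => inl (i1 y) | inr x => inr x end.
pose g2 (s : Y2 + X) : option (Y1 + Y2) + X := match s with inl y => inl (i2 y) | inr x => inr x end.
pose fl : dterm (option (Y1 + Y2)) := DVar None.
pose fl' : dterm (option (Y1 + Y2) + X) := DVar (inl None).
exists (option (Y1 + Y2)), (fun S x => (0 < dev x fl /\ T1 S (fun y => x (i1 y))) \/ (~ 0 < dev x fl /\ T2 S (fun y => x (i2 y)))),
  (QOr (QAnd (QPos fl') (qmap g1 q1)) (QAnd (QNot (QPos fl')) (qmap g2 q2))); split.
  apply: Rr_or; apply: Rr_and; [exact: Rr_pos|exact: (Rr_map i1 a1)| |exact: (Rr_map i2 a2)].
  by apply: Rr_not; exact: Rr_pos.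
move=> S v; rewrite b1 b2.
have e1 (x : option (Y1 + Y2) -> S) : qsat (sm x v) (qmap g1 q1) = qsat (sm (fun y => x (i1 y)) v) q1.
  by rewrite qsat_map; congr qsat; apply/funext => -[].
have e2 (x : option (Y1 + Y2) -> S) : qsat (sm x v) (qmap g2 q2) = qsat (sm (fun y => x (i2 y)) v) q2.
  by rewrite qsat_map; congr qsat; apply/funext => -[].
split=> [[[x1 [c1 d1 f1]]|[x2 [c2 d2 f2]]]|[x [c d]]].
- exists (asn (sm x1 (fun=> 0)) 1); split.
  + by case=> [[y|y]|] /=; [exact: c1|exact: k0|exact: k1].
  + by left; split=> //; exact: ltr01.
  + by rewrite qsat_or /= e1 f1 ltr01.
- exists (asn (sm (fun=> 0) x2) 0); split.
  + by case=> [[y|y]|] /=; [exact: k0|exact: c2|exact: k0].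
  + by right; split=> //=; rewrite ltxx.
  + by rewrite qsat_or /= e2 f2 ltxx.
rewrite qsat_or /= e1 e2; case: d => /= -[d1 d2].
  by rewrite d1 /= orbF => f1; left; exists (fun y => x (i1 y)).
by move/negP: d1 => /negPf -> /= f2; right; exists (fun y => x (i2 y)).
Qed.

Lemma Sp_exU X (Q : rpred (option X)) : Sp Q -> Sp (fun S v => exists2 u : S, u \in lk S & Q S (asn v u)).
Proof.
move=> [Y [Th [q [h1 h2]]]].
pose g (s : Y + option X) : option Y + X := match s with
  | inl y => inl (Some y) | inr (Some x) => inr x | inr None => inl None end.
exists (option Y), (fun S x => Th S (fun y => x (Some y))), (qmap g q); split; first exact: (Rr_map Some h1).
move=> S v.
have e (x : option Y -> S) : qsat (sm x v) (qmap g q) = qsat (sm (fun y => x (Some y)) (asn v (x None))) q.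
  by rewrite qsat_map; congr qsat; apply/funext => -[|[]].
split=> [[u uk /h2[x [a b c]]]|[x [a b]]].
  by exists (asn x u); split=> //; [case|rewrite e].
by rewrite e => c; exists (x None) => //; apply/h2; exists (fun y => x (Some y)).
Qed.

(** Only the quantifier-free part involves [b]. There [core] eliminates it, with the lift variables
    as further parameters, and the new lift variables join the old ones. *)
Lemma Sp_ex (X : finType) (Q : rpred (option X)) : Sp Q -> Sp (fun S v => exists b : S, Q S (asn v b)).
Proof.
move=> [Y [Th [q [h1 h2]]]].
pose Z : finType := (Y + X)%type.
pose r (s : Y + option X) : option 'I_#|Z| := match s with
  | inl y => Some (enum_rank (inl y : Z)) | inr (Some x) => Some (enum_rank (inr x : Z)) | inr None => None end.
have [[m psi] he] := core (qmap r q).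
pose g (s : 'I_m + 'I_#|Z|) : ('I_m + Y) + X := match s with
  | inl i => inl (inl i)
  | inr l => match enum_val l : Z with inl y => inl (inr y) | inr x => inr x end end.
exists ('I_m + Y)%type, (fun S x => Th S (fun y => x (inr y))), (qmap g psi); split.
  exact: (Rr_map inr h1).
move=> S v.
have e0 (x : Y -> S) (b : S) : qsat (asn (fun l => sm x v (enum_val l : Z)) b) (qmap r q) = qsat (sm x (asn v b)) q.
  by rewrite qsat_map; congr qsat; apply/funext => -[y|[x'|]] //=; rewrite enum_rankK.
have e1 (x : 'I_m + Y -> S) : qsat (sm x v) (qmap g psi) =
    qsat (sm (fun i => x (inl i)) (fun l => sm (fun y => x (inr y)) v (enum_val l : Z))) psi.
  by rewrite qsat_map; congr qsat; apply/funext => -[i|l] //=; case: (enum_val l).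
split=> [[b /h2[x [a b' c]]]|[x [a b]]].
  have /he[z zk hz] : exists b : S, qsat (asn (fun l => sm x v (enum_val l : Z)) b) (qmap r q).
    by exists b; rewrite e0.
  by exists (sm z x); split; [case|by []|rewrite e1].
rewrite e1 => c.
have /he[b' hb] : esat (existT _ m psi) S (fun l => sm (fun y => x (inr y)) v (enum_val l : Z)).
  by exists (fun i => x (inl i)).
by exists b'; apply/h2; exists (fun y => x (inr y)); split=> //; rewrite -e0.
Qed.

Lemma Sp_exs n (X : finType) (Q : rpred ('I_n + X)) : Sp Q ->
  Sp (fun S (v : X -> S) => exists z : 'I_n -> S, Q S (sm z v)).
Proof.
elim: n X Q => [|n IH] X Q h.
  pose f (s : 'I_0 + X) : X := match s with inl i => False_rect _ (notF (ltn_ord i)) | inr y => y end.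
  apply: (Sp_ext (Sp_map f h)) => S x.
  have e (z : 'I_0 -> S) : sm z x = fun y => x (f y) by apply/funext => -[[]|].
  split=> [hh|[z]]; last by rewrite e.
  by exists (@ar0 S); rewrite e.
pose f (s : 'I_n.+1 + X) : option ('I_n + X) := match s with
  | inl i => if unlift ord0 i is Some j then Some (inl j) else None | inr y => Some (inr y) end.
have e S (z : 'I_n -> S) (x : X -> S) (u : S) : (fun s => asn (sm z x) u (f s)) = sm (scons u z) x :> (_ -> S).
  by apply/funext => -[i|y] //=; rewrite /scons; case: (unlift ord0 i).
apply: (Sp_ext (IH _ _ (Sp_ex (Sp_map f h)))) => S x; split=> [[z [u]]|[z hT]].
  by rewrite e => hT; exists (scons u z).
exists (fun i => z (lift ord0 i)), (z ord0); rewrite e.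
by rewrite (_ : scons _ _ = z) //; apply: sconsP => [|i]; rewrite ?scons0 ?sconsS.
Qed.

Lemma Sp_all n X (Q : 'I_n -> rpred X) : (forall i, Sp (Q i)) -> Sp (fun S v => forall i, Q i S v).
Proof.
elim: n Q => [|n IH] Q h; first by apply: (Sp_ext (Sp_qf (QT : qfm X))) => S v; split=> // _ [].
apply: (Sp_ext (Sp_and (h ord0) (IH (fun i => Q (lift ord0 i)) (fun i => h (lift ord0 i))))) => S v.
split=> [[h0 hS] i|hh]; last by split=> [|i].
by case: (unliftP ord0 i) => [j ->|->].
Qed.

Lemma Sp_exF n X (Q : 'I_n -> rpred X) : (forall i, Sp (Q i)) -> Sp (fun S v => exists i, Q i S v).
Proof.
elim: n Q => [|n IH] Q h.
  by apply: (Sp_ext (Sp_qf (QNot QT : qfm X))) => S v; split=> // -[[]].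
apply: (Sp_ext (Sp_or (h ord0) (IH (fun i => Q (lift ord0 i)) (fun i => h (lift ord0 i))))) => S v.
split=> [[h0|[i hi]]|[i]]; [by exists ord0|by exists (lift ord0 i)|].
by case: (unliftP ord0 i) => [j ->|->]; [right; exists j|left].
Qed.

(** * Negation through coordinates in a valuation basis *)

Section Negation.

Variables (Y : finType) (X : Type) (N : nat) (c : 'I_N -> dterm X) (pf : dterm (Y + X) -> 'I_N -> dterm Y).
Variable s : nat.
Notation A := (('I_N * 'I_s) + ('I_s * 'I_N))%type.

(** The basis elements as combinations of the [c l] with variable coefficients; the first block of
    [A] holds the coordinates of the [c l] in this basis. *)
Definition et (j : 'I_s) : dterm (A + X) :=
  dsum (fun l : 'I_N => DMul (DVar (inl (inr (j, l)))) (tsub (fun x => DVar (inr x)) (c l))).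

Definition basisq : qfm (A + X) :=
  QAnd (qconj (fun j => QPos (et j)))
  (QAnd (qconj (fun jj : 'I_s * 'I_s => if (jj.1 < jj.2)%N then QNot (QDm (et jj.1) (et jj.2)) else QT))
        (qconj (fun l : 'I_N => QEq (tsub (fun x => DVar (inr x)) (c l))
           (dsum (fun j : 'I_s => DMul (DVar (inl (inl (l, j)))) (et j)))))).

(** The [j]-th coordinate of [t], a term in variables of the lift alone. *)
Definition bt (t : dterm (Y + X)) (j : 'I_s) : dterm (Y + A) :=
  dsum (fun l : 'I_N => DMul (tsub (fun y => DVar (inl y)) (pf t l)) (DVar (inr (inl (l, j))))).

(** Leading coordinates decide, as in [basis_pos] and [basis_dm]. The negated implication says that
    [j'] is at most [j] and has a nonzero coordinate, in a form covered by [Rr_const]. *)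
Fixpoint Qh (S : lstr) (w : Y + A -> S) (q : qfm (Y + X)) : Prop :=
  match q with
  | QT => True
  | QPos t => exists j, 0 < dev w (bt t j) /\ forall j' : 'I_s, (j' < j)%N -> dev w (bt t j') = 0
  | QDm t t' => forall j, ~ dev w (bt t j) = 0 ->
      exists j' : 'I_s, ~ ((j' <= j)%N -> dev w (bt t' j') = 0)
  | QNot a => ~ Qh w a
  | QAnd a b => Qh w a /\ Qh w b
  end.

Lemma Rr_Qh q : Rr (fun S w => @Qh S w q).
Proof.
elim: q => [|t|t t'|a IH|a IH b IH'] /=.
- exact: Rr_true.
- apply: Rr_ex => j; apply: Rr_and; first exact: Rr_pos.
  by apply: Rr_all => j'; apply: Rr_const; exact: Rr_eq0.
- apply: Rr_all => j.
  have h1 := Rr_eq0 (bt t j).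
  have h2 : Rr (fun S w => exists j' : 'I_s, ~ ((j' <= j)%N -> dev (M := S) w (bt t' j') = 0)).
    by apply: Rr_ex => j'; apply: Rr_not; apply: Rr_const; exact: Rr_eq0.
  apply: (Rr_ext (Rr_or h1 h2)) => S x _; split=> [[h //|//]|h].
  by have [e|ne] := eqVneq (dev x (bt t j)) 0; [left|right; apply: h; apply/eqP].
- exact: Rr_not.
- exact: Rr_and.
Qed.

Variables (S : lstr) (a : A -> S) (v : X -> S).
Hypothesis ak : forall i, a i \in lk S.
Hypothesis basis : qsat (sm a v) basisq.
Notation e := (fun j => dev (sm a v) (et j)).

Lemma basis_facts : [/\ forall j, 0 < e j, forall j j' : 'I_s, (j < j')%N -> sd (e j') (e j) &
  forall l, dev v (c l) = \sum_j a (inl (l, j)) * e j].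
Proof.
move: basis => /= /and3P[/qsat_conj h1 /qsat_conj h2 /qsat_conj h3]; split.
- by move=> j; have := h1 j.
- by move=> j j' jj; have := h2 (j, j'); rewrite /= jj.
- move=> l; have := h3 l; rewrite qsat_eq dev_sub dev_dsum => /eqP /= ->.
  by apply: eq_bigr.
Qed.

Lemma Qh_correct q (x : Y -> S) : (forall y, x y \in lk S) ->
  (forall t, List.In t (qts q) -> dev (sm x v) t = \sum_l dev x (pf t l) * dev v (c l)) ->
  qsat (sm x v) q <-> Qh (sm x a) q.
Proof.
have [e0 de ce] := basis_facts; move=> xk.
have btE t j : dev (sm x a) (bt t j) = \sum_l dev x (pf t l) * a (inl (l, j)).
  by rewrite dev_dsum; apply: eq_bigr => l _ /=; rewrite dev_sub.
have btk t j : dev (sm x a) (bt t j) \in lk S by apply: k_dev => -[].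
have tE t : dev (sm x v) t = \sum_l dev x (pf t l) * dev v (c l) ->
    dev (sm x v) t = \sum_j dev (sm x a) (bt t j) * e j.
  move=> ->; under eq_bigr => l _ do rewrite ce mulr_sumr.
  rewrite exchange_big /=; apply: eq_bigr => j _; rewrite btE mulr_suml.
  by apply: eq_bigr => l _; rewrite mulrA.
elim: q => [|t|t t'|q IH|q IH q' IH'] /= h.
- by [].
- rewrite (tE t (h t (or_introl erefl))).
  rewrite basis_pos //; split=> -[j].
    by move=> h1 h2; exists j.
  by move=> [h1 h2]; exists j.
- rewrite (tE t (h t (or_introl erefl))) (tE t' (h t' (or_intror (or_introl erefl)))).
  rewrite basis_dm //; split=> H j hj.
    have [|j' jj hj'] := H j; first by apply/eqP.
    by exists j' => hh; move/eqP: hj'; apply; apply: hh.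
  have [j' hj'] := H j (elimN eqP hj).
  have [jj|jj] := leqP j' j; last by case: hj'; rewrite leqNgt jj.
  by exists j' => //; apply/eqP => hh; apply: hj'.
- by rewrite -(IH h); split=> /negP.
- rewrite -IH -?IH'; last 2 first.
  + by move=> t ht; apply: h; apply/List.in_app_iff; right.
  + by move=> t ht; apply: h; apply/List.in_app_iff; left.
  by split=> /andP.
Qed.

End Negation.

(** A valuation basis always exists, and relative to any basis the failure of [Q] is a condition on
    elements of the lift, the same whichever basis is used. So failure can be stated by asking for
    some basis, of one of finitely many sizes, with that condition. *)
Lemma Sp_not X (Q : rpred X) : Sp Q -> Sp (fun S v => ~ Q S v).
Proof.
move=> [Y [Th [q [h1 h2]]]].
have [N [c hc]] := rep_terms (qts q).
have /choice[pf hpf] : forall t : dterm (Y + X), exists p : 'I_N -> dterm Y, List.In t (qts q) ->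
    forall (M : dhlField) (x : Y -> M) (v : X -> M), dev (sm x v) t = \sum_l dev x (p l) * dev v (c l).
  move=> t; have [ht|ht] := pselect (List.In t (qts q)); last by exists (fun=> DZero).
  by have [p hp] := hc t ht; exists p.
pose D (s : 'I_N.+1) : rpred X := fun S v => exists x : ('I_N * 'I_s) + ('I_s * 'I_N) -> S,
  [/\ forall y, x y \in lk S, ~ (exists2 z : Y -> S, forall i, z i \in lk S &
        Th S (fun y => sm z x (inl y)) /\ Qh pf (sm z x) q) & qsat (sm x v) (basisq c s)].
have hD s : Sp (D s).
  exists (('I_N * 'I_s) + ('I_s * 'I_N))%type, (fun S x => ~ (exists2 z : Y -> S, forall i, z i \in lk S &
        Th S (fun y => sm z x (inl y)) /\ Qh pf (sm z x) q)), (basisq c s); split=> //.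
  apply: Rr_not; apply: (@Rr_exsF Y _ (fun S w => Th S (fun y => w (inl y)) /\ Qh pf w q)).
  by apply: Rr_and; [exact: (Rr_map inl h1)|exact: Rr_Qh].
apply: (Sp_ext (Sp_exF hD)) => S v.
have corr s (a : ('I_N * 'I_s) + ('I_s * 'I_N) -> S) (x : Y -> S) : (forall i, a i \in lk S) ->
    qsat (sm a v) (basisq c s) -> (forall y, x y \in lk S) -> qsat (sm x v) q <-> Qh pf (sm x a) q.
  by move=> ak hb xk; apply: (@Qh_correct Y X N c pf s S a v ak hb q x xk) => t ht; apply: hpf.
split=> [[s [a [ak na hb]]] /h2[x [xk tx qx]]|nQ].
  by apply: na; exists x => //; split=> //; apply/corr.
have [s [e [a [m [sN amk e0 de [ce ee]]]]]] := vbasis (fun l => dev v (c l)).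
have sN' : (s < N.+1)%N by [].
pose A := sm (fun p : 'I_N * 'I_s => a p.1 p.2) (fun p : 'I_s * 'I_N => m p.1 p.2).
have Ak i : A i \in lk S by case: i => p; [case: (amk p.1 p.2)|case: (amk p.2 p.1)].
have etE j : dev (sm A v) (et c j) = e j.
  by rewrite dev_dsum ee; apply: eq_bigr => l _ /=; rewrite dev_sub.
have hb : qsat (sm A v) (basisq c s).
  apply/and3P; split; apply/qsat_conj.
  - by move=> j; rewrite /= etE.
  - by move=> [j j'] /=; case: ifP => // jj; rewrite /= !etE; apply: de.
  - move=> l; rewrite qsat_eq dev_sub dev_dsum; apply/eqP; rewrite [LHS]ce.
    by apply: eq_bigr => j _ /=; rewrite etE.
exists (Ordinal sN'), A; split=> // -[x xk [tx qx]]; apply: nQ; apply/h2; exists x; split=> //.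
by apply/(corr s A x).
Qed.

(** The values are named by quantifiers over the whole field, since arguments of a symbol need not
    lie in the lift. *)
Lemma Sp_subst j (X : finType) (Q : rpred ('I_j + X)) (T : 'I_j -> forall S : lstr, (X -> S) -> S) :
  Sp Q -> (forall i, Sp (fun S (w : option X -> S) => w None = T i S (fun x => w (Some x)))) ->
  Sp (fun S v => Q S (sm (fun i => T i S v) v)).
Proof.
move=> hQ hT.
pose f i (o : option X) : 'I_j + X := if o is Some x then inr x else inl i.
have h := Sp_exs (Sp_and hQ (Sp_all (fun i => Sp_map (f i) (hT i)))).
apply: (Sp_ext h) => S v; split=> [[z [h1 h2]]|hh]; last by exists (fun i => T i S v).
by rewrite (_ : (fun i => T i S v) = z) //; apply/funext => i; exact: (esym (h2 i)).
Qed.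

Lemma Sp_inU (X : Type) (x : X) : Sp (fun S v => v x \in lk S).
Proof.
pose h := Sp_exU (Sp_qf (QEq (DVar None) (DVar (Some x)))).
apply: (Sp_ext h) => S v; split=> [[u uk]|vk]; first by rewrite qsat_eq => /eqP /= <-.
by exists (v x) => //; rewrite qsat_eq.
Qed.

Lemma sC_closed (S : lstr) j (f : fsym E j) (a : 'I_j -> S) :
  (forall i, a i \in lk S) -> fint (sI S) f a \in lk S.
Proof. by move=> ha; have [clk _] := sC S; exact: (clk j (inr f) a ha). Qed.

Lemma Sp_fint j (f : fsym (lang_lift E) j) :
  Sp (fun S (w : option 'I_j -> S) => w None = fint (interp (str S)) f (fun i => w (Some i))).
Proof.
case: f => [[f|[]]|[f|[]]].
- case: f.
  + by apply: (Sp_ext (Sp_qf (QEq (DVar None) DZero))) => S v; rewrite qsat_eq; split=> /eqP.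
  + by apply: (Sp_ext (Sp_qf (QEq (DVar None) DOne))) => S v; rewrite qsat_eq; split=> /eqP.
  + by apply: (Sp_ext (Sp_qf (QEq (DVar None) (DOpp (DVar (Some ord0)))))) => S v; rewrite qsat_eq; split=> /eqP.
  + by apply: (Sp_ext (Sp_qf (QEq (DVar None) (DDer (DVar (Some ord0)))))) => S v; rewrite qsat_eq; split=> /eqP.
  + by apply: (Sp_ext (Sp_qf (QEq (DVar None) (DAdd (DVar (Some ord0)) (DVar (Some ord_max)))))) => S v; rewrite qsat_eq; split=> /eqP.
  + by apply: (Sp_ext (Sp_qf (QEq (DVar None) (DMul (DVar (Some ord0)) (DVar (Some ord_max)))))) => S v; rewrite qsat_eq; split=> /eqP.
(* Off the lift an extra symbol takes the value 0; on the lift its graph is stated for lift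
   variables that are then equated with the given elements. *)
have hk : Sp (fun S (w : option 'I_j -> S) => forall i, w (Some i) \in lk S).
  by apply: Sp_all => i; apply: Sp_inU.
pose P1 : rpred (option 'I_j) := fun S w => exists x : option 'I_j -> S,
  [/\ forall y, x y \in lk S, x None = fint (sI S) f (fun i => x (Some i)) &
      qsat (sm x w) (qconj (fun o : option 'I_j => QEq (DVar (inl o)) (DVar (inr o))))].
have h1 : Sp P1.
  by exists (option 'I_j), (fun S x => x None = fint (sI S) f (fun i => x (Some i))),
    (qconj (fun o : option 'I_j => QEq (DVar (inl o)) (DVar (inr o)))); split=> //; exact: Rr_ffun.
have h2 := Sp_and (Sp_not hk) (Sp_qf (QEq (DVar (None : option 'I_j)) DZero)).
apply: (Sp_ext (Sp_or h1 h2)) => S w; split=> [[[x [xk xf /qsat_conj xw]]|[nk]]|e].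
- have e : x = w by apply/funext => o; have := xw o; rewrite qsat_eq => /eqP.
  by rewrite -e.
- rewrite qsat_eq => /eqP /= ->; case: (sT S) => hf _; symmetry; apply: hf.
  by apply: contrapT => no; apply: nk => i; apply/negPn/negP => hi; apply: no; exists i.
have [wk|nk] := pselect (forall i, w (Some i) \in lk S); [left|right].
  exists w; split=> //; last by apply/qsat_conj => o; rewrite qsat_eq.
  by case=> // ; rewrite e; apply: sC_closed.
split=> //; rewrite qsat_eq; apply/eqP; rewrite /= e; apply: (proj1 (sT S)).
by apply: contrapT => no; apply: nk => i; apply/negPn/negP => hi; apply: no; exists i.
Qed.

Lemma Sp_rint j (r : rsym (lang_lift E) j) : Sp (fun S (w : 'I_j -> S) => rint (interp (str S)) r w).
Proof.
case: r => [[r|r]|[r|r]].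
- case: r; apply: (Sp_ext (Sp_qf (QNot (QPos (DAdd (DVar ord0) (DOpp (DVar ord_max))))))) => S v.
  by rewrite /= subr_gt0 -leNgt.
- case: r; apply: (Sp_ext (Sp_qf (QDm (DVar ord0) (DVar ord_max)))) => S v.
  by rewrite /=; apply: iff_sym; exact: dm_dom.
- exists 'I_j, (fun S x => rint (sI S) r x), (qconj (fun o : 'I_j => QEq (DVar (inl o)) (DVar (inr o)))).
  split=> [|S w]; first exact: Rr_rel.
  split=> [h|[x [xk xr /qsat_conj xw]]]; last first.
    have e : x = w by apply/funext => o; have := xw o; rewrite qsat_eq => /eqP.
    by rewrite -e.
  exists w; split=> //; last by apply/qsat_conj => o; rewrite qsat_eq.
  move=> y; apply: contrapT => /negP ny; case: (sT S) => _ hr; apply: (hr j r w) => //.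
  by exists y.
- by case: r; apply: (Sp_ext (Sp_inU ord0)).
Qed.

Lemma Sp_term n (t : term (lang_lift E) n) :
  Sp (fun S (w : option 'I_n -> S) => w None = eval (M := str S) (fun i => w (Some i)) t).
Proof.
elim: t => [i|j f a IH].
  by apply: (Sp_ext (Sp_qf (QEq (DVar None) (DVar (Some i))))) => S v; rewrite qsat_eq; split=> /eqP.
pose g (o : option 'I_j) : 'I_j + option 'I_n := if o is Some i then inl i else inr None.
pose f' (o : option 'I_n) : option (option 'I_n) := if o is Some i then Some (Some i) else None.
have := @Sp_subst j (option 'I_n) _ (fun i S w => eval (M := str S) (fun l => w (Some l)) (a i))
  (Sp_map g (Sp_fint f)) (fun i => Sp_map f' (IH i)).
by move=> h; apply: (Sp_ext h).
Qed.

Lemma Sp_formula n (psi : formula (lang_lift E) n) : Sp (fun S (v : 'I_n -> S) => sat (M := str S) psi v).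
Proof.
have sub j m (Q : rpred 'I_j) (a : 'I_j -> term (lang_lift E) m) : Sp Q ->
    Sp (fun S (v : 'I_m -> S) => Q S (fun i => eval (M := str S) v (a i))).
  move=> hQ; have := @Sp_subst j 'I_m _ (fun i S w => eval (M := str S) w (a i))
    (Sp_map (inl : 'I_j -> 'I_j + 'I_m) hQ) (fun i => Sp_term (a i)).
  by move=> h; apply: (Sp_ext h).
have exq m (Q : rpred 'I_m.+1) : Sp Q -> Sp (fun S (v : 'I_m -> S) => exists b : S, Q S (scons b v)).
  move=> h; apply: (Sp_ext (Sp_ex (Sp_map (fun i : 'I_m.+1 => unlift ord0 i) h))) => S v.
  have e b : (fun i : 'I_m.+1 => asn v b (unlift ord0 i)) = scons b v :> ('I_m.+1 -> S).
    by apply/funext => i; rewrite /scons; case: (unlift ord0 i).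
  by split=> -[b hb]; exists b; rewrite ?e // -e.
elim: psi => {n}.
- by move=> n; apply: (Sp_ext (Sp_qf QT)).
- by move=> n; apply: (Sp_ext (Sp_qf (QNot QT))).
- move=> n s t.
  apply: (Sp_ext (sub 2%N n _ (ar2 s t) (Sp_qf (QEq (DVar ord0) (DVar ord_max))))) => S v.
  by rewrite qsat_eq; split=> /eqP.
- by move=> n k r a; exact: (sub _ _ _ a (Sp_rint r)).
- by move=> n phi IH; apply: Sp_not.
- by move=> n phi IH psi IH'; apply: Sp_and.
- by move=> n phi IH psi IH'; apply: Sp_or.
- by move=> n phi IH; exact: (exq _ _ IH).
- move=> n phi IH; apply: (Sp_ext (Sp_not (exq _ _ (Sp_not IH)))) => S v; split=> [h b|h [b]]; last by apply; apply: h.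
  by apply: contrapT => nb; apply: h; exists b.
Qed.

Lemma sat_FExsU (S : lstr) m n (phi : formula (lang_lift E) (m + n)) (v : 'I_n -> S) :
  sat (M := str S) (FExsU phi) v <-> exists2 x : 'I_m -> S, forall i, x i \in lk S &
    sat (M := str S) phi (fun i => sm x v (split i)).
Proof.
elim: m phi => [|m IH] phi /=.
  have e (x : 'I_0 -> S) : (fun i : 'I_(0 + n) => sm x v (split i)) = v.
    by apply/funext => i; case: splitP => [[]//|l el] /=; congr v; apply: ord_inj.
  split=> [h|[x _]]; last by rewrite e.
  by exists (@ar0 S); [case|rewrite e].
have e (u : S) (x : 'I_m -> S) :
    scons u (fun i : 'I_(m + n) => sm x v (split i)) = (fun i : 'I_(m.+1 + n) => sm (scons u x) v (split i)).
  apply: sconsP => [|i].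
    rewrite scons0; case: splitP => [l el|l] //=.
    have -> : l = ord0 by apply: ord_inj; rewrite -el.
    by rewrite scons0.
  rewrite sconsS; case: splitP => [l el|l el]; case: splitP => [l' el'|l' el'] /=.
  - have -> : l' = lift ord0 l by apply: ord_inj; rewrite -el' /= /bump /= el.
    by rewrite sconsS.
  - by exfalso; have := ltn_ord l; move: el'; rewrite /= /bump /= el add1n; lia.
  - by exfalso; have := ltn_ord l'; move: el'; rewrite /= /bump /= el add1n; lia.
  - by congr v; apply: ord_inj; move: el'; rewrite /= /bump /= el add1n; lia.
rewrite IH; split=> [[x xk [u [/= uk hu]]]|[x xk hx]].
  rewrite scons0 in uk; exists (scons u x); last by rewrite -e.
  by move=> i; case: (unliftP ord0 i) => [j ->|->]; rewrite ?sconsS ?scons0.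
exists (fun i => x (lift ord0 i)) => //; exists (x ord0); split; first by rewrite /= scons0.
rewrite e (_ : scons _ _ = x) //; apply: sconsP => [|i]; by rewrite ?scons0 ?sconsS.
Qed.

Lemma Sp_special n (Q : rpred 'I_n) : Sp Q -> exists2 psi : formula (lang_lift E) n, special psi &
  forall (S : lstr) (v : 'I_n -> S), Q S v <-> sat (M := str S) psi v.
Proof.
move=> [Y [Th [q [hR hQ]]]].
have [th [h1 h2]] := hR #|Y| enum_rank.
pose r (s : Y + 'I_n) : 'I_(#|Y| + n) := match s with inl y => lshift n (enum_rank y) | inr l => rshift #|Y| l end.
pose phi := q2f r q.
exists (FExsU (FAnd (frename (@lshift #|Y| n) th) (fmap (L_to_lift E) phi))).
  by exists #|Y|, th, phi; split=> //; exact: q2f_qf.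
move=> S v; rewrite sat_FExsU hQ.
have eL (x : 'I_#|Y| -> S) : (fun i : 'I_(#|Y| + n) => sm x v (split i)) \o @lshift #|Y| n = x.
  by apply/funext => i /=; rewrite (unsplitK (inl i : 'I_#|Y| + 'I_n)).
have eq (x : 'I_#|Y| -> S) : (fun s => sm x v (split (r s))) = sm (fun y => x (enum_rank y)) v.
  by apply/funext => -[y|l] /=; [rewrite (unsplitK (inl _ : 'I_#|Y| + 'I_n))|rewrite (unsplitK (inr l : 'I_#|Y| + 'I_n))].
have sq (x : 'I_#|Y| -> S) : sat (M := str S) (fmap (L_to_lift E) phi) (fun i => sm x v (split i)) <->
    qsat (sm (fun y => x (enum_rank y)) v) q.
  by rewrite sat_fmap -eq; exact: (@sat_q2f S _ _ r q).
split=> [[x [xk tx qx]]|[x xk [tx qx]]].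
  have ex : (fun y => x (enum_val (enum_rank y))) = x by apply/funext => y; rewrite enum_rankK.
  exists (fun i => x (enum_val i)) => //; split; last by apply/sq; rewrite ex.
  by apply/sat_frename; rewrite eL; apply/h2 => //; rewrite ex.
have tx' := (sat_frename (M := str S) th (@lshift #|Y| n) (fun i => sm x v (split i))).1 tx.
rewrite eL in tx'; exists (fun y => x (enum_rank y)); split=> //; last exact: (sq x).1 qx.
exact: (h2 S x (fun y => xk _)).1 tx'.
Qed.

End Special.

Theorem theorem4p4 (E : language) (Tres : theory (lang_res E)) (n : nat)
    (psi : formula (lang_lift E) n) :
  exists psi' : formula (lang_lift E) n,
    boolean_combination (@special E n) psi' /\
    equivalent_in (dhl_lift Tres) psi psi'.
Proof.
have [psi' sp h] := Sp_special (Sp_formula Tres psi).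
(* Closure under negation makes a single special formula suffice. *)
exists psi'; split; first exact: BCbase.
move=> M hM; case: M / hM => K der O k I dhlK lk tr lm v.
exact: (h (@LStr E Tres (@LMod (DhlField dhlK) k lk) I tr lm) v).
Qed.
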